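(* Let $d\in\{1,2,3\}$ and let $(B_K)_{K\in\mathbb{N}^*}$ satisfy Assumption 1 of the context. For all $k\in\mathbb{N}$ with $k>d/2$, all integers $j\ge k$, all $L\in\mathbb{N}^*$, $T>0$ and $K_0>0$, there exist $\delta t_0(j,L,K_0)>0$ and $C(j,L,K_0,T)>0$ such that for all $\phi_0\in\Sigma^j(\mathbb{R}^d)$, all $\delta t=T/N\le\delta t_0(j,L,K_0)$ ($N\in\mathbb{N}^*$) and all $K\in\mathbb{N}^*$ with $K\le K_0\,\delta t^{-1/4}$, there exists a unique discrete $(\mathcal{F}_n)$-adapted process $\phi=(\phi^n)_{n=0,\dots,N}$ in $L^2(\Omega;L^\infty([0,T];\Sigma^j(\mathbb{R}^d)))$ satisfying $$\phi^{n+1}=S_{\delta t,K,n+1,C_0}\phi^n-i\,\delta t\,T^{-1}_{\delta t,K,n+1,C_0}P_Kg^k_L(\phi^n,\phi^{n+1}),\quad 0\le n\le N-1,\qquad\phi^0=P_K\phi_0,$$ with $C_0=C_0(j)$, and moreover $$\mathbb{E}\Big[\sup_{n\le N}|\phi^n|_{\Sigma^j}^2\Big]\le C(j,L,K_0,T)\,|\phi_0|_{\Sigma^j}^2.$$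
   Context: $(W_t)_{t\ge0}$ is a real Brownian motion on a probability space $\Omega$. $\langle u,v\rangle=\int_{\mathbb{R}^d}u\overline v\,dx$. The discrete process is identified with the function of time which is constant on every interval $[n\delta t,(n+1)\delta t)$. Spaces. $A=-\Delta+|x|^2$ on $L^2(\mathbb{R}^d)$. For $k\in\mathbb{N}$, $\Sigma^k(\mathbb{R}^d)=\{v\in L^2: x^\beta\partial^\alpha v\in L^2 \text{ for } |\alpha|+|\beta|\le k\}$, with norm $|v|_{\Sigma^k}^2=\langle A^kv,v\rangle$, equivalent to $\sum_{|\alpha|+|\beta|\le k}|x^\beta\partial^\alpha v|_{L^2}^2$. $(e_m)_{m\in\mathbb{N}}$ are the normalized Hermite functions on $\mathbb{R}$, $(-\partial_x^2+x^2)e_m=(2m+1)e_m$. $\Sigma_K(\mathbb{R}^d)$ is the $K^d$-dimensional space spanned by tensor products of the first $K$ Hermite functions, $P_K$ is the orthogonal projection of $L^2(\mathbb{R}^d)$ onto it, and $A_K=AP_K$. Operators $B_K$. For each $K\in\mathbb{N}^*$, $B_K$ is an operator with values in $\Sigma_K(\mathbb{R}^d)$. $|||\cdot|||_{\mathcal{L}(\Sigma^m,\Sigma^n)}$ denotes the operator norm from $\Sigma^m$ to $\Sigma^n$. Assumption 1: for all $k\in\mathbb{N}$ there is $C(k)>0$ such that for all $K\in\mathbb{N}^*$: $B_K=B_K^*$ (in $L^2$); $|||B_K|||_{\mathcal{L}(\Sigma^{k+2},\Sigma^k)}\le C(k)$; $|||B_K|||_{\mathcal{L}(\Sigma^k,\Sigma^k)}\le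 C(k)K$; $|||[A^k,B_K]|||_{\mathcal{L}(\Sigma^{2k},L^2)}\le C(k)$; and $|\mathrm{Re}\langle[A^k,B_K]\phi,B_K\phi\rangle|\le C(k)|\phi|_{\Sigma^k}^2$ for all $\phi\in\Sigma^k$. Discretization. $\delta t=T/N$, $t_n=n\delta t$, $\chi^{n+1}=\delta t^{-1/2}(W_{t_{n+1}}-W_{t_n})$, $\mathcal{F}_n=\sigma(W_s,s\le t_n)$. For $C_0>0$, $\tau(\delta t,C_0)=\min(\{1\le n\le N:|W_{t_n}-W_{t_{n-1}}|\ge C_0\}\cup\{N+1\})$. On $\Sigma_K(\mathbb{R}^d)$ define, if $n+1<\tau(\delta t,C_0)$, $$T^{-1}_{\delta t,K,n+1,C_0}=\Big(Id+i\tfrac{\delta t}2A_K+i\tfrac{\sqrt{\delta t}}2\chi^{n+1}B_K\Big)^{-1},\quad S_{\delta t,K,n+1,C_0}=T^{-1}_{\delta t,K,n+1,C_0}\Big(Id-i\tfrac{\delta t}2A_K-i\tfrac{\sqrt{\delta t}}2\chi^{n+1}B_K\Big),$$ and $T^{-1}_{\delta t,K,n+1,C_0}=0$, $S_{\delta t,K,n+1,C_0}=Id$ otherwise. For each $j$ a constant $C_0(j)>0$ is fixed such that a.s. $|S_{\delta t,K,n+1,C_0(j)}\phi|^2_{\Sigma^j}\le2|\phi|^2_{\Sigma^j}$ and $|T^{-1}_{\delta t,K,n+1,C_0(j)}\phi|^2_{\Sigma^j}\le2|\phi|^2_{\Sigma^j}$ for all $K\in\mathbb{N}^*$, $\phi\in\Sigma_K(\mathbb{R}^d)$,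 $\delta t\in(0,1)$, $n\in\mathbb{N}$ (such a constant exists under Assumption 1). Truncated nonlinearity. $\theta\in C^\infty(\mathbb{R}^+)$, $\theta\ge0$, $\mathrm{Supp}\,\theta\subset[0,2]$, $\theta\equiv1$ on $[0,1]$, $\theta_L(x)=\theta(x/L)$, and $$g^k_L(\phi_1,\phi_2)=\theta_L(|\phi_1|_{\Sigma^k}^2)\,\theta_L(|\phi_2|_{\Sigma^k}^2)\,\tfrac12(|\phi_1|^2+|\phi_2|^2)\,\tfrac{\phi_1+\phi_2}{2}.$$ *)

(* Defs.v *)
From HB Require Import structures.
From mathcomp Require Import all_boot all_order all_algebra.
From mathcomp Require Import all_classical all_reals all_analysis.
From mathcomp Require Import complex.

Set Implicit Arguments.
Unset Strict Implicit.
Unset Printing Implicit Defensive.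

Import Order.TTheory GRing.Theory Num.Theory.
Import numFieldNormedType.Exports.

Local Open Scope classical_set_scope.
Local Open Scope ring_scope.
Local Open Scope complex_scope.

(* The product sigma-algebra on R^n, realized as 'rV[R]_n so that the library's
   topology and directional derivatives are available on the same type. *)
Section measurable_rV.
Context {R : realType} (n : nat).

Let coor (i : 'I_n) (x : 'rV[R]_n) : R := x 0 i.

Let rV_set0 : g_sigma_preimage coor set0.
Proof. exact: sigma_algebra0. Qed.

Let rV_setC A : g_sigma_preimage coor A -> g_sigma_preimage coor (~` A).
Proof. exact: sigma_algebraC. Qed.

Let rV_bigcup (F : (set 'rV[R]_n)^nat) :
  (forall i, g_sigma_preimage coor (F i)) ->
  g_sigma_preimage coor (\bigcup_i F i).
Proof. exact: sigma_algebra_bigcup. Qed.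

HB.instance Definition _ := @isMeasurable.Build default_measure_display
  'rV[R]_n (g_sigma_preimage coor) rV_set0 rV_setC rV_bigcup.

Lemma measurable_coor (i : 'I_n) :
  measurable_fun [set: 'rV[R]_n] (fun x : 'rV[R]_n => x 0 i).
Proof.
move=> _ Y mY; rewrite setTI; apply: sub_sigma_algebra => /=.
rewrite -bigcup_seq/=; exists i => /=; first by rewrite mem_index_enum.
by exists Y => //; rewrite setTI.
Qed.

Lemma measurable_fun_rV d (T : measurableType d) (f : T -> 'rV[R]_n) :
  (forall i, measurable_fun [set: T] (fun t => f t 0 i)) ->
  measurable_fun [set: T] f.
Proof.
move=> mf.
suff prefS : g_sigma_preimage (fun i => coor i \o f) `<=` measurable.
  by move=> _ A mA; apply: prefS; rewrite g_sigma_preimage_comp; exists A.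
apply: smallest_sub; first exact: sigma_algebra_measurable.
rewrite -bigcup_seq => A [i _ [B mB <-]]; exact: mf.
Qed.

End measurable_rV.

Section lebesgue_rV.
Context {R : realType}.

Definition consrV n (p : R * 'rV[R]_n) : 'rV[R]_n.+1 :=
  \row_i oapp (p.2 0) p.1 (unlift ord0 i).

Definition unconsrV n (x : 'rV[R]_n.+1) : R * 'rV[R]_n :=
  (x 0 ord0, \row_i x 0 (lift ord0 i)).

Lemma consrVK n : cancel (@consrV n) (@unconsrV n).
Proof.
case=> a x; rewrite /unconsrV /consrV mxE unlift_none /=; congr pair.
by apply/rowP => i; rewrite !mxE liftK.
Qed.

Lemma measurable_consrV n : measurable_fun setT (@consrV n).
Proof.
apply: measurable_fun_rV => i; case: (unliftP ord0 i) => [j|] ->.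
  rewrite (_ : (fun _ => _) = (fun x : 'rV[R]_n => x 0 j) \o snd).
    by apply: measurableT_comp; [exact: measurable_coor|exact: measurable_snd].
  by apply/funext => p; rewrite mxE liftK.
rewrite (_ : (fun _ => _) = fst); first exact: measurable_fst.
by apply/funext => p; rewrite mxE unlift_none.
Qed.

Lemma measurable_unconsrV n : measurable_fun setT (@unconsrV n).
Proof.
apply/measurable_fun_pair; first exact: measurable_coor.
apply: measurable_fun_rV => i.
rewrite (_ : (fun _ => _) = (fun x : 'rV[R]_n.+1 => x 0 (lift ord0 i))).
  exact: measurable_coor.
by apply/funext => x; rewrite mxE.
Qed.

Section lebesgue_step.
Context n (m : {sigma_finite_measure set 'rV[R]_n -> \bar R}).

Let prod : {measure set (measurableTypeR R * 'rV[R]_n)%type -> \bar R} :=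
  (@lebesgue_measure R \x m)%E.

Definition lebesgue_step : set 'rV[R]_n.+1 -> \bar R :=
  pushforward (@lebesgue_measure R \x m)%E (@consrV n).

Let step0 : lebesgue_step set0 = 0%E.
Proof. by rewrite /lebesgue_step /pushforward preimage_set0 measure0. Qed.

Let step_ge0 A : (0 <= lebesgue_step A)%E.
Proof. exact: (measure_ge0 prod). Qed.

Let step_sigma_additive : semi_sigma_additive lebesgue_step.
Proof.
move=> F mF tF mUF; rewrite /lebesgue_step /pushforward preimage_bigcup.
have mc A : measurable A -> measurable (@consrV n @^-1` A).
  by move=> mA; rewrite -[X in measurable X]setTI; exact: measurable_consrV.
apply: (@measure_semi_sigma_additive _ _ _ prod).
- by move=> k; exact: mc.
- apply/trivIsetP => /= i j _ _ ij; rewrite -preimage_setI.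
  by move/trivIsetP : tF => /(_ _ _ _ _ ij) ->//; rewrite preimage_set0.
- by rewrite -preimage_bigcup; exact: mc.
Qed.

HB.instance Definition _ := isMeasure.Build _ _ _
  lebesgue_step step0 step_ge0 step_sigma_additive.

Let step_sigma_finite : sigma_finite setT lebesgue_step.
Proof.
have /sigma_finiteP[F [TF ndF Foo]] :=
  sigma_finiteT (@lebesgue_measure R : {sigma_finite_measure set _ -> \bar R}).
have /sigma_finiteP[G [TG ndG Goo]] := sigma_finiteT m.
exists (fun k => @unconsrV n @^-1` (F k `*` G k)).
  rewrite -preimage_bigcup -[LHS](preimage_setT (@unconsrV n)); congr (_ @^-1` _).
  rewrite -setXTT TF TG predeqE => -[x y]; split.
    move=> [/= [i _ Fix] [k _ Gky]]; exists (maxn i k) => //; split.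
    - by move: x Fix; exact/subsetPset/ndF/leq_maxl.
    - by move: y Gky; exact/subsetPset/ndG/leq_maxr.
  by move=> [i _ []/= ? ?]; split; exists i.
move=> k; have [mFk Fk] := Foo k; have [mGk Gk] := Goo k; split.
  rewrite -[X in measurable X]setTI.
  by apply: measurable_unconsrV => //; exact: measurableX.
rewrite /lebesgue_step /pushforward -comp_preimage.
rewrite (_ : _ \o _ = id); last by apply/funext => p /=; rewrite consrVK.
by rewrite preimage_id product_measure1E// lte_mul_pinfty// ge0_fin_numE.
Qed.

HB.instance Definition _ := Measure_isSigmaFinite.Build _ _ _
  lebesgue_step step_sigma_finite.

End lebesgue_step.

(* Lebesgue measure on R^n: the unit mass on R^0, and the n-fold product of
   the library's Lebesgue measure on R. *)
Fixpoint lebesgue_rV n : {sigma_finite_measure set 'rV[R]_n -> \bar R} :=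
  match n with
  | 0 => \d_(0 : 'rV[R]_0)
  | n'.+1 => lebesgue_step (lebesgue_rV n')
  end.

End lebesgue_rV.

Section weighted_sobolev.
Context {R : realType} {d : nat}.
Local Notation X := 'rV[R]_d.
Local Notation leb := (@lebesgue_rV R d).
Implicit Types (u v : X -> R[i]) (a : 'I_d -> nat).

Definition cintegral u : R[i] :=
  (\int[leb]_x complex.Re (u x)) +i* (\int[leb]_x complex.Im (u x)).

Definition inner u v : R[i] := cintegral (fun x => u x * conjc (v x)).

(* Elements of L^2 are represented by Borel functions; on these, the notions
   below only depend on the class for equality almost everywhere. *)
Definition L2 : set (X -> R[i]) := [set u : X -> R[i] |
  [/\ measurable_fun setT (fun x => complex.Re (u x)),
      measurable_fun setT (fun x => complex.Im (u x)) &
      (\int[leb]_x (complex.Re (u x) ^+ 2 + complex.Im (u x) ^+ 2)%:E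
        < +oo)%E]].

Definition L2norm2 u : R := complex.Re (inner u u).

Definition eq_L2 u v : Prop := {ae leb, forall x, u x = v x}.

Definition partial (i : 'I_d) (f : X -> R) : X -> R :=
  fun x => 'D_(delta_mx 0 i) f x.

Definition test_function (f : X -> R) : Prop :=
  compact (closure [set x | f x != 0]) /\
  forall s : seq 'I_d, let g := foldr partial f s in
    continuous g /\ forall i x, derivable g x (delta_mx 0 i).

Definition mindex_size a : nat := (\sum_i a i)%N.

Definition mpartial a (f : X -> R) : X -> R :=
  foldr (fun i => iter (a i) (partial i)) f (enum 'I_d).

Definition monom a (x : X) : R := \prod_i x 0 i ^+ a i.

Definition is_weak_deriv a u v : Prop :=
  forall f, test_function f ->
    cintegral (fun x => u x * (mpartial a f x)%:C) =
    (-1) ^+ mindex_size a * cintegral (fun x => v x * (f x)%:C).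

Definition weak_deriv a u : X -> R[i] :=
  xget (fun=> 0) [set v : X -> R[i] | L2 v /\ is_weak_deriv a u v].

Definition Sigma (k : nat) : set (X -> R[i]) := [set u : X -> R[i] | L2 u /\
  forall a b, (mindex_size a + mindex_size b <= k)%N ->
    exists v, [/\ L2 v, is_weak_deriv a u v &
                  L2 (fun x => (monom b x)%:C * v x)]].

Definition mdelta (i : 'I_d) (n : nat) : 'I_d -> nat :=
  fun j => if j == i then n else 0%N.

(* - Delta + |x|^2; meaningful on its domain Sigma 2 *)
Definition opA u : X -> R[i] := fun x =>
  - (\sum_i weak_deriv (mdelta i 2) u x) + (\sum_i x 0 i ^+ 2)%:C * u x.

(* <A u, u>, as a quadratic form on Sigma 1 *)
Definition formA u : R :=
  \sum_i (L2norm2 (weak_deriv (mdelta i 1) u) +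
          L2norm2 (fun x => (x 0 i)%:C * u x)).

(* <A^k u, u> on the whole of Sigma k. For u in Sigma (2 k) it is literally
   <A^k u, u>; in general half of the powers of A are moved to the right-hand
   argument: <A^(2m) u, u> = |A^m u|^2 and
   <A^(2m+1) u, u> = <A (A^m u), A^m u>. *)
Definition Snorm2 (k : nat) u : R :=
  let w := iter k./2 opA u in if odd k then formA w else L2norm2 w.

Definition Snorm (k : nat) u : R := Num.sqrt (Snorm2 k u).

Definition Sopen (k : nat) (U : set (X -> R[i])) : Prop :=
  U `<=` Sigma k /\
  forall u, U u -> exists2 r : R, 0 < r &
    forall v, Sigma k v -> Snorm k (fun x => v x - u x) < r -> U v.

End weighted_sobolev.

Section hermite.
Context {R : realType} {d : nat}.
Local Notation X := 'rV[R]_d.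
Implicit Types (u v : X -> R[i]).

(* physicists' Hermite polynomials *)
Fixpoint hermite_poly (m : nat) : {poly R} :=
  match m with
  | 0 => 1
  | m'.+1 => 2%:P * 'X * hermite_poly m' - (hermite_poly m')^`()
  end.

Definition hermite (m : nat) (x : R) : R :=
  (Num.sqrt (2 ^+ m * m`!%:R * Num.sqrt pi))^-1 *
  (hermite_poly m).[x] * expR (- (x ^+ 2 / 2)).

Definition hermite_tensor K (m : {ffun 'I_d -> 'I_K}) (x : X) : R :=
  \prod_i hermite (m i) (x 0 i).

Definition SigmaK (K : nat) : set (X -> R[i]) := [set u : X -> R[i] |
  exists c : {ffun 'I_d -> 'I_K} -> R[i],
    u = fun x => \sum_m c m * (hermite_tensor m x)%:C].

(* The expansion in the orthonormal basis (hermite_tensor m) of SigmaK *)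
Definition projK (K : nat) u : X -> R[i] := fun x =>
  \sum_(m : {ffun 'I_d -> 'I_K})
    inner u (fun y => (hermite_tensor m y)%:C) * (hermite_tensor m x)%:C.

Definition opAK (K : nat) u : X -> R[i] := opA (projK K u).

(* F u is in general only determined almost everywhere (it involves weak
   derivatives), hence F is inverted on SigmaK up to equality in L^2. *)
Definition invK (K : nat) (F : (X -> R[i]) -> (X -> R[i])) v : X -> R[i] :=
  xget (fun=> 0) [set u : X -> R[i] | SigmaK K u /\ eq_L2 (F u) v].

Definition commA (k : nat) (Q : (X -> R[i]) -> (X -> R[i])) u : X -> R[i] :=
  fun x => iter k opA (Q u) x - Q (iter k opA u) x.

(* <[A^k, Q] u, Q u> for u in Sigma k, where A^k u is only an element of the
   dual of Sigma k: since Q is symmetric with values in some SigmaK, the second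
   term <Q A^k u, Q u> is the duality bracket <u, A^k Q Q u>. *)
Definition commA_form (k : nat) (Q : (X -> R[i]) -> (X -> R[i])) u : R[i] :=
  inner (iter k opA (Q u)) (Q u) - inner u (iter k opA (Q (Q u))).

Definition opnorm_le (m n : nat) (Q : (X -> R[i]) -> (X -> R[i])) (c : R) :
    Prop :=
  forall u, Sigma m u -> Snorm n (Q u) <= c * Snorm m u.

Record noise_operator (B : nat -> (X -> R[i]) -> (X -> R[i])) : Prop := {
  noise_linear : forall K u v (c : R[i]), (0 < K)%N -> L2 u -> L2 v ->
    B K (fun x => c * u x + v x) = fun x => c * B K u x + B K v x ;
  noise_range : forall K u, (0 < K)%N -> L2 u -> SigmaK K (B K u) ;
  noise_sym : forall K u v, (0 < K)%N -> L2 u -> L2 v ->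
    inner (B K u) v = inner u (B K v) ;
  noise_bounds : forall k : nat, exists2 C : R, 0 < C & forall K, (0 < K)%N ->
    [/\ opnorm_le k.+2 k (B K) C,
        opnorm_le k k (B K) (C * K%:R),
        opnorm_le (2 * k) 0 (commA k (B K)) C &
        forall u, Sigma k u ->
          `|complex.Re (commA_form k (B K) u)| <= C * Snorm2 k u] }.

End hermite.

Section brownian.
Context {R : realType} {disp : measure_display} {Omega : measurableType disp}.
Implicit Type W : R -> Omega -> R.

Definition history W (t : R) : set (set Omega) :=
  <<s [set A | exists (s : R) (E : set R),
        [/\ 0 <= s <= t, measurable E & A = W s @^-1` E]] >>.

Record brownian (P : probability Omega R) W : Prop := {
  brownian_measurable : forall t : R, 0 <= t -> measurable_fun setT (W t) ;
  brownian_start : {ae P, forall w, W 0 w = 0} ;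
  brownian_continuous : {ae P, forall w,
    {within [set t : R | 0 <= t], continuous (fun t => W t w)}} ;
  brownian_gaussian : forall s t : R, 0 <= s < t ->
    forall E : set R, measurable E ->
      P ((W t \- W s) @^-1` E) = normal_prob 0 (Num.sqrt (t - s)) E ;
  brownian_indep : forall s t : R, 0 <= s < t ->
    forall (A : set Omega) (E : set R), history W s A -> measurable E ->
      P (A `&` (W t \- W s) @^-1` E) = (P A * P ((W t \- W s)%R @^-1` E))%E }.

End brownian.

Section scheme.
Context {R : realType} {d : nat}.
Context {disp : measure_display} {Omega : measurableType disp}.
Local Notation X := 'rV[R]_d.
Variables (P : probability Omega R) (W : R -> Omega -> R).
Variable B : nat -> (X -> R[i]) -> (X -> R[i]).
Variables (T : R) (N : nat).
Implicit Types (u v : X -> R[i]) (w : Omega) (n K : nat).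

Definition dt : R := T / N%:R.

Definition time n : R := n%:R * dt.

Definition chi n w : R := (Num.sqrt dt)^-1 * (W (time n) w - W (time n.-1) w).

Definition tau (C0 : R) w : nat :=
  \big[minn/N.+1]_(1 <= n < N.+1 | C0 <= `|W (time n) w - W (time n.-1) w|) n.

Definition midpoint_op K n w u : X -> R[i] := fun x =>
  (dt / 2)%:C * opAK K u x + (Num.sqrt dt / 2 * chi n w)%:C * B K u x.

(* schemeTinv K n.+1 C0 and schemeS K n.+1 C0 are the operators T^{-1} and S
   attached to the time step from n to n.+1. *)
Definition schemeTinv K n (C0 : R) w u : X -> R[i] :=
  if (n < tau C0 w)%N then
    invK K (fun v x => v x + 'i%C * midpoint_op K n w v x) u
  else fun=> 0.

Definition schemeS K n (C0 : R) w u : X -> R[i] :=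
  if (n < tau C0 w)%N then
    schemeTinv K n C0 w (fun x => u x - 'i%C * midpoint_op K n w u x)
  else u.

Definition truncated_cubic (theta : R -> R) (k L : nat) u v : X -> R[i] :=
  fun x =>
  (theta (Snorm2 k u / L%:R) * theta (Snorm2 k v / L%:R))%:C *
  ((`|u x| ^+ 2 + `|v x| ^+ 2) / 2) * ((u x + v x) / 2).

Definition sup_Snorm2 (j : nat) (phi : nat -> Omega -> X -> R[i]) w : R :=
  \big[Num.max/0]_(n < N.+1) Snorm2 j (phi n w).

Record discrete_solution (theta : R -> R) (k j L : nat) (C0 : R) K
    (phi0 : X -> R[i]) (phi : nat -> Omega -> X -> R[i]) : Prop := {
  sol_space : forall n w, (n <= N)%N -> Sigma j (phi n w) ;
  (* Borel measurability for the topology of Sigma j *)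
  sol_adapted : forall n U, (n <= N)%N -> Sopen j U ->
    history W (time n) (phi n @^-1` U) ;
  sol_integrable : ('E_P[sup_Snorm2 j phi] < +oo)%E ;
  sol_init : {ae P, forall w, eq_L2 (phi 0%N w) (projK K phi0)} ;
  sol_step : {ae P, forall w, forall n, (n < N)%N ->
    eq_L2 (phi n.+1 w)
      (fun x => schemeS K n.+1 C0 w (phi n w) x
         - 'i%C * dt%:C * schemeTinv K n.+1 C0 w
             (projK K (truncated_cubic theta k L (phi n w) (phi n.+1 w))) x)} }.

End scheme.

Record stable_threshold {R : realType} {d : nat} {disp : measure_display}
    {Omega : measurableType disp} (P : probability Omega R)
    (W : R -> Omega -> R)
    (B : nat -> ('rV[R]_d -> R[i]) -> ('rV[R]_d -> R[i])) (j : nat) (C0 : R) :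
    Prop := {
  threshold_gt0 : 0 < C0 ;
  threshold_stable : forall (T : R) (N : nat), 0 < T -> (0 < N)%N ->
    dt T N < 1 -> {ae P, forall w, forall K n (u : 'rV[R]_d -> R[i]),
      (0 < K)%N -> SigmaK K u ->
      Snorm2 j (schemeS W B T N K n.+1 C0 w u) <= 2 * Snorm2 j u /\
      Snorm2 j (schemeTinv W B T N K n.+1 C0 w u) <= 2 * Snorm2 j u} }.

(* Smoothness at 0 on [0, +oo[ is contained in cutoff_one. *)
Record cutoff {R : realType} (theta : R -> R) : Prop := {
  cutoff_smooth : forall (n : nat) (x : R), 0 < x ->
    derivable (theta^`(n))%classic x 1 ;
  cutoff_ge0 : forall x, 0 <= x -> 0 <= theta x ;
  cutoff_supp : forall x, 2 < x -> theta x = 0 ;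
  cutoff_one : forall x, 0 <= x <= 1 -> theta x = 1 }.

(* Main.v *)
Require Import Defs.
From HB Require Import structures.
From mathcomp Require Import all_boot all_order all_algebra.
From mathcomp Require Import all_classical all_reals all_analysis.
From mathcomp Require Import measurable_realfun complex ring lra.

(** In the Hermite basis the scheme is a Cayley step on finitely many coefficients c_n, and
    |u|_{Sigma^s}^2 becomes the sum of lam_n^s |c_n|^2.

    The truncated cubic term is linearly bounded in Sigma^j and Lipschitz in Sigma^k, uniformly in
    K: this is a tame estimate resting on a sup-norm bound by a Sigma norm of low order, obtained
    from a pointwise bound for the sum of the squares of the Hermite functions (Agmon's inequality
    in dimension one). T^-1 contracts L^2 and is bounded on Sigma^j, hence by interpolation on
    Sigma^k, so the implicit step is a contraction of Sigma^k for small dt.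

    The Cayley transform is unitary on L^2, so the change of |c|_j^2 over a step only sees the
    commutator [A^j, B_K]. With x the Brownian increment, its first-order part is x m(c), where m
    is a quadratic form bounded by |c|_j^2; the second-order part involves
    Re <[A^j, B_K] c, B_K c>, and altogether the rest is at most C (dt + x^2 + K^4 x^4) |c|_j^2,
    where K^4 dt <= K_0^4. The increment truncated at C_0 is centred
    and independent of the past, so |phi^n|_j^2 is dominated by a martingale plus a small multiple
    of itself: Gronwall's lemma for second moments and Doob's L^2 inequality conclude. *)

Set Implicit Arguments.
Unset Strict Implicit.
Unset Printing Implicit Defensive.

Import Order.TTheory GRing.Theory Num.Theory.
Import numFieldNormedType.Exports.

Local Open Scope classical_set_scope.
Local Open Scope ring_scope.
Local Open Scope complex_scope.

(** * Integration on R^n *)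

(** Every constant must be uniform in [K], although all norms are equivalent on a space of dimension
    [K^d]. The main tool is [krein], which moves a bound from a stronger to a weaker norm without
    loss: it gives the interpolation of T^-1, and it turns the bound of [A^j, B_K] from Sigma^2j to
    L^2 into a bound of the form <[A^j, B_K] u, v> on Sigma^j. The cubic term is estimated at the
    fixed order [kd] <= 2, the least integer above d/2, which makes its linear bound independent of
    k. The fixed point is sought in Sigma^k because the cutoff controls that norm only, whereas the
    threshold C_0(j) gives stability at order j; this is why T^-1 has to be interpolated. The
    commutator form must be taken at c, known before the increment, and not at T^-1 c. The exchange
    produces powers of [K], since B_K costs a factor [K] on Sigma^j; the condition K <= K_0
    dt^(-1/4) absorbs them. An a priori bound by 16^n, valid almost surely and imposed on the
    construction, makes all random variables bounded; it never enters a constant. *)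

Section real_integral.
Context d (T : measurableType d) (R : realType).
Variable mu : {measure set T -> \bar R}.
Implicit Types f g : T -> R.

Definition rint f := mu.-integrable setT (EFin \o f).

Lemma rint_measurable f : rint f -> measurable_fun setT f.
Proof. by move=> /measurable_int/measurable_EFinP. Qed.

Lemma rint_le f g : measurable_fun setT f -> (forall x, `|f x| <= g x) ->
  rint g -> rint f.
Proof.
move=> mf fg ig; apply: le_integrable ig => //; first exact/measurable_EFinP.
move=> x _ /=; rewrite lee_fin (le_trans (fg x))//.
by rewrite ger0_norm// (le_trans _ (fg x)).
Qed.

Lemma rint0 : rint (fun=> 0).
Proof. exact: integrable0. Qed.

Lemma rintD f g : rint f -> rint g -> rint (fun x => f x + g x).
Proof.
by move=> fi gi; have := integrableD measurableT fi gi; apply: eq_integrable.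
Qed.

Lemma rintN f : rint f -> rint (fun x => - f x).
Proof. by move=> fi; have := integrableN fi; apply: eq_integrable. Qed.

Lemma rintB f g : rint f -> rint g -> rint (fun x => f x - g x).
Proof. by move=> fi gi; apply: rintD => //; exact: rintN. Qed.

Lemma rintZ (k : R) f : rint f -> rint (fun x => k * f x).
Proof.
by move=> fi; have := integrableZl measurableT k fi; apply: eq_integrable.
Qed.

Lemma rint_sum (I : Type) (s : seq I) (p : pred I) (F : I -> T -> R) :
  (forall i, p i -> rint (F i)) -> rint (fun x => \sum_(i <- s | p i) F i x).
Proof.
move=> Fi; have := integrable_sum measurableT s Fi.
by apply: eq_integrable => // x _ /=; rewrite -sumEFin.
Qed.

Lemma rint_norm f : rint f -> rint (fun x => `|f x|).
Proof. by move=> fi; have := integrable_norm fi; apply: eq_integrable. Qed.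

Lemma rintM f g : measurable_fun setT f -> measurable_fun setT g ->
  rint (fun x => f x ^+ 2) -> rint (fun x => g x ^+ 2) ->
  rint (fun x => f x * g x).
Proof.
move=> mf mg f2 g2; apply: rint_le (rintD f2 g2).
  exact: measurable_funM.
move=> x; rewrite normrM -(real_normK (num_real (f x))).
rewrite -(real_normK (num_real (g x))).
have := normr_ge0 (f x); have := normr_ge0 (g x).
move: `|f x| `|g x| => a b ha hb; nra.
Qed.

Lemma IntD f g : rint f -> rint g ->
  \int[mu]_x (f x + g x) = \int[mu]_x f x + \int[mu]_x g x.
Proof. exact: RintegralD. Qed.

Lemma IntB f g : rint f -> rint g ->
  \int[mu]_x (f x - g x) = \int[mu]_x f x - \int[mu]_x g x.
Proof. exact: RintegralB. Qed.

Lemma IntZ (k : R) f : rint f -> \int[mu]_x (k * f x) = k * \int[mu]_x f x.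
Proof. exact: RintegralZl. Qed.

Lemma IntN f : rint f -> \int[mu]_x (- f x) = - \int[mu]_x f x.
Proof.
move=> fi; rewrite -mulN1r -IntZ//; apply: eq_Rintegral => x _.
by rewrite mulN1r.
Qed.

Lemma Int0 : \int[mu]_x (0 : R) = 0.
Proof. by rewrite /Rintegral integral0. Qed.

Lemma Int_sum (I : Type) (s : seq I) (p : pred I) (F : I -> T -> R) :
  (forall i, p i -> rint (F i)) ->
  \int[mu]_x (\sum_(i <- s | p i) F i x) = \sum_(i <- s | p i) \int[mu]_x F i x.
Proof.
move=> Fi; elim: s => [|i s IH].
  rewrite big_nil -[RHS]Int0; apply: eq_Rintegral => x _; by rewrite big_nil.
rewrite big_cons; case: ifP => pi.
  rewrite -IH -IntD//; [|exact: Fi|exact: rint_sum].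
  by apply: eq_Rintegral => x _; rewrite big_cons pi.
by rewrite -IH; apply: eq_Rintegral => x _; rewrite big_cons pi.
Qed.

Lemma Int_le f g : rint f -> rint g -> (forall x, f x <= g x) ->
  \int[mu]_x f x <= \int[mu]_x g x.
Proof. by move=> fi gi fg; apply: le_Rintegral. Qed.

Lemma Int_ge0 f : (forall x, 0 <= f x) -> 0 <= \int[mu]_x f x.
Proof. by move=> f0; apply: Rintegral_ge0. Qed.

Lemma EFin_Int f : rint f -> (\int[mu]_x f x)%:E = (\int[mu]_x (f x)%:E)%E.
Proof. by move=> fi; rewrite /Rintegral fineK//; exact: integrable_fin_num. Qed.

Lemma Int_ae f g : measurable_fun setT f -> measurable_fun setT g ->
  {ae mu, forall x, f x = g x} -> \int[mu]_x f x = \int[mu]_x g x.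
Proof.
move=> mf mg fg; rewrite /Rintegral; congr fine.
apply: ae_eq_integral => //; try exact/measurable_EFinP.
by apply: filterS fg => x + _ => ->.
Qed.

Lemma rint_ae f g : measurable_fun setT f -> measurable_fun setT g ->
  {ae mu, forall x, f x = g x} -> rint f -> rint g.
Proof.
move=> mf mg fg /integrableP[_ fi]; apply/integrableP; split.
  exact/measurable_EFinP.
rewrite (_ : (\int[mu]_x _ = \int[mu]_x `|(f x)%:E|)%E)//.
apply: ae_eq_integral => //.
- by apply: measurableT_comp => //; exact/measurable_EFinP.
- by apply: measurableT_comp => //; exact/measurable_EFinP.
- by apply: filterS fg => x + _ /= => ->.
Qed.

Lemma rint_lty f : measurable_fun setT f -> (forall x, 0 <= f x) ->
  rint f <-> (\int[mu]_x (f x)%:E < +oo)%E.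
Proof.
move=> mf f0; split.
  move=> fi; rewrite -EFin_Int//; exact: ltry.
move=> fi; apply/integrableP; split; first exact/measurable_EFinP.
rewrite (_ : (\int[mu]_x _ = \int[mu]_x (f x)%:E)%E)//.
by apply: eq_integral => x _ /=; rewrite ger0_norm.
Qed.

Lemma rint_bounded f (M : R) : (mu setT < +oo)%E -> measurable_fun setT f ->
  (forall x, `|f x| <= M) -> rint f.
Proof.
move=> muT mf fM; apply: measurable_bounded_integrable => //.
exists M; split; first exact: num_real.
by move=> y My x _ /=; rewrite (le_trans (fM x))// ltW.
Qed.

Lemma Int_dominated (F : nat -> T -> R) f g :
  (forall n, measurable_fun setT (F n)) -> rint g ->
  (forall n x, `|F n x| <= g x) ->
  (forall x, F n x @[n --> \oo] --> f x) ->
  (\int[mu]_x F n x) @[n --> \oo] --> \int[mu]_x f x.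
Proof.
move=> mF gi Fg Ff.
have fi : rint f.
  apply: rint_le gi.
    by apply: (@measurable_fun_cvg _ _ _ _ (fun n => F n)) => // x _; exact: Ff.
  move=> x; have cx : `|F n x| @[n --> \oo] --> `|f x| by apply: cvg_norm; exact: Ff.
  by apply: cvgr_to_le cx _; near=> n; exact: Fg.
suff : (\int[mu]_x (F n x)%:E)%E @[n --> \oo] --> (\int[mu]_x (f x)%:E)%E.
  by rewrite -EFin_Int// => /fine_cvg.
have Ffe x : (F n x)%:E @[n --> \oo] --> (f x)%:E.
  by apply/fine_cvgP; split; [exact: nearW | exact: Ff].
apply: (@dominated_cvg _ _ _ mu setT measurableT (fun n x => (F n x)%:E) _ (EFin \o g)).
- by move=> n; exact/measurable_EFinP.
- by move=> x _; exact: Ffe.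
- by [].
- exact: gi.
- by move=> n x _; rewrite lee_fin; exact: Fg.
Unshelve. all: by end_near.
Qed.
End real_integral.
Arguments rint {d T R} mu f.

(** * Borel sets of R^n *)

Section rV_borel.
Context {R : realType} (n : nat).
Local Notation X := 'rV[R]_n.

Lemma rV_ballP (x y : X) (e : R) :
  ball x e y <-> 0 < e /\ forall i, `|x 0 i - y 0 i| < e.
Proof.
split=> -[e0 xy]; split => //; first by move=> i; exact: xy.
by move=> i j; rewrite (ord1 i); exact: xy.
Qed.

Lemma measurable_rV_ball (x : X) (e : R) : measurable (ball x e : set X).
Proof.
have [e0|e0] := ltP 0 e; last first.
  rewrite (_ : ball x e = set0); first exact: measurable0.
  by apply/seteqP; split => y // /rV_ballP[]; rewrite ltNge e0.
rewrite (_ : ball x e = \bigcap_(i in [set: 'I_n])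
    ((fun y : X => y 0 i) @^-1` `]x 0 i - e, x 0 i + e[%classic)); last first.
  apply/seteqP; split => y.
    by move=> /rV_ballP[_ xy] i _ /=; rewrite in_itv/= -ltr_distlC.
  move=> xy; apply/rV_ballP; split => // i; have := xy i Logic.I.
  by rewrite /= in_itv/= -ltr_distlC.
apply: fin_bigcap_measurable; first exact: finite_finset.
move=> i _; rewrite -[X in measurable X]setTI.
by apply: measurable_coor => //; exact: measurable_itv.
Qed.

(** The sigma-algebra on rows is generated by the coordinates, so it has to be compared with the
    topology. An open set is the union of the balls that it contains with rational centre and radius
    1/(n+1): a countable family of finite intersections of coordinate slabs. *)
Lemma open_measurable_rV (U : set X) : open U -> measurable U.
Proof.
move=> oU.
pose D := ('rV[rat]_n * nat)%type.
pose q (p : D) : X := map_mx ratr p.1.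
pose F (p : D) : set X := [set y | ball (q p) p.2.+1%:R^-1 y /\
   (ball (q p) p.2.+1%:R^-1 : set X) `<=` U].
rewrite (_ : U = \bigcup_p F p).
  apply: countable_bigcupT_measurable; first exact: countableP.
  move=> p; have [qU|qU] := pselect ((ball (q p) p.2.+1%:R^-1 : set X) `<=` U).
    rewrite (_ : F p = (ball (q p) p.2.+1%:R^-1 : set X)).
      exact: measurable_rV_ball.
    by apply/seteqP; split => [y []|y yq].
  rewrite (_ : F p = set0); first exact: measurable0.
  by apply/seteqP; split => y // [_].
apply/seteqP; split => [x Ux|x [p _ [xp pU]]]; last exact: pU.
have /nbhs_ballP[e /= e0 eU] : nbhs x U by exact: open_nbhs_nbhs.
have [k ke] : exists k, k.+1%:R^-1 < e / 2.
  have e2 : 0 < e / 2 by rewrite divr_gt0.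
  have [k /= _ kP] := near_infty_natSinv_lt (PosNum e2).
  by exists k; have := kP k (leqnn k).
have qx i : exists r : rat, ratr r \in `]x 0 i - k.+1%:R^-1, x 0 i + k.+1%:R^-1[.
  by apply: rat_in_itvoo; rewrite ltrD2l gtrN// invr_gt0.
pose r := \row_i projT1 (cid (qx i)) : 'rV[rat]_n.
have rx i : `|ratr (r 0 i) - x 0 i| < k.+1%:R^-1.
  rewrite mxE; case: cid => /= s; rewrite in_itv/= => /andP[h1 h2].
  by rewrite ltr_distl h1 h2.
exists (r, k) => //; split.
  by apply/rV_ballP; split=> [|j]; [rewrite invr_gt0|rewrite mxE].
move=> y /rV_ballP[_ yq]; apply: eU; apply/rV_ballP; split => // j.
have /= := yq j; rewrite mxE /= => h.
rewrite (le_lt_trans (ler_distD (ratr (r 0 j)) _ _))//.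
have hx : `|x 0 j - ratr (r 0 j)| < e / 2.
  by rewrite distrC; exact: lt_trans (rx j) ke.
have hy := lt_trans h ke.
by have := ltrD hx hy; rewrite -splitr.
Qed.

Lemma continuous_measurable_rV (f : X -> R) :
  continuous f -> measurable_fun setT f.
Proof.
move=> /continuousP cf; apply: (measurability _ (RGenOpens.measurableE R)).
move=> _ [_ [a [b ->]] <-]; rewrite setTI; apply: open_measurable_rV.
by apply: cf; exact: interval_open.
Qed.

End rV_borel.

(** * Integrals of derivatives on the line *)

Section one_dim.
Context {R : realType}.
Local Notation mu := (@lebesgue_measure R).

(** This is the basic integrable majorant; its integrability comes from the primitive arctan on the
    half-line and parity. *)
Lemma rint_inv1px2 : rint mu (fun x : R => (1 + x ^+ 2)^-1).
Proof.
have c : continuous (fun x : R => (1 + x ^+ 2)^-1).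
  move=> x; apply: cvgV; first by rewrite gt_eqF// ltr_wpDr// sqr_ge0.
  by apply: cvgD; [exact: cvg_cst|exact: exprn_continuous].
have p0 x : 0 <= (1 + x ^+ 2 :R)^-1 by rewrite invr_ge0 addr_ge0// sqr_ge0.
apply/rint_lty => //; first exact: continuous_measurable_fun.
rewrite ge0_symfun_integralT//; last by move=> x /=; rewrite sqrrN.
rewrite -set_itvcy (@ge0_continuous_FTC2y _ _ atan 0 (pi / 2)).
- by rewrite ltry.
- by move=> x _.
- exact: continuous_subspaceT.
- exact: cvgy_atan.
- by move=> x _; apply: ex_derive; exact: is_derive1_atan.
- apply: cvg_at_right_filter; exact: continuous_atan.
- by move=> x _; rewrite derive1E; apply: derive_val.
Qed.

(** The fundamental theorem of calculus on [-(n+1), n+1] leaves boundary terms of size C/(n+1), and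
    the integrable bound on [g] allows dominated convergence to the whole line. *)
Lemma int_derivative_eq0 (f g : R -> R) (C : R) :
  (forall x : R, is_derive x 1 f (g x)) -> continuous g ->
  (forall x, `|f x| <= C * (1 + x ^+ 2)^-1) ->
  (forall x, `|g x| <= C * (1 + x ^+ 2)^-1) ->
  \int[mu]_x g x = 0.
Proof.
move=> fg cg fC gC.
have cf : continuous f.
  move=> x; apply: differentiable_continuous.
  by apply/derivable1_diffP; apply: ex_derive; exact: fg.
have mg := continuous_measurable_fun cg.
have ig : rint mu (fun x => C * (1 + x ^+ 2)^-1) by apply: rintZ; exact: rint_inv1px2.
pose A n := `[- (n.+1%:R : R), n.+1%:R]%classic.
have lim0 : (\int[mu]_x (g x * \1_(A n) x)) @[n --> \oo] --> \int[mu]_x g x.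
  apply: Int_dominated ig _ _.
  - move=> n; apply: measurable_funM => //; apply: measurable_indic; exact: measurable_itv.
  - move=> n x; rewrite normrM indicE; case: (_ \in _) => /=.
      by rewrite normr1 mulr1.
    by rewrite normr0 mulr0 (le_trans _ (gC x)).
  - move=> x; apply: cvg_near_cst.
    near=> n; rewrite indicE mem_set ?mulr1// /A /= in_itv/= -ler_norml.
    apply: (@le_trans _ _ n%:R); last by rewrite ler_nat.
    near: n; exact: nbhs_infty_ger.
have E n : \int[mu]_x (g x * \1_(A n) x) = f n.+1%:R - f (- n.+1%:R).
  rewrite (_ : \int[mu]_x _ = \int[mu]_(x in A n) g x); last first.
    rewrite [RHS]Rintegral_mkcond; apply: eq_Rintegral => x _.
    by rewrite patchE indicE; case: ifPn => _; rewrite ?mulr1 ?mulr0.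
  rewrite /Rintegral (@continuous_FTC2 _ g f)//.
  - by rewrite gtrN.
  - exact: continuous_subspaceT.
  - split => //.
    + by apply: cvg_at_right_filter; exact: cf.
    + by apply: cvg_at_left_filter; exact: cf.
  - by move=> x _; rewrite derive1E; apply: derive_val.
have dec : (fun n : nat => C * (2 * (n.+1%:R : R)^-1)) @ \oo --> (0 : R).
  rewrite -[X in _ --> X](mulr0 C) -[X in _ --> C * X](mulr0 2).
  apply: cvgM; first exact: cvg_cst.
  apply: cvgM; first exact: cvg_cst.
  exact: cvg_harmonic.
have b n (s : R) : s ^+ 2 = n.+1%:R ^+ 2 -> `|f s| <= C * (n.+1%:R)^-1.
  move=> sn; rewrite (le_trans (fC s))// sn ler_wpM2l//.
    have := le_trans (normr_ge0 _) (fC 0).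
    by rewrite expr0n/= addr0 invr1 mulr1.
  have : 1 <= n.+1%:R :> R by rewrite ler1n.
  by move: n.+1%:R => t ht; rewrite lef_pV2 ?posrE; nra.
suff /(cvg_unique _ lim0) -> // :
    (\int[mu]_x (g x * \1_(A n) x)) @[n --> \oo] --> (0 : R) by [].
have dec' : (fun n : nat => - (C * (2 * (n.+1%:R : R)^-1))) @ \oo --> (0 : R).
  by rewrite -[X in _ --> X]oppr0; exact: cvgN dec.
apply: (squeeze_cvgr _ dec' dec).
near=> n; rewrite -ler_norml E mulrCA mulr_natl mulr2n.
by rewrite (le_trans (ler_normB _ _))// lerD// b// sqrrN.
Unshelve. all: by end_near.
Qed.

End one_dim.

Section product_integral.
Context d1 d2 (T1 : measurableType d1) (T2 : measurableType d2) {R : realType}.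
Variables (m1 : {sigma_finite_measure set T1 -> \bar R})
  (m2 : {sigma_finite_measure set T2 -> \bar R}).

Lemma rint_prod (f : T1 -> R) (g : T2 -> R) : rint m1 f -> rint m2 g ->
  rint (m1 \x m2)%E (fun p => f p.1 * g p.2).
Proof.
move=> fi gi.
have mfg : measurable_fun setT (fun p : T1 * T2 => f p.1 * g p.2).
  apply: measurable_funM.
    by apply: measurableT_comp; [exact: rint_measurable fi|exact: measurable_fst].
  by apply: measurableT_comp; [exact: rint_measurable gi|exact: measurable_snd].
apply/integrable12ltyP; first exact/measurable_EFinP.
rewrite (_ : (\int[m1]_x _)%E = (\int[m1]_x (`|f x| * \int[m2]_y `|g y|)%:E)%E).
  have := integrable_lty measurableT (rintZ (\int[m2]_y `|g y|) (rint_norm fi)).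
  by congr (_ < _)%E; apply: eq_integral => x _ /=; rewrite mulrC.
apply: eq_integral => x _ /=.
under eq_integral do rewrite normrM.
rewrite -EFin_Int; first by rewrite IntZ//; exact: rint_norm.
by apply: rintZ; exact: rint_norm.
Qed.

Lemma Int_prod12 (F : T1 * T2 -> R) : rint (m1 \x m2)%E F ->
  (forall x, rint m2 (fun y => F (x, y))) ->
  \int[(m1 \x m2)%E]_p F p = \int[m1]_x (\int[m2]_y F (x, y)).
Proof.
move=> Fi Fs; rewrite /Rintegral -integral12_prod_meas1//; congr fine.
by apply: eq_integral => x _; rewrite /fubini_F fineK//; apply: integrable_fin_num => //; exact: Fs.
Qed.

Lemma Int_prod21 (F : T1 * T2 -> R) : rint (m1 \x m2)%E F ->
  (forall y, rint m1 (fun x => F (x, y))) ->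
  \int[(m1 \x m2)%E]_p F p = \int[m2]_y (\int[m1]_x F (x, y)).
Proof.
move=> Fi Fs; rewrite /Rintegral -integral21_prod_meas1//; congr fine.
by apply: eq_integral => x _; rewrite /fubini_G fineK//; apply: integrable_fin_num => //; exact: Fs.
Qed.

Lemma Int_prodM (f : T1 -> R) (g : T2 -> R) : rint m1 f -> rint m2 g ->
  \int[(m1 \x m2)%E]_p (f p.1 * g p.2) = (\int[m1]_x f x) * \int[m2]_y g y.
Proof.
move=> fi gi; rewrite Int_prod12; [|exact: rint_prod|by move=> x /=; exact: (rintZ (f x) gi)].
rewrite mulrC -IntZ//; apply: eq_Rintegral => x _ /=.
by rewrite IntZ// mulrC.
Qed.

End product_integral.

(** An affine line turns one difference quotient into the other, term by term, so only directional
    derivatives are involved and no chain rule. *)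
Lemma is_derive_shift {R : realType} (U V W : normedModType R) (phi : U -> V)
    (u t : U) (v : V) (F : V -> W) g :
  (forall h, phi (h *: u + t) = h *: v + phi t) ->
  is_derive (phi t) v F g -> is_derive t u (F \o phi) g.
Proof.
move=> E [dF DF].
have EE : (fun h : R => h^-1 *: (((F \o phi) \o shift t) (h *: u) - (F \o phi) t))
    = (fun h : R => h^-1 *: ((F \o shift (phi t)) (h *: v) - F (phi t))).
  by apply/funext => h /=; rewrite E.
by split; [rewrite /derivable EE|rewrite /derive EE].
Qed.

Lemma nonexpansive_continuous {R : realType} (V W : normedModType R) (f : V -> W) :
  (forall x y, `|f x - f y| <= `|x - y|) -> continuous f.
Proof.
move=> h x; apply/cvgrPdist_lt => e e0; near=> y.
by rewrite (le_lt_trans (h _ _))//; near: y; exact: cvgr_dist_lt.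
Unshelve. all: by end_near.
Qed.

(** * Iterated integrals on R^n and vanishing integrals of partial derivatives *)

Section fubini_rV.
Context {R : realType}.
Local Notation mu := (@lebesgue_measure R).
Local Notation leb n := (@lebesgue_rV R n).

Lemma rint_consrV n (f : 'rV[R]_n.+1 -> R) : measurable_fun setT f ->
  rint (mu \x leb n)%E (f \o @consrV R n) -> rint (leb n.+1) f.
Proof.
move=> mf fi; apply: (@integrable_pushforward _ _ (measurableTypeR R * 'rV[R]_n)%type _ _ _
  (@measurable_consrV R n) _ setT) => //.
exact/measurable_EFinP.
Qed.

Lemma Int_consrV n (f : 'rV[R]_n.+1 -> R) : measurable_fun setT f ->
  rint (mu \x leb n)%E (f \o @consrV R n) ->
  \int[leb n.+1]_x f x = \int[(mu \x leb n)%E]_p f (consrV p).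
Proof.
move=> mf fi; rewrite /Rintegral; congr fine.
apply: (@integral_pushforward _ _ (measurableTypeR R * 'rV[R]_n)%type _ _ _
  (@measurable_consrV R n) _ setT) => //.
exact/measurable_EFinP.
Qed.

Lemma consrV0 n (p : R * 'rV[R]_n) : consrV p 0 ord0 = p.1.
Proof. by rewrite mxE unlift_none. Qed.

Lemma consrVS n (p : R * 'rV[R]_n) i : consrV p 0 (lift ord0 i) = p.2 0 i.
Proof. by rewrite mxE liftK. Qed.

Definition tens n (g : 'I_n -> R -> R) (x : 'rV[R]_n) : R := \prod_i g i (x 0 i).

Lemma tens_consrV n (g : 'I_n.+1 -> R -> R) p :
  tens g (consrV p) = g ord0 p.1 * tens (fun i => g (lift ord0 i)) p.2.
Proof.
rewrite /tens big_ord_recl consrV0; congr (_ * _).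
by apply: eq_bigr => i _; rewrite consrVS.
Qed.

Lemma measurable_tens n (g : 'I_n -> R -> R) :
  (forall i, measurable_fun setT (g i)) -> measurable_fun setT (tens g).
Proof.
move=> mg; apply: measurable_prod => i _.
by apply: measurableT_comp => //; exact: measurable_coor.
Qed.

Lemma tensE0 (g : 'I_0 -> R -> R) : tens g = fun=> 1.
Proof. by apply/funext => x; rewrite /tens big_ord0. Qed.

Lemma tens_int n (g : 'I_n -> R -> R) : (forall i, rint mu (g i)) ->
  rint (leb n) (tens g) /\ \int[leb n]_x tens g x = \prod_i \int[mu]_x g i x.
Proof.
elim: n g => [|n IH] g gi.
  rewrite tensE0 big_ord0; split.
    by apply: (@rint_bounded _ _ _ _ _ 1) => //; rewrite ?diracT ?ltry// => x; rewrite normr1.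
  by rewrite /Rintegral /= integral_dirac// diracT mul1e.
have [ri rI] := IH _ (fun i => gi (lift ord0 i)).
have mg : measurable_fun setT (tens g).
  by apply: measurable_tens => i; exact: (rint_measurable (gi i)).
have E : tens g \o @consrV R n =
    fun p => g ord0 p.1 * tens (fun i => g (lift ord0 i)) p.2.
  by apply/funext => p; exact: tens_consrV.
have ti : rint (mu \x leb n)%E (tens g \o @consrV R n).
  by rewrite E; apply: rint_prod.
split; first exact: rint_consrV.
rewrite Int_consrV// (_ : (fun p => _) = tens g \o @consrV R n)// E Int_prodM//.
by rewrite rI big_ord_recl.
Qed.

(** A product weight rather than a radial one: it splits under [consrV] and is integrated one
    variable at a time. Its powers measure the decay of Schwartz functions. *)
Definition wt n : 'rV[R]_n -> R := tens (fun=> fun x => (1 + x ^+ 2)^-1).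

Lemma inv1px2_gt0 (t : R) : 0 < (1 + t ^+ 2)^-1.
Proof. by rewrite invr_gt0 ltr_wpDr// sqr_ge0. Qed.

Lemma wt_gt0 n (x : 'rV[R]_n) : 0 < wt x.
Proof. by apply: prodr_gt0 => i _; exact: inv1px2_gt0. Qed.

Lemma rint_wt n : rint (leb n) (@wt n).
Proof. by apply: (tens_int _).1 => i; exact: rint_inv1px2. Qed.

Lemma wt_consrV n (p : R * 'rV[R]_n) : wt (consrV p) = (1 + p.1 ^+ 2)^-1 * wt p.2.
Proof. exact: tens_consrV. Qed.

Lemma continuous_consrV1 n (x : 'rV[R]_n) : continuous (fun t : R => consrV (t, x)).
Proof.
apply: nonexpansive_continuous => t s.
rewrite [leLHS]mx_normrE; apply: bigmax_le => // -[i j] _ /=.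
by rewrite !mxE; case: (unlift _ _) => //= k; rewrite subrr normr0.
Qed.

Lemma continuous_consrV2 n (t : R) : continuous (fun x : 'rV[R]_n => consrV (t, x)).
Proof.
apply: nonexpansive_continuous => x s.
rewrite [leLHS]mx_normrE; apply: bigmax_le => // -[i j] _ /=.
rewrite !mxE; case: (unlift _ _) => [k|] /=; last by rewrite subrr normr0.
rewrite [leRHS]mx_normrE.
by apply: le_trans (le_bigmax _ _ (0, k)) => /=; rewrite !mxE.
Qed.

(** Induction on the dimension. If [i] is the first coordinate, that variable is integrated first
    and the one-dimensional result applies on each line; otherwise the remaining variables are
    integrated first and the induction hypothesis applies on each slice. Since the weight factors,
    the bounds on slices keep the same form. *)
Lemma int_partial_eq0 n (i : 'I_n) (F G : 'rV[R]_n -> R) (C : R) :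
  (forall x, is_derive x (delta_mx 0 i : 'rV[R]_n) F (G x)) -> continuous G ->
  (forall x, `|F x| <= C * wt x) -> (forall x, `|G x| <= C * wt x) ->
  \int[leb n]_x G x = 0.
Proof.
elim: n i F G C => [[]//|n IH] i F G C FG cG FC GC.
have mG := continuous_measurable_rV cG.
have cG1 x : continuous (fun t : R => G (consrV (t, x))).
  move=> t; apply: (@continuous_comp _ _ _ (fun t : R => consrV (t, x)) G).
    exact: continuous_consrV1.
  exact: cG.
have cG2 t : continuous (fun x : 'rV[R]_n => G (consrV (t, x))).
  move=> x; apply: (@continuous_comp _ _ _ (fun x : 'rV[R]_n => consrV (t, x)) G).
    exact: continuous_consrV2.
  exact: cG.
have b1 t x : `|G (consrV (t, x))| <= (C * (1 + t ^+ 2)^-1) * wt x.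
  by rewrite (le_trans (GC _))// wt_consrV mulrA.
have b2 t x : `|G (consrV (t, x))| <= (C * wt x) * (1 + t ^+ 2)^-1.
  by rewrite (le_trans (b1 t x))// mulrAC.
have Gi : rint (mu \x leb n)%E (G \o @consrV R n).
  have := rintZ C (rint_prod rint_inv1px2 (@rint_wt n)); apply: rint_le.
    by apply: measurableT_comp => //; exact: measurable_consrV.
  by move=> [t x] /=; rewrite mulrA.
rewrite Int_consrV//.
case: (unliftP ord0 i) => [j|] ei.
  transitivity (\int[mu]_t (\int[leb n]_x G (consrV (t, x)))).
    apply: (Int_prod12 Gi) => t; apply: rint_le (rintZ _ (@rint_wt n)); last exact: b1.
    exact: (continuous_measurable_rV (cG2 t)).
  rewrite -[RHS](Int0 mu); apply: eq_Rintegral => t _ /=.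
  apply: (IH j (fun x => F (consrV (t, x))) _ (C * (1 + t ^+ 2)^-1)).
  - move=> x; apply: (@is_derive_shift _ _ _ _ (fun x => consrV (t, x)) _ _ (delta_mx 0 i)) => //.
    move=> h; apply/rowP => k; rewrite !mxE ei; case: (unliftP ord0 k) => [l|] -> /=.
      by rewrite !mxE eqxx /= (inj_eq lift_inj).
    by rewrite mulr0 add0r.
  - exact: cG2.
  - by move=> x; rewrite (le_trans (FC _))// wt_consrV mulrA.
  - by move=> x; exact: b1.
transitivity (\int[leb n]_x (\int[mu]_t G (consrV (t, x)))).
  apply: (Int_prod21 Gi) => x; apply: rint_le (rintZ _ rint_inv1px2); last by move=> t; exact: b2.
  exact: (continuous_measurable_fun (cG1 x)).
rewrite -[RHS](Int0 (leb n)); apply: eq_Rintegral => x _ /=.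
apply: (@int_derivative_eq0 _ (fun t => F (consrV (t, x))) _ (C * wt x)).
- move=> t; apply: (@is_derive_shift _ _ _ _ (fun t => consrV (t, x)) _ _ (delta_mx 0 i)) => //.
  move=> h; apply/rowP => k; rewrite !mxE ei; case: (unliftP ord0 k) => [l|] -> /=.
    by rewrite mulr0 add0r.
  by rewrite ?eqxx /= ?[h *: _]mulr1 ?mulr1.
- exact: cG1.
- by move=> t; rewrite (le_trans (FC _))// wt_consrV mulrA mulrAC.
- by move=> t; exact: b2.
Qed.

End fubini_rV.

(** * Schwartz functions *)

Section continuous_real.
Context {R : realType} (T : topologicalType).
Implicit Types f g : T -> R.

Lemma continuous_add f g : continuous f -> continuous g ->
  continuous (fun x => f x + g x).
Proof. by move=> cf cg x; apply: cvgD; [exact: cf|exact: cg]. Qed.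

Lemma continuous_mul f g : continuous f -> continuous g ->
  continuous (fun x => f x * g x).
Proof. by move=> cf cg x; apply: cvgM; [exact: cf|exact: cg]. Qed.

Lemma continuous_const (c : R) : continuous (fun _ : T => c).
Proof. by move=> x; exact: cvg_cst. Qed.

Lemma continuous_scale (c : R) f : continuous f -> continuous (fun x => c * f x).
Proof. by move=> cf; apply: continuous_mul => //; exact: continuous_const. Qed.

End continuous_real.

Section schwartz_class.
Context {R : realType} {d : nat}.
Local Notation X := 'rV[R]_d.
Local Notation leb := (@lebesgue_rV R d).
Implicit Types (f g : X -> R) (i j : 'I_d) (s : seq 'I_d).

Local Notation e_ i := (delta_mx 0 i : X).

Definition decays f := forall p : nat, exists C, forall x, `|f x| <= C * wt x ^+ p.

Lemma wt_le1 (x : X) : wt x <= 1.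
Proof.
rewrite /wt /tens -[leRHS](@big1 R 1 *%R 'I_d (index_enum _) xpredT (fun=> 1))//.
apply: ler_prod => i _; rewrite invr_ge0 addr_ge0 ?sqr_ge0//= invf_le1.
  by rewrite lerDl sqr_ge0.
by rewrite ltr_wpDr// sqr_ge0.
Qed.

Lemma wt_coor (x : X) i : (1 + `|x 0 i|) * wt x <= 2.
Proof.
rewrite /wt /tens (bigD1 i)//= mulrA.
have h1 : (1 + `|x 0 i|) * (1 + x 0 i ^+ 2)^-1 <= 2.
  rewrite ler_pdivrMr; last by rewrite ltr_wpDr// sqr_ge0.
  rewrite -(real_normK (num_real (x 0 i))); move: `|x 0 i| => t; nra.
rewrite -[leRHS]mulr1; apply: ler_pM => //.
- by rewrite mulr_ge0// ?addr_ge0// invr_ge0 addr_ge0// sqr_ge0.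
- by apply: prodr_ge0 => j _; rewrite ltW// inv1px2_gt0.
- rewrite -[leRHS](@big1 R 1 *%R 'I_d (index_enum _) (fun j => j != i) (fun=> 1))//.
  apply: ler_prod => j _; rewrite invr_ge0 addr_ge0 ?sqr_ge0//= invf_le1.
    by rewrite lerDl sqr_ge0.
  by rewrite ltr_wpDr// sqr_ge0.
Qed.

Lemma decays_bounded f : decays f -> exists C, forall x, `|f x| <= C.
Proof.
by move=> /(_ 0) [C h]; exists C => x; have := h x; rewrite expr0 mulr1.
Qed.

Lemma decaysD f g : decays f -> decays g -> decays (fun x => f x + g x).
Proof.
move=> df dg p; have [C hC] := df p; have [D hD] := dg p; exists (C + D) => x.
by rewrite (le_trans (ler_normD _ _))// mulrDl lerD.
Qed.

Lemma decaysM_bounded f g : decays f -> (exists C, forall x, `|g x| <= C) ->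
  decays (fun x => f x * g x).
Proof.
move=> df [D hD] p; have [C hC] := df p; exists (C * D) => x.
rewrite normrM mulrAC; apply: ler_pM => //.
Qed.

Lemma decays_coor f i : decays f -> decays (fun x => x 0 i * f x).
Proof.
move=> df p; have [C hC] := df p.+1; exists (2 * C) => x.
have h := wt_coor x i; have w0 := wt_gt0 x.
have C0 : 0 <= C.
  have := le_trans (normr_ge0 _) (hC x).
  by rewrite pmulr_lge0// exprn_gt0.
rewrite normrM (le_trans (ler_wpM2l (normr_ge0 _) (hC x)))// exprS.
have wp : 0 <= wt x ^+ p by rewrite exprn_ge0// ltW.
rewrite mulrCA mulrA (mulrA _ (wt x)) -mulrA -[leRHS]mulrA.
have h2 : `|x 0 i| * wt x <= 2 by move: h; rewrite mulrDl mul1r; lra.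
rewrite (_ : _ * _ = (`|x 0 i| * wt x) * (C * wt x ^+ p)); last by ring.
by apply: ler_wpM2r => //; rewrite mulr_ge0.
Qed.

(** Stratification by the number of derivatives turns the closure properties into inductions on [n].
    Multiplication by coordinates is harmless because [decays] asks for every power of the weight
    and a coordinate uses up one of them. *)
Fixpoint schwn n f : Prop := (continuous f /\ decays f) /\
  if n is n'.+1 then (forall i x, derivable f x (e_ i)) /\
    forall i, schwn n' (partial i f) else True.

Definition schwartz f := forall n, schwn n f.

Lemma schwnS n f : schwn n.+1 f <-> [/\ continuous f, decays f,
  (forall i x, derivable f x (e_ i)) & forall i, schwn n (partial i f)].
Proof. by split=> [[[? ?] [? ?]]|[]]. Qed.

Lemma schwnW n f : schwn n.+1 f -> schwn n f.
Proof.
elim: n f => [|n IH] f; first by case.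
by move=> /schwnS[cf df ef sf]; apply/schwnS; split => // i; exact/IH/sf.
Qed.

Lemma partial_is_derive f i x df : is_derive x (e_ i) f df -> partial i f x = df.
Proof. by case. Qed.

Lemma schwn0 n : schwn n (fun=> 0).
Proof.
elim: n => [|n IH]; (split; [split|]) => //.
- exact: continuous_const.
- by move=> p; exists 0 => x; rewrite normr0 mul0r.
- exact: continuous_const.
- by move=> p; exists 0 => x; rewrite normr0 mul0r.
split=> [i x|i]; first exact: derivable_cst.
rewrite (_ : partial i _ = fun=> 0)//; apply/funext => x; exact: derive_cst.
Qed.

Lemma partialD i f g x : derivable f x (e_ i) -> derivable g x (e_ i) ->
  is_derive x (e_ i) (fun x => f x + g x) (partial i f x + partial i g x).
Proof.
move=> df dg; have [? ?] : is_derive x (e_ i) (f + g) (partial i f x + partial i g x).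
  by apply: is_deriveD; exact: DeriveDef.
by [].
Qed.

Lemma partialM i f g x : derivable f x (e_ i) -> derivable g x (e_ i) ->
  is_derive x (e_ i) (fun x => f x * g x)
    (partial i f x * g x + f x * partial i g x).
Proof.
move=> df dg.
have E : (fun x : X => f x * g x) = f * g by [].
rewrite E; have h := derivableM df dg; have e := deriveM df dg.
split; first exact: h.
by rewrite e addrC; congr (_ + _); exact: mulrC.
Qed.

Lemma coor_is_derive i j x : is_derive x (e_ i) (fun y : X => y 0 j) (i == j)%:R.
Proof.
have E (h : R) : h^-1 *: (((fun y : X => y 0 j) \o shift x) (h *: e_ i) - x 0 j)
   = (h^-1 * h) * (i == j)%:R.
  by rewrite /= !mxE eqxx /= addrK -[_ *: _]/(_ * _) mulrA eq_sym.
have L : (fun h : R => h^-1 *: (((fun y : X => y 0 j) \o shift x) (h *: e_ i) - x 0 j)) @ 0^' --> ((i == j)%:R : R).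
  apply: cvg_near_cst; near=> h; rewrite E mulVf ?mul1r//.
  by near: h; exact: nbhs_dnbhs_neq.
split; [by apply/cvg_ex; exists (i == j)%:R|exact: cvg_lim].
Unshelve. all: by end_near.
Qed.

Lemma schwnD n f g : schwn n f -> schwn n g -> schwn n (fun x => f x + g x).
Proof.
elim: n f g => [|n IH] f g.
  move=> [[cf df] sf] [[cg dg] sg]; split => //.
  by split; [exact: continuous_add|exact: decaysD].
move=> /schwnS[cf df ef sf] /schwnS[cg dg eg sg]; apply/schwnS; split.
- exact: continuous_add.
- exact: decaysD.
- by move=> i x; have [] := partialD (ef i x) (eg i x).
move=> i; rewrite (_ : partial i _ = fun x => partial i f x + partial i g x).
  by apply: IH; [exact: sf|exact: sg].
by apply/funext => x; apply: partial_is_derive; exact: partialD.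
Qed.

Lemma schwnM n f g : schwn n f -> schwn n g -> schwn n (fun x => f x * g x).
Proof.
elim: n f g => [|n IH] f g.
  move=> [[cf df] sf] [[cg dg] sg]; split => //; split.
    exact: continuous_mul.
  by apply: decaysM_bounded => //; exact: decays_bounded.
move=> sf1 sg1; have [sf0 sg0] := (schwnW sf1, schwnW sg1).
move: sf1 sg1 => /schwnS[cf df ef sf] /schwnS[cg dg eg sg]; apply/schwnS; split.
- exact: continuous_mul.
- by apply: decaysM_bounded => //; exact: decays_bounded.
- by move=> i x; have [] := partialM (ef i x) (eg i x).
move=> i; rewrite (_ : partial i _ = fun x => partial i f x * g x + f x * partial i g x).
  by apply: schwnD; apply: IH.
by apply/funext => x; apply: partial_is_derive; exact: partialM.
Qed.

Lemma schwnZ n (c : R) f : schwn n f -> schwn n (fun x => c * f x).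
Proof.
have dZ h : decays h -> decays (fun x => c * h x).
  move=> dh p; have [C hC] := dh p; exists (`|c| * C) => x.
  by rewrite normrM -mulrA ler_wpM2l.
elim: n f => [|n IH] f.
  by move=> [[cf df] sf]; split => //; split; [exact: continuous_scale|exact: dZ].
move=> /schwnS[cf df ef sf].
have D i x : is_derive x (e_ i) (fun x => c * f x) (c * partial i f x).
  have : is_derive x (e_ i) (c \*: f) (c *: partial i f x).
    by apply: is_deriveZ; apply: DeriveDef => //; exact: ef.
  by [].
apply/schwnS; split; [exact: continuous_scale|exact: dZ| |].
  by move=> i x; have [] := D i x.
move=> i; rewrite (_ : partial i _ = fun x => c * partial i f x); first exact: IH.
by apply/funext => x; apply: partial_is_derive; exact: D.
Qed.

Lemma schwn_coor n f j : schwn n f -> schwn n (fun x => x 0 j * f x).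
Proof.
have cC h : continuous h -> continuous (fun x : X => x 0 j * h x).
  by move=> ch; apply: continuous_mul => //; exact: coord_continuous.
elim: n f => [|n IH] f.
  by case=> -[cf df] _; split => //; split; [exact: cC|exact: decays_coor].
move=> sf1; have sf0 := schwnW sf1; move: sf1 => /schwnS[cf df ef sf].
have D i x : is_derive x (e_ i) (fun x => x 0 j * f x) ((i == j)%:R * f x + x 0 j * partial i f x).
  have [c1 c2] := coor_is_derive i j x.
  by have := partialM c1 (ef i x); rewrite /partial c2.
apply/schwnS; split; [exact: cC|exact: decays_coor| |].
  by move=> i x; have [] := D i x.
move=> i; rewrite (_ : partial i _ = fun x => (i == j)%:R * f x + x 0 j * partial i f x).
  by apply: schwnD; [exact: schwnZ|exact: IH].
by apply/funext => x; apply: partial_is_derive; exact: D.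
Qed.

(** For a family given by a formula, such as polynomials times a Gaussian, it suffices to examine
    one differentiation. *)
Lemma schwartz_coind (Q : (X -> R) -> Prop) :
  (forall f, Q f -> [/\ continuous f, decays f, (forall i x, derivable f x (e_ i)) &
     forall i, Q (partial i f)]) ->
  forall f, Q f -> schwartz f.
Proof.
move=> H f Qf n; elim: n f Qf => [|n IH] f /H[] cf df ef Qf; first by split.
by apply/schwnS; split => // i; exact: IH.
Qed.

Lemma schwartz0 : schwartz (fun=> 0).
Proof. by move=> n; exact: schwn0. Qed.
Lemma schwartzD f g : schwartz f -> schwartz g -> schwartz (fun x => f x + g x).
Proof. by move=> sf sg n; exact: schwnD. Qed.
Lemma schwartzM f g : schwartz f -> schwartz g -> schwartz (fun x => f x * g x).
Proof. by move=> sf sg n; exact: schwnM. Qed.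
Lemma schwartzZ (c : R) f : schwartz f -> schwartz (fun x => c * f x).
Proof. by move=> sf n; exact: schwnZ. Qed.
Lemma schwartz_coor f j : schwartz f -> schwartz (fun x => x 0 j * f x).
Proof. by move=> sf n; exact: schwn_coor. Qed.
Lemma schwartz_partial f i : schwartz f -> schwartz (partial i f).
Proof. by move=> sf n; have [_ [_]] := sf n.+1; apply. Qed.
Lemma schwartzN f : schwartz f -> schwartz (fun x => - f x).
Proof.
move=> sf; rewrite (_ : (fun x => _) = fun x => -1 * f x); first exact: schwartzZ.
by apply/funext => x; rewrite mulN1r.
Qed.
Lemma schwartz_sum (I : Type) (r : seq I) (P : pred I) (F : I -> X -> R) :
  (forall k, P k -> schwartz (F k)) -> schwartz (fun x => \sum_(k <- r | P k) F k x).
Proof.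
move=> sF; elim: r => [|a r IH].
  rewrite (_ : (fun x => _) = fun=> 0); first exact: schwartz0.
  by apply/funext => x; rewrite big_nil.
have [Pa|Pa] := boolP (P a); last first.
  by under eq_fun do rewrite big_cons (negbTE Pa).
by under eq_fun do rewrite big_cons Pa; apply: schwartzD => //; exact: sF.
Qed.

Lemma schwartz_is_derive f i x : schwartz f ->
  is_derive x (e_ i) f (partial i f x).
Proof. by move=> sf; apply: DeriveDef => //; have [_ []] := sf 1%N. Qed.
Lemma schwartz_derivable f i x : schwartz f -> derivable f x (e_ i).
Proof. by move=> sf; have [] := schwartz_is_derive i x sf. Qed.
Arguments schwartz_derivable [f] i x _.
Lemma schwartz_continuous f : schwartz f -> continuous f.
Proof. by move=> /(_ 0%N) [[]]. Qed.
Lemma schwartz_decays f : schwartz f -> decays f.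
Proof. by move=> /(_ 0%N) [[]]. Qed.
Lemma schwartz_measurable f : schwartz f -> measurable_fun setT f.
Proof. by move=> sf; apply: continuous_measurable_rV; exact: schwartz_continuous. Qed.
Lemma schwartz_rint f : schwartz f -> rint leb f.
Proof.
move=> sf; have [C hC] := schwartz_decays sf 1.
apply: (rint_le (schwartz_measurable sf) _ (rintZ C (@rint_wt R d))).
by move=> x; have := hC x; rewrite expr1.
Qed.
Lemma schwartz_bounded f : schwartz f -> exists C, forall x, `|f x| <= C.
Proof. by move=> sf; apply/decays_bounded/schwartz_decays. Qed.

Lemma schwartz_partialD i f g : schwartz f -> schwartz g ->
  partial i (fun x => f x + g x) = fun x => partial i f x + partial i g x.
Proof.
by move=> sf sg; apply/funext => x; apply/partial_is_derive/partialD;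
  exact: schwartz_derivable.
Qed.
Lemma schwartz_partialM i f g : schwartz f -> schwartz g ->
  partial i (fun x => f x * g x) = fun x => partial i f x * g x + f x * partial i g x.
Proof.
by move=> sf sg; apply/funext => x; apply/partial_is_derive/partialM;
  exact: schwartz_derivable.
Qed.
Lemma schwartz_partialZ i (c : R) f : schwartz f ->
  partial i (fun x => c * f x) = fun x => c * partial i f x.
Proof.
move=> sf; apply/funext => x; apply/partial_is_derive.
have : is_derive x (e_ i) (c \*: f) (c *: partial i f x).
  by apply: is_deriveZ; exact: schwartz_is_derive.
by [].
Qed.

Lemma schwartz_partialX i j f : schwartz f ->
  partial i (fun x => x 0 j * f x) = fun x => (i == j)%:R * f x + x 0 j * partial i f x.
Proof.
move=> sf; apply/funext => x; apply/partial_is_derive.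
have [c1 c2] := coor_is_derive i j x.
by have := partialM c1 (schwartz_derivable i x sf); rewrite /partial c2.
Qed.
Lemma partial0 i : partial i (fun=> 0 : R) = fun=> 0.
Proof. by apply/funext => x; exact: derive_cst. Qed.
Lemma schwartz_partial_sum i (I : Type) (r : seq I) (P : pred I) (F : I -> X -> R) :
  (forall k, P k -> schwartz (F k)) ->
  partial i (fun x => \sum_(k <- r | P k) F k x) =
  fun x => \sum_(k <- r | P k) partial i (F k) x.
Proof.
move=> sF; elim: r => [|a r IH].
  rewrite (_ : (fun x => _) = fun=> 0); last by apply/funext => x; rewrite big_nil.
  by rewrite partial0; apply/funext => x; rewrite big_nil.
have [Pa|Pa] := boolP (P a); last first.
  under eq_fun do rewrite big_cons (negbTE Pa).
  by rewrite IH; apply/funext => x; rewrite big_cons (negbTE Pa).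
under eq_fun do rewrite big_cons Pa.
rewrite schwartz_partialD ?IH//; [|exact: sF|exact: schwartz_sum].
by apply/funext => x; rewrite big_cons Pa.
Qed.

Lemma int_partial f i : schwartz f -> \int[leb]_x partial i f x = 0.
Proof.
move=> sf; have [C hC] := schwartz_decays sf 1.
have [D hD] := schwartz_decays (schwartz_partial i sf) 1.
apply: (@int_partial_eq0 _ _ i f _ (Num.max C D)).
- by move=> x; exact: schwartz_is_derive.
- exact/schwartz_continuous/schwartz_partial.
- move=> x; have := hC x; rewrite expr1 => /le_trans; apply.
  by rewrite ler_wpM2r// ?le_max ?lexx// ltW// wt_gt0.
- move=> x; have := hD x; rewrite expr1 => /le_trans; apply.
  by rewrite ler_wpM2r// ?le_max ?lexx ?orbT// ltW// wt_gt0.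
Qed.

Lemma int_by_parts f g i : schwartz f -> schwartz g ->
  \int[leb]_x (partial i f x * g x) = - \int[leb]_x (f x * partial i g x).
Proof.
move=> sf sg; apply/eqP; rewrite -subr_eq0 opprK -IntD; last 2 first.
- by apply/schwartz_rint/schwartzM => //; exact: schwartz_partial.
- by apply/schwartz_rint/schwartzM => //; exact: schwartz_partial.
by rewrite -(@int_partial _ i (schwartzM sf sg)) schwartz_partialM.
Qed.

End schwartz_class.

(** * Symmetry of mixed derivatives *)

Section clairaut.
Context {R : realType} {d : nat}.
Local Notation X := 'rV[R]_d.
Implicit Types (f g : X -> R) (i j : 'I_d) (s : seq 'I_d).
Local Notation e_ i := (delta_mx 0 i : X).

Lemma mvt_from0 (F dF : R -> R) (h : R) :
  (forall t : R, is_derive t (1 : R) F (dF t)) -> 0 < h ->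
  exists2 c, 0 <= c <= h & F h - F 0 = dF c * h.
Proof.
move=> D h0; have cF : {within `[0, h], continuous F}.
  by apply: derivable_within_continuous => t _; have [] := D t.
have [c /= cin E] := MVT_segment (ltW h0) (fun t _ => D t) cF.
by exists c; [move: cin; rewrite in_itv|rewrite E subr0].
Qed.

Lemma mvt_line f i (x : X) (h : R) : schwartz f -> 0 < h ->
  exists2 c, 0 <= c <= h & f (h *: e_ i + x) - f x = partial i f (c *: e_ i + x) * h.
Proof.
move=> sf h0.
have D (t : R) : is_derive t (1 : R) (fun t : R => f (t *: e_ i + x)) (partial i f (t *: e_ i + x)).
  apply: (@is_derive_shift _ _ _ _ (fun t : R => t *: e_ i + x) 1 t (e_ i)).
    by move=> s; rewrite scalerDl -[s *: 1]/(s * 1) mulr1 addrA.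
  exact: schwartz_is_derive.
have [c cin E] := mvt_from0 D h0; exists c => //.
by move: E; rewrite scale0r add0r.
Qed.

Lemma norm_e_le i : `|e_ i| <= 1.
Proof.
rewrite [leLHS]mx_normrE; apply: bigmax_le => // -[a b] _ /=; rewrite mxE.
by case: (_ && _); rewrite ?normr1 ?normr0.
Qed.

(** The mean value theorem is used twice: along e_i for the increment y -> f (h e_j + y) - f y, then
    along e_j for the partial derivative that this produces. *)
Lemma second_difference f i j (x : X) (h : R) : schwartz f -> 0 < h ->
  exists2 y, `|y - x| <= 2 * h &
  f (h *: e_ i + (h *: e_ j + x)) - f (h *: e_ i + x) - (f (h *: e_ j + x) - f x)
  = partial j (partial i f) y * h ^+ 2.
Proof.
move=> sf h0; pose g y := f (h *: e_ j + y) - f y.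
have D (t : R) : is_derive t (1 : R) (fun t : R => g (t *: e_ i + x))
   (partial i f (h *: e_ j + (t *: e_ i + x)) - partial i f (t *: e_ i + x)).
  have D1 : is_derive t (1 : R) (fun t : R => f (h *: e_ j + (t *: e_ i + x)))
     (partial i f (h *: e_ j + (t *: e_ i + x))).
    apply: (@is_derive_shift _ _ _ _ (fun t : R => h *: e_ j + (t *: e_ i + x)) 1 t (e_ i)).
      by move=> s; rewrite scalerDl -[s *: 1]/(s * 1) mulr1 -addrA (addrCA (h *: e_ j)).
    exact: schwartz_is_derive.
  have D2 : is_derive t (1 : R) (fun t : R => f (t *: e_ i + x)) (partial i f (t *: e_ i + x)).
    apply: (@is_derive_shift _ _ _ _ (fun t : R => t *: e_ i + x) 1 t (e_ i)).
      by move=> s; rewrite scalerDl -[s *: 1]/(s * 1) mulr1 addrA.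
    exact: schwartz_is_derive.
  exact: is_deriveB.
have [c cin E] := mvt_from0 D h0.
have [b bh B] := mvt_line j (c *: e_ i + x) (schwartz_partial i sf) h0.
exists (b *: e_ j + (c *: e_ i + x)).
  rewrite addrA addrK (le_trans (ler_normD _ _))// !normrZ.
  move: cin bh => /andP[c0 ch] /andP[b0 bh].
  rewrite !ger0_norm//; have := norm_e_le i; have := norm_e_le j.
  have := normr_ge0 (e_ i); have := normr_ge0 (e_ j).
  move: `|e_ i| `|e_ j| => u v; nra.
move: E; rewrite scale0r add0r B -mulrA -expr2 => <-.
by rewrite /g addrCA.
Qed.

Lemma small_step (r1 r2 : R) : 0 < r1 -> 0 < r2 ->
  exists h, [/\ 0 < h, 2 * h < r1 & 2 * h < r2].
Proof.
move=> h1 h2; have a : Num.min r1 r2 <= r1 by rewrite ge_min lexx.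
have b : Num.min r1 r2 <= r2 by rewrite ge_min lexx orbT.
have c : 0 < Num.min r1 r2 by rewrite lt_min h1.
by exists (Num.min r1 r2 / 4); split; lra.
Qed.

Lemma far_apart (a b c : R) : `|a - c| < `|a - b| / 2 -> `|b - c| < `|a - b| / 2 ->
  False.
Proof. by have := ler_distD c a b; rewrite (distrC c b) => h1 h2 h3; lra. Qed.

(** The second difference of [f] is symmetric in the two directions and equals h^2 times either
    mixed derivative at some point within 2h of [x]. Continuity of both mixed derivatives then
    excludes a gap between their values at [x]. *)
Lemma partialC f i j : schwartz f -> partial i (partial j f) = partial j (partial i f).
Proof.
move=> sf.
have cA := schwartz_continuous (schwartz_partial i (schwartz_partial j sf)).
have cB := schwartz_continuous (schwartz_partial j (schwartz_partial i sf)).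
have P h x : 0 < h -> exists y1 y2, [/\ `|y1 - x| <= 2 * h, `|y2 - x| <= 2 * h &
    partial i (partial j f) y1 = partial j (partial i f) y2].
  move=> h0.
  have [y1 y1x E1] := second_difference j i x sf h0.
  have [y2 y2x E2] := second_difference i j x sf h0.
  exists y1, y2; split; [exact: y1x|exact: y2x|].
  have hh : h ^+ 2 != 0 by rewrite expf_neq0// gt_eqF.
  apply: (mulIf hh); rewrite -E1 -E2 (addrCA (h *: e_ j)).
  move: (f _) (f _) (f _) (f _) => a1 a2 a3 a4; ring.
move: (partial i (partial j f)) (partial j (partial i f)) cA cB P => A B cA cB P.
apply/funext => x; apply/eqP; rewrite -subr_eq0; apply/negPn/negP => ne.
have e2 : 0 < `|A x - B x| / 2 by rewrite divr_gt0// normr_gt0.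
have /nbhs_ballP[r1 /= r10 h1] : \forall y \near x, `|A x - A y| < `|A x - B x| / 2.
  by have /cvgrPdist_lt := cA x; apply.
have /nbhs_ballP[r2 /= r20 h2] : \forall y \near x, `|B x - B y| < `|A x - B x| / 2.
  by have /cvgrPdist_lt := cB x; apply.
have [h [h0 hr1 hr2]] := small_step r10 r20.
have [y1 [y2 [y1x y2x AB]]] := P h x h0.
apply: (@far_apart (A x) (B x) (A y1)).
  by apply: h1; rewrite -ball_normE /= distrC (le_lt_trans y1x).
by rewrite AB; apply: h2; rewrite -ball_normE /= distrC (le_lt_trans y2x).
Qed.

End clairaut.

(** * Iterated partial derivatives as words *)

Section words.
Context {R : realType} {d : nat}.
Local Notation X := 'rV[R]_d.
Local Notation leb := (@lebesgue_rV R d).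
Implicit Types (f g : X -> R) (i j : 'I_d) (s : seq 'I_d).
Local Notation e_ i := (delta_mx 0 i : X).

Local Notation D s f := (foldr (@partial R d) f s).

Lemma schwartz_word s f : schwartz f -> schwartz (D s f).
Proof. by move=> sf; elim: s => //= i s IH; exact: schwartz_partial. Qed.

Lemma word_rcons s i f : D (rcons s i) f = D s (partial i f).
Proof. by rewrite -cats1 foldr_cat. Qed.

Lemma word_partial s i f : schwartz f -> D s (partial i f) = partial i (D s f).
Proof.
move=> sf; elim: s => //= j s ->; apply: partialC; exact: schwartz_word.
Qed.

Lemma word_rem s i f : schwartz f -> i \in s -> D s f = partial i (D (rem i s) f).
Proof.
move=> sf; elim: s => //= j s IH; rewrite inE; have [->|ij] := eqVneq j i.
  by [].
move=> /= /IH ->.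
by apply: partialC; exact: schwartz_word.
Qed.

Lemma word_perm s t f : schwartz f -> perm_eq s t -> D s f = D t f.
Proof.
move=> sf; elim: s t => [|i s IH] t.
  by move/perm_size => /= /esym/size0nil ->.
move=> ist; have it : i \in t by rewrite -(perm_mem ist) inE eqxx.
rewrite (word_rem sf it) /= (IH (rem i t))//.
by rewrite -(perm_cons i); apply: perm_trans ist _; exact: perm_to_rem.
Qed.

Lemma wordD s f g : schwartz f -> schwartz g ->
  D s (fun x => f x + g x) = fun x => D s f x + D s g x.
Proof.
move=> sf sg; elim: s => //= i s ->.
by rewrite schwartz_partialD//; exact: schwartz_word.
Qed.

(** Leibniz rule for a coordinate: any one occurrence of [j] may fall on the factor x_j and
    disappear, and by symmetry of derivatives it does not matter which. *)
Lemma wordX s j f : schwartz f -> D s (fun x => x 0 j * f x) =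
  fun x => x 0 j * D s f x + (count_mem j s)%:R * D (rem j s) f x.
Proof.
move=> sf; elim: s => [|i s IH] /=.
  by apply/funext => x; rewrite mul0r addr0.
have ss := schwartz_word s sf; have sr := schwartz_word (rem j s) sf.
rewrite IH schwartz_partialD; [|exact: schwartz_coor|exact: schwartzZ].
rewrite schwartz_partialX// schwartz_partialZ//; apply/funext => x.
have [->|ij] := eqVneq i j.
  rewrite mul1r natrD -addrA addrCA; congr (_ + _).
  rewrite mulrDl mul1r; congr (_ + _).
  have [js|js] := boolP (j \in s); first by rewrite (word_rem sf js).
  by rewrite (count_memPn js) !mul0r.
by rewrite mul0r !add0r.
Qed.

(** Multi-indices are traded for words, on which induction is direct. Since derivatives commute,
    only the letter counts matter, and [wcount_perm] leads back. *)
Definition mword (a : 'I_d -> nat) : seq 'I_d := flatten [seq nseq (a i) i | i <- enum 'I_d].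

Lemma mpartialE a f : mpartial a f = D (mword a) f.
Proof.
rewrite /mpartial /mword; elim: (enum 'I_d) => //= i r ->.
by rewrite foldr_cat; elim: (a i) => //= n ->.
Qed.

Lemma count_mword a i : count_mem i (mword a) = a i.
Proof.
rewrite /mword count_flatten -map_comp.
rewrite (eq_map (g := fun j => ((j == i) * a j)%N)); last first.
  by move=> j /=; rewrite count_nseq.
rewrite sumnE big_map (bigD1_seq i) ?mem_enum ?enum_uniq//= eqxx mul1n big1 ?addn0//.
by move=> j /negbTE ->.
Qed.

Lemma size_mword a : size (mword a) = mindex_size a.
Proof.
rewrite /mword size_flatten /shape -map_comp sumnE big_map /mindex_size big_enum_cond /=.
by apply: eq_bigr => i _; rewrite size_nseq.
Qed.

Definition wcount s : 'I_d -> nat := fun i => count_mem i s.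

Lemma wcount_perm s : perm_eq (mword (wcount s)) s.
Proof. by apply/allP => i _ /=; rewrite count_mword. Qed.

Lemma size_wcount s : mindex_size (wcount s) = size s.
Proof. by rewrite -size_mword (perm_size (wcount_perm s)). Qed.

End words.

(** * Test functions and the du Bois-Reymond lemma *)

Section flat_exponential.
Context {R : realType}.
Implicit Types (p q : {poly R}) (x t : R).

Lemma pow_le_expR n : exists C, forall t, 0 <= t -> t ^+ n <= C * expR t.
Proof.
case: n => [|n].
  by exists 1 => t t0; rewrite expr0 mul1r; have := expR_ge1Dx t; lra.
exists (n.+1%:R ^+ n.+1) => t t0.
have n0 : 0 < n.+1%:R :> R by [].
have -> : t = n.+1%:R * (n.+1%:R^-1 * t) by rewrite mulrA mulfV ?mul1r// gt_eqF.
set u := n.+1%:R^-1 * t; have u0 : 0 <= u by rewrite mulr_ge0// ltW// invr_gt0.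
rewrite expRM_natl exprMn; apply: ler_wpM2l; first by rewrite exprn_ge0 ?ltW.
rewrite lerXn2r ?nnegrE ?expR_ge0//.
by have := expR_ge1Dx u; lra.
Qed.

Lemma poly_le_expR p : exists2 C, 0 <= C & forall x, `|p.[x]| <= C * expR `|x|.
Proof.
pose C n := projT1 (cid (pow_le_expR n)).
have CP n t : 0 <= t -> t ^+ n <= C n * expR t by rewrite /C; case: cid => /= c; apply.
have C0 n : 0 <= C n.
  by have := CP n 1 ler01; rewrite expr1n => h; have := expR_gt0 (1 : R); nra.
exists (\sum_(i < size p) `|p`_i| * C i); first by apply: sumr_ge0 => i _; rewrite mulr_ge0.
move=> x; rewrite horner_coef (le_trans (ler_norm_sum _ _ _))// mulr_suml.
by apply: ler_sum => i _; rewrite normrM normrX -mulrA ler_wpM2l// CP.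
Qed.

Definition flat p x : R := if x <= 0 then 0 else p.[x^-1] * expR (- x^-1).

(** The derivative of p(1/x) exp(-1/x) is q(1/x) exp(-1/x) with q = X^2 (p - p'), so the family
    [flat] is closed under differentiation. *)
Definition flat' p : {poly R} := 'X^2 * (p - p^`()).

Lemma flat_bound_aux (C h t a E E' : R) : 0 < h -> 0 < E' -> E * E' = 1 ->
  h * t = 1 -> t ^+ 2 * a <= C * E -> t * (a * E') <= C * h.
Proof.
move=> h0 E'0 EE ht hb.
have -> : t * (a * E') = (h * E') * (t ^+ 2 * a) by rewrite -[LHS]mul1r -ht; ring.
rewrite (le_trans (ler_wpM2l _ hb))//; first by rewrite mulr_ge0// ltW.
have -> : h * E' * (C * E) = C * h * (E * E') by ring.
by rewrite EE mulr1.
Qed.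

(** Only the origin is delicate: with t = 1/h > 0, the bound |t^2 p(t)| <= C exp t makes the
    difference quotient at most C h. *)
Lemma flat_is_derive p x : is_derive x (1 : R) (flat p) (flat (flat' p) x).
Proof.
have [x0|x0|->] := ltgtP x 0.
- have -> : flat (flat' p) x = 0 by rewrite /flat (ltW x0).
  apply: (near_eq_is_derive (f := fun=> 0)).
  near=> y; rewrite /flat ifT//; near: y.
  exact: lt_le_nbhsl.
- have xn0 : x != 0 by rewrite gt_eqF.
  have dV : is_derive x (1 : R) (fun y : R => y^-1) (- x^-2).
    by have := is_deriveV xn0 (is_derive_id x (1:R)); rewrite scaler1.
  have d1 : is_derive x (1 : R) (fun y : R => p.[y^-1]) (p^`().[x^-1] * (- x^-2)).
    exact: (is_derive1_comp (is_derive_poly p x^-1) dV).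
  have d2 : is_derive x (1 : R) (fun y : R => expR (- y^-1)) (expR (- x^-1) * (- (- x^-2))).
    have dN : is_derive x (1 : R) (fun y : R => - y^-1) (- (- x^-2)) by exact: is_deriveN.
    exact: (@is_derive1_comp R expR (fun y => - y^-1) x _ _ (is_derive_expR _) dN).
  have d3 : is_derive x (1 : R) (fun y : R => p.[y^-1] * expR (- y^-1)) (flat (flat' p) x).
    have [e1 e2] := is_deriveM d1 d2; split; first exact: e1.
    rewrite [LHS]e2 /flat ifF; last by apply/negbTE; rewrite -ltNge.
    rewrite /flat' hornerM hornerXn hornerD hornerN -![_ *: _]/(_ * _) opprK.
    rewrite exprVn; move: (p.[_]) (p^`().[_]) (expR _) (x ^- 2) => a b c e; ring.
  refine (near_eq_is_derive _ d3).
  near=> y; rewrite /flat ifF//; apply/negbTE; rewrite -ltNge; near: y.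
  exact: lt_nbhsr.
have -> : flat (flat' p) 0 = 0 by rewrite /flat lexx.
have [C C0 hC] := poly_le_expR ('X^2 * p).
have bd h : `|h^-1 *: ((flat p \o shift 0) (h *: (1:R)) - flat p 0)| <= C * `|h|.
  rewrite /= addr0 -[h *: 1]/(h * 1) mulr1 /flat lexx subr0.
  case: ifPn => [_|]; first by rewrite scaler0 normr0 mulr_ge0.
  rewrite -ltNge => h0; rewrite -[_ *: _]/(_ * _).
  have hi : 0 < h^-1 by rewrite invr_gt0.
  have := hC h^-1; rewrite hornerM hornerXn expr2 !normrM !(gtr0_norm hi) (gtr0_norm h0) -expr2.
  have e1 : expR h^-1 * expR (- h^-1) = 1 by rewrite -expRD subrr expR0.
  have e0 := expR_gt0 (- h^-1); have hh : h * h^-1 = 1 by rewrite mulfV// gt_eqF.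
  rewrite (gtr0_norm e0).
  exact: (flat_bound_aux h0 e0 e1 hh).
have L : (fun h : R => h^-1 *: ((flat p \o shift 0) (h *: (1:R)) - flat p 0)) @ 0^' --> (0 : R).
  apply/cvgr0Pnorm_lt => e e0; near=> h.
  rewrite (le_lt_trans (bd h))// (@le_lt_trans _ _ ((C + 1) * `|h|))//.
    by rewrite ler_wpM2r// lerDl.
  rewrite -ltr_pdivlMl; last by rewrite ltr_wpDl.
  near: h; apply: dnbhs0_lt; rewrite mulr_gt0// invr_gt0 ltr_wpDl//.
by split; [apply/cvg_ex; exists 0|exact: cvg_lim].
Unshelve. all: by end_near.
Qed.

End flat_exponential.

Lemma not_forall_exists (T : Type) (P : T -> Prop) :
  ~ (forall x, P x) -> exists x, ~ P x.
Proof. by move=> nP; apply: contrapT => nE; apply: nP => x; apply: contrapT => nx; apply: nE; exists x. Qed.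

Lemma continuous_inv {R : realType} (T : topologicalType) (f : T -> R) :
  continuous f -> (forall x, f x != 0) -> continuous (fun x => (f x)^-1).
Proof. by move=> cf f0 x; apply: cvgV; [exact: f0|exact: cf]. Qed.

(** * Smooth functions of compact support *)

Section smooth_functions.
Context {R : realType} {d : nat}.
Local Notation X := 'rV[R]_d.
Local Notation leb := (@lebesgue_rV R d).
Implicit Types (f g : X -> R) (i j : 'I_d) (s : seq 'I_d).
Local Notation e_ i := (delta_mx 0 i : X).
Local Notation D s f := (foldr (@partial R d) f s).

Fixpoint smn n f : Prop := continuous f /\
  if n is n'.+1 then (forall i x, derivable f x (e_ i)) /\
    forall i, smn n' (partial i f) else True.

Definition smooth f := forall n, smn n f.

Lemma smnS n f : smn n.+1 f <-> [/\ continuous f,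
  (forall i x, derivable f x (e_ i)) & forall i, smn n (partial i f)].
Proof. by split=> [[? [? ?]]|[]]. Qed.

Lemma smnW n f : smn n.+1 f -> smn n f.
Proof.
elim: n f => [|n IH] f; first by case.
by move=> /smnS[cf ef sf]; apply/smnS; split => // i; exact/IH/sf.
Qed.

Lemma smnD n f g : smn n f -> smn n g -> smn n (fun x => f x + g x).
Proof.
elim: n f g => [|n IH] f g.
  by move=> [cf sf] [cg sg]; split => //; exact: continuous_add.
move=> /smnS[cf ef sf] /smnS[cg eg sg]; apply/smnS; split.
- exact: continuous_add.
- by move=> i x; have [] := partialD (ef i x) (eg i x).
move=> i; rewrite (_ : partial i _ = fun x => partial i f x + partial i g x).
  by apply: IH; [exact: sf|exact: sg].
by apply/funext => x; apply: partial_is_derive; exact: partialD.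
Qed.

Lemma smnM n f g : smn n f -> smn n g -> smn n (fun x => f x * g x).
Proof.
elim: n f g => [|n IH] f g.
  by move=> [cf sf] [cg sg]; split => //; exact: continuous_mul.
move=> sf1 sg1; have [sf0 sg0] := (smnW sf1, smnW sg1).
move: sf1 sg1 => /smnS[cf ef sf] /smnS[cg eg sg]; apply/smnS; split.
- exact: continuous_mul.
- by move=> i x; have [] := partialM (ef i x) (eg i x).
move=> i; rewrite (_ : partial i _ = fun x => partial i f x * g x + f x * partial i g x).
  by apply: smnD; apply: IH.
by apply/funext => x; apply: partial_is_derive; exact: partialM.
Qed.

Lemma smooth_coind (Q : (X -> R) -> Prop) :
  (forall f, Q f -> [/\ continuous f, (forall i x, derivable f x (e_ i)) &
     forall i, Q (partial i f)]) ->
  forall f, Q f -> smooth f.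
Proof.
move=> H f Qf n; elim: n f Qf => [|n IH] f /H[] cf ef Qf; first by split.
by apply/smnS; split => // i; exact: IH.
Qed.

Lemma smooth_partial i f : smooth f -> smooth (partial i f).
Proof. by move=> sf n; have /smnS[_ _] := sf n.+1; apply. Qed.

Lemma smooth_word s f : smooth f -> smooth (D s f).
Proof. by move=> sf; elim: s => //= i s IH; exact: smooth_partial. Qed.

Lemma smooth_cst (c : R) : smooth (fun=> c).
Proof.
apply: (smooth_coind (Q := fun f => exists c : R, f = fun=> c)); last by exists c.
move=> f [b ->]; split; first exact: continuous_const.
- by move=> i x; exact: derivable_cst.
- by move=> i; exists 0; apply/funext => x; exact: derive_cst.
Qed.

Lemma smooth_prod (I : Type) (r : seq I) (F : I -> X -> R) :
  (forall k, smooth (F k)) -> smooth (fun x => \prod_(k <- r) F k x).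
Proof.
move=> sF; elim: r => [|a r IH].
  by under eq_fun do rewrite big_nil; exact: smooth_cst.
by under eq_fun do rewrite big_cons; move=> n; apply: smnM; [exact: sF|exact: IH].
Qed.

Lemma partial_off_support i f (K : set X) x : closed K ->
  (forall y, ~ K y -> f y = 0) -> ~ K x -> partial i f x = 0.
Proof.
move=> cK f0 Kx; apply: partial_is_derive.
have d0 : is_derive x (e_ i) (fun=> 0 : R) (0 : R).
  exact: (DeriveDef (derivable_cst _ _ _) (derive_cst _ _ _)).
refine (near_eq_is_derive _ d0).
have : nbhs x (~` K) by apply: open_nbhs_nbhs; split => //; exact: closed_openC.
by apply: filterS => y /f0 ->.
Qed.

Lemma continuous_tens (g : 'I_d -> R -> R) : (forall i, continuous (g i)) ->
  continuous (tens g).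
Proof.
move=> cg; rewrite /tens; elim: (index_enum _) => [|i r IH].
  by under eq_fun do rewrite big_nil; exact: continuous_const.
under eq_fun do rewrite big_cons; apply: continuous_mul => // x.
by apply: (@continuous_comp _ _ _ (fun x : X => x 0 i) (g i)); [exact: coord_continuous|exact: cg].
Qed.

Lemma bounded_on_compact f (K : set X) : compact K -> continuous f ->
  exists C, forall x, K x -> `|f x| <= C.
Proof.
move=> cK cf; have : compact [set f x | x in K].
  by apply: continuous_compact => //; exact: continuous_subspaceT.
move=> /compact_bounded[M [_ HM]]; exists (M + 1) => x Kx.
by apply: (HM (M + 1)); [rewrite ltrDl|exists x].
Qed.

Lemma continuous_wt : continuous (@wt R d).
Proof.
apply: continuous_tens => i x; apply: cvgV; first by rewrite gt_eqF// ltr_wpDr// sqr_ge0.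
by apply: cvgD; [exact: cvg_cst|exact: exprn_continuous].
Qed.

(** The quotient by a power of the positive continuous weight is continuous, hence bounded on the
    compact set; derivatives vanish outside the same set. *)
Lemma smooth_compact_schwartz f (K : set X) : compact K -> smooth f ->
  (forall x, ~ K x -> f x = 0) -> schwartz f.
Proof.
move=> cK sf f0; have clK : closed K by apply: compact_closed.
apply: (schwartz_coind (Q := fun f => smooth f /\ forall x, ~ K x -> f x = 0)) => //.
move=> {sf f0}f [sf f0]; have [cf ef _] := (smnS 0 f).1 (sf 1%N).
split => //; last first.
  by move=> i; split; [exact: smooth_partial|move=> x; exact: partial_off_support].
move=> p; have cg : continuous (fun x => f x * (wt x ^+ p)^-1).
  apply: continuous_mul => //; apply: continuous_inv => x; last first.
    by apply: lt0r_neq0; rewrite exprn_gt0// wt_gt0.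
  by apply: (@continuous_comp _ _ _ (@wt R d) (fun y => y ^+ p)); [exact: continuous_wt|exact: exprn_continuous].
have [C HC] := bounded_on_compact cK cg; exists (Num.max C 0) => x.
have wp : 0 < wt x ^+ p by rewrite exprn_gt0// wt_gt0.
have [Kx|Kx] := pselect (K x); last first.
  rewrite f0// normr0; apply: mulr_ge0; last exact: ltW.
  by rewrite le_max lexx orbT.
have := HC x Kx; rewrite normrM normfV (gtr0_norm wp) ler_pdivrMr// => /le_trans; apply.
by apply: ler_wpM2r; [exact: ltW|rewrite le_max lexx].
Qed.

Lemma test_schwartz f : test_function f -> schwartz f.
Proof.
move=> [cK sf]; apply: (smooth_compact_schwartz cK).
  apply: (smooth_coind (Q := fun f => forall s, continuous (D s f) /\
    forall i x, derivable (D s f) x (e_ i))); last exact: sf.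
  move=> g sg; split; [exact: (sg [::]).1|exact: (sg [::]).2|].
  by move=> i s; have := sg (rcons s i); rewrite word_rcons.
move=> x; apply: contra_notP => /eqP fx; apply: subset_closure; exact: fx.
Qed.

Lemma test_intro f (K : set X) : compact K -> smooth f ->
  (forall x, ~ K x -> f x = 0) -> test_function f.
Proof.
move=> cK sf f0; split.
  apply: (subclosed_compact (@closed_closure _ _) cK).
  rewrite [X in _ `<=` X](closure_id K).1; last exact: compact_closed.
  by apply: closure_subset => x /= fx; apply: contrapT => /f0/eqP; rewrite (negbTE fx).
by move=> s /=; have /smnS[] := smooth_word s sf 1%N.
Qed.

Lemma test_support f : test_function f -> exists K : set X,
  [/\ compact K, smooth f & forall x, ~ K x -> f x = 0].
Proof.
move=> tf; have [cK sf] := tf; exists (closure [set x | f x != 0]); split => //.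
  apply: (smooth_coind (Q := fun f => forall s, continuous (D s f) /\
    forall i x, derivable (D s f) x (e_ i))); last exact: sf.
  move=> g sg; split; [exact: (sg [::]).1|exact: (sg [::]).2|].
  by move=> i s; have := sg (rcons s i); rewrite word_rcons.
move=> x; apply: contra_notP => /eqP fx; apply: subset_closure; exact: fx.
Qed.

Lemma test_partial i f : test_function f -> test_function (partial i f).
Proof.
move=> /test_support[K [cK sf f0]]; apply: (test_intro cK).
  exact: smooth_partial.
by move=> x; apply: partial_off_support => //; exact: compact_closed.
Qed.

Lemma test_word s f : test_function f -> test_function (D s f).
Proof. by move=> tf; elim: s => [|i s IH] /=; [exact: tf|exact: test_partial]. Qed.

Lemma coord_fun_is_derive (phi : R -> R) phi' i j (x : X) :
  is_derive (x 0 i) (1 : R) phi phi' ->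
  is_derive x (e_ j) (fun y : X => phi (y 0 i)) ((j == i)%:R * phi').
Proof.
move=> dphi; have [->|ji] := eqVneq j i.
  rewrite mul1r; apply: (@is_derive_shift _ X _ _ (fun y : X => y 0 i) _ x 1) => //.
  by move=> h; rewrite !mxE !eqxx.
rewrite mul0r.
have E : (fun h : R => h^-1 *: (((fun y : X => phi (y 0 i)) \o shift x) (h *: e_ j) - phi (x 0 i))) = fun=> 0.
  apply/funext => h /=; rewrite !mxE eqxx eq_sym (negbTE ji) mulr0 add0r subrr.
  by rewrite scaler0.
by split; rewrite /derivable /derive E; [exact: is_cvg_cst|exact: lim_cst].
Qed.

Lemma is_derive_continuous1 (phi phi' : R -> R) : (forall t : R, is_derive t (1 : R) phi (phi' t)) ->
  continuous phi.
Proof.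
move=> dphi t; apply: differentiable_continuous; apply/derivable1_diffP.
by have [] := dphi t.
Qed.

Lemma smooth_coord (Q : (R -> R) -> Prop) i :
  (forall phi, Q phi -> exists phi', (forall t : R, is_derive t (1 : R) phi (phi' t)) /\ Q phi') ->
  Q (fun=> 0) ->
  forall phi, Q phi -> smooth (fun x : X => phi (x 0 i)).
Proof.
move=> HQ Q0 phi Qphi.
apply: (smooth_coind (Q := fun f => exists2 phi, Q phi & f = fun x : X => phi (x 0 i))); last by exists phi.
move=> f [{Qphi}phi0 Qp ->]; have [psi [dp Qpsi]] := HQ _ Qp; split.
- move=> x; apply: (@continuous_comp _ _ _ (fun x : X => x 0 i) phi0).
    exact: coord_continuous.
  exact: is_derive_continuous1 dp _.
- by move=> j x; have [] := coord_fun_is_derive j (dp (x 0 i)).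
- move=> j; have [->|ji] := eqVneq j i.
    exists psi => //; apply/funext => x; apply: partial_is_derive.
    by have := coord_fun_is_derive i (dp (x 0 i)); rewrite eqxx mul1r.
  exists (fun=> 0) => //; apply/funext => x; apply: partial_is_derive.
  by have := coord_fun_is_derive j (dp (x 0 i)); rewrite (negbTE ji) mul0r.
Qed.

Lemma smooth_flat (c b : R) i : smooth (fun x : X => flat 1 (c * x 0 i + b)).
Proof.
apply: (@smooth_coord (fun phi => exists p (k : R), phi = fun t => k * flat p (c * t + b)) i
  _ _ (fun t => flat 1 (c * t + b))); last first.
- by exists 1, 1; apply/funext => t; rewrite mul1r.
- by exists 1, 0; apply/funext => t; rewrite mul0r.
move=> _ [p [k ->]]; exists (fun t => (k * c) * flat (flat' p) (c * t + b)); split; last first.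
  by exists (flat' p), (k * c).
move=> t.
have dl : is_derive t (1 : R) (fun t : R => c * t + b) c.
  have := @is_deriveD _ _ _ _ _ t (1:R) _ _ (is_deriveZ c (is_derive_id t (1:R))) (is_derive_cst b t (1:R)).
  by rewrite addr0 -[c *: 1]/(c * 1) mulr1.
have df := @is_derive1_comp R (flat p) (fun t => c * t + b) t _ _ (flat_is_derive p _) dl.
by have := is_deriveZ k df; rewrite -[k *: (_ * c)]/(k * (_ * c)) (mulrC _ c) mulrA.
Qed.

(** As [n] grows these bumps converge pointwise to the indicator of the open box between [a] and [b]
    and stay below it; through them, pairings with test functions determine integrals over boxes. *)
Definition box_bump (n : nat) (a b : 'I_d -> R) (x : X) : R :=
  \prod_i (flat 1 (n%:R * x 0 i + - (n%:R * a i)) * flat 1 (- n%:R * x 0 i + n%:R * b i)).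

Lemma test_box_bump n (a b : 'I_d -> R) : test_function (box_bump n.+1 a b).
Proof.
apply: (@test_intro _ [set x : X | forall i, `[a i, b i]%classic (x 0 i)]).
- by apply: (@rV_compact R d (fun i => `[a i, b i]%classic)) => i; exact: segment_compact.
- apply: smooth_prod => i m; apply: smnM; exact: smooth_flat.
- move=> x /= nx; have [i /negP] := not_forall_exists nx.
  rewrite /= in_itv/= negb_and -!ltNge => xi.
  rewrite /box_bump (bigD1 i)//=; case/orP: xi => xi; rewrite /flat.
    by rewrite ifT ?mul0r// -mulrN -mulrDr pmulr_rle0// subr_le0 ltW.
  by rewrite (@ifT _ (_ + n.+1%:R * b i <= 0)) ?mulr0 ?mul0r// mulNr addrC -mulrBr pmulr_rle0// subr_le0 ltW.
Qed.

Lemma flat1_gt0 (x : R) : 0 < x -> flat 1 x = expR (- x^-1).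
Proof. by move=> x0; rewrite /flat leNgt x0 /= hornerC mul1r. Qed.

Lemma flat1_range (x : R) : 0 <= flat 1 x <= 1.
Proof.
have [x0|x0] := leP x 0; first by rewrite /flat x0 lexx ler01.
rewrite flat1_gt0// expR_ge0 /= -[leRHS](expR0 R) ler_expR oppr_le0 invr_ge0.
exact: ltW.
Qed.

Lemma flat1_cvg (t : R) : flat 1 (n.+1%:R * t) @[n --> \oo] --> ((0 < t)%R%:R : R).
Proof.
have [t0|t0] := ltP 0 t; last first.
  apply: cvg_near_cst; apply: nearW => n; rewrite /flat ifT//.
  by rewrite pmulr_rle0.
rewrite (_ : (fun n => _) = fun n : nat => expR (- (n.+1%:R^-1 * t^-1))); last first.
  by apply/funext => n; rewrite flat1_gt0 ?mulr_gt0// invfM.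
rewrite -[X in _ --> X](expR0 R) -[X in _ --> expR X]oppr0 -[X in _ --> expR (- X)](mul0r (t^-1)).
apply: (@cvg_comp _ _ _ (fun n : nat => - (n.+1%:R^-1 * t^-1)) expR _ (nbhs (- (0 * t^-1) : R))).
  by apply: cvgN; apply: cvgM; [exact: cvg_harmonic|exact: cvg_cst].
exact: continuous_expR.
Qed.

Definition box (a b : 'I_d -> R) : set X := [set x | forall i, `]a i, b i[%classic (x 0 i)].

Lemma measurable_box a b : measurable (box a b).
Proof.
rewrite (_ : box a b = \bigcap_(i in [set: 'I_d])
  ((fun y : X => y 0 i) @^-1` `]a i, b i[%classic)).
  apply: fin_bigcap_measurable; first exact: finite_finset.
  move=> i _; rewrite -[X in measurable X]setTI.
  by apply: measurable_coor => //; exact: measurable_itv.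
by apply/seteqP; split => [x h i _|x h i]; have := h i; apply.
Qed.

Lemma indic_box a b (x : X) : (\1_(box a b) x : R) = \prod_i ((0 < x 0 i - a i)%R%:R * (0 < b i - x 0 i)%R%:R).
Proof.
rewrite indicE; have [xb|xb] := boolP (x \in box a b).
  rewrite big1// => i _; have := set_mem xb i; rewrite /= in_itv/= => /andP[h1 h2].
  by rewrite !subr_gt0 h1 h2 mulr1.
have nx : ~ (forall i, x 0 i \in `]a i, b i[).
  by move=> h; move/negP: xb; apply; rewrite inE => i; exact: h.
have [i /negP] := not_forall_exists nx; rewrite in_itv/= negb_and => xi; rewrite (bigD1 i)//= !subr_gt0.
by case/orP: xi => /negbTE ->; rewrite ?mul0r ?mulr0 ?mul0r.
Qed.

Lemma rint_indic_box a b : rint leb (\1_(box a b)).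
Proof.
have h : rint leb (tens (fun i (t : R) => \1_(`]a i, b i[%classic) t)).
  by apply: (tens_int _).1 => i; exact: integrable_indic_itv.
apply: rint_le h; first by apply: measurable_indic; exact: measurable_box.
move=> x; rewrite ger0_norm; last by rewrite indicE.
rewrite indicE; have [xb|xb] := boolP (x \in box a b); last first.
  by apply: prodr_ge0 => i _; rewrite indicE.
rewrite /tens big1// => i _; rewrite indicE mem_set//.
by have := set_mem xb i.
Qed.

Lemma box_bump_cvg a b (x : X) : box_bump n.+1 a b x @[n --> \oo] --> (\1_(box a b) x : R).
Proof.
rewrite indic_box /box_bump; elim: (index_enum _) => [|i r IH].
  by under eq_fun do rewrite big_nil; rewrite big_nil; exact: cvg_cst.
under eq_fun do rewrite big_cons; rewrite big_cons; apply: cvgM => //; apply: cvgM.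
  by under eq_fun do rewrite -mulrN -mulrDr; exact: flat1_cvg.
by under eq_fun do rewrite mulNr addrC -mulrBr; exact: flat1_cvg.
Qed.

Lemma box_bump_le n a b (x : X) : `|box_bump n.+1 a b x| <= \1_(box a b) x.
Proof.
rewrite indicE; have [xb|xb] := boolP (x \in box a b).
  rewrite normr_prod -[leRHS](@big1 R 1 *%R 'I_d (index_enum _) xpredT (fun=> 1))//.
  apply: ler_prod => i _; rewrite normr_ge0 normrM /=.
  have /andP[h1 h2] := flat1_range (n.+1%:R * x 0 i + - (n.+1%:R * a i)).
  have /andP[h3 h4] := flat1_range (- n.+1%:R * x 0 i + n.+1%:R * b i).
  by rewrite !ger0_norm// -[leRHS]mulr1; apply: ler_pM.
have nx : ~ (forall i, x 0 i \in `]a i, b i[).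
  by move=> h; move/negP: xb; apply; rewrite inE => i; exact: h.
have [i /negP] := not_forall_exists nx; rewrite in_itv/= negb_and -!leNgt => xi.
rewrite /box_bump (bigD1 i)//= (_ : _ * flat 1 _ = 0) ?mul0r ?normr0//.
case/orP: xi => xi; rewrite /flat.
  by rewrite ifT ?mul0r// -mulrN -mulrDr pmulr_rle0// subr_le0.
by rewrite (@ifT _ (_ + n.+1%:R * b i <= 0)) ?mulr0// mulNr addrC -mulrBr pmulr_rle0// subr_le0.
Qed.

Lemma box_integral_eq0 (u : X -> R) a b : measurable_fun setT u ->
  rint leb (fun x => u x ^+ 2) ->
  (forall f, test_function f -> \int[leb]_x (u x * f x) = 0) ->
  \int[leb]_x (u x * \1_(box a b) x) = 0.
Proof.
move=> mu u2 Hu.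
have mb := @measurable_box a b.
have m1 : measurable_fun setT (\1_(box a b) : X -> R) by exact: measurable_indic.
have gi : rint leb (fun x => `|u x * \1_(box a b) x|).
  apply: rint_norm; apply: rintM => //.
  rewrite (_ : (fun x => _) = \1_(box a b)); first exact: rint_indic_box.
  by apply/funext => x; rewrite indicE; case: (_ \in _); rewrite ?expr1n// expr0n.
have L : (\int[leb]_x (u x * box_bump n.+1 a b x)) @[n --> \oo] -->
    \int[leb]_x (u x * \1_(box a b) x).
  apply: Int_dominated gi _ _.
  - move=> n; apply: measurable_funM => //; apply: schwartz_measurable.
    exact/test_schwartz/test_box_bump.
  - move=> n x; rewrite !normrM ler_wpM2l// (le_trans (box_bump_le _ _ _ _))//.
    exact: ler_norm.
  - by move=> x; apply: cvgM; [exact: cvg_cst|exact: box_bump_cvg].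
have L0 : (\int[leb]_x (u x * box_bump n.+1 a b x)) @[n --> \oo] --> (0 : R).
  by apply: cvg_near_cst; apply: nearW => n; exact/Hu/test_box_bump.
exact: cvg_unique L L0.
Qed.

Lemma boxI a b a' b' : box a b `&` box a' b' =
  box (fun i => Num.max (a i) (a' i)) (fun i => Num.min (b i) (b' i)).
Proof.
apply/seteqP; split => x /=.
  move=> [h1 h2] i; have := h1 i; have := h2 i; rewrite /= !in_itv/=.
  by rewrite gt_max lt_min => /andP[-> ->] /andP[-> ->].
move=> h; split=> i; have := h i; rewrite /= !in_itv/= gt_max lt_min.
  by case/andP => /andP[-> _] /andP[-> _].
by case/andP => /andP[_ ->] /andP[_ ->].
Qed.

Lemma measurable_boxes : (@measurable _ X) = <<s [set A | exists a b, A = box a b] >>.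
Proof.
apply/seteqP; split; last first.
  apply: smallest_sub; first exact: sigma_algebra_measurable.
  by move=> _ [a [b ->]]; exact: measurable_box.
apply: smallest_sub; first exact: smallest_sigma_algebra.
rewrite -bigcup_seq => A [i _ [B mB <-]]; rewrite setTI.
suff : measurable_fun setT (fun x : g_sigma_algebraType [set A | exists a b, A = box a b] => (x : X) 0 i).
  by move=> /(_ measurableT B mB); rewrite setTI.
apply: (measurability _ (RGenOpens.measurableE R)).
move=> _ [_ [a [b ->]] <-]; rewrite setTI.
rewrite (_ : _ @^-1` _ = \bigcup_n box (fun j => if j == i then a else - n%:R)
   (fun j => if j == i then b else n%:R)).
  apply: bigcup_measurable => n _; apply: sub_sigma_algebra.
  by exists (fun j => if j == i then a else - n%:R), (fun j => if j == i then b else n%:R).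
apply/seteqP; split => x /=; last first.
  by move=> [n _ /(_ i)]; rewrite /= eqxx.
rewrite in_itv/= => xi.
have [n nx] : exists n : nat, forall j, `|(x : X) 0 j| < n%:R.
  exists (Num.truncn (\sum_j `|(x : X) 0 j|)).+1 => j.
  rewrite (le_lt_trans _ (truncnS_gt _))// (bigD1 j)//= lerDl.
  by apply: sumr_ge0.
exists n => // j; rewrite /= in_itv/=; case: eqP => [->|_]; first exact: xi.
by rewrite -ltr_norml.
Qed.

(** Integrals of [u] over boxes vanish by approximation with [box_bump]. Boxes are stable under
    intersection and generate the Borel sets, so integrals over all Borel subsets of a cube vanish
    and [u] is zero almost everywhere on each cube. Cubes enter because a square-integrable function
    is integrable on sets of finite measure. *)
Lemma dubois_reymond (u : X -> R) : measurable_fun setT u ->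
  rint leb (fun x => u x ^+ 2) ->
  (forall f, test_function f -> \int[leb]_x (u x * f x) = 0) ->
  {ae leb, forall x, u x = 0}.
Proof.
move=> mu u2 Hu.
pose Q (k : nat) := box (fun=> - (k%:R : R)) (fun=> k%:R).
have mQ k : measurable (Q k) by exact: measurable_box.
have ri A k : measurable A -> rint leb (\1_(A `&` Q k)).
  move=> mA; have mAQ : measurable (A `&` Q k) by exact: measurableI.
  apply: rint_le (rint_indic_box (fun=> - (k%:R : R)) (fun=> k%:R)).
    exact: measurable_indic.
  move=> x; rewrite !indicE in_setI; case: (x \in A) => /=; last by rewrite normr0.
  by case: (x \in _); rewrite /= ?normr1// normr0.
have iu A : measurable A -> forall k, rint leb (fun x => u x * \1_(A `&` Q k) x).
  move=> mA k; apply: rintM => //; first exact: (rint_measurable (ri A k mA)).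
  rewrite (_ : (fun x => _) = \1_(A `&` Q k)); first exact: ri.
  by apply/funext => x; rewrite indicE; case: (_ \in _); rewrite ?expr1n// expr0n.
have E A k : measurable A -> (\int[leb]_(x in A `&` Q k) (u x)%:E =
    (\int[leb]_x (u x * \1_(A `&` Q k) x)%R)%:E)%E.
  move=> mA; rewrite (EFin_Int (iu A mA k)) [LHS]integral_mkcond; apply: eq_integral => x _.
  by rewrite patchE indicE; case: ifPn => _; rewrite ?mulr1 ?mulr0.
(* Dynkin's lemma: the sets whose trace on the cube has integral 0 contain the boxes and are stable
   under complements and countable disjoint unions. *)
have H k A : measurable A -> \int[leb]_x (u x * \1_(A `&` Q k) x) = 0.
  move=> mA; have mAs := mA; rewrite measurable_boxes in mAs; move: mAs.
  apply: (@dynkin_induction _ X [set A | exists a b, A = box a b]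
    (fun A => \int[leb]_x (u x * \1_(A `&` Q k) x) = 0) measurable_boxes).
  - move=> _ _ [a [b ->]] [a' [b' ->]]; rewrite boxI.
    by exists (fun i => Num.max (a i) (a' i)), (fun i => Num.min (b i) (b' i)).
  - by rewrite setTI; exact: box_integral_eq0.
  - by move=> _ [a [b ->]]; rewrite boxI; exact: box_integral_eq0.
  - move=> S mS HS; have : \int[leb]_x (u x * \1_(setT `&` Q k) x) = 0.
      by rewrite setTI; exact: box_integral_eq0.
    rewrite -[X in _ -> X = _]addr0 -HS -IntD; [|exact: (iu _ (measurableC mS))|exact: (iu _ mS)].
    move=> <-; apply: eq_Rintegral => x _; rewrite -mulrDr !indicE !in_setI in_setC in_setT /=.
    by case: (x \in S); rewrite /= ?add0r ?addr0.
  - move=> F mF tF HF.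
    have mFQ n : measurable (F n `&` Q k) by exact: measurableI.
    have ib : leb.-integrable (\bigcup_n (F n `&` Q k)) (EFin \o u).
      apply/integrable_mkcond; first exact: bigcup_measurable.
      have mUF : measurable (\bigcup_n F n) by exact: bigcup_measurable.
      have := iu _ mUF k.
      apply: eq_integrable => // x _ /=; rewrite -setI_bigcupl patchE indicE.
      by case: ifPn => _; rewrite ?mulr1 ?mulr0.
    have tFQ : trivIset setT (fun n => F n `&` Q k).
      by move=> i j _ _ [x [[Fi _] [Fj _]]]; apply: (tF i j) => //; exists x.
    have := integral_bigcup tFQ mFQ ib.
    rewrite eseries0; last by move=> n _ _; rewrite E// HF.
    have mUF : measurable (\bigcup_n F n) by exact: bigcup_measurable.
    by rewrite -setI_bigcupl (E _ _ mUF) => -[].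
have ae0 k : {ae leb, forall x, u x * \1_(setT `&` Q k) x = 0}.
  have := @integral_ae_eq _ _ _ leb setT measurableT (EFin \o (fun=> 0))
    (EFin \o (fun x => u x * \1_(setT `&` Q k) x)) (iu _ measurableT k).
  have m0 : measurable_fun [set: X] (EFin \o (fun=> 0 : R)) by exact: measurable_cst.
  move=> /(_ m0) h; have : ae_eq leb setT (EFin \o (fun x => u x * \1_(setT `&` Q k) x)) (EFin \o (fun=> 0)).
    apply: h => S _ mS; rewrite [RHS]integral0_eq//.
    transitivity (\int[leb]_(x in S `&` Q k) (u x)%:E)%E; last by rewrite E// H.
    rewrite [LHS]integral_mkcond [RHS]integral_mkcond; apply: eq_integral => x _.
    rewrite !patchE /= indicE !in_setI in_setT /=.
    by case: (x \in S) => //=; case: (x \in _); rewrite ?mulr1 ?mulr0.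
  by apply: filterS => x /(_ Logic.I) /= [].
have /ae_foralln aeA := ae0; apply: filterS aeA => x Hx.
have [n nx] : exists n : nat, forall j, `|x 0 j| < n%:R.
  exists (Num.truncn (\sum_j `|x 0 j|)).+1 => j.
  rewrite (le_lt_trans _ (truncnS_gt _))// (bigD1 j)//= lerDl.
  by apply: sumr_ge0.
have := Hx n; rewrite setTI indicE mem_set ?mulr1// => i /=.
by rewrite in_itv/= -ltr_norml.
Qed.

End smooth_functions.

(** * Weighted Sobolev spaces *)

Section weak_derivatives.
Context {R : realType} {d : nat}.
Local Notation X := 'rV[R]_d.
Local Notation leb := (@lebesgue_rV R d).
Implicit Types (f g phi : X -> R) (i j : 'I_d) (s : seq 'I_d) (b : 'I_d -> nat).
Local Notation D s f := (foldr (@partial R d) f s).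

Definition L2r f := measurable_fun setT f /\ rint leb (fun x => f x ^+ 2).

(** Weak derivatives along words, for real functions; complex functions are handled through their
    real and imaginary parts, and [wd_parts] returns to multi-indices. *)
Definition wdr s f g := forall phi, test_function phi ->
  \int[leb]_x (f x * D s phi x) = (-1) ^+ size s * \int[leb]_x (g x * phi x).

Lemma L2r_rintM f g : L2r f -> L2r g -> rint leb (fun x => f x * g x).
Proof. by move=> [mf f2] [mg g2]; exact: rintM. Qed.

Lemma schwartz_L2r f : schwartz f -> L2r f.
Proof.
move=> sf; split; first exact: schwartz_measurable.
by apply: schwartz_rint; under eq_fun do rewrite expr2; exact: schwartzM.
Qed.

Lemma L2rM_schwartz f phi : L2r f -> schwartz phi -> rint leb (fun x => f x * phi x).
Proof. by move=> Lf sp; apply: L2r_rintM => //; exact: schwartz_L2r. Qed.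

Lemma L2r0 : L2r (fun=> 0).
Proof. by apply: schwartz_L2r; exact: schwartz0. Qed.

Lemma L2rZ (c : R) f : L2r f -> L2r (fun x => c * f x).
Proof.
move=> [mf f2]; split; first by apply: measurable_funM.
by under eq_fun do rewrite exprMn; exact: rintZ.
Qed.

Lemma L2rD f g : L2r f -> L2r g -> L2r (fun x => f x + g x).
Proof.
move=> Lf Lg; split; first by apply: measurable_funD; [exact: Lf.1|exact: Lg.1].
under eq_fun do rewrite sqrrD; apply: rintD; last exact: Lg.2.
apply: rintD; first exact: Lf.2.
have := rintZ 2 (L2r_rintM Lf Lg); under eq_fun do rewrite mulr_natl.
by [].
Qed.

Lemma L2rN f : L2r f -> L2r (fun x => - f x).
Proof. by move=> /(L2rZ (-1)); under eq_fun do rewrite mulN1r. Qed.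

Lemma L2rB f g : L2r f -> L2r g -> L2r (fun x => f x - g x).
Proof. by move=> Lf Lg; apply: L2rD => //; exact: L2rN. Qed.

Lemma L2r_ae f g : measurable_fun setT g -> {ae leb, forall x, f x = g x} ->
  L2r f -> L2r g.
Proof.
move=> mg fg [mf f2]; split => //.
apply: (rint_ae _ _ _ f2); [exact: measurable_funX|exact: measurable_funX|].
by apply: filterS fg => x ->.
Qed.

Lemma schwartz_uniq f g : L2r f -> L2r g ->
  (forall phi, schwartz phi -> \int[leb]_x (f x * phi x) = \int[leb]_x (g x * phi x)) ->
  {ae leb, forall x, f x = g x}.
Proof.
move=> Lf Lg H; have Lfg := L2rB Lf Lg.
have : {ae leb, forall x, f x - g x = 0}.
  apply: dubois_reymond; [exact: Lfg.1|exact: Lfg.2|] => phi /test_schwartz sp.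
  under eq_Rintegral do rewrite mulrBl.
  by rewrite IntB ?H ?subrr//; exact: L2rM_schwartz.
by apply: filterS => x /eqP; rewrite subr_eq0 => /eqP.
Qed.

Lemma test_uniq f g : L2r f -> L2r g ->
  (forall phi, test_function phi -> \int[leb]_x (f x * phi x) = \int[leb]_x (g x * phi x)) ->
  {ae leb, forall x, f x = g x}.
Proof.
move=> Lf Lg H; have Lfg := L2rB Lf Lg.
have : {ae leb, forall x, f x - g x = 0}.
  apply: dubois_reymond; [exact: Lfg.1|exact: Lfg.2|] => phi tp.
  have sp := test_schwartz tp.
  under eq_Rintegral do rewrite mulrBl.
  by rewrite IntB ?H ?subrr//; exact: L2rM_schwartz.
by apply: filterS => x /eqP; rewrite subr_eq0 => /eqP.
Qed.

Lemma wdr_uniq s f g g' : L2r g -> L2r g' -> wdr s f g -> wdr s f g' ->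
  {ae leb, forall x, g x = g' x}.
Proof.
move=> Lg Lg' h h'; apply: test_uniq => // phi tp.
have e : (-1) ^+ size s != 0 :> R by rewrite signr_eq0.
by apply: (mulfI e); rewrite -h// -h'.
Qed.

Lemma wdr_perm s t f g : perm_eq s t -> wdr s f g -> wdr t f g.
Proof.
move=> st h phi tp; rewrite -(perm_size st) -h//.
by rewrite (word_perm (test_schwartz tp) st).
Qed.

Lemma int_word s f phi : schwartz f -> schwartz phi ->
  \int[leb]_x (f x * D s phi x) = (-1) ^+ size s * \int[leb]_x (D s f x * phi x).
Proof.
move=> + sp; elim: s f => [|i s IH] f sf /=; first by rewrite expr0 mul1r.
have ss := schwartz_word s sp.
have := int_by_parts i sf ss; move/eqP; rewrite -eqr_oppLR => /eqP <-.
rewrite IH; last exact: schwartz_partial.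
by rewrite word_partial// exprS -mulrA mulN1r.
Qed.

Lemma wdr_schwartz s f : schwartz f -> wdr s f (D s f).
Proof. by move=> sf phi /test_schwartz sp; exact: int_word. Qed.

Lemma wdr_ae s f f' g : measurable_fun setT f -> measurable_fun setT f' ->
  {ae leb, forall x, f x = f' x} -> wdr s f g -> wdr s f' g.
Proof.
move=> mf mf' ff h phi tp; rewrite -h//; apply: Int_ae.
- apply: measurable_funM => //; apply: schwartz_measurable.
  by apply: schwartz_word; exact: test_schwartz.
- apply: measurable_funM => //; apply: schwartz_measurable.
  by apply: schwartz_word; exact: test_schwartz.
- by apply: filterS ff => x ->.
Qed.

Lemma measurable_monom b : measurable_fun setT (@monom R d b).
Proof.
by apply: measurable_prod => i _; apply: measurable_funX; exact: measurable_coor.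
Qed.

Definition SigR (k : nat) f := L2r f /\ forall s b, (size s + mindex_size b <= k)%N ->
  exists g, [/\ L2r g, wdr s f g & L2r (fun x => monom b x * g x)].

Lemma SigR_L2 k f : SigR k f -> L2r f.
Proof. by case. Qed.

Lemma SigRW k l f : (k <= l)%N -> SigR l f -> SigR k f.
Proof.
by move=> kl [Lf H]; split => // s b h; apply: H; exact: leq_trans h kl.
Qed.

Lemma wdrD s f f' g g' : L2r f -> L2r f' -> L2r g -> L2r g' ->
  wdr s f g -> wdr s f' g' -> wdr s (fun x => f x + f' x) (fun x => g x + g' x).
Proof.
move=> Lf Lf' Lg Lg' h h' phi tp; have sp := test_schwartz tp.
have ss := schwartz_word s sp.
under eq_Rintegral do rewrite mulrDl; rewrite IntD ?h ?h'//; last 2 first.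
- exact: L2rM_schwartz.
- exact: L2rM_schwartz.
by under [in RHS]eq_Rintegral do rewrite mulrDl; rewrite IntD ?mulrDr//; exact: L2rM_schwartz.
Qed.

Lemma wdrZ s (c : R) f g : L2r f -> L2r g ->
  wdr s f g -> wdr s (fun x => c * f x) (fun x => c * g x).
Proof.
move=> Lf Lg h phi tp; have sp := test_schwartz tp.
have ss := schwartz_word s sp.
under eq_Rintegral do rewrite -mulrA; rewrite IntZ ?h//; last exact: L2rM_schwartz.
rewrite mulrCA; congr (_ * _); rewrite -IntZ; last exact: L2rM_schwartz.
by apply: eq_Rintegral => x _; rewrite mulrA.
Qed.

Lemma SigRD k f g : SigR k f -> SigR k g -> SigR k (fun x => f x + g x).
Proof.
move=> [Lf Hf] [Lg Hg]; split; first exact: L2rD.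
move=> s b h; have [f' [? ? ?]] := Hf s b h; have [g' [? ? ?]] := Hg s b h.
exists (fun x => f' x + g' x); split; [exact: L2rD|exact: wdrD|].
by under eq_fun do rewrite mulrDr; exact: L2rD.
Qed.

Lemma SigRZ k (c : R) f : SigR k f -> SigR k (fun x => c * f x).
Proof.
move=> [Lf Hf]; split; first exact: L2rZ.
move=> s b h; have [f' [? ? ?]] := Hf s b h.
exists (fun x => c * f' x); split; [exact: L2rZ|exact: wdrZ|].
by under eq_fun do rewrite mulrCA; exact: L2rZ.
Qed.

Lemma schwartz_monom b phi : schwartz phi -> schwartz (fun x => monom b x * phi x).
Proof.
move=> sp; rewrite /monom; elim: (index_enum _) => [|i r IH].
  by under eq_fun do rewrite big_nil mul1r.
under eq_fun do rewrite big_cons -mulrA; elim: (b i) => [|n IHn].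
  by under eq_fun do rewrite expr0 mul1r.
by under eq_fun do rewrite exprS -mulrA; exact: schwartz_coor.
Qed.

Lemma schwartz_SigR k f : schwartz f -> SigR k f.
Proof.
move=> sf; split; first exact: schwartz_L2r.
move=> s b _; exists (D s f); have ss := schwartz_word s sf; split.
- exact: schwartz_L2r.
- exact: wdr_schwartz.
- by apply: schwartz_L2r; exact: schwartz_monom.
Qed.

Lemma SigR0 k : SigR k (fun=> 0).
Proof. by apply: schwartz_SigR; exact: schwartz0. Qed.

Lemma SigR_sum k (I : Type) (r : seq I) (F : I -> X -> R) :
  (forall n, SigR k (F n)) -> SigR k (fun x => \sum_(n <- r) F n x).
Proof.
move=> LF; elim: r => [|a r IH].
  by under eq_fun do rewrite big_nil; exact: SigR0.
by under eq_fun do rewrite big_cons; exact: SigRD.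
Qed.

Lemma wdr_comp s t f g h : wdr t f g -> wdr (t ++ s) f h -> wdr s g h.
Proof.
move=> fg fh phi tp; have := fg _ (test_word s tp); rewrite -foldr_cat fh// size_cat exprD -mulrA.
have e : (-1) ^+ size t != 0 :> R by rewrite signr_eq0.
by move/(mulfI e)/esym.
Qed.

Lemma SigR_wdr k t f g : SigR (size t + k) f -> L2r g -> wdr t f g -> SigR k g.
Proof.
move=> [Lf Hf] Lg fg; split => // s b sb.
have [|h [Lh fh bh]] := Hf (t ++ s) b; first by rewrite size_cat -addnA leq_add2l.
by exists h; split => //; exact: wdr_comp fg fh.
Qed.

Definition bump_index b i : 'I_d -> nat := fun j => (b j + (j == i))%N.

Lemma monom_bump b i (x : X) : monom (bump_index b i) x = x 0 i * monom b x.
Proof.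
rewrite /monom /bump_index (bigD1 i)//= [in RHS](bigD1 i)//= eqxx addn1 exprS -!mulrA.
by congr (_ * (_ * _)); apply: eq_bigr => j /negbTE ->; rewrite addn0.
Qed.

Lemma size_bump b i : mindex_size (bump_index b i) = (mindex_size b).+1.
Proof.
rewrite /mindex_size /bump_index big_split /= -addn1; congr addn.
by rewrite (bigD1 i)//= eqxx big1 ?addn0// => j /negbTE ->.
Qed.

Lemma size_index0 : mindex_size (fun _ : 'I_d => 0%N) = 0%N.
Proof. by rewrite /mindex_size big1. Qed.

Lemma monom0 (x : X) : monom (fun _ : 'I_d => 0%N) x = 1.
Proof. by rewrite /monom big1// => i _; rewrite expr0. Qed.

Lemma SigR_ae_witness k s b f g : SigR k f -> (size s + mindex_size b <= k)%N ->
  L2r g -> wdr s f g -> L2r (fun x => monom b x * g x).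
Proof.
move=> [Lf Hf] sb Lg fg; have [g' [Lg' fg' bg']] := Hf s b sb.
apply: (L2r_ae (f := fun x => monom b x * g' x)) => //.
  by apply: measurable_funM; [exact: measurable_monom|exact: Lg.1].
by apply: filterS (wdr_uniq Lg' Lg fg' fg) => x ->.
Qed.

Lemma schwartz_smooth f : schwartz f -> smooth f.
Proof.
move=> sf n; have := sf n; elim: n f {sf} => [|n IH] f.
  by move=> [[cf _] _]; split.
move=> /schwnS[cf _ ef sf]; apply/smnS; split => // i; exact: IH.
Qed.

Lemma test_coor i phi : test_function phi -> test_function (fun x : X => x 0 i * phi x).
Proof.
move=> tp; have [K [cK smp p0]] := test_support tp; apply: (test_intro cK).
  by apply: schwartz_smooth; apply: schwartz_coor; exact: test_schwartz.
by move=> x /p0 ->; rewrite mulr0.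
Qed.

(** By [wordX], the weak derivative of x_i f along [s] is x_i g, with g that of [f], plus the
    multiplicity of [i] in [s] times the derivative of [f] along [s] with one [i] removed. Both keep
    their weighted L^2 bounds because [f] has one order to spare. *)
Lemma SigR_coor k i f : SigR k.+1 f -> SigR k (fun x => x 0 i * f x).
Proof.
move=> Sf; have Lf := SigR_L2 Sf.
have w0 : wdr [::] f f by move=> phi tp; rewrite expr0 mul1r.
have Lxf : L2r (fun x => x 0 i * f x).
  have := @SigR_ae_witness k.+1 [::] (bump_index (fun=> 0%N) i) f f Sf.
  rewrite size_bump size_index0 /= => /(_ isT Lf w0).
  by under eq_fun do rewrite monom_bump monom0 mulr1.
split => // s b sb.
have [|g [Lg fg xg]] := Sf.2 s (bump_index (fun=> 0%N) i).
  by rewrite size_bump size_index0 addn1 ltnS (leq_trans _ sb)// leq_addr.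
have bg : L2r (fun x => monom (bump_index b i) x * g x).
  have := @SigR_ae_witness k.+1 s (bump_index b i) f g Sf.
  by rewrite size_bump addnS ltnS => /(_ sb Lg fg).
have {}xg : L2r (fun x => x 0 i * g x).
  by move: xg; under eq_fun do rewrite monom_bump monom0 mulr1.
(* If [i] does not occur in [s], the correction has coefficient 0 and the witness 0 serves. *)
have [h [Lh fh bh]] : exists h, [/\ L2r h, (i \in s -> wdr (rem i s) f h) &
    L2r (fun x => monom b x * h x)].
  have [si|si] := boolP (i \in s); last first.
    exists (fun=> 0); split => //; first exact: L2r0.
    by under eq_fun do rewrite mulr0; exact: L2r0.
  have [|h [? ? ?]] := Sf.2 (rem i s) b; last by exists h; split.
  rewrite size_rem// (leq_trans _ (leq_trans sb _))// leq_add2r; exact: leq_pred.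
exists (fun x : X => x 0 i * g x + (count_mem i s)%:R * h x); split.
- by apply: L2rD => //; exact: L2rZ.
- move=> phi tp; have sp := test_schwartz tp; have sxp := schwartz_coor i sp.
  have txp : test_function (fun x => x 0 i * phi x).
    exact: test_coor.
  have E := wordX s i sp.
  have -> : \int[leb]_x (x 0 i * f x * D s phi x) =
     \int[leb]_x (f x * D s (fun x => x 0 i * phi x) x) -
     (count_mem i s)%:R * \int[leb]_x (f x * D (rem i s) phi x).
    rewrite -IntZ; last by apply: L2rM_schwartz => //; exact: schwartz_word.
    rewrite -IntB; last 2 first.
    - by apply: L2rM_schwartz => //; exact: schwartz_word.
    - by apply: rintZ; apply: L2rM_schwartz => //; exact: schwartz_word.
    apply: eq_Rintegral => x _; rewrite E; move: (D s phi x) (D _ phi x) => p q; ring.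
  have -> : \int[leb]_x ((x 0 i * g x + (count_mem i s)%:R * h x) * phi x) =
    \int[leb]_x (g x * (x 0 i * phi x)) + (count_mem i s)%:R * \int[leb]_x (h x * phi x).
    rewrite -IntZ; last exact: L2rM_schwartz.
    rewrite -IntD; last 2 first.
    - exact: L2rM_schwartz.
    - by apply: rintZ; exact: L2rM_schwartz.
    by apply: eq_Rintegral => x _; ring.
  rewrite mulrDr fg//; congr (_ + _).
  have [si|si] := boolP (i \in s); last by rewrite (count_memPn si) !mul0r mulr0 oppr0.
  rewrite fh// size_rem//; case: s si {sb fg bg fh E} => // j s _ /=.
  by rewrite exprS; ring.
- under eq_fun do rewrite mulrDr mulrA (mulrC (monom _ _)) -monom_bump mulrCA.
  by apply: L2rD => //; exact: L2rZ.
Qed.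

End weak_derivatives.

Lemma is_derive_line {R : realType} (V W : normedModType R) (x v : V) (F : V -> W) df :
  is_derive (0 : R) (1 : R) (fun t : R => F (t *: v + x)) df -> is_derive x v F df.
Proof.
move=> [dF DF].
have EE : (fun h : R => h^-1 *: (((fun t : R => F (t *: v + x)) \o shift 0) (h *: (1 : R)) - F (0 *: v + x)))
    = (fun h : R => h^-1 *: ((F \o shift x) (h *: v) - F x)).
  by apply/funext => h /=; rewrite addr0 -[h *: 1]/(h * 1) mulr1 scale0r add0r.
by split; [rewrite /derivable -EE|rewrite /derive -EE].
Qed.

(** * Schwartz functions as test functions for weak derivatives *)

Section cutoff_extension.
Context {R : realType} {d : nat}.
Local Notation X := 'rV[R]_d.
Local Notation leb := (@lebesgue_rV R d).
Implicit Types (f g phi chi : X -> R) (i j : 'I_d) (s : seq 'I_d) (b : 'I_d -> nat).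
Local Notation D s f := (foldr (@partial R d) f s).
Local Notation e_ i := (delta_mx 0 i : X).

Lemma partial_scale i (c : R) chi : schwartz chi ->
  (forall x, is_derive x (e_ i) (fun x : X => chi (c *: x)) (c * partial i chi (c *: x))).
Proof.
move=> sc x; apply: is_derive_line.
have d1 : is_derive (c * 0) (1 : R) (fun t : R => chi (t *: e_ i + c *: x)) (partial i chi (c *: x)).
  apply: (@is_derive_shift _ _ _ _ (fun t : R => t *: e_ i + c *: x) 1 _ (e_ i)).
    by move=> h; rewrite scalerDl -[h *: 1]/(h * 1) mulr1 addrA.
  by rewrite mulr0 scale0r add0r; exact: schwartz_is_derive.
have d2 : is_derive (0 : R) (1 : R) (fun t : R => c * t) c.
  by have := is_deriveZ c (is_derive_id (0 : R) (1:R)); rewrite -[c *: 1]/(c * 1) mulr1.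
have := @is_derive1_comp R _ (fun t => c * t) 0 _ _ d1 d2; rewrite mulrC.
rewrite (_ : _ \o _ = fun t => chi (c *: (t *: e_ i + x)))//.
by apply/funext => t /=; rewrite scalerDr scalerA.
Qed.

Lemma smooth_scale (c : R) chi : schwartz chi -> smooth (fun x : X => chi (c *: x)).
Proof.
move=> sc; apply: (smooth_coind (Q := fun f => exists chi (k : R), schwartz chi /\
  f = fun x => k * chi (c *: x))); last first.
  by exists chi, 1; split => //; apply/funext => x; rewrite mul1r.
move=> _ [{sc}chi [k [sc ->]]]; split.
- apply: continuous_scale => x; apply: (@continuous_comp _ _ _ (fun x : X => c *: x) chi).
    exact: scaler_continuous.
  exact: schwartz_continuous.
- move=> i x; have := is_deriveZ k (partial_scale i c sc x).
  by case.
- move=> i; exists (partial i chi), (k * c); split; first exact: schwartz_partial.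
  apply/funext => x; apply: partial_is_derive.
  by rewrite -mulrA; exact: (is_deriveZ k (partial_scale i c sc x)).
Qed.

Definition cut (n : nat) chi (x : X) := chi (n.+1%:R^-1 *: x).

Lemma schwartz_cut n phi chi : schwartz phi -> schwartz chi ->
  schwartz (fun x => phi x * cut n chi x).
Proof.
move=> sp sc; apply: (schwartz_coind (Q := fun f => forall m, schwn m f)) => //.
  move=> f sf; have /schwnS[? ? ? ?] := sf 1%N; split => // i m.
  by have /schwnS[_ _ _] := sf m.+1; apply.
move=> m; elim: m phi chi sp sc => [|m IH] phi chi sp sc.
  split => //; split.
    apply: continuous_mul; first exact: schwartz_continuous.
    exact: (smooth_scale n.+1%:R^-1 sc 0%N).1.
  apply: decaysM_bounded; first exact: schwartz_decays.
  by have [C hC] := schwartz_bounded sc; exists C => x; exact: hC.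
have dc i x := partial_scale i n.+1%:R^-1 sc x.
have dm i x : is_derive x (e_ i) (fun x => phi x * cut n chi x)
   (partial i phi x * cut n chi x + phi x * (n.+1%:R^-1 * cut n (partial i chi) x)).
  have [h1 h2] := dc i x; have := partialM (@schwartz_derivable R d phi i x sp) h1.
  by rewrite /partial h2.
apply/schwnS; split.
- apply: continuous_mul; first exact: schwartz_continuous.
  exact: (smooth_scale n.+1%:R^-1 sc 0%N).1.
- apply: decaysM_bounded; first exact: schwartz_decays.
  by have [C hC] := schwartz_bounded sc; exists C => x; exact: hC.
- by move=> i x; have [] := dm i x.
move=> i; rewrite (_ : partial i _ = fun x => partial i phi x * cut n chi x + n.+1%:R^-1 * (phi x * cut n (partial i chi) x)).
  apply: schwnD; first by apply: IH => //; exact: schwartz_partial.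
  by apply: schwnZ; apply: IH => //; exact: schwartz_partial.
by apply/funext => x; rewrite [in RHS]mulrCA; apply: partial_is_derive; exact: dm.
Qed.

Lemma partial_cut i n phi chi : schwartz phi -> schwartz chi ->
  partial i (fun x => phi x * cut n chi x) =
  fun x => partial i phi x * cut n chi x + n.+1%:R^-1 * (phi x * cut n (partial i chi) x).
Proof.
move=> sp sc; apply/funext => x; rewrite [in RHS]mulrCA; apply: partial_is_derive.
have [h1 h2] := partial_scale i n.+1%:R^-1 sc x.
have := partialM (@schwartz_derivable R d phi i x sp) h1.
by rewrite /partial h2.
Qed.

Lemma wordZ s (c : R) f : schwartz f -> D s (fun x => c * f x) = fun x => c * D s f x.
Proof.
move=> sf; elim: s => //= k s ->.
by rewrite schwartz_partialZ//; exact: schwartz_word.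
Qed.

(** Each derivative falling on the dilated cutoff brings a factor 1/(n+1) and disappears in the
    limit. The induction removes the innermost letter, which preserves the shape of a Schwartz
    function times a dilated cutoff; therefore [phi] and [chi] vary in it. *)
Lemma word_cut s phi chi : schwartz phi -> schwartz chi ->
  (exists C, forall n x, `|D s (fun x => phi x * cut n chi x) x| <= C * wt x) /\
  forall x, D s (fun x => phi x * cut n chi x) x @[n --> \oo] --> D s phi x * chi 0.
Proof.
elim/last_ind: s phi chi => [|s i IH] phi chi sp sc /=.
  split.
    have [C hC] := schwartz_decays sp 1; have [M hM] := schwartz_bounded sc.
    exists (C * M) => n x; rewrite normrM mulrAC; apply: ler_pM => //.
    exact: hM.
  move=> x; apply: cvgM; first exact: cvg_cst.
  apply: (@cvg_comp _ _ _ (fun n : nat => n.+1%:R^-1 *: x) chi _ (nbhs (0 : X))); last first.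
    exact: schwartz_continuous.
  have h : n.+1%:R^-1 *: x @[n --> \oo] --> (0 : R) *: x by apply: cvgZr_tmp; exact: cvg_harmonic.
  by rewrite scale0r in h.
have [[C1 h1] l1] := IH _ _ (schwartz_partial i sp) sc.
have [[C2 h2] l2] := IH _ _ sp (schwartz_partial i sc).
have E n : D (rcons s i) (fun x => phi x * cut n chi x) =
   fun x => D s (fun x => partial i phi x * cut n chi x) x +
     n.+1%:R^-1 * D s (fun x => phi x * cut n (partial i chi) x) x.
  rewrite word_rcons partial_cut// wordD; last 2 first.
  - by apply: schwartz_cut => //; exact: schwartz_partial.
  - by apply: schwartzZ; apply: schwartz_cut => //; exact: schwartz_partial.
  apply/funext => x; congr (_ + _).
  by rewrite wordZ//; apply: schwartz_cut => //; exact: schwartz_partial.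
split.
  exists (C1 + C2) => n x; rewrite E (le_trans (ler_normD _ _))// mulrDl lerD//.
  rewrite normrM (le_trans _ (h2 n x))// -[leRHS]mul1r ler_wpM2r//.
  by rewrite ger0_norm// invf_le1// ler1n.
move=> x; under eq_fun do rewrite E; rewrite word_rcons.
have l3 : n.+1%:R^-1 * D s (fun x => phi x * cut n (partial i chi) x) x @[n --> \oo]
    --> 0 * (D s phi x * partial i chi 0).
  by apply: cvgM; [exact: cvg_harmonic|exact: l2].
rewrite mul0r in l3; rewrite -(addr0 (_ * chi 0)).
by apply: cvgD; [exact: l1|exact: l3].
Qed.

Lemma unit_bump : exists2 chi : X -> R, test_function chi & chi 0 = 1.
Proof.
pose c : R := flat 1 1 * flat 1 1.
have c0 : 0 < \prod_(i < d) c.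
  by apply: prodr_gt0 => i _; rewrite mulr_gt0// flat1_gt0// expR_gt0.
exists (fun x => (\prod_(i < d) c)^-1 * box_bump 1 (fun=> -1) (fun=> 1) x).
  have := @test_box_bump R d 0 (fun=> -1) (fun=> 1) => /test_support[K [cK sb b0]].
  apply: (test_intro cK); first by move=> n; apply: smnM => //; exact: smooth_cst.
  by move=> x /b0 ->; rewrite mulr0.
rewrite (_ : box_bump 1 _ _ 0 = \prod_(i < d) c); first by rewrite mulVf// gt_eqF.
by apply: eq_bigr => i _; rewrite !mxE !mulr0 !add0r mul1r mulr1 opprK.
Qed.

(** Weak derivatives are defined with compactly supported functions, while Hermite functions never
    have compact support. The functions phi(x) chi(x/(n+1)) with chi(0) = 1 are admissible, converge
    with their derivatives and are dominated by the weight, so the identity passes to the limit. *)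
Lemma wdr_extend s f g phi : L2r f -> L2r g -> wdr s f g -> schwartz phi ->
  \int[leb]_x (f x * D s phi x) = (-1) ^+ size s * \int[leb]_x (g x * phi x).
Proof.
move=> Lf Lg fg sp; have [chi tc c1] := unit_bump; have sc := test_schwartz tc.
have [[C hC] L] := word_cut s sp sc; have [[C' hC'] L'] := word_cut [::] sp sc.
have swt : L2r (@wt R d).
  split; first by apply: continuous_measurable_rV; exact: continuous_wt.
  apply: rint_le (@rint_wt R d).
    by apply: measurable_funX; apply: continuous_measurable_rV; exact: continuous_wt.
  move=> x; have w0 := wt_gt0 x; have w1 := wt_le1 x.
  by rewrite ger0_norm ?sqr_ge0// expr2 ler_piMr// ltW.
have dom h (F : nat -> X -> R) G B : L2r h -> (forall n, measurable_fun setT (F n)) ->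
    (forall n x, `|F n x| <= B * wt x) ->
    (forall x, F n x @[n --> \oo] --> (G x : R)) ->
    (\int[leb]_x (h x * F n x)) @[n --> \oo] --> \int[leb]_x (h x * G x).
  move=> Lh mF FB FG.
  apply: (@Int_dominated _ _ _ leb _ _ (fun x => `|h x * (B * wt x)|)).
  - by move=> n; apply: measurable_funM => //; exact: Lh.1.
  - by apply: rint_norm; apply: L2r_rintM => //; exact: L2rZ.
  - move=> n x; rewrite !normrM ler_wpM2l// -normrM (le_trans (FB n x))//.
    exact: ler_norm.
  - by move=> x; apply: cvgM; [exact: cvg_cst|exact: FG].
have l1 := dom f _ _ C Lf (fun n => schwartz_measurable (schwartz_word s (schwartz_cut n sp sc))) hC L.
have l2 := dom g _ _ C' Lg (fun n => schwartz_measurable (schwartz_cut n sp sc)) hC' L'.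
have E h F : \int[leb]_x (h x * (F x * chi 0)) = \int[leb]_x (h x * F x).
  by apply: eq_Rintegral => x _; rewrite c1 mulr1.
rewrite !E in l1 l2.
have l3 : (-1) ^+ size s * \int[leb]_x (g x * (phi x * cut n chi x)) @[n --> \oo] -->
    (-1) ^+ size s * \int[leb]_x (g x * phi x).
  by apply: cvgM; [exact: cvg_cst|exact: l2].
suff l4 : (-1) ^+ size s * \int[leb]_x (g x * (phi x * cut n chi x)) @[n --> \oo] -->
    \int[leb]_x (f x * D s phi x) by exact: cvg_unique l4 l3.
apply: cvg_trans l1; apply: near_eq_cvg; apply: nearW => n.
apply: fg.
have [K [cK smc k0]] := test_support tc.
apply: (@test_intro _ _ _ [set n.+1%:R *: x | x in K]).
- by apply: continuous_compact => //; apply: continuous_subspaceT => x; exact: scaler_continuous.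
- by apply: schwartz_smooth; exact: schwartz_cut.
- move=> x Kx; rewrite /cut k0 ?mulr0// => Kn; apply: Kx; exists (n.+1%:R^-1 *: x) => //.
  by rewrite scalerA mulfV ?scale1r.
Qed.

End cutoff_extension.

(** * Complex-valued functions and powers of the harmonic oscillator *)

Section complex_sobolev.
Context {R : realType} {d : nat}.
Local Notation X := 'rV[R]_d.
Local Notation leb := (@lebesgue_rV R d).
Implicit Types (f g phi : X -> R) (u v : X -> R[i]) (i j : 'I_d) (s : seq 'I_d).
Local Notation D s f := (foldr (@partial R d) f s).

Definition reP u : X -> R := fun x => complex.Re (u x).
Definition imP u : X -> R := fun x => complex.Im (u x).

Lemma complex_eq (z w : R[i]) : complex.Re z = complex.Re w ->
  complex.Im z = complex.Im w -> z = w.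
Proof. by case: z w => [a b] [a' b'] /= -> ->. Qed.

Lemma Re_mul_real (z : R[i]) (r : R) : complex.Re (z * r%:C) = complex.Re z * r.
Proof. by case: z => a b /=; rewrite mulr0 subr0. Qed.

Lemma Im_mul_real (z : R[i]) (r : R) : complex.Im (z * r%:C) = complex.Im z * r.
Proof. by case: z => a b /=; rewrite mulr0 add0r. Qed.

Lemma Re_real_mul (z : R[i]) (r : R) : complex.Re (r%:C * z) = r * complex.Re z.
Proof. by rewrite mulrC Re_mul_real mulrC. Qed.

Lemma Im_real_mul (z : R[i]) (r : R) : complex.Im (r%:C * z) = r * complex.Im z.
Proof. by rewrite mulrC Im_mul_real mulrC. Qed.

Lemma ReD (z w : R[i]) : complex.Re (z + w) = complex.Re z + complex.Re w.
Proof. by case: z w => [? ?] [? ?]. Qed.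
Lemma ImD (z w : R[i]) : complex.Im (z + w) = complex.Im z + complex.Im w.
Proof. by case: z w => [? ?] [? ?]. Qed.
Lemma ReN (z : R[i]) : complex.Re (- z) = - complex.Re z.
Proof. by case: z. Qed.
Lemma ImN (z : R[i]) : complex.Im (- z) = - complex.Im z.
Proof. by case: z. Qed.
Lemma ReM (z w : R[i]) : complex.Re (z * w) = complex.Re z * complex.Re w - complex.Im z * complex.Im w.
Proof. by case: z w => [? ?] [? ?]. Qed.
Lemma ImM (z w : R[i]) : complex.Im (z * w) = complex.Re z * complex.Im w + complex.Im z * complex.Re w.
Proof. by case: z w => [? ?] [? ?]. Qed.
Lemma Re_conj (z : R[i]) : complex.Re (conjc z) = complex.Re z.
Proof. by case: z. Qed.
Lemma Im_conj (z : R[i]) : complex.Im (conjc z) = - complex.Im z.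
Proof. by case: z. Qed.
Lemma Re_sum (I : Type) (r : seq I) (P : pred I) (F : I -> R[i]) :
  complex.Re (\sum_(k <- r | P k) F k) = \sum_(k <- r | P k) complex.Re (F k).
Proof.
elim: r => [|a r IH]; first by rewrite !big_nil.
by rewrite !big_cons; case: ifP => _; rewrite ?ReD IH.
Qed.
Lemma Im_sum (I : Type) (r : seq I) (P : pred I) (F : I -> R[i]) :
  complex.Im (\sum_(k <- r | P k) F k) = \sum_(k <- r | P k) complex.Im (F k).
Proof.
elim: r => [|a r IH]; first by rewrite !big_nil.
by rewrite !big_cons; case: ifP => _; rewrite ?ImD IH.
Qed.

Lemma signC n : (-1) ^+ n = ((-1) ^+ n)%:C :> R[i].
Proof.
elim: n => [|n IH]; first by rewrite !expr0.
rewrite !exprS IH; apply: complex_eq; rewrite ?ReM ?ImM /=; ring.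
Qed.

Lemma L2_parts u : L2 u <-> L2r (reP u) /\ L2r (imP u).
Proof.
split.
  move=> [mr mi ui].
  have : rint leb (fun x => reP u x ^+ 2 + imP u x ^+ 2).
    apply/rint_lty => //; last by move=> x; rewrite addr_ge0// sqr_ge0.
    by apply: measurable_funD; apply: measurable_funX.
  move=> h; split; split => //; apply: rint_le h; try exact: measurable_funX.
    by move=> x; rewrite ger0_norm ?sqr_ge0// lerDl sqr_ge0.
  by move=> x; rewrite ger0_norm ?sqr_ge0// lerDr sqr_ge0.
move=> [[mr r2] [mi i2]]; split => //.
have := rintD r2 i2; rewrite rint_lty//.
  by apply: measurable_funD; apply: measurable_funX.
by move=> x; rewrite addr_ge0// sqr_ge0.
Qed.

Lemma wd_parts (a : 'I_d -> nat) u v : is_weak_deriv a u v <->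
  wdr (mword a) (reP u) (reP v) /\ wdr (mword a) (imP u) (imP v).
Proof.
have E f : mpartial a f = D (mword a) f by exact: mpartialE.
split=> [h|[h1 h2] f tf].
  split=> f tf; have := h f tf; rewrite E signC -size_mword.
    move/(congr1 (@complex.Re R)); rewrite Re_real_mul /cintegral /=.
    under eq_Rintegral do rewrite Re_mul_real.
    by under [in X in _ -> _ = X]eq_Rintegral do rewrite -/(reP v _); under [in X in _ = _ * X -> _]eq_Rintegral do rewrite Re_mul_real.
  move/(congr1 (@complex.Im R)); rewrite Im_real_mul /cintegral /=.
  under eq_Rintegral do rewrite Im_mul_real.
  by under [in X in _ = _ * X -> _]eq_Rintegral do rewrite Im_mul_real.
rewrite E signC -size_mword; apply: complex_eq.
  rewrite Re_real_mul /cintegral /=; under eq_Rintegral do rewrite Re_mul_real.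
  rewrite [LHS](h1 f tf); congr (_ * _); apply: eq_Rintegral => x _.
  by rewrite Re_mul_real.
rewrite Im_real_mul /cintegral /=; under eq_Rintegral do rewrite Im_mul_real.
rewrite [LHS](h2 f tf); congr (_ * _); apply: eq_Rintegral => x _.
by rewrite Im_mul_real.
Qed.

Lemma Sigma_parts k u : Sigma k u <-> SigR k (reP u) /\ SigR k (imP u).
Proof.
split.
  move=> [Lu H]; have [Lr Li] := (L2_parts u).1 Lu; split; split => // s b sb.
    have [|v [Lv uv bv]] := H (wcount s) b; first by rewrite size_wcount.
    exists (reP v); split; first by have [] := (L2_parts v).1 Lv.
      by have [/(wdr_perm (wcount_perm s))] := (wd_parts _ _ _).1 uv.
    have [+ _] := (L2_parts _).1 bv; rewrite /reP.
    by under eq_fun do rewrite Re_real_mul.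
  have [|v [Lv uv bv]] := H (wcount s) b; first by rewrite size_wcount.
  exists (imP v); split; first by have [] := (L2_parts v).1 Lv.
    by have [_ /(wdr_perm (wcount_perm s))] := (wd_parts _ _ _).1 uv.
  have [_ +] := (L2_parts _).1 bv; rewrite /imP.
  by under eq_fun do rewrite Im_real_mul.
move=> [[Lr Hr] [Li Hi]]; split; first exact/L2_parts.
move=> a b ab; have [|f [Lf uf bf]] := Hr (mword a) b; first by rewrite size_mword.
have [|g [Lg ug bg]] := Hi (mword a) b; first by rewrite size_mword.
exists (fun x => f x +i* g x); split; first exact/L2_parts.
  exact/wd_parts.
apply/L2_parts; rewrite /reP /imP; split.
  by under eq_fun do rewrite Re_real_mul.
by under eq_fun do rewrite Im_real_mul.
Qed.

(** [weak_deriv] is a choice with default value 0; membership in [Sigma k] makes the set of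
    candidates non-empty. *)
Lemma weak_deriv_spec (a : 'I_d -> nat) u k : Sigma k u -> (mindex_size a <= k)%N ->
  L2 (weak_deriv a u) /\ is_weak_deriv a u (weak_deriv a u).
Proof.
move=> [Lu H] ak; have [|v [Lv uv _]] := H a (fun=> 0%N).
  by rewrite size_index0 addn0.
by have [] := xgetPex (fun=> 0) (ex_intro (fun v => L2 v /\ is_weak_deriv a u v) v (conj Lv uv)).
Qed.

Lemma mword_delta i n : perm_eq (mword (mdelta i n)) (nseq n i).
Proof.
apply/allP => j _ /=; rewrite count_mword count_nseq /mdelta /= [i == j]eq_sym.
by case: (j == i); rewrite ?mul1n ?mul0n.
Qed.

Lemma size_mdelta i n : mindex_size (mdelta i n) = n.
Proof. by rewrite -size_mword (perm_size (mword_delta i n)) size_nseq. Qed.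

(** The pointwise operator on Schwartz functions. [opA], made of chosen weak derivatives, is
    compared with it by duality. *)
Definition Aop f : X -> R := fun x =>
  - (\sum_i partial i (partial i f) x) + (\sum_i x 0 i ^+ 2) * f x.

Lemma AopE f : Aop f = fun x => \sum_i (- partial i (partial i f) x + x 0 i * (x 0 i * f x)).
Proof.
apply/funext => x; rewrite /Aop big_split /= sumrN mulr_suml; congr (_ + _).
by apply: eq_bigr => i _; rewrite expr2 mulrA.
Qed.

Lemma schwartz_Aop f : schwartz f -> schwartz (Aop f).
Proof.
move=> sf; rewrite AopE; apply: schwartz_sum => i _; apply: schwartzD.
  by apply: schwartzN; do 2 apply: schwartz_partial.
by do 2 apply: schwartz_coor.
Qed.

Lemma schwartz_iterA l f : schwartz f -> schwartz (iter l Aop f).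
Proof. by move=> sf; elim: l => //= l; exact: schwartz_Aop. Qed.

(* Applied to the real and imaginary parts of opA u, with W i the chosen second weak derivative. *)
Lemma opA_real_step k f (W : 'I_d -> X -> R) : SigR k.+2 f ->
  (forall i, L2r (W i)) -> (forall i, wdr [:: i; i] f (W i)) ->
  let g := fun x => - (\sum_i W i x) + (\sum_i x 0 i ^+ 2) * f x in
  SigR k g /\ forall phi, schwartz phi ->
    \int[leb]_x (g x * phi x) = \int[leb]_x (f x * Aop phi x).
Proof.
move=> Sf LW fW g.
have gE : g = fun x => \sum_i (- 1 * W i x + x 0 i * (x 0 i * f x)).
  apply/funext => x; rewrite /g big_split /= -mulr_sumr mulN1r mulr_suml; congr (_ + _).
  by apply: eq_bigr => i _; rewrite expr2 mulrA.
have SW i : SigR k (W i) by apply: (@SigR_wdr _ _ k [:: i; i] f).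
have Sx i : SigR k (fun x => x 0 i * (x 0 i * f x)) by do 2 apply: SigR_coor.
split; first by rewrite gE; apply: SigR_sum => i; apply: SigRD => //; exact: SigRZ.
move=> phi sp; rewrite gE AopE.
have Lf := SigR_L2 Sf.
have spp i : schwartz (partial i (partial i phi)) by do 2 apply: schwartz_partial.
have sxx i : schwartz (fun x : X => x 0 i * (x 0 i * phi x)) by do 2 apply: schwartz_coor.
under eq_Rintegral do rewrite mulr_suml.
under [RHS]eq_Rintegral do rewrite mulr_sumr.
rewrite Int_sum; last first.
  move=> i _; apply: L2rM_schwartz => //; apply: L2rD; last exact: SigR_L2 (Sx i).
  exact: L2rZ.
rewrite Int_sum; last first.
  move=> i _; apply: L2rM_schwartz => //; apply: schwartzD => //.
  exact: schwartzN.
apply: eq_bigr => i _.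
transitivity (- (\int[leb]_x (W i x * phi x)) + \int[leb]_x (x 0 i * (x 0 i * f x) * phi x)).
  rewrite -IntN; last exact: L2rM_schwartz.
  rewrite -IntD; last 2 first.
  - by apply: rintN; exact: L2rM_schwartz.
  - by apply: L2rM_schwartz => //; exact: SigR_L2 (Sx i).
  by apply: eq_Rintegral => x _; rewrite mulrDl mulN1r mulNr.
have := wdr_extend Lf (LW i) (fW i) sp; rewrite /= sqrrN expr1n mul1r => <-.
transitivity (- (\int[leb]_x (f x * partial i (partial i phi) x)) + \int[leb]_x (f x * (x 0 i * (x 0 i * phi x)))).
  by congr (_ + _); apply: eq_Rintegral => x _; ring.
rewrite -IntN; last exact: L2rM_schwartz.
rewrite -IntD; last 2 first.
- by apply: rintN; exact: L2rM_schwartz.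
- exact: L2rM_schwartz.
by apply: eq_Rintegral => x _; rewrite mulrDr mulrN.
Qed.

Lemma opA_step k u : Sigma k.+2 u -> Sigma k (opA u) /\
  forall phi, schwartz phi ->
    \int[leb]_x (reP (opA u) x * phi x) = \int[leb]_x (reP u x * Aop phi x) /\
    \int[leb]_x (imP (opA u) x * phi x) = \int[leb]_x (imP u x * Aop phi x).
Proof.
move=> Su; have [Sr Si] := (Sigma_parts _ _).1 Su.
have ws i : L2 (weak_deriv (mdelta i 2) u) /\ is_weak_deriv (mdelta i 2) u (weak_deriv (mdelta i 2) u).
  by apply: weak_deriv_spec Su _; rewrite size_mdelta.
have reE : reP (opA u) = fun x => - (\sum_i reP (weak_deriv (mdelta i 2) u) x) + (\sum_i x 0 i ^+ 2) * reP u x.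
  by apply/funext => x; rewrite /reP /opA ReD ReN Re_sum Re_real_mul.
have imE : imP (opA u) = fun x => - (\sum_i imP (weak_deriv (mdelta i 2) u) x) + (\sum_i x 0 i ^+ 2) * imP u x.
  by apply/funext => x; rewrite /imP /opA ImD ImN Im_sum Im_real_mul.
have [S1 P1] : SigR k (reP (opA u)) /\ forall phi, schwartz phi ->
    \int[leb]_x (reP (opA u) x * phi x) = \int[leb]_x (reP u x * Aop phi x).
  rewrite reE; apply: opA_real_step => // i; first by have [/L2_parts[]] := ws i.
  by have [_ /wd_parts[/(wdr_perm (mword_delta i 2))]] := ws i.
have [S2 P2] : SigR k (imP (opA u)) /\ forall phi, schwartz phi ->
    \int[leb]_x (imP (opA u) x * phi x) = \int[leb]_x (imP u x * Aop phi x).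
  rewrite imE; apply: opA_real_step => // i; first by have [/L2_parts[]] := ws i.
  by have [_ /wd_parts[_ /(wdr_perm (mword_delta i 2))]] := ws i.
split; first exact/Sigma_parts.
by move=> phi sp; split; [exact: P1|exact: P2].
Qed.

(** All powers are controlled by duality with Schwartz functions, on which the operator acts
    pointwise; each application uses up two orders of regularity. *)
Lemma opA_iter l k u : Sigma (l.*2 + k) u -> Sigma k (iter l opA u) /\
  forall phi, schwartz phi ->
    \int[leb]_x (reP (iter l opA u) x * phi x) = \int[leb]_x (reP u x * iter l Aop phi x) /\
    \int[leb]_x (imP (iter l opA u) x * phi x) = \int[leb]_x (imP u x * iter l Aop phi x).
Proof.
elim: l k => [|l IH] k /= Su; first by split.
have [|S1 P1] := IH k.+2; first by move: Su; rewrite doubleS !addSn !addnS.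
have [S2 P2] := opA_step S1; split => // phi sp.
have [-> ->] := P2 _ sp; have [-> ->] := P1 _ (schwartz_Aop sp).
by rewrite -iterSr.
Qed.

Lemma L2_measurable u : L2 u -> measurable_fun setT (reP u) /\ measurable_fun setT (imP u).
Proof. by move=> /L2_parts[[? _] [? _]]. Qed.

Lemma eq_L2_parts u v : eq_L2 u v <->
  {ae leb, forall x, reP u x = reP v x} /\ {ae leb, forall x, imP u x = imP v x}.
Proof.
split=> [uv|[h1 h2]].
  by split; apply: filterS uv => x; rewrite /reP /imP => ->.
by apply: filterS2 h1 h2 => x; exact: complex_eq.
Qed.

Lemma eq_L2_sym u v : eq_L2 u v -> eq_L2 v u.
Proof. by apply: filterS => x. Qed.

Lemma eq_L2_trans v u w : eq_L2 u v -> eq_L2 v w -> eq_L2 u w.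
Proof. by move=> h1 h2; apply: filterS2 h1 h2 => x ->. Qed.

(** The equality is exact: both functions have the same candidates for a weak derivative, hence the
    same chosen one. *)
Lemma weak_deriv_ae (a : 'I_d -> nat) u u' : L2 u -> L2 u' -> eq_L2 u u' ->
  weak_deriv a u = weak_deriv a u'.
Proof.
move=> /L2_measurable[mr mi] /L2_measurable[mr' mi'] /eq_L2_parts[er ei].
rewrite /weak_deriv; congr xget; apply/seteqP; split => v [Lv /wd_parts[h1 h2]];
  split => //; apply/wd_parts; split.
- exact: wdr_ae er h1.
- exact: wdr_ae ei h2.
- by apply: wdr_ae h1 => //; apply: filterS er => x ->.
- by apply: wdr_ae h2 => //; apply: filterS ei => x ->.
Qed.

Lemma SigR_ae k f f' : measurable_fun setT f' -> {ae leb, forall x, f x = f' x} ->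
  SigR k f -> SigR k f'.
Proof.
move=> mf' ff [Lf H]; split; first exact: L2r_ae ff Lf.
move=> s b sb; have [g [Lg fg bg]] := H s b sb; exists g; split => //.
by apply: wdr_ae ff fg => //; exact: Lf.1.
Qed.

Lemma Sigma_ae k u u' : L2 u' -> eq_L2 u u' -> Sigma k u -> Sigma k u'.
Proof.
move=> /L2_measurable[mr mi] /eq_L2_parts[er ei] /Sigma_parts[Sr Si].
by apply/Sigma_parts; split; [exact: SigR_ae er Sr|exact: SigR_ae ei Si].
Qed.

Lemma opA_ae u u' : L2 u -> L2 u' -> eq_L2 u u' -> eq_L2 (opA u) (opA u').
Proof.
move=> Lu Lu' uu; apply: filterS (uu) => x ux; rewrite /opA ux; congr (- _ + _).
by apply: eq_bigr => i _; rewrite (weak_deriv_ae _ Lu Lu' uu).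
Qed.

Lemma iterA_ae l u u' : Sigma l.*2 u -> L2 u' -> eq_L2 u u' ->
  eq_L2 (iter l opA u) (iter l opA u') /\ L2 (iter l opA u').
Proof.
move=> + Lu' uu; elim: l => [|l IH] Su //=.
have Su2 : Sigma (l.*2 + 2) u by move: Su; rewrite doubleS !addnS addn0.
have Su' : Sigma (l.*2 + 2) u' by apply: Sigma_ae Su2.
have [S2 _] := opA_iter Su2; have [S2' _] := opA_iter Su'.
have S0 : Sigma l.*2 u.
  have /Sigma_parts[a b] := Su2; apply/Sigma_parts; split.
    by apply: SigRW a; rewrite leq_addr.
  by apply: SigRW b; rewrite leq_addr.
have [e L] := IH S0.
split; first by apply: opA_ae => //; exact: S2.1.
by have [[]] := opA_step S2'.
Qed.

Lemma L2norm2E u : L2 u -> L2norm2 u = \int[leb]_x (reP u x ^+ 2) + \int[leb]_x (imP u x ^+ 2).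
Proof.
move=> /L2_parts[[mr r2] [mi i2]]; rewrite -IntD// /L2norm2 /inner /cintegral /=.
by apply: eq_Rintegral => x _; rewrite ReM Re_conj Im_conj mulrN opprK !expr2.
Qed.

Lemma L2_ae u u' : L2 u -> measurable_fun setT (reP u') -> measurable_fun setT (imP u') ->
  eq_L2 u u' -> L2 u'.
Proof.
move=> /L2_parts[Lr Li] mr mi /eq_L2_parts[er ei]; apply/L2_parts.
by split; [exact: L2r_ae er Lr|exact: L2r_ae ei Li].
Qed.

Lemma L2norm2_ae u u' : L2 u -> L2 u' -> eq_L2 u u' -> L2norm2 u = L2norm2 u'.
Proof.
move=> Lu Lu' /eq_L2_parts[er ei]; rewrite !L2norm2E//.
have [mr mi] := L2_measurable Lu; have [mr' mi'] := L2_measurable Lu'.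
by congr (_ + _); apply: Int_ae; try exact: measurable_funX;
  [apply: filterS er => x ->|apply: filterS ei => x ->].
Qed.

Lemma Sigma_L2 k u : Sigma k u -> L2 u.
Proof. by case. Qed.

Lemma SigmaW k l u : (k <= l)%N -> Sigma l u -> Sigma k u.
Proof.
by move=> kl /Sigma_parts[a b]; apply/Sigma_parts; split; [exact: SigRW a|exact: SigRW b].
Qed.

Lemma Sigma_coor k i u : Sigma k.+1 u -> Sigma k (fun x => (x 0 i)%:C * u x).
Proof.
move=> /Sigma_parts[a b]; apply/Sigma_parts; rewrite /reP /imP; split.
  by under eq_fun do rewrite Re_real_mul; exact: SigR_coor.
by under eq_fun do rewrite Im_real_mul; exact: SigR_coor.
Qed.

Lemma formA_ae u u' : Sigma 1 u -> L2 u' -> eq_L2 u u' -> formA u = formA u'.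
Proof.
move=> Su Lu' uu; rewrite /formA; apply: eq_bigr => i _.
rewrite (weak_deriv_ae _ (Sigma_L2 Su) Lu' uu); congr +%R.
have Su' := Sigma_ae Lu' uu Su.
apply: L2norm2_ae; [exact: Sigma_L2 (Sigma_coor i Su)|exact: Sigma_L2 (Sigma_coor i Su')|].
by apply: filterS uu => x ->.
Qed.

Lemma half_double_le k : (k./2.*2 <= k)%N.
Proof. by rewrite -[leqRHS]odd_double_half leq_addl. Qed.

Lemma Snorm2_ae k u u' : Sigma k u -> L2 u' -> eq_L2 u u' -> Snorm2 k u = Snorm2 k u'.
Proof.
move=> Su Lu' uu; have Su2 : Sigma k./2.*2 u by apply: SigmaW Su; exact: half_double_le.
have [e L] := iterA_ae Su2 Lu' uu; rewrite /Snorm2; case: ifP => ok.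
  apply: formA_ae => //.
  have Su1 : Sigma (k./2.*2 + 1) u by rewrite addnC -[1%N]/(true : nat) -ok odd_double_half.
  by have [] := opA_iter Su1.
apply: L2norm2_ae => //; have Su0 : Sigma (k./2.*2 + 0) u by rewrite addn0.
by have [/Sigma_L2] := opA_iter Su0.
Qed.

Definition schwartzC u := schwartz (reP u) /\ schwartz (imP u).

Definition AopC u : X -> R[i] := fun x => Aop (reP u) x +i* Aop (imP u) x.

Lemma schwartzC_Sigma k u : schwartzC u -> Sigma k u.
Proof. by move=> [a b]; apply/Sigma_parts; split; exact: schwartz_SigR. Qed.

Lemma iter_AopC l u : reP (iter l AopC u) = iter l Aop (reP u) /\
  imP (iter l AopC u) = iter l Aop (imP u).
Proof. by elim: l => //= l [e1 e2]; rewrite /AopC e1 e2. Qed.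

Lemma Aop_sym f g : schwartz f -> schwartz g ->
  \int[leb]_x (Aop f x * g x) = \int[leb]_x (f x * Aop g x).
Proof.
move=> sf sg; have := @opA_real_step 0 f (fun i => partial i (partial i f)) (schwartz_SigR 2 sf).
move=> /(_ (fun i => schwartz_L2r (schwartz_partial i (schwartz_partial i sf)))) h.
by have [_ /(_ g sg)] := h (fun i => @wdr_schwartz R d [:: i; i] f sf).
Qed.

Lemma Aop_sym_iter l f g : schwartz f -> schwartz g ->
  \int[leb]_x (iter l Aop f x * g x) = \int[leb]_x (f x * iter l Aop g x).
Proof.
move=> sf; elim: l g => [|l IH] g sg //=.
rewrite Aop_sym//; last exact: schwartz_iterA.
by rewrite IH; [rewrite -iterSr|exact: schwartz_Aop].
Qed.

(** Both sides have the same pairing with every Schwartz function, by duality on the left and by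
    symmetry of the pointwise operator on the right. *)
Lemma iterA_schwartz l u : schwartzC u -> eq_L2 (iter l opA u) (iter l AopC u).
Proof.
move=> [sr si]; have Su : Sigma (l.*2 + 0) u by exact: schwartzC_Sigma.
have [/Sigma_L2/L2_parts[Lr Li] P] := opA_iter Su.
have [e1 e2] := iter_AopC l u; apply/eq_L2_parts; rewrite e1 e2; split.
  apply: schwartz_uniq => //; first exact/schwartz_L2r/schwartz_iterA.
  by move=> phi sp; have [-> _] := P phi sp; rewrite Aop_sym_iter.
apply: schwartz_uniq => //; first exact/schwartz_L2r/schwartz_iterA.
by move=> phi sp; have [_ ->] := P phi sp; rewrite Aop_sym_iter.
Qed.

(** The counterpart of [Snorm2] for real Schwartz functions, with classical derivatives; by [NrE] it
    is the pairing of f with A^k f for both parities of [k]. *)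
Definition Nr k f : R := let w := iter k./2 Aop f in
  if odd k then \sum_i (\int[leb]_x (partial i w x ^+ 2) + \int[leb]_x ((x 0 i * w x) ^+ 2))
  else \int[leb]_x (w x ^+ 2).

Lemma schwartzC_L2 u : schwartzC u -> L2 u.
Proof. by move/(schwartzC_Sigma 0)/Sigma_L2. Qed.

Lemma formA_schwartz u : schwartzC u -> formA u =
  \sum_i (\int[leb]_x (partial i (reP u) x ^+ 2) + \int[leb]_x ((x 0 i * reP u x) ^+ 2)) +
  \sum_i (\int[leb]_x (partial i (imP u) x ^+ 2) + \int[leb]_x ((x 0 i * imP u x) ^+ 2)).
Proof.
move=> su; have [sr si] := su; rewrite -big_split; apply: eq_bigr => i _ /=.
have Su : Sigma 1 u by exact: schwartzC_Sigma.
have [|Lw /wd_parts[w1 w2]] := @weak_deriv_spec (mdelta i 1) u 1 Su; first by rewrite size_mdelta.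
have w1' := wdr_perm (mword_delta i 1) w1; have w2' := wdr_perm (mword_delta i 1) w2.
have /L2_parts[Lr Li] := Lw.
rewrite addrACA; congr (_ + _).
  rewrite L2norm2E//; congr (_ + _); apply: Int_ae.
  - by apply: measurable_funX; exact: Lr.1.
  - by apply: measurable_funX; apply: schwartz_measurable; exact: schwartz_partial.
  - have := wdr_uniq Lr (schwartz_L2r (schwartz_partial i sr)) w1' (@wdr_schwartz R d [:: i] _ sr).
    by apply: filterS => x ->.
  - by apply: measurable_funX; exact: Li.1.
  - by apply: measurable_funX; apply: schwartz_measurable; exact: schwartz_partial.
  - have := wdr_uniq Li (schwartz_L2r (schwartz_partial i si)) w2' (@wdr_schwartz R d [:: i] _ si).
    by apply: filterS => x ->.
rewrite L2norm2E; last exact: Sigma_L2 (Sigma_coor i Su).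
by rewrite /reP /imP; congr (_ + _); apply: eq_Rintegral => x _; rewrite ?Re_real_mul ?Im_real_mul.
Qed.

Lemma Snorm2_schwartz k u : schwartzC u -> Snorm2 k u = Nr k (reP u) + Nr k (imP u).
Proof.
move=> su; have [sr si] := su; have e := iterA_schwartz k./2 su.
have [e1 e2] := iter_AopC k./2 u.
have sw : schwartzC (iter k./2 AopC u).
  by split; rewrite ?e1 ?e2; exact: schwartz_iterA.
rewrite /Snorm2 /Nr; case: ifP => _.
  rewrite (formA_ae _ _ e); last exact: schwartzC_L2.
    by rewrite formA_schwartz// e1 e2.
  have [] := @opA_iter k./2 1 u; first exact: schwartzC_Sigma.
  by [].
rewrite (L2norm2_ae _ _ e); last exact: schwartzC_L2.
  by rewrite L2norm2E ?e1 ?e2//; exact: schwartzC_L2.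
have [/Sigma_L2] := @opA_iter k./2 0 u (schwartzC_Sigma _ su).
by [].
Qed.

End complex_sobolev.

(** * Hermite functions *)

Section hermite_1d.
Context {R : realType}.
Local Notation mu := (@lebesgue_measure R).
Implicit Types (p q : {poly R}) (x t : R) (m n : nat).

Local Notation gau x := (expR (- (x ^+ 2 / 2))).

Definition pgauss p x : R := p.[x] * gau x.

Lemma pgauss_is_derive p x : is_derive x (1 : R) (pgauss p) (pgauss (p^`() - 'X * p) x).
Proof.
have d0 : is_derive x (1 : R) (fun y : R => - (y ^+ 2 / 2)) (- x).
  have h := is_derive_poly ((- 2^-1)%:P * 'X * 'X : {poly R}) x.
  have e : ((- 2^-1)%:P * 'X * 'X : {poly R})^`().[x] = - x.
    by rewrite !(derivM, derivC, derivX, hornerE); field.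
  rewrite e in h; rewrite (_ : (fun y => _) = horner ((- 2^-1)%:P * 'X * 'X : {poly R}))//.
  by apply/funext => y; rewrite !hornerE; field.
have d1 : is_derive x (1 : R) (fun y : R => gau y) (gau x * - x).
  exact: (@is_derive1_comp R expR (fun y => - (y ^+ 2 / 2)) x _ _ (is_derive_expR _) d0).
have [e1 e2] := is_deriveM (is_derive_poly p x) d1; split; first exact: e1.
rewrite [LHS]e2 /pgauss !hornerE -![_ *: _]/(_ * _).
by move: (expR _) (p.[x]) (p^`().[x]) => a b c; ring.
Qed.

Lemma pgauss_bound p (k : nat) : exists C, forall x, `|pgauss p x| <= C * ((1 + x ^+ 2)^-1) ^+ k.
Proof.
(* The factor (1 + x^2)^k is put into the polynomial before it is bounded by C exp |x|; then |x| -
   x^2/2 <= 1. *)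
have [C C0 hC] := poly_le_expR (p * (1 + 'X^2) ^+ k); exists (C * expR 1) => x.
have x2 : 0 < 1 + x ^+ 2 by rewrite ltr_wpDr// sqr_ge0.
have pE : p.[x] = (p * (1 + 'X^2) ^+ k).[x] * ((1 + x ^+ 2)^-1) ^+ k.
  rewrite hornerM horner_exp hornerD hornerXn hornerC -mulrA -exprMn mulfV ?gt_eqF//.
  by rewrite expr1n mulr1.
rewrite /pgauss pE mulrAC normrM (ger0_norm (_ : 0 <= _ ^+ k)); last first.
  by rewrite exprn_ge0// invr_ge0 ltW.
apply: ler_wpM2r; first by rewrite exprn_ge0// invr_ge0 ltW.
rewrite normrM (ger0_norm (expR_ge0 _)).
rewrite (le_trans (ler_wpM2r (expR_ge0 _) (hC x)))// -mulrA ler_wpM2l// -expRD ler_expR.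
by rewrite -(real_normK (num_real x)); move: `|x| => t; nra.
Qed.

Lemma continuous_pgauss p : continuous (pgauss p).
Proof. exact: is_derive_continuous1 (pgauss_is_derive p). Qed.

Lemma pgaussM_bound p q : exists C, forall x, `|pgauss p x * pgauss q x| <= C * (1 + x ^+ 2)^-1.
Proof.
have [C hC] := pgauss_bound p 1; have [D hD] := pgauss_bound q 0; exists (C * D) => x.
rewrite normrM mulrAC; have := hC x; have := hD x; rewrite expr0 mulr1 expr1 => h1 h2.
by apply: ler_pM => //; exact: normr_ge0.
Qed.

Lemma rint_pgaussM p q : rint mu (fun x => pgauss p x * pgauss q x).
Proof.
have [C hC] := pgaussM_bound p q; apply: rint_le (rintZ C rint_inv1px2) => //.
by apply: continuous_measurable_fun; apply: continuous_mul; exact: continuous_pgauss.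
Qed.

Lemma pgauss_by_parts p q :
  \int[mu]_x (pgauss (p^`() - 'X * p) x * pgauss q x) =
  - \int[mu]_x (pgauss p x * pgauss (q^`() - 'X * q) x).
Proof.
have [C hC] := pgaussM_bound p q.
have [D1 hD1] := pgaussM_bound (p^`() - 'X * p) q.
have [D2 hD2] := pgaussM_bound p (q^`() - 'X * q).
pose g x := pgauss (p^`() - 'X * p) x * pgauss q x + pgauss p x * pgauss (q^`() - 'X * q) x.
have i1px x : 0 <= (1 + x ^+ 2 : R)^-1 by rewrite ltW// inv1px2_gt0.
have C0 : 0 <= C by have := le_trans (normr_ge0 _) (hC 0); rewrite expr0n /= addr0 invr1 mulr1.
have D10 : 0 <= D1 by have := le_trans (normr_ge0 _) (hD1 0); rewrite expr0n /= addr0 invr1 mulr1.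
have D20 : 0 <= D2 by have := le_trans (normr_ge0 _) (hD2 0); rewrite expr0n /= addr0 invr1 mulr1.
have h : \int[mu]_x g x = 0.
  apply: (@int_derivative_eq0 R (fun x => pgauss p x * pgauss q x) g (C + D1 + D2)).
  - move=> x; have [e1 e2] := is_deriveM (pgauss_is_derive p x) (pgauss_is_derive q x).
    split; first exact: e1.
    rewrite [LHS]e2 /g -![_ *: _]/(_ * _) addrC; congr (_ + _); exact: mulrC.
  - by apply: continuous_add; apply: continuous_mul; exact: continuous_pgauss.
  - by move=> x; rewrite (le_trans (hC x))// ler_wpM2r//; lra.
  - move=> x; rewrite (le_trans (ler_normD _ _))// !mulrDl -addrA.
    by rewrite (le_trans (lerD (hD1 x) (hD2 x)))// lerDr mulr_ge0.
by move: h; rewrite IntD; [move/eqP; rewrite addr_eq0 => /eqP|exact: rint_pgaussM|exact: rint_pgaussM].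
Qed.

Local Notation H := (@hermite_poly R).

Lemma hermite_polyS m : H m.+1 = 2%:P * 'X * H m - (H m)^`().
Proof. by []. Qed.

Lemma deriv_hermite_poly m : (H m)^`() = (2 * m)%:R%:P * H m.-1.
Proof.
elim: m => [|m IH]; first by rewrite [H 0]/= derivC mul0r.
case: m IH => [|m] IH.
  rewrite hermite_polyS derivB !derivM !derivC derivX [H 0]/=.
  by rewrite mul0r add0r !mulr1 mulr0 addr0 subr0.
rewrite hermite_polyS derivB !derivM !derivC derivX mul0r add0r mulr1 IH.
rewrite derivM derivC mul0r add0r [m.+1.-1]/= [m.+2.-1]/= (hermite_polyS m).
rewrite (_ : (2 * m.+2 = 2 + 2 * m.+1)%N); last by rewrite mulnS.
rewrite (natrD _ 2 (2 * m.+1)) (polyCD _ (2 * m.+1)%:R).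
by move: (H m) (H m)^`() ((2 * m.+1)%:R%:P) (2%:P) => a b c e; ring.
Qed.

Lemma hermite_polyS_eval m x : (H m.+1).[x] = 2 * x * (H m).[x] - (H m)^`().[x].
Proof. by rewrite hermite_polyS hornerD hornerN !hornerM hornerC hornerX. Qed.

Lemma deriv_hermite_eval m x : (H m)^`().[x] = (2 * m)%:R * (H m.-1).[x].
Proof. by rewrite deriv_hermite_poly hornerM hornerC. Qed.

Definition hnorm m : R := (Num.sqrt (2 ^+ m * m`!%:R * Num.sqrt pi))^-1.

(** Ladder coefficients: x e_m = hs m e_(m-1) + hs (m+1) e_(m+1), and the derivative of e_m has a
    minus sign before the second term. Since [hs 0] = 0, the conventional value [0.-1] = 0 does no
    harm. *)
Definition hs m : R := Num.sqrt (m%:R / 2).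

Lemma hs_sqr m : hs m ^+ 2 = m%:R / 2.
Proof. by rewrite sqr_sqrtr// divr_ge0. Qed.

Lemma hs0 : hs 0 = 0.
Proof. by rewrite /hs mul0r sqrtr0. Qed.

Lemma hs_gt0 m : 0 < hs m.+1.
Proof. by rewrite sqrtr_gt0 divr_gt0. Qed.

Lemma hermiteE m : hermite m = pgauss ((hnorm m)%:P * H m).
Proof. by apply/funext => x; rewrite /hermite /pgauss hornerM hornerC. Qed.

Lemma hnormS m : hnorm m = 2 * hs m.+1 * hnorm m.+1.
Proof.
have p0 : 0 < Num.sqrt pi :> R by rewrite sqrtr_gt0 pi_gt0.
have a0 : 0 < 2 ^+ m * m`!%:R * Num.sqrt pi :> R.
  by rewrite !mulr_gt0// ?exprn_gt0// ltr0n fact_gt0.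
have b0 : 0 < 2 * m.+1%:R :> R by rewrite mulr_gt0.
have e : 2 * hs m.+1 = Num.sqrt (2 * m.+1%:R).
  rewrite /hs -[X in X * _](ger0_norm (ler0n _ 2)) -sqrtr_sqr -sqrtrM ?sqr_ge0//.
  by congr Num.sqrt; field.
rewrite e /hnorm (_ : 2 ^+ m.+1 * _ * _ = (2 * m.+1%:R) * (2 ^+ m * m`!%:R * Num.sqrt pi)); last first.
  by rewrite factS natrM exprS; ring.
rewrite (sqrtrM _ (ltW b0)).
have s0 : Num.sqrt (2 * m.+1%:R : R) != 0 by rewrite gt_eqF// sqrtr_gt0.
move: (Num.sqrt (2 * _)) s0 (Num.sqrt _) => a ha b.
by rewrite invfM mulrA mulfV// mul1r.
Qed.

Lemma hermite_X m x : x * hermite m x = hs m * hermite m.-1 x + hs m.+1 * hermite m.+1 x.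
Proof.
rewrite !hermiteE /pgauss !hornerM !hornerC hermite_polyS_eval deriv_hermite_eval.
case: m => [|m].
  by rewrite hs0 muln0 /= (hnormS 0); move: (expR _) (H 0).[x] (hnorm _) (hs _) => a b c e; ring.
have s2 := hs_sqr m.+1; rewrite (hnormS m.+1) [m.+1.-1]/= (hnormS m).
rewrite natrM (_ : m.+1%:R = 2 * hs m.+1 ^+ 2); last by rewrite s2; field.
rewrite (hnormS m.+1).
move: (expR _) (H m.+1).[x] (H m).[x] (hnorm _) (hs m.+1) (hs _) => a b c e f g; ring.
Qed.

Definition dhermite m x : R := hs m * hermite m.-1 x - hs m.+1 * hermite m.+1 x.

Lemma dhermiteE m : dhermite m = pgauss (((hnorm m)%:P * H m)^`() - 'X * ((hnorm m)%:P * H m)).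
Proof.
apply/funext => x; have := hermite_X m x; rewrite /dhermite.
have F : hs m.+1 * hermite m.+1 x = (x * hermite m x) - (hnorm m / 2) * (H m)^`().[x] * gau x.
  rewrite !hermiteE /pgauss !hornerM !hornerC hermite_polyS_eval (hnormS m).
  by move: (expR _) (H m).[x] (H m)^`().[x] (hnorm _) (hs _) => a b c e f; field.
move=> X1; have -> : hs m * hermite m.-1 x = x * hermite m x - hs m.+1 * hermite m.+1 x by rewrite X1; ring.
rewrite F /pgauss derivM derivC mul0r add0r hornerD hornerN !hornerM hornerX hornerC hermiteE /pgauss hornerM hornerC.
by move: (expR _) (H m).[x] (H m)^`().[x] (hnorm _) => a b c e; field.
Qed.

Lemma hermite_is_derive m x : is_derive x (1 : R) (hermite m) (dhermite m x).
Proof. by rewrite hermiteE dhermiteE; exact: pgauss_is_derive. Qed.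

Lemma rint_hermiteM m n : rint mu (fun x => hermite m x * hermite n x).
Proof. by rewrite !hermiteE; exact: rint_pgaussM. Qed.

Lemma hermite_by_parts m n : \int[mu]_x (dhermite m x * hermite n x) =
  - \int[mu]_x (hermite m x * dhermite n x).
Proof. by rewrite !dhermiteE !hermiteE; exact: pgauss_by_parts. Qed.

Lemma rint_xhermiteM m n : rint mu (fun x => x * hermite m x * hermite n x).
Proof.
have := rintD (rintZ (hs m) (rint_hermiteM m.-1 n)) (rintZ (hs m.+1) (rint_hermiteM m.+1 n)).
congr (rint _ _); apply/funext => x; rewrite hermite_X.
move: (hermite _ x) (hermite _ x) (hermite _ x) => a b c; ring.
Qed.

Lemma rint_dhermiteM m n : rint mu (fun x => dhermite m x * hermite n x).
Proof. by rewrite !dhermiteE !hermiteE; exact: rint_pgaussM. Qed.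

(** The raising operator (x - d/dx)/2 sends e_n to hs (n+1) e_(n+1), and its adjoint (x + d/dx)/2
    sends e_m to hs m e_(m-1); integration by parts exchanges them. *)
Lemma hermite_ladder m n : hs n.+1 * \int[mu]_x (hermite m x * hermite n.+1 x) =
  hs m * \int[mu]_x (hermite m.-1 x * hermite n x).
Proof.
have e1 : hs n.+1 * \int[mu]_x (hermite m x * hermite n.+1 x) =
    2^-1 * (\int[mu]_x (x * hermite n x * hermite m x) - \int[mu]_x (dhermite n x * hermite m x)).
  rewrite -IntB; [|exact: rint_xhermiteM|exact: rint_dhermiteM].
  rewrite -IntZ; last exact: rint_hermiteM.
  rewrite -IntZ; last exact: rintB (rint_xhermiteM n m) (rint_dhermiteM n m).
  by apply: eq_Rintegral => x _; rewrite /dhermite hermite_X; field.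
rewrite e1 hermite_by_parts opprK.
have -> : \int[mu]_x (hermite n x * dhermite m x) = \int[mu]_x (dhermite m x * hermite n x).
  by apply: eq_Rintegral => x _; rewrite mulrC.
have -> : \int[mu]_x (x * hermite n x * hermite m x) = \int[mu]_x (x * hermite m x * hermite n x).
  by apply: eq_Rintegral => x _; rewrite mulrAC.
rewrite -IntD; [|exact: rint_xhermiteM|exact: rint_dhermiteM].
rewrite -(IntZ 2^-1 (rintD (rint_xhermiteM m n) (rint_dhermiteM m n))).
rewrite -IntZ; last exact: rint_hermiteM.
by apply: eq_Rintegral => x _; rewrite /dhermite hermite_X; field.
Qed.

Lemma hermite00 : \int[mu]_x (hermite 0 x * hermite 0 x) = 1.
Proof.
have p0 : 0 < Num.sqrt pi :> R by rewrite sqrtr_gt0 pi_gt0.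
have E x : hermite 0 x * hermite 0 x = (Num.sqrt pi)^-1 * gauss_fun x.
  rewrite /hermite /= expr0 fact0 !mul1r hornerC mulr1 /gauss_fun mulrACA -expRD.
  congr (_ * expR _); last by field.
  by rewrite -invfM -expr2 sqr_sqrtr// ltW.
under eq_Rintegral do rewrite E.
rewrite IntZ; last exact: integrableT_gauss.
by rewrite /Rintegral integralT_gauss /= mulVf// gt_eqF.
Qed.

(** [hermite_ladder] lowers both indices by one, and [hs 0] = 0 disposes of the pairs where only one
    index is 0. The single integral to compute is the Gaussian one for e_0. *)
Lemma hermite_ortho m n : \int[mu]_x (hermite m x * hermite n x) = (m == n)%:R.
Proof.
elim: n m => [|n IH] m.
  case: m => [|m]; first exact: hermite00.
  have := hermite_ladder 0 m; rewrite hs0 mul0r => /eqP.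
  rewrite mulf_eq0 gt_eqF ?hs_gt0//= => /eqP h.
  by rewrite -[RHS]h; apply: eq_Rintegral => x _; rewrite mulrC.
have sn := hs_gt0 n; apply: (mulfI (lt0r_neq0 sn)); rewrite hermite_ladder.
case: m => [|m]; first by rewrite hs0 mul0r mulr0.
rewrite IH eqSS; have [->//|mn] := eqVneq m n.
by rewrite !mulr0.
Qed.

End hermite_1d.

(** * Tensor products of Hermite functions *)

Section hermite_nd.
Context {R : realType} {d : nat}.
Local Notation X := 'rV[R]_d.
Local Notation leb := (@lebesgue_rV R d).
Local Notation e_ i := (delta_mx 0 i : X).
Local Notation idx := ('I_d -> nat).
Implicit Types (f g phi : X -> R) (i j : 'I_d) (m : idx).

Lemma tens_at (g : 'I_d -> R -> R) i (x : X) :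
  tens g x = g i (x 0 i) * \prod_(j < d | j != i) g j (x 0 j).
Proof. by rewrite /tens (bigD1 i). Qed.

Lemma tens_is_derive (g : 'I_d -> R -> R) i (x : X) dg :
  is_derive (x 0 i) (1 : R) (g i) dg ->
  is_derive x (e_ i) (tens g) (dg * \prod_(j < d | j != i) g j (x 0 j)).
Proof.
move=> dgi; apply: is_derive_line; set c := \prod_(j < d | _) _.
rewrite (_ : (fun t => _) = fun t : R => c * g i (t + x 0 i)); last first.
  apply/funext => t; rewrite (tens_at _ i) mulrC !mxE !eqxx mulr1; congr (_ * _).
  by apply: eq_bigr => j /negbTE ji; rewrite !mxE ji andbF mulr0 add0r.
have d1 : is_derive (0 : R) (1 : R) (fun t : R => g i (t + x 0 i)) dg.
  apply: (@is_derive_shift _ _ _ _ (fun t : R => t + x 0 i) 1 0 1); last by rewrite add0r.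
  by move=> h; rewrite addrA.
by have := is_deriveZ c d1; rewrite -[c *: dg]/(c * dg) mulrC.
Qed.

Lemma schwartz_pgauss (p : 'I_d -> {poly R}) : schwartz (tens (fun i => pgauss (p i)) : X -> R).
Proof.
apply: (schwartz_coind (Q := fun f => exists p, f = tens (fun i => pgauss (p i)))); last by exists p.
move=> _ {p}[p ->]; split.
- by apply: continuous_tens => i; exact: continuous_pgauss.
- move=> k; pose C i := projT1 (cid (pgauss_bound (p i) k)).
  have CP i (t : R) : `|pgauss (p i) t| <= C i * ((1 + t ^+ 2)^-1) ^+ k.
    by rewrite /C; case: cid => /= c; apply.
  exists (\prod_i C i) => x; rewrite /tens normr_prod /wt /tens -prodrXl -big_split /=.
  by apply: ler_prod => i _; rewrite normr_ge0 CP.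
- by move=> i x; have [] := @tens_is_derive (fun i => pgauss (p i)) i x _ (pgauss_is_derive (p i) (x 0 i)).
move=> i; exists (fun j => if j == i then (p i)^`() - 'X * p i else p j).
apply/funext => x; apply: partial_is_derive.
rewrite (tens_at _ i) eqxx (eq_bigr (fun j => pgauss (p j) (x 0 j))); last first.
  by move=> j /negbTE ->.
exact: (@tens_is_derive (fun i => pgauss (p i)) i x _ (pgauss_is_derive (p i) (x 0 i))).
Qed.

Definition hT m : X -> R := tens (fun i => hermite (m i)).

Definition upd m i n : idx := fun j => if j == i then n else m j.

Lemma schwartz_hT m : schwartz (hT m).
Proof.
rewrite /hT (_ : (fun i => _) = fun i => pgauss ((hnorm (m i))%:P * hermite_poly (m i))).
  exact: schwartz_pgauss.
by apply/funext => i; exact: hermiteE.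
Qed.

Lemma hT_upd m i n (x : X) : hT (upd m i n) x =
  hermite n (x 0 i) * \prod_(j < d | j != i) hermite (m j) (x 0 j).
Proof.
rewrite /hT (tens_at _ i) /upd eqxx; congr (_ * _).
by apply: eq_bigr => j /negbTE ->.
Qed.

Lemma hT_X m i (x : X) : x 0 i * hT m x =
  hs (m i) * hT (upd m i (m i).-1) x + hs (m i).+1 * hT (upd m i (m i).+1) x.
Proof.
by rewrite !hT_upd /hT (tens_at _ i) mulrA hermite_X mulrDl !mulrA.
Qed.

Lemma hT_partial m i : partial i (hT m) = fun x =>
  hs (m i) * hT (upd m i (m i).-1) x - hs (m i).+1 * hT (upd m i (m i).+1) x.
Proof.
apply/funext => x; apply: partial_is_derive; rewrite !hT_upd.
set q := \prod_(j < d | _) _.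
have -> : hs (m i) * (hermite (m i).-1 (x 0 i) * q) - hs (m i).+1 * (hermite (m i).+1 (x 0 i) * q) =
    dhermite (m i) (x 0 i) * q.
  by rewrite /dhermite; move: (hermite _ _) (hermite _ _) => a b; ring.
exact: (@tens_is_derive (fun i => hermite (m i)) i x _ (hermite_is_derive (m i) (x 0 i))).
Qed.

Lemma upd_upd m i a b : upd (upd m i a) i b = upd m i b.
Proof. by apply/funext => j; rewrite /upd; case: eqP. Qed.

Lemma upd_id m i : upd m i (m i) = m.
Proof. by apply/funext => j; rewrite /upd; case: eqP => [->|]. Qed.

Lemma upd_at m i n : upd m i n i = n.
Proof. by rewrite /upd eqxx. Qed.

Definition lam m : R := \sum_i (2 * m i + 1)%:R.

(** Two ladder steps in each term: between x_i^2 and the second derivative the components at m_i - 2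
    and m_i + 2 cancel, while the diagonal ones add up to 2 (m_i/2) + 2 ((m_i + 1)/2). *)
Lemma hT_osc m i (x : X) : - partial i (partial i (hT m)) x + x 0 i * (x 0 i * hT m x) =
  (2 * m i + 1)%:R * hT m x.
Proof.
have P : partial i (partial i (hT m)) x =
    hs (m i) * partial i (hT (upd m i (m i).-1)) x - hs (m i).+1 * partial i (hT (upd m i (m i).+1)) x.
  rewrite (hT_partial m i); under eq_fun do rewrite -mulNr.
  rewrite schwartz_partialD; [|exact/schwartzZ/schwartz_hT|exact/schwartzZ/schwartz_hT].
  rewrite !schwartz_partialZ; [|exact: schwartz_hT|exact: schwartz_hT].
  by rewrite mulNr.
rewrite P hT_X mulrDr !(mulrCA (x 0 i)) !hT_X !hT_partial !upd_at !upd_upd.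
have F : hs (m i) * (hs (m i).-1.+1 * hT (upd m i (m i).-1.+1) x) = (m i)%:R / 2 * hT m x :> R.
  have [->|m0] := posnP (m i); first by rewrite hs0 !mul0r.
  by rewrite prednK// mulrA -expr2 hs_sqr upd_id.
have G : hs (m i).+1 * (hs (m i).+1 * hT (upd m i (m i)) x) = (m i).+1%:R / 2 * hT m x :> R.
  by rewrite mulrA -expr2 hs_sqr upd_id.
have e1 : (2 * m i + 1)%:R = 2 * (m i)%:R + 1 :> R by rewrite natrD natrM.
have e2 : (m i).+1%:R = (m i)%:R + 1 :> R by rewrite -natr1.
move: F G; rewrite /= e1 e2.
move: (hT (upd m i (m i).-1.+1) x) (hT (upd m i (m i)) x) (hs (m i)) (hs (m i).-1.+1) (hs (m i).+1) => a b s s1 s2 F G.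
move: (hs _) (hs _) (hT (upd m i _) x) (hT (upd m i _) x) => u v y z.
apply: (@eq_trans _ _ (2 * (s * (s1 * a)) + 2 * (s2 * (s2 * b)))); first by ring.
by rewrite F G; field.
Qed.

Lemma Aop_hT m : Aop (hT m) = fun x => lam m * hT m x.
Proof.
rewrite AopE; apply/funext => x; rewrite /lam mulr_suml; apply: eq_bigr => i _.
exact: hT_osc.
Qed.

Lemma rint_hTM m m' : rint leb (fun x => hT m x * hT m' x).
Proof. by apply: schwartz_rint; apply: schwartzM; exact: schwartz_hT. Qed.

Lemma hT_ortho m m' : \int[leb]_x (hT m x * hT m' x) = \prod_i (m i == m' i)%:R.
Proof.
rewrite (_ : (fun x => _) = tens (fun i t => hermite (m i) t * hermite (m' i) t)).
  have [_ ->] := @tens_int R d (fun i t => hermite (m i) t * hermite (m' i) t) (fun i => rint_hermiteM (m i) (m' i)).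
  by apply: eq_bigr => i _; exact: hermite_ortho.
by apply/funext => x; rewrite /hT /tens -big_split.
Qed.

Section box_expansion.
Variable K : nat.
Local Notation I := {ffun 'I_d -> 'I_K}.
Implicit Types (c : I -> R) (n : I).

Definition vidx n : idx := fun i => n i.

Definition hexp c : X -> R := fun x => \sum_n c n * hT (vidx n) x.

Lemma box_ortho n n' : \int[leb]_x (hT (vidx n) x * hT (vidx n') x) = (n == n')%:R.
Proof.
rewrite hT_ortho; have [->|nn'] := eqVneq n n'; first by rewrite big1// => i _; rewrite eqxx.
have [i ni] : exists i, n i != n' i.
  by apply/existsP; apply: contraR nn' => /existsPn h; apply/eqP/ffunP => i; apply/eqP; have := h i; rewrite negbK.
by rewrite (bigD1 i)//= (_ : vidx n i == vidx n' i = false) ?mul0r//; apply/negbTE.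
Qed.

Lemma schwartz_hexp c : schwartz (hexp c).
Proof. by apply: schwartz_sum => n _; apply: schwartzZ; exact: schwartz_hT. Qed.

Lemma hexp_coef c n : \int[leb]_x (hexp c x * hT (vidx n) x) = c n.
Proof.
under eq_Rintegral do rewrite /hexp mulr_suml.
rewrite Int_sum; last first.
  move=> n' _; apply: schwartz_rint; apply: schwartzM; last exact: schwartz_hT.
  by apply: schwartzZ; exact: schwartz_hT.
rewrite (bigD1 n)//= big1 ?addr0.
  under eq_Rintegral do rewrite -mulrA.
  by rewrite IntZ ?box_ortho ?eqxx ?mulr1//; exact: rint_hTM.
move=> n' nn'; under eq_Rintegral do rewrite -mulrA.
by rewrite IntZ ?box_ortho ?(negbTE nn') ?mulr0//; exact: rint_hTM.
Qed.

Lemma hexp_pair f c : L2r f ->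
  \int[leb]_x (f x * hexp c x) = \sum_n c n * \int[leb]_x (f x * hT (vidx n) x).
Proof.
move=> Lf; under eq_Rintegral do rewrite /hexp mulr_sumr.
rewrite Int_sum; last first.
  move=> n' _; apply: L2rM_schwartz => //.
  by apply: schwartzZ; exact: schwartz_hT.
apply: eq_bigr => n _; under eq_Rintegral do rewrite mulrCA.
by rewrite IntZ//; apply: L2rM_schwartz => //; exact: schwartz_hT.
Qed.

Lemma hexp_dot c c' : \int[leb]_x (hexp c x * hexp c' x) = \sum_n c n * c' n.
Proof.
rewrite hexp_pair; last exact/schwartz_L2r/schwartz_hexp.
by apply: eq_bigr => n _; rewrite hexp_coef mulrC.
Qed.

Lemma Aop_sum (T : Type) (r : seq T) (F : T -> X -> R) : (forall t, schwartz (F t)) ->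
  Aop (fun x => \sum_(t <- r) F t x) = fun x => \sum_(t <- r) Aop (F t) x.
Proof.
move=> sF; apply/funext => x; rewrite AopE.
under [RHS]eq_bigr do rewrite AopE.
rewrite exchange_big /=; apply: eq_bigr => i _.
rewrite big_split /= sumrN; congr (- _ + _); last by rewrite !mulr_sumr.
rewrite schwartz_partial_sum//.
by rewrite schwartz_partial_sum// => t _; exact: schwartz_partial.
Qed.

Lemma AopZ (a : R) f : schwartz f -> Aop (fun x => a * f x) = fun x => a * Aop f x.
Proof.
move=> sf; apply/funext => x; rewrite !AopE mulr_sumr; apply: eq_bigr => i _.
rewrite !schwartz_partialZ//; last exact: schwartz_partial.
by move: (partial _ _ _) => p; ring.
Qed.

Lemma Aop_hexp c : Aop (hexp c) = hexp (fun n => lam (vidx n) * c n).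
Proof.
rewrite /hexp Aop_sum; last by move=> n; apply: schwartzZ; exact: schwartz_hT.
apply/funext => x; apply: eq_bigr => n _; rewrite AopZ; last exact: schwartz_hT.
by rewrite Aop_hT mulrA (mulrC (c n)).
Qed.

Lemma iterA_hexp l c : iter l Aop (hexp c) = hexp (fun n => lam (vidx n) ^+ l * c n).
Proof.
elim: l => [|l IH] /=.
  by congr hexp; apply/funext => n; rewrite expr0 mul1r.
by rewrite IH Aop_hexp; congr hexp; apply/funext => n; rewrite exprS mulrA.
Qed.

Lemma form_Aop f : schwartz f ->
  \sum_i (\int[leb]_x (partial i f x ^+ 2) + \int[leb]_x ((x 0 i * f x) ^+ 2)) =
  \int[leb]_x (f x * Aop f x).
Proof.
move=> sf; have sp i := schwartz_partial i sf; have sx i := schwartz_coor i sf.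
rewrite AopE; under [RHS]eq_Rintegral do rewrite mulr_sumr.
rewrite Int_sum; last first.
  move=> i _; apply/schwartz_rint/schwartzM => //; apply: schwartzD.
    by apply: schwartzN; exact: schwartz_partial.
  exact: schwartz_coor.
apply: eq_bigr => i _; under [RHS]eq_Rintegral do rewrite mulrDr.
rewrite IntD; last 2 first.
- by apply/schwartz_rint/schwartzM => //; apply: schwartzN; exact: schwartz_partial.
- by apply/schwartz_rint/schwartzM => //; exact: schwartz_coor.
congr (_ + _); last by apply: eq_Rintegral => x _; ring.
under eq_Rintegral do rewrite expr2.
rewrite int_by_parts// -IntN; last by apply/schwartz_rint/schwartzM => //; exact: schwartz_partial.
by apply: eq_Rintegral => x _; rewrite mulrN.
Qed.

Lemma NrE k f : schwartz f -> Nr k f = \int[leb]_x (f x * iter k Aop f x).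
Proof.
move=> sf; rewrite /Nr; case: ifP => ok.
  have sw := schwartz_iterA k./2 sf; rewrite form_Aop// -iterS Aop_sym_iter//; last exact: schwartz_iterA.
  by rewrite -iterD addnS addnn -[in RHS](odd_double_half k) ok.
under eq_Rintegral do rewrite expr2.
rewrite Aop_sym_iter//; last exact: schwartz_iterA.
by rewrite -iterD addnn -[in RHS](odd_double_half k) ok.
Qed.

Lemma Nr_hexp k c : Nr k (hexp c) = \sum_n lam (vidx n) ^+ k * c n ^+ 2.
Proof.
rewrite NrE; last exact: schwartz_hexp.
by rewrite iterA_hexp hexp_dot; apply: eq_bigr => n _; rewrite mulrCA expr2.
Qed.

Lemma lam_ge0 m : 0 <= lam m.
Proof. by apply: sumr_ge0. Qed.

Lemma bessel0 f : L2r f ->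
  \sum_n (\int[leb]_x (f x * hT (vidx n) x)) ^+ 2 <= \int[leb]_x (f x ^+ 2).
Proof.
move=> Lf; pose c n := \int[leb]_x (f x * hT (vidx n) x).
have Lp := schwartz_L2r (schwartz_hexp c).
have : 0 <= \int[leb]_x ((f x - hexp c x) ^+ 2) by apply: Int_ge0 => x; exact: sqr_ge0.
have -> : \int[leb]_x ((f x - hexp c x) ^+ 2) =
    \int[leb]_x (f x ^+ 2) - 2 * \int[leb]_x (f x * hexp c x) + \int[leb]_x (hexp c x * hexp c x).
  rewrite -IntZ; last exact: L2r_rintM.
  rewrite -IntB; [|exact: Lf.2|by apply: rintZ; exact: L2r_rintM].
  rewrite -IntD; last exact: L2r_rintM.
    by apply: eq_Rintegral => x _; ring.
  by apply: rintB; [exact: Lf.2|apply: rintZ; exact: L2r_rintM].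
rewrite hexp_pair// hexp_dot -/c; under eq_bigr do rewrite -/(c _).
under [X in _ -> X <= _]eq_bigr do rewrite -/(c _).
by move: (\sum_n c n * c n) (\int[leb]_x _) => a b; lra.
Qed.

(** Bessel's inequality for the quadratic form of A. With [p] the expansion of [f] in the box, it
    comes from the nonnegativity of the squared norms of W_i - d_i p and x_i f - x_i p; by
    [wdr_extend] the cross terms sum to the pairing of f with A p, which equals the form at [p]. *)
Lemma bessel1 f (W : 'I_d -> X -> R) : L2r f -> (forall i, L2r (W i)) ->
  (forall i, L2r (fun x => x 0 i * f x)) -> (forall i, wdr [:: i] f (W i)) ->
  \sum_n lam (vidx n) * (\int[leb]_x (f x * hT (vidx n) x)) ^+ 2 <=
  \sum_i (\int[leb]_x (W i x ^+ 2) + \int[leb]_x ((x 0 i * f x) ^+ 2)).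
Proof.
move=> Lf LW Lx fW; pose c n := \int[leb]_x (f x * hT (vidx n) x).
set p := hexp c; have sp : schwartz p by exact: schwartz_hexp.
have spi i : schwartz (partial i p) by exact: schwartz_partial.
have spx i : schwartz (fun x => x 0 i * p x) by exact: schwartz_coor.
have sq g h : L2r g -> L2r h -> 2 * \int[leb]_x (g x * h x) - \int[leb]_x (h x ^+ 2) <= \int[leb]_x (g x ^+ 2).
  move=> Lg Lh; have : 0 <= \int[leb]_x ((g x - h x) ^+ 2) by apply: Int_ge0 => x; exact: sqr_ge0.
  have -> : \int[leb]_x ((g x - h x) ^+ 2) =
    \int[leb]_x (g x ^+ 2) - 2 * \int[leb]_x (g x * h x) + \int[leb]_x (h x ^+ 2).
    rewrite -IntZ; last exact: L2r_rintM.
    rewrite -IntB; [|exact: Lg.2|by apply: rintZ; exact: L2r_rintM].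
    rewrite -IntD; last exact: Lh.2.
      by apply: eq_Rintegral => x _; ring.
    by apply: rintB; [exact: Lg.2|apply: rintZ; exact: L2r_rintM].
  by move: (\int[leb]_x _) (\int[leb]_x _) (\int[leb]_x _) => a b e; lra.
have E1 : \sum_i (\int[leb]_x (W i x * partial i p x) + \int[leb]_x ((x 0 i * f x) * (x 0 i * p x))) =
    \int[leb]_x (f x * Aop p x).
  rewrite AopE; under [RHS]eq_Rintegral do rewrite mulr_sumr.
  rewrite Int_sum; last first.
    move=> i _; apply: L2rM_schwartz => //; apply: schwartzD; last exact: schwartz_coor.
    by apply: schwartzN; exact: schwartz_partial.
  apply: eq_bigr => i _; under [RHS]eq_Rintegral do rewrite mulrDr.
  rewrite IntD; last 2 first.
  - by apply: L2rM_schwartz => //; apply: schwartzN; exact: schwartz_partial.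
  - by apply: L2rM_schwartz => //; exact: schwartz_coor.
  congr (_ + _); last by apply: eq_Rintegral => x _; ring.
  have := wdr_extend Lf (LW i) (fW i) (spi i); rewrite /= mulN1r => /eqP.
  rewrite -eqr_oppLR => /eqP <-; rewrite -IntN; last by apply: L2rM_schwartz => //; exact: schwartz_partial.
  by apply: eq_Rintegral => x _; rewrite mulrN.
have E2 : \int[leb]_x (f x * Aop p x) = \sum_n lam (vidx n) * c n ^+ 2.
  by rewrite Aop_hexp hexp_pair//; apply: eq_bigr => n _; rewrite -/(c n) -mulrA -expr2.
have E3 : \int[leb]_x (p x * Aop p x) = \sum_n lam (vidx n) * c n ^+ 2.
  by rewrite Aop_hexp hexp_dot; apply: eq_bigr => n _; rewrite mulrCA -expr2.
have := form_Aop sp; rewrite E3 => E4.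
apply: (@le_trans _ _ (2 * \sum_i (\int[leb]_x (W i x * partial i p x) + \int[leb]_x ((x 0 i * f x) * (x 0 i * p x)))
   - \sum_i (\int[leb]_x (partial i p x ^+ 2) + \int[leb]_x ((x 0 i * p x) ^+ 2)))).
  rewrite E1 E2 E4 -/c; under eq_bigr do rewrite -/(c _).
  by move: (\sum_n _) => a; lra.
rewrite mulr_sumr -sumrB; apply: ler_sum => i _.
have h1 := sq _ _ (LW i) (schwartz_L2r (spi i)); have h2 := sq _ _ (Lx i) (schwartz_L2r (spx i)).
by rewrite mulrDr opprD addrACA; apply: lerD.
Qed.

End box_expansion.
End hermite_nd.

(** * Hermite coefficients and the truncated operators *)

Definition nsq {R : realType} (z : R[i]) : R := complex.Re z ^+ 2 + complex.Im z ^+ 2.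

(** Stated for any finite index type and any weights, so that the linear algebra of the scheme is
    separated from Hermite functions; with the eigenvalues as weights it is the squared Sigma^s norm
    ([Snorm2_hexpC]). *)
Definition wn {R : realType} (I : finType) (lam : I -> R) s (c : I -> R[i]) : R :=
  \sum_n lam n ^+ s * nsq (c n).

Section spectral.
Context {R : realType} {d : nat} (K : nat).
Local Notation X := 'rV[R]_d.
Local Notation leb := (@lebesgue_rV R d).
Local Notation I := {ffun 'I_d -> 'I_K}.
Implicit Types (u v : X -> R[i]) (c : I -> R[i]) (n : I).

Definition lamK n : R := lam (vidx n).

Definition hexpC c : X -> R[i] := fun x => \sum_n c n * (hT (vidx n) x)%:C.

Definition coef u n : R[i] := inner u (fun y => (hT (vidx n) y)%:C).

Lemma reP_hexpC c : reP (hexpC c) = hexp (fun n => complex.Re (c n)).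
Proof.
apply/funext => x; rewrite /reP /hexpC Re_sum; apply: eq_bigr => n _.
by rewrite Re_mul_real.
Qed.

Lemma imP_hexpC c : imP (hexpC c) = hexp (fun n => complex.Im (c n)).
Proof.
apply/funext => x; rewrite /imP /hexpC Im_sum; apply: eq_bigr => n _.
by rewrite Im_mul_real.
Qed.

Lemma hexpC_schwartz c : schwartzC (hexpC c).
Proof. by split; rewrite ?reP_hexpC ?imP_hexpC; exact: schwartz_hexp. Qed.

Lemma hexpC_L2 c : L2 (hexpC c).
Proof. exact: schwartzC_L2 (hexpC_schwartz c). Qed.

Lemma hexpC_Sigma k c : Sigma k (hexpC c).
Proof. exact: schwartzC_Sigma (hexpC_schwartz c). Qed.

Lemma SigmaKP u : SigmaK K u <-> exists c, u = hexpC c.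
Proof. by split=> -[c ->]; exists c. Qed.

Lemma Snorm2_hexpC k c : Snorm2 k (hexpC c) = wn lamK k c.
Proof.
rewrite Snorm2_schwartz; last exact: hexpC_schwartz.
rewrite reP_hexpC imP_hexpC !Nr_hexp -big_split; apply: eq_bigr => n _ /=.
by rewrite mulrDr.
Qed.

Lemma coefE u n : coef u n = (\int[leb]_x (reP u x * hT (vidx n) x)) +i*
   (\int[leb]_x (imP u x * hT (vidx n) x)).
Proof.
rewrite /coef /inner /cintegral; congr (_ +i* _); apply: eq_Rintegral => x _.
  by rewrite ReM Re_conj Im_conj /= oppr0 mulr0 subr0.
by rewrite ImM Re_conj Im_conj /= oppr0 mulr0 add0r.
Qed.

Lemma coef_hexpC c n : coef (hexpC c) n = c n.
Proof. by rewrite coefE reP_hexpC imP_hexpC !hexp_coef; case: (c n). Qed.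

Lemma projKE u : Defs.projK K u = hexpC (coef u).
Proof. by []. Qed.

Lemma coef_ae u u' : L2 u -> L2 u' -> eq_L2 u u' -> coef u = coef u'.
Proof.
move=> /L2_measurable[mr mi] /L2_measurable[mr' mi'] /eq_L2_parts[er ei].
apply/funext => n; rewrite !coefE; congr (_ +i* _); apply: Int_ae.
- by apply: measurable_funM => //; apply: schwartz_measurable; exact: schwartz_hT.
- by apply: measurable_funM => //; apply: schwartz_measurable; exact: schwartz_hT.
- by apply: filterS er => x ->.
- by apply: measurable_funM => //; apply: schwartz_measurable; exact: schwartz_hT.
- by apply: measurable_funM => //; apply: schwartz_measurable; exact: schwartz_hT.
- by apply: filterS ei => x ->.
Qed.

Lemma hexpC_inj c c' : eq_L2 (hexpC c) (hexpC c') -> c = c'.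
Proof.
move=> e; apply/funext => n; rewrite -(coef_hexpC c) -(coef_hexpC c').
by rewrite (coef_ae (hexpC_L2 c) (hexpC_L2 c') e).
Qed.

Lemma coef_opA_iter l u n : Sigma l.*2 u ->
  coef (iter l opA u) n = (lamK n ^+ l)%:C * coef u n.
Proof.
move=> Su; have [|_ P] := @opA_iter R d l 0 u; first by rewrite addn0.
have [e1 e2] := P _ (schwartz_hT (vidx n)).
have h1 : iter l Aop (hT (vidx n)) = fun x => lamK n ^+ l * hT (vidx n) x :> R.
  elim: l {Su P e1 e2} => [|l /= ->]; first by apply/funext => x; rewrite mul1r.
  rewrite AopZ; last exact: schwartz_hT.
  by apply/funext => x; rewrite Aop_hT exprSr mulrA.
have /L2_parts[Lr Li] := Sigma_L2 Su.
rewrite !coefE e1 e2 h1; apply: complex_eq; rewrite ?Re_real_mul ?Im_real_mul /=.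
  rewrite -IntZ; last by apply: L2rM_schwartz => //; exact: schwartz_hT.
  by apply: eq_Rintegral => x _; rewrite mulrCA.
rewrite -IntZ; last by apply: L2rM_schwartz => //; exact: schwartz_hT.
by apply: eq_Rintegral => x _; rewrite mulrCA.
Qed.

Lemma nsqZ (a : R) (z : R[i]) : nsq (a%:C * z) = a ^+ 2 * nsq z.
Proof. by rewrite /nsq Re_real_mul Im_real_mul; ring. Qed.

(** The coefficients of w = A^l u, with l half of [j] rounded down, are those of [u] times powers of
    the eigenvalues, because A is symmetric. What remains is Bessel's inequality for w: plain for
    even [j], in the form of A for odd [j]. *)
Lemma proj_contract j u : Sigma j u -> wn lamK j (coef u) <= Snorm2 j u.
Proof.
move=> Su; set l := j./2.
have jE : (odd j + l.*2 = j)%N by exact: odd_double_half.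
have Su2 : Sigma l.*2 u by apply: SigmaW Su; exact: half_double_le.
rewrite /Snorm2; set w := iter l opA u.
have E : wn lamK j (coef u) = wn lamK (odd j) (coef w).
  apply: eq_bigr => n _; rewrite coef_opA_iter// nsqZ mulrA -exprM -exprD; congr (_ ^+ _ * _).
  by rewrite muln2.
rewrite E; case: ifP => oj; rewrite /wn; last first.
  have /L2_parts[Lr Li] : L2 w.
    by have [|/Sigma_L2] := @opA_iter R d l 0 u; rewrite ?addn0.
  rewrite L2norm2E; last by apply/L2_parts.
  apply: (le_trans _ (lerD (bessel0 K Lr) (bessel0 K Li))).
  by rewrite -big_split; apply: ler_sum => n _; rewrite expr0 mul1r coefE.
have Sw : Sigma 1 w.
  have jE1 : (l.*2 + 1 = j)%N by rewrite -[RHS]jE oj addnC.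
  by have [|//] := @opA_iter R d l 1 u; rewrite jE1.
have /L2_parts[Lr Li] := Sigma_L2 Sw.
have P i : [/\ L2r (reP (weak_deriv (mdelta i 1) w)), L2r (imP (weak_deriv (mdelta i 1) w)),
    wdr [:: i] (reP w) (reP (weak_deriv (mdelta i 1) w)) &
    wdr [:: i] (imP w) (imP (weak_deriv (mdelta i 1) w))].
  have [|/L2_parts[? ?] /wd_parts[w1 w2]] := @weak_deriv_spec _ _ (mdelta i 1) w 1 Sw; first by rewrite size_mdelta.
  split=> //; first exact: wdr_perm (mword_delta i 1) w1.
  exact: wdr_perm (mword_delta i 1) w2.
have Q i : L2r (fun x => x 0 i * reP w x) /\ L2r (fun x => x 0 i * imP w x).
  have /Sigma_L2/L2_parts := Sigma_coor i Sw; rewrite /reP /imP => -[].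
  by under eq_fun do rewrite Re_real_mul; under [X in _ -> L2r X -> _]eq_fun do rewrite Im_real_mul.
have b1 := @bessel1 _ _ K _ (fun i => reP (weak_deriv (mdelta i 1) w)) Lr (fun i => let: And4 a _ _ _ := P i in a)
  (fun i => (Q i).1) (fun i => let: And4 _ _ a _ := P i in a).
have b2 := @bessel1 _ _ K _ (fun i => imP (weak_deriv (mdelta i 1) w)) Li (fun i => let: And4 _ a _ _ := P i in a)
  (fun i => (Q i).2) (fun i => let: And4 _ _ _ a := P i in a).
have -> : formA w =
  \sum_i (\int[leb]_x (reP (weak_deriv (mdelta i 1) w) x ^+ 2) + \int[leb]_x ((x 0 i * reP w x) ^+ 2)) +
  \sum_i (\int[leb]_x (imP (weak_deriv (mdelta i 1) w) x ^+ 2) + \int[leb]_x ((x 0 i * imP w x) ^+ 2)).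
  rewrite -big_split; apply: eq_bigr => i _ /=; have [Lwr Lwi _ _] := P i.
  rewrite addrACA; congr (_ + _).
    by rewrite L2norm2E//; apply/L2_parts.
  rewrite L2norm2E; last exact: Sigma_L2 (Sigma_coor i Sw).
  by rewrite /reP /imP; congr (_ + _); apply: eq_Rintegral => x _; rewrite ?Re_real_mul ?Im_real_mul.
apply: (le_trans _ (lerD b1 b2)); rewrite -big_split; apply: ler_sum => n _ /=.
by rewrite expr1 coefE /nsq mulrDr.
Qed.

Lemma opA_hexpC l c : eq_L2 (iter l opA (hexpC c)) (hexpC (fun n => (lamK n ^+ l)%:C * c n)).
Proof.
apply: (eq_L2_trans (iterA_schwartz l (hexpC_schwartz c))).
have [e1 e2] := @iter_AopC R d l (hexpC c).
apply/eq_L2_parts; rewrite e1 e2 !reP_hexpC !imP_hexpC !iterA_hexp.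
split; apply: filterE => x; apply: eq_bigr => n _; rewrite ?Re_real_mul ?Im_real_mul//.
Qed.

Lemma hexpC_lin (a : R[i]) c c' x : hexpC (fun n => a * c n + c' n) x = a * hexpC c x + hexpC c' x.
Proof.
rewrite /hexpC mulr_sumr -big_split; apply: eq_bigr => n _ /=.
by rewrite mulrDl mulrA.
Qed.

Lemma inner_hexpC u c : L2 u -> inner u (hexpC c) = \sum_n coef u n * conjc (c n).
Proof.
move=> /L2_parts[Lr Li]; rewrite /inner /cintegral.
have P f (c' : I -> R) : L2r f -> \int[leb]_x (f x * hexp c' x) =
   \sum_n c' n * \int[leb]_x (f x * hT (vidx n) x) by exact: hexp_pair.
have H (c' : I -> R) : schwartz (hexp c' : X -> R) by exact: schwartz_hexp.
apply: complex_eq => /=; rewrite ?Re_sum ?Im_sum.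
  transitivity (\int[leb]_x (reP u x * reP (hexpC c) x) + \int[leb]_x (imP u x * imP (hexpC c) x)).
    rewrite -IntD; [|by rewrite reP_hexpC; exact: L2rM_schwartz|by rewrite imP_hexpC; exact: L2rM_schwartz].
    by apply: eq_Rintegral => x _; rewrite ReM Re_conj Im_conj mulrN opprK.
  rewrite reP_hexpC imP_hexpC !P// -big_split; apply: eq_bigr => n _ /=.
  by rewrite ReM coefE Re_conj Im_conj /=; ring.
transitivity (\int[leb]_x (imP u x * reP (hexpC c) x) - \int[leb]_x (reP u x * imP (hexpC c) x)).
  rewrite -IntB; [|by rewrite reP_hexpC; exact: L2rM_schwartz|by rewrite imP_hexpC; exact: L2rM_schwartz].
  by apply: eq_Rintegral => x _; rewrite ImM Re_conj Im_conj /reP /imP; ring.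
rewrite reP_hexpC imP_hexpC !P// -sumrB; apply: eq_bigr => n _ /=.
by rewrite ImM coefE Re_conj Im_conj /=; ring.
Qed.

End spectral.

(** * The matrix of B_K *)

Section operator_matrix.
Context {R : realType} {d : nat}.
Local Notation X := 'rV[R]_d.
Variable B : nat -> (X -> R[i]) -> (X -> R[i]).
Hypothesis hB : noise_operator B.
Variable K : nat.
Hypothesis K0 : (0 < K)%N.
Local Notation I := {ffun 'I_d -> 'I_K}.
Implicit Types (c : I -> R[i]).

Definition bop c : I -> R[i] := coef (B K (hexpC c)).

Lemma B_hexpC c : B K (hexpC c) = hexpC (bop c).
Proof.
have /SigmaKP[c' e] := noise_range hB K0 (hexpC_L2 c).
by rewrite /bop e; congr hexpC; apply/funext => n; rewrite coef_hexpC.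
Qed.

Lemma bop_lin (a : R[i]) c c' : bop (fun n => a * c n + c' n) = fun n => a * bop c n + bop c' n.
Proof.
apply: hexpC_inj; apply: filterE => x; rewrite hexpC_lin -!B_hexpC.
rewrite -(congr1 (fun F => F x) (noise_linear hB a K0 (hexpC_L2 c) (hexpC_L2 c'))) /=.
by congr (B K _ x); apply/funext => y; rewrite hexpC_lin.
Qed.

Lemma bop_sym c c' : \sum_n bop c n * conjc (c' n) = \sum_n c n * conjc (bop c' n).
Proof.
have := noise_sym hB K0 (hexpC_L2 c) (hexpC_L2 c').
rewrite !B_hexpC !inner_hexpC; [|exact: hexpC_L2|exact: hexpC_L2].
under eq_bigr do rewrite coef_hexpC; by under [in X in _ = X]eq_bigr do rewrite coef_hexpC.
Qed.

(** [B K] acts on functions, not on classes. Being symmetric with values in [SigmaK], it has as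
    coefficients of its value at u the inner products of u with the images of the basis functions,
    and these do not see null sets. *)
Lemma B_ae (u u' : X -> R[i]) : L2 u -> L2 u' -> eq_L2 u u' -> B K u = B K u'.
Proof.
move=> Lu Lu' e; have /SigmaKP[a ea] := noise_range hB K0 Lu.
have /SigmaKP[a' ea'] := noise_range hB K0 Lu'.
rewrite ea ea'; congr hexpC; apply/funext => n.
have key (v : X -> R[i]) b : L2 v -> B K v = hexpC b ->
    b n = \sum_k coef v k * conjc (bop (fun m => (m == n)%:R) k).
  move=> Lv eb; have := noise_sym hB K0 Lv (hexpC_L2 (fun m => (m == n)%:R)).
  rewrite eb B_hexpC !inner_hexpC//; last exact: hexpC_L2.
  move=> <-; rewrite (bigD1 n)//= eqxx big1 ?addr0; first by rewrite coef_hexpC rmorph1 mulr1.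
  by move=> k /negbTE ->; rewrite rmorph0 mulr0.
by rewrite (key u a Lu ea) (key u' a' Lu' ea') (coef_ae K Lu Lu' e).
Qed.

Lemma commA_hexpC k c : eq_L2 (commA k (B K) (hexpC c))
  (hexpC (fun n => (lamK n ^+ k)%:C * bop c n - bop (fun m => (lamK m ^+ k)%:C * c m) n)).
Proof.
have e1 := @opA_hexpC _ _ K k (bop c); have e2 := @opA_hexpC _ _ K k c.
have L : L2 (iter k opA (hexpC c)).
  by have [|/Sigma_L2] := @opA_iter R d k 0 (hexpC c); first exact: hexpC_Sigma.
rewrite /commA (B_ae L (hexpC_L2 _) e2) !B_hexpC.
apply: filterS e1 => x ->.
have := hexpC_lin (-1) (bop (fun m => (lamK m ^+ k)%:C * c m)) (fun n => (lamK n ^+ k)%:C * bop c n) x.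
rewrite mulN1r addrC => <-; congr (hexpC _ x); apply/funext => n.
by rewrite mulN1r addrC.
Qed.

End operator_matrix.

(** * Interpolation in the scale of weighted norms *)

Section real_form.
Context {R : realType} {I : finType}.
Variable lam : I -> R.
Hypothesis lam1 : forall n, 1 <= lam n.
Local Notation V := (I -> R[i]).
Local Notation Re := complex.Re.
Local Notation Im := complex.Im.
Implicit Types (u v w : V) (s t k j : nat) (n : I).
Local Notation wn := (wn lam).

(** The real part of the Sigma^s inner product. With a real form the energy identities stay real,
    and multiplication by the imaginary unit becomes the skew operator [mulI]. *)
Definition rip s u v : R := \sum_n lam n ^+ s * (Re (u n) * Re (v n) + Im (u n) * Im (v n)).
Definition mulI u : V := fun n => 'i%C * u n.
Definition lamop p u : V := fun n => (lam n ^+ p)%:C * u n.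
Local Notation Lop := lamop.

Lemma lam_ge0' n : 0 <= lam n. Proof. by rewrite (le_trans ler01). Qed.

Lemma lamX_ge0 s n : 0 <= lam n ^+ s.
Proof. by rewrite exprn_ge0 ?lam_ge0'. Qed.

Lemma nsq_ge0 (z : R[i]) : 0 <= nsq z.
Proof. by rewrite addr_ge0 ?sqr_ge0. Qed.

Lemma wn_ge0 s u : 0 <= wn s u.
Proof. by apply: sumr_ge0 => n _; rewrite mulr_ge0 ?lamX_ge0 ?nsq_ge0. Qed.

Lemma wnE s u : wn s u = rip s u u.
Proof. by apply: eq_bigr => n _; rewrite /nsq !expr2. Qed.

Lemma wn_le s t u : (s <= t)%N -> wn s u <= wn t u.
Proof.
move=> st; apply: ler_sum => n _; rewrite ler_wpM2r ?nsq_ge0//.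
by rewrite ler_weXn2l.
Qed.

Lemma ripC s u v : rip s u v = rip s v u.
Proof. by apply: eq_bigr => n _; congr (_ * _); rewrite mulrC [X in _ + X]mulrC. Qed.

Lemma Re_mulI u n : Re (mulI u n) = - Im (u n).
Proof. by rewrite /mulI; case: (u n) => a b /=; rewrite mul0r mul1r sub0r. Qed.

Lemma Im_mulI u n : Im (mulI u n) = Re (u n).
Proof. by rewrite /mulI; case: (u n) => a b /=; rewrite mul0r mul1r add0r. Qed.

Lemma rip_mulI s u v : rip s (mulI u) v = - rip s u (mulI v).
Proof. by rewrite -sumrN; apply: eq_bigr => n _; rewrite !Re_mulI !Im_mulI; ring. Qed.

Lemma wn_mulI s u : wn s (mulI u) = wn s u.
Proof. by apply: eq_bigr => n _; rewrite /nsq Re_mulI Im_mulI; ring. Qed.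

Lemma rip_mulI0 s u : rip s u (mulI u) = 0.
Proof. by rewrite /rip big1// => n _; rewrite Re_mulI Im_mulI; ring. Qed.

Lemma mulIK u : mulI (mulI u) = fun n => - u n.
Proof. by apply/funext => n; apply: complex_eq; rewrite ?(Re_mulI, Im_mulI, ReN, ImN). Qed.

Lemma ripDr s u v w : rip s u (fun n => v n + w n) = rip s u v + rip s u w.
Proof. by rewrite -big_split; apply: eq_bigr => n _ /=; rewrite ReD ImD; ring. Qed.

Lemma ripZr s (a : R) u v : rip s u (fun n => a%:C * v n) = a * rip s u v.
Proof. by rewrite mulr_sumr; apply: eq_bigr => n _; rewrite Re_real_mul Im_real_mul; ring. Qed.

Lemma ripNr s u v : rip s u (fun n => - v n) = - rip s u v.
Proof. by rewrite -sumrN; apply: eq_bigr => n _; rewrite ReN ImN; ring. Qed.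

Lemma wnZ s (a : R) u : wn s (fun n => a%:C * u n) = a ^+ 2 * wn s u.
Proof. by rewrite mulr_sumr; apply: eq_bigr => n _; rewrite nsqZ mulrCA. Qed.

Lemma wnD s u v : wn s (fun n => u n + v n) = wn s u + 2 * rip s u v + wn s v.
Proof.
rewrite mulr_sumr -!big_split; apply: eq_bigr => n _ /=.
by rewrite /nsq ReD ImD; ring.
Qed.

Lemma rip_CS s u v : rip s u v ^+ 2 <= wn s u * wn s v.
Proof.
have P (t : R) : 0 <= wn s u - 2 * t * rip s u v + t ^+ 2 * wn s v.
  rewrite -(wnZ s t v) -[X in _ - X](_ : 2 * rip s u (fun n => t%:C * v n) = _); last by rewrite ripZr; ring.
  apply: le_trans (wn_ge0 s (fun n => u n - t%:C * v n)) _.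
  rewrite (wnD s u (fun n => - (t%:C * v n))) ripNr mulrN.
  by rewrite (_ : wn s (fun n => - _) = wn s (fun n => t%:C * v n))//; apply: eq_bigr => n _; rewrite /nsq ReN ImN !sqrrN.
move: (wn_ge0 s u) (wn_ge0 s v) P; move: (wn s u) (wn s v) (rip s u v) => a b c a0 b0 P.
have [b00|bp] := eqVneq b 0.
  have [->|c0] := eqVneq c 0; first by rewrite expr0n /= mulr_ge0.
  have := P ((a + 1) / (2 * c)); rewrite b00 mulr0 addr0.
  by rewrite (_ : 2 * ((a + 1) / (2 * c)) * c = a + 1); [lra|field].
have bpos : 0 < b by rewrite lt_neqAle eq_sym bp.
have := P (c / b); rewrite (_ : _ + _ = (a * b - c ^+ 2) / b); last by field.
by rewrite pmulr_lge0 ?invr_gt0// subr_ge0.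
Qed.

Lemma geom_unbounded (q D : R) : 1 < q -> exists m, D < q ^+ m.
Proof.
move=> q1; have B (m : nat) : 1 + m%:R * (q - 1) <= q ^+ m.
  elim: m => [|m IH]; first by rewrite mul0r addr0 expr0.
  rewrite exprS -natr1; have m0 : 0 <= m%:R :> R by [].
  have h1 : q * (1 + m%:R * (q - 1)) <= q * q ^+ m by rewrite ler_wpM2l//; lra.
  have h2 : 0 <= m%:R * (q - 1) ^+ 2 by rewrite mulr_ge0// sqr_ge0.
  by move: (q ^+ m) (m%:R : R) h1 h2 => p r h1 h2; nra.
have q10 : 0 < q - 1 by rewrite subr_gt0.
exists (Num.truncn (`|D| / (q - 1))).+1; apply: lt_le_trans (B _).
have := truncnS_gt (`|D| / (q - 1)); rewrite ltr_pdivrMr// => h.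
by rewrite (le_lt_trans (ler_norm D))// (lt_le_trans h)// lerDr.
Qed.

(* Krein's lemma: the norms of the iterates of Q are log-convex for the weaker norm. *)
Lemma krein j t (E : R) (Q : V -> V) : (j <= t)%N -> 0 < E ->
  (forall u v, `|rip j (Q u) v| = `|rip j u (Q v)|) ->
  (forall u, wn t (Q u) <= E * wn t u) -> forall u, wn j (Q u) <= E * wn j u.
Proof.
move=> jt E0 Qs Qt u; pose A m := wn j (iter m Q u).
have A0 m : 0 <= A m by exact: wn_ge0.
have cvx m : A m.+1 ^+ 2 <= A m * A m.+2.
  rewrite /A /= wnE -[X in X <= _](real_normK (num_real _)) Qs real_normK ?num_real//.
  exact: rip_CS.
have grow m : A m <= E ^+ m * wn t u.
  apply: (le_trans (wn_le _ jt)); elim: m => [|m IH]; first by rewrite expr0 mul1r.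
  by rewrite exprS -mulrA (le_trans (Qt _))// ler_pM2l.
rewrite leNgt; apply/negP => h.
have A1 : E * A 0 < A 1 by [].
have A0p : 0 < A 0.
  rewrite lt_neqAle A0 andbT eq_sym; apply/eqP => e.
  have := cvx 0; rewrite e mul0r; have : 0 < A 1 by rewrite (le_lt_trans _ A1)// mulr_ge0 // ltW.
  by move=> p /(lt_le_trans (exprn_gt0 2 p)); rewrite ltxx.
(* If this first ratio exceeded [E], log-convexity would keep all later ratios above it, and the
   iterates would grow like q^m, against the bound E^m coming from the stronger norm. *)
set q := A 1 / A 0.
have qE : E < q by rewrite ltr_pdivlMr.
have q0 : 0 < q by rewrite (lt_trans E0).
have step m : 0 < A m /\ q * A m <= A m.+1.
  elim: m => [|m [p IH]]; first by rewrite /q divfK ?gt_eqF.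
  have p1 : 0 < A m.+1 by rewrite (lt_le_trans _ IH)// mulr_gt0.
  split => //; rewrite -(ler_pM2l p); apply: le_trans (cvx m).
  by rewrite mulrA (mulrC (A m)) expr2 ler_pM2r.
have low m : q ^+ m * A 0 <= A m.
  elim: m => [|m IH]; first by rewrite expr0 mul1r.
  by rewrite exprS -mulrA (le_trans _ (step m).2)// ler_pM2l.
have q1 : 1 < q / E by rewrite ltr_pdivlMr ?mul1r.
have [m hm] := geom_unbounded (wn t u / A 0) q1.
have := le_trans (low m) (grow m); rewrite leNgt => /negP; apply.
move: hm; rewrite ltr_pdivrMr// expr_div_n mulrAC ltr_pdivlMr ?exprn_gt0//.
by rewrite mulrC.
Qed.

(** Log-convexity of the norms of [Q] at three consecutive orders. Let Y = Q'Q with Q' the adjoint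
    in Sigma^(k+1). At order k+2 it is bounded by a b: its squared norm is the pairing of Q u with Q
    (lam Y u), the first measured at order k+2 and the second at order k, and lam is an isometry
    from Sigma^(k+2) to Sigma^k. Since Y is symmetric at order k+1, [krein] moves the bound
    there. *)
Lemma scale_step k (a b : R) (Q Qa : V -> V) : 0 < a -> 0 < b ->
  (forall u v, rip 0 (Q u) v = rip 0 u (Qa v)) ->
  (forall u, wn k (Q u) <= a * wn k u) -> (forall u, wn k.+2 (Q u) <= b * wn k.+2 u) ->
  forall u, wn k.+1 (Q u) ^+ 2 <= a * b * wn k.+1 u ^+ 2.
Proof.
move=> a0 b0 adj Ha Hb.
have ripL s p u v : rip s (Lop p u) v = rip (s + p) u v.
  by apply: eq_bigr => n _; rewrite Re_real_mul Im_real_mul exprD; ring.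
have ripLr s p u v : rip s u (Lop p v) = rip (s + p) u v by rewrite ripC ripL ripC.
pose Li p u : V := fun n => ((lam n ^+ p)^-1)%:C * u n.
have ln0 p n : lam n ^+ p != 0 by rewrite expf_neq0// gt_eqF// (lt_le_trans ltr01).
have LiK s p u v : rip (s + p) (Li p u) v = rip s u v.
  apply: eq_bigr => n _; rewrite Re_real_mul Im_real_mul exprD.
  by move: (ln0 p n); move: (lam n ^+ p) => l l0; field.
pose Y u := Li k.+1 (Qa (Lop k.+1 (Q u))).
have YE u v : rip k.+1 (Y u) v = rip k.+1 (Q u) (Q v).
  by rewrite -[k.+1]add0n LiK ripC -adj ripLr ripC.
have Yb u : wn k.+2 (Y u) <= a * b * wn k.+2 u.
  have e : wn k.+2 (Y u) = rip k.+1 (Q u) (Q (Lop 1 (Y u))).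
    by rewrite wnE -YE ripLr addn1.
  have CS : rip k.+1 (Q u) (Q (Lop 1 (Y u))) ^+ 2 <= wn k.+2 (Q u) * wn k (Q (Lop 1 (Y u))).
    have := rip_CS k (Lop 1 (Q u)) (Q (Lop 1 (Y u))); rewrite ripL addn1.
    by rewrite [wn k (Lop 1 _)]wnE ripL ripLr -addnA addn2 -wnE.
  have h1 := Hb u; have h2 := Ha (Lop 1 (Y u)).
  rewrite [wn k (Lop 1 _)]wnE ripL ripLr -addnA addn2 -wnE in h2.
  rewrite -e in CS; move: (wn_ge0 k.+2 (Y u)) (wn_ge0 k.+2 u) (wn_ge0 k.+2 (Q u)) (wn_ge0 k (Q (Lop 1 (Y u)))) CS h1 h2.
  move: (wn k.+2 (Y u)) (wn k.+2 u) (wn k.+2 (Q u)) (wn k _) => y z p q y0 z0 p0 q0 CS h1 h2.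
  have [->|yn] := eqVneq y 0; first by rewrite !mulr_ge0// ltW.
  have yp : 0 < y by rewrite lt_neqAle eq_sym yn.
  rewrite -(ler_pM2r yp) -expr2 (le_trans CS)// (le_trans (ler_pM p0 q0 h1 h2))//.
  by rewrite le_eqVlt; apply/orP; left; apply/eqP; ring.
have Ys u v : `|rip k.+1 (Y u) v| = `|rip k.+1 u (Y v)|.
  by rewrite YE [in RHS]ripC YE ripC.
have K1 := krein (leqnSn k.+1) (mulr_gt0 a0 b0) Ys Yb.
move=> u; rewrite wnE -YE; apply: le_trans (rip_CS _ _ _) _.
by rewrite expr2 mulrA ler_wpM2r ?wn_ge0.
Qed.

(** By [scale_step] the optimal constants, kept at least 1, are log-convex in the order, so their
    maximum is at an end. [M] makes the infima finite and does not appear in the conclusion; it may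
    therefore depend on the dimension. *)
Lemma scale_interpolation j (M : R) (Q Qa : V -> V) :
  (forall u v, rip 0 (Q u) v = rip 0 u (Qa v)) ->
  (forall k u, (k <= j)%N -> wn k (Q u) <= M * wn k u) ->
  (forall u, wn 0 (Q u) <= 2 * wn 0 u) -> (forall u, wn j (Q u) <= 2 * wn j u) ->
  forall k u, (k <= j)%N -> wn k (Q u) <= 2 * wn k u.
Proof.
move=> adj HM H0 Hj.
pose P k := [set a : R | 1 <= a /\ forall u, wn k (Q u) <= a * wn k u].
pose a k := inf (P k).
have Plb k : has_lbound (P k) by exists 1 => x [].
have PM k : (k <= j)%N -> P k (Num.max 1 M).
  move=> kj; split => [|u]; first by rewrite le_max lexx.
  by rewrite (le_trans (HM k u kj))// ler_wpM2r ?wn_ge0// le_max lexx orbT.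
have a1 k : (k <= j)%N -> 1 <= a k.
  by move=> kj; apply: lb_le_inf; [exists (Num.max 1 M); exact: PM|move=> x []].
have aP k u : (k <= j)%N -> wn k (Q u) <= a k * wn k u.
  move=> kj; have [e|n0] := eqVneq (wn k u) 0.
    by have := HM k u kj; rewrite e !mulr0.
  have p : 0 < wn k u by rewrite lt_neqAle eq_sym n0 wn_ge0.
  rewrite -ler_pdivrMr//; apply: lb_le_inf; first by exists (Num.max 1 M); exact: PM.
  by move=> x [_ h]; rewrite ler_pdivrMr.
have ale k x : (k <= j)%N -> 1 <= x -> (forall u, wn k (Q u) <= x * wn k u) -> a k <= x.
  by move=> kj x1 h; apply: ge_inf => //; split.
have a0 : a 0%N <= 2 by apply: ale => //; lra.
have aj : a j <= 2 by apply: ale => //; lra.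
suff A2 k : (k <= j)%N -> a k <= 2.
  by move=> k u kj; rewrite (le_trans (aP k u kj))// ler_wpM2r ?wn_ge0// A2.
move=> kj; rewrite leNgt; apply/negP => hk.
have [i0 _ imax] := @arg_maxP _ _ _ (ord0 : 'I_j.+1) xpredT (fun i => a i) isT.
have ex : exists i, (i <= j)%N && (a i == a i0).
  by exists i0; rewrite eqxx andbT -ltnS ltn_ord.
(* At the first index where the maximum is attained, the left neighbour is strictly smaller and the
   right one not larger, which contradicts log-convexity. *)
have := ex_minnP ex => -[m /andP[mj /eqP am] mmin].
have M2 : 2 < a m by rewrite am (lt_le_trans hk)//; exact: (imax (Ordinal (kj : (k < j.+1)%N))).
have mle i : (i <= j)%N -> a i <= a m.
  by move=> ij; rewrite am; exact: (imax (Ordinal (ij : (i < j.+1)%N))).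
have mltj : (m < j)%N.
  by rewrite ltn_neqAle mj andbT; apply/eqP => e; move: M2; rewrite e ltNge aj.
case: m mj am mmin M2 mle mltj => [|m] mj am mmin M2 mle mltj; first by move: M2; rewrite ltNge a0.
have mj' : (m <= j)%N by exact: ltnW.
have lt1 : a m < a m.+1.
  rewrite lt_neqAle mle// andbT; apply/eqP => e.
  by have := mmin m; rewrite mj' e am eqxx ltnn => /(_ isT).
have le2 := mle m.+2 mltj.
have h := @scale_step m (a m) (a m.+2) Q Qa (lt_le_trans ltr01 (a1 m mj')) (lt_le_trans ltr01 (a1 _ mltj)) adj
  (fun u => aP m u mj') (fun u => aP m.+2 u mltj).
pose c := Num.sqrt (a m * a m.+2).
have p1 := a1 m mj'; have p2 := a1 m.+2 mltj.
have cc : c ^+ 2 = a m * a m.+2 by rewrite sqr_sqrtr// mulr_ge0//; lra.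
have c0 : 0 <= c by exact: sqrtr_ge0.
have c1 : 1 <= c by rewrite -[leLHS]sqrtr1 ler_sqrt; nra.
have : a m.+1 <= c.
  apply: ale => // u; rewrite -(@ler_pXn2r _ 2)// ?nnegrE ?wn_ge0// ?mulr_ge0 ?wn_ge0//.
  by rewrite exprMn cc; exact: h.
by move=> ac; move: cc lt1 le2 p1 p2; nra.
Qed.

End real_form.

(** * The Cayley transform *)

Section linear_inverse.
Context {F : fieldType} {I : finType}.
Local Notation V := (I -> F).
Implicit Types (u v : V).

Definition rowV u : 'rV[F]_#|I| := \row_p u (enum_val p).
Definition unrowV (r : 'rV[F]_#|I|) : V := fun n => r 0 (enum_rank n).

Lemma rowVK : cancel rowV unrowV.
Proof. by move=> u; apply/funext => n; rewrite /unrowV mxE enum_rankK. Qed.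

Lemma unrowVK : cancel unrowV rowV.
Proof. by move=> r; apply/rowP => p; rewrite mxE /unrowV enum_valK. Qed.

Definition clinear (L : V -> V) := forall (a : F) u v,
  L (fun n => a * u n + v n) = fun n => a * L u n + L v n.

Variable L : V -> V.
Hypothesis Llin : clinear L.

Lemma clinear0 : L (fun=> 0) = fun=> 0.
Proof.
have := Llin 1 (fun=> 0) (fun=> 0); under eq_fun do rewrite mul1r addr0.
move=> e; apply/funext => n; have := congr1 (fun f => f n) e => /=.
by rewrite mul1r => /eqP; rewrite -[X in X == _]addr0 (inj_eq (addrI _)) => /eqP.
Qed.

Lemma clinear_sum (J : Type) (r : seq J) (a : J -> F) (f : J -> V) :
  L (fun n => \sum_(p <- r) a p * f p n) = fun n => \sum_(p <- r) a p * L (f p) n.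
Proof.
elim: r => [|p r IH].
  under eq_fun do rewrite big_nil; rewrite clinear0.
  by apply/funext => n; rewrite big_nil.
under eq_fun do rewrite big_cons; rewrite Llin IH.
by apply/funext => n; rewrite big_cons.
Qed.

Definition kron (m : I) : V := fun n => (n == m)%:R.

Lemma kron_exp u : u = fun n => \sum_m u m * kron m n.
Proof.
apply/funext => n; rewrite (bigD1 n)//= /kron eqxx mulr1 big1 ?addr0// => m.
by rewrite eq_sym => /negbTE ->; rewrite mulr0.
Qed.

Definition lmatrix (M : V -> V) : 'M[F]_#|I| :=
  \matrix_(p, q) M (kron (enum_val p)) (enum_val q).

Lemma lmatrixE u : rowV (L u) = rowV u *m lmatrix L.
Proof.
apply/rowP => q; rewrite !mxE [in LHS](kron_exp u) clinear_sum.
rewrite (reindex (fun p : 'I_#|I| => enum_val p)) /=; last by exists enum_rank => x _; [exact: enum_valK|exact: enum_rankK].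
by apply: eq_bigr => p _; rewrite !mxE.
Qed.

(** The inverse goes through the inverse matrix, given by determinants; this makes it measurable in
    the Brownian increment ([vmeas_cayR]). *)
Definition linv u : V := unrowV (rowV u *m invmx (lmatrix L)).

Hypothesis Linj : forall u, L u = (fun=> 0) -> u = fun=> 0.

Lemma lmatrix_unit : lmatrix L \in unitmx.
Proof.
rewrite -row_free_unit; apply: inj_row_free => v v0.
have := lmatrixE (unrowV v); rewrite unrowVK v0 => /(congr1 unrowV); rewrite rowVK => e.
have : unrowV v = fun=> 0 by apply: Linj; rewrite e; apply/funext => n; rewrite /unrowV mxE.
by move/(congr1 rowV); rewrite unrowVK => ->; apply/rowP => p; rewrite !mxE.
Qed.

Lemma linvK u : L (linv u) = u.
Proof.
apply: (can_inj rowVK); rewrite lmatrixE /linv unrowVK.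
by rewrite mulmxKV// lmatrix_unit.
Qed.

Lemma Klinv u : linv (L u) = u.
Proof. by rewrite /linv lmatrixE mulmxK ?rowVK// lmatrix_unit. Qed.

End linear_inverse.

(** * Resolvent and Cayley transform of a symmetric matrix *)

Section cayley.
Context {R : realType} {I : finType}.
Variable lam : I -> R.
Hypothesis lam1 : forall n, 1 <= lam n.
Local Notation V := (I -> R[i]).
Local Notation wn := (wn lam).
Local Notation rip := (rip lam).
Local Notation Lop := (lamop lam).
Variable b : V -> V.
Hypothesis blin : clinear b.
Hypothesis bsym : forall u v, \sum_n b u n * conjc (v n) = \sum_n u n * conjc (b v n).
Implicit Types (u v c : V) (h x : R) (j : nat).

Lemma rip0E u v : rip 0 u v = complex.Re (\sum_n u n * conjc (v n)).
Proof.
rewrite Re_sum; apply: eq_bigr => n _.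
by rewrite expr0 mul1r ReM Re_conj Im_conj mulrN opprK.
Qed.

Lemma b_rip u v : rip 0 (b u) v = rip 0 u (b v).
Proof. by rewrite !rip0E bsym. Qed.

Lemma b_mulI u : b (mulI u) = mulI (b u).
Proof.
have := blin 'i%C u (fun=> 0); rewrite (clinear0 blin).
under eq_fun do rewrite addr0; rewrite /mulI => ->.
by apply/funext => n; rewrite addr0.
Qed.

(** With [h] the time step and [x] the Brownian increment this is the midpoint operator of the
    scheme, called H below. *)
Definition ham h x u : V := fun n => (h / 2)%:C * Lop 1 u n + (x / 2)%:C * b u n.
Definition cayT h x u : V := fun n => u n + 'i%C * ham h x u n.

Lemma Lop_lin p : clinear (Lop p).
Proof. by move=> a u v; apply/funext => n; rewrite /lamop; ring. Qed.

Lemma ham_lin h x : clinear (ham h x).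
Proof.
move=> a u v; apply/funext => n; rewrite /ham Lop_lin blin /=.
by move: (Lop _ u n) (Lop _ v n) (b u n) (b v n) (h / 2)%:C (x / 2)%:C => *; ring.
Qed.

Lemma cayT_lin h x : clinear (cayT h x).
Proof.
move=> a u v; apply/funext => n; rewrite /cayT ham_lin /=.
by move: (ham h x u n) (ham h x v n) => *; ring.
Qed.

Lemma Lop_rip s p u v : rip s (Lop p u) v = rip (s + p) u v.
Proof. by apply: eq_bigr => n _; rewrite Re_real_mul Im_real_mul exprD; ring. Qed.

Lemma Lop_ripr s p u v : rip s u (Lop p v) = rip (s + p) u v.
Proof. by rewrite ripC Lop_rip ripC. Qed.

Lemma ham_rip h x u v : rip 0 (ham h x u) v = rip 0 u (ham h x v).
Proof.
rewrite ripC /ham !ripDr !ripZr !Lop_ripr (ripC _ _ v) (ripC _ _ v (b u)) b_rip.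
by [].
Qed.

Lemma ham_mulI h x u : ham h x (mulI u) = mulI (ham h x u).
Proof.
apply/funext => n; rewrite /ham b_mulI /mulI /lamop.
by move: (b u n) => z; ring.
Qed.

(** H is symmetric and commutes with i, so the cross term Re <u, iHu> vanishes. Injectivity of 1 +
    iH and the L^2 contraction of its inverse follow, for every increment. *)
Lemma cay_norm h x u : wn 0 (cayT h x u) = wn 0 u + wn 0 (ham h x u).
Proof.
rewrite (wnD lam 0 u (mulI (ham h x u))) wn_mulI.
suff -> : rip 0 u (mulI (ham h x u)) = 0 by rewrite mulr0 addr0.
have e : rip 0 u (mulI (ham h x u)) = - rip 0 u (mulI (ham h x u)).
  by rewrite -[in LHS]ham_mulI -ham_rip [in LHS]ripC rip_mulI.
by move: e; move: (rip _ _ _) => r; lra.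
Qed.

Lemma wn0_eq0 u : wn 0 u <= 0 -> u = fun=> 0.
Proof.
move=> h; have /psumr_eq0P : wn 0 u = 0 by apply/eqP; rewrite eq_le h wn_ge0.
move=> e; apply/funext => n; have := e _ n isT; rewrite expr0 mul1r /nsq.
move=> e'; have /eqP := e' (fun i _ => mulr_ge0 (lamX_ge0 lam1 0 i) (nsq_ge0 _)).
by rewrite paddr_eq0 ?sqr_ge0// !sqrf_eq0 => /andP[/eqP a /eqP b']; apply: complex_eq.
Qed.

Lemma cayT_inj h x u : cayT h x u = (fun=> 0) -> u = fun=> 0.
Proof.
move=> e; apply: wn0_eq0; have := cay_norm h x u; rewrite e.
have -> : wn 0 (fun=> 0) = 0 by rewrite [LHS]big1// => n _; rewrite /nsq !expr0n /= addr0 mulr0.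
have := wn_ge0 lam1 0 (ham h x u); move: (wn 0 _) (wn 0 _) => p q; lra.
Qed.

Definition cayR h x : V -> V := linv (cayT h x).

Lemma cayRK h x u : cayT h x (cayR h x u) = u.
Proof. by apply: linvK; [exact: cayT_lin|exact: cayT_inj]. Qed.

Lemma cayKR h x u : cayR h x (cayT h x u) = u.
Proof. by apply: Klinv; [exact: cayT_lin|exact: cayT_inj]. Qed.

Lemma cayR_contract h x u : wn 0 (cayR h x u) <= wn 0 u.
Proof. by rewrite -[in leRHS](cayRK h x u) cay_norm lerDl wn_ge0. Qed.

Definition cayS h x u : V := cayR h x (fun n => u n - 'i%C * ham h x u n).

(** The inverse of 1 + iH commutes with 1 - iH. With p = T^-1 c one has c = p + iHp and S c = p -
    iHp, the symmetric form behind [energy_identity]. *)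
Lemma cayS_E h x u : cayS h x u = fun n => cayR h x u n - 'i%C * ham h x (cayR h x u) n.
Proof.
rewrite /cayS; set v := cayR h x u; rewrite -(cayKR h x (fun n => v n - _)); congr cayR.
rewrite -(cayRK h x u) -/v; have HL := ham_lin h x.
have E a : ham h x (fun n => v n + a * ham h x v n) = fun n => ham h x v n + a * ham h x (ham h x v) n.
  have := HL a (ham h x v) v; under eq_fun do rewrite addrC.
  by move=> ->; apply/funext => n; rewrite addrC.
apply/funext => n; rewrite /cayT.
under [X in _ = _ - _ + _ * ham h x X n]eq_fun do rewrite -mulNr.
rewrite !E; move: (ham h x v n) (ham h x _ n) => p q; ring.
Qed.

(* For H = ham h x, the adjoint of (1 + iH)^-1 is (1 - iH)^-1 = (1 + i ham (-h) (-x))^-1 *)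
Lemma cayR_adj h x u v : rip 0 (cayR h x u) v = rip 0 u (cayR (- h) (- x) v).
Proof.
have key p q : rip 0 p (cayT (- h) (- x) q) = rip 0 (cayT h x p) q.
  rewrite (ripDr lam 0 p q (mulI (ham (- h) (- x) q))) ripC [in RHS]ripC.
  rewrite (ripDr lam 0 q p (mulI (ham h x p))); congr (_ + _).
  rewrite (_ : mulI (ham (- h) (- x) q) = fun n => - mulI (ham h x q) n); last first.
    apply/funext => n; rewrite /mulI /ham !mulNr !rmorphN /=; move: (b q n) (Lop 1 q n) => s t; ring.
  by rewrite ripNr -ham_mulI -ham_rip -rip_mulI ripC.
by rewrite -[in LHS](cayRK (- h) (- x) v) key cayRK.
Qed.

Lemma lam_sum n : lam n <= \sum_m lam m.
Proof. by rewrite (bigD1 n)//= lerDl sumr_ge0// => m _; exact: lam_ge0'. Qed.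

Lemma cayR_scale j h x : (forall u, wn j (cayR h x u) <= 2 * wn j u) ->
  forall k u, (k <= j)%N -> wn k (cayR h x u) <= 2 * wn k u.
Proof.
(* For k <= j the squared Sigma^k norm is at most M^j times the squared L^2 norm. This bound depends
   on the dimension, but interpolation forgets it. *)
move=> Hj; pose M := Num.max 1 (\sum_m lam m).
have M1 : 1 <= M by rewrite le_max lexx.
apply: (@scale_interpolation _ _ lam lam1 j (M ^+ j) _ (cayR (- h) (- x))) => //.
- exact: cayR_adj.
- move=> k u kj; apply: (@le_trans _ _ (M ^+ j * wn 0 (cayR h x u))).
    rewrite mulr_sumr; apply: ler_sum => n _; rewrite expr0 mul1r ler_wpM2r ?nsq_ge0//.
    rewrite (le_trans _ (ler_weXn2l M1 kj))// lerXn2r ?nnegrE ?lam_ge0'// ?(le_trans ler01)//.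
    by rewrite le_max lam_sum orbT.
  rewrite ler_wpM2l ?exprn_ge0 ?(le_trans ler01 M1)//.
  by rewrite (le_trans (cayR_contract h x u))// wn_le.
- by move=> u; rewrite (le_trans (cayR_contract h x u))// ler_peMl ?wn_ge0//; lra.
Qed.

End cayley.

(** * Scalar inequalities for one step *)

Section energy_numeric.
Context {R : realFieldType}.

(** The left side is the remainder of [energy_step]. Young's inequality splits its products into
    squares; h^2 K^2 and h^4 K^4 are at most multiples of [h] because K^4 h <= kap, and |x|^3 K^2
    leaves the term x^4 K^4. *)
Lemma drift_bound (C h x K kap : R) : 0 <= C -> 0 <= h <= 1 -> 0 <= K -> K ^+ 4 * h <= kap ->
  `|x| * (2 * (6 * C * h * K + C * `|x| + C * (18 * h ^+ 2 * K ^+ 2 + C ^+ 2 * K ^+ 2 * x ^+ 2 / 2))) <=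
  (24 * C * (1 + kap) + 26 * C + C ^+ 3) * (h + x ^+ 2 + x ^+ 4 * K ^+ 4).
Proof.
move=> C0 /andP[h0 h1] K0 hk.
rewrite -(real_normK (num_real x)) (_ : x ^+ 4 = `|x| ^+ 4); last first.
  by rewrite -[4%N]/(2 * 2)%N !exprM real_normK ?num_real.
move: `|x| (normr_ge0 x) => y y0.
have k0 : 0 <= kap by apply: le_trans hk; rewrite mulr_ge0// exprn_ge0.
have hh : h ^+ 2 <= h by rewrite expr2 ler_piMr.
have hK2 : h ^+ 2 * K ^+ 2 <= h * (1 + kap).
  apply: (@le_trans _ _ (h ^+ 2 * (1 + K ^+ 4))).
    rewrite ler_wpM2l ?sqr_ge0// (_ : K ^+ 4 = K ^+ 2 * K ^+ 2); last by rewrite -exprD.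
    by move: (K ^+ 2) (sqr_ge0 K) => k k0'; have := sqr_ge0 (k - 1); nra.
  by rewrite mulrDr mulr1 mulrDr mulr1 lerD// expr2 -mulrA ler_wpM2l// mulrC.
have h4 : h ^+ 4 * K ^+ 4 <= h * kap.
  rewrite exprSr -mulrA (mulrC h) (le_trans (ler_wpM2l (exprn_ge0 3 h0) hk))//.
  rewrite ler_wpM2r// exprS ler_piMr// (le_trans hh)//.
have T1 : y * h * K * 2 <= y ^+ 2 + h ^+ 2 * K ^+ 2.
  by rewrite -exprMn; move: (h * K) (mulrA y h K) => p <-; have := sqr_ge0 (y - p); nra.
have T3 : y * (h ^+ 2 * K ^+ 2) * 2 <= y ^+ 2 + h ^+ 4 * K ^+ 4.
  rewrite (_ : h ^+ 4 * K ^+ 4 = (h ^+ 2 * K ^+ 2) ^+ 2); last by rewrite exprMn -!exprM.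
  by move: (h ^+ 2 * _) => p; have := sqr_ge0 (y - p); nra.
have T4 : y ^+ 3 * K ^+ 2 * 2 <= y ^+ 2 + y ^+ 4 * K ^+ 4.
  rewrite (_ : y ^+ 4 * K ^+ 4 = (y ^+ 2 * K ^+ 2) ^+ 2); last by rewrite exprMn -!exprM.
  rewrite (_ : y ^+ 3 * K ^+ 2 = y * (y * (y * K ^+ 2))); last by ring.
  rewrite (_ : y ^+ 2 * K ^+ 2 = y * (y * K ^+ 2)); last by ring.
  by move: (y * (y * K ^+ 2)) => p; have := sqr_ge0 (y - p); nra.
set a := y ^+ 2 in T1 T3 T4 *; have a0 : 0 <= a by exact: sqr_ge0.
set q := y ^+ 4 * K ^+ 4 in T4 *; have q0 : 0 <= q by rewrite mulr_ge0// exprn_ge0.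
rewrite (_ : y * _ = 6 * C * (y * h * K * 2) + 2 * C * a + 18 * C * (y * (h ^+ 2 * K ^+ 2) * 2) +
  (C ^+ 3 / 2) * (y ^+ 3 * K ^+ 2 * 2)); last by rewrite /a; field.
have C3 : 0 <= C ^+ 3 by rewrite exprn_ge0.
have S1 : 6 * C * (y * h * K * 2) <= 6 * C * (a + h * (1 + kap)).
  by rewrite ler_wpM2l ?mulr_ge0// (le_trans T1)// lerD2l.
have S3 : 18 * C * (y * (h ^+ 2 * K ^+ 2) * 2) <= 18 * C * (a + h * kap).
  by rewrite ler_wpM2l ?mulr_ge0// (le_trans T3)// lerD2l.
have S4 : (C ^+ 3 / 2) * (y ^+ 3 * K ^+ 2 * 2) <= (C ^+ 3 / 2) * (a + q).
  by rewrite ler_wpM2l// divr_ge0.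
apply: (le_trans (lerD (lerD (lerD S1 (lexx _)) S3) S4)).
move: (C ^+ 3) C3 => c3 c30.
have e1 : 0 <= C * a by rewrite mulr_ge0. have e2 : 0 <= C * h by rewrite mulr_ge0.
have e3 : 0 <= C * q by rewrite mulr_ge0. have e4 : 0 <= C * kap * a by rewrite !mulr_ge0.
have e5 : 0 <= C * kap * h by rewrite !mulr_ge0. have e6 : 0 <= C * kap * q by rewrite !mulr_ge0.
have e7 : 0 <= c3 * a by rewrite mulr_ge0. have e8 : 0 <= c3 * h by rewrite mulr_ge0.
have e9 : 0 <= c3 * q by rewrite mulr_ge0.
rewrite -subr_ge0.
rewrite (_ : _ - _ = 24 * (C * kap * a) + 24 * (C * kap * q) + 24 * (C * a) + 50 * (C * q) + 44 * (C * h) +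
  (C * kap * h) * 0 + (c3 * a) / 2 + (c3 * q) / 2 + c3 * h); last by field.
lra.
Qed.

(** Here [a], [s], [r], [p] stand for the squared norms of the old value c, of S c, of T^-1 applied
    to the nonlinearity, and of the new value. Since 8 Cg h <= 1, the terms in [p] are absorbed on
    the left, which gives p <= 16 a with room to spare; inserted once more, this gives 68 = 4 (1 +
    16). *)
Lemma implicit_step (h Cg a s r p : R) : 0 <= h <= 1 -> 0 <= Cg -> 8 * Cg * h <= 1 -> 0 <= a -> 0 <= p ->
  s <= 2 * a -> r <= 2 * (Cg * (a + p)) -> p <= (1 + h) * s + (h + h ^+ 2) * r ->
  p <= 16 * a /\ p <= s + (2 * h + 68 * (Cg * h)) * a.
Proof.
move=> /andP[h0 h1] Cg0 hC a0 p0 sa rp pp.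
have hh : h ^+ 2 <= h by rewrite expr2 ler_piMr.
have g0 : 0 <= Cg * h by rewrite mulr_ge0.
have e1 : (h + h ^+ 2) * r <= 4 * (Cg * h) * (a + p).
  apply: (@le_trans _ _ ((h + h ^+ 2) * (2 * (Cg * (a + p))))).
    by rewrite ler_wpM2l// addr_ge0// sqr_ge0.
  apply: (@le_trans _ _ ((h + h) * (2 * (Cg * (a + p))))).
    by rewrite ler_wpM2r ?lerD2l// !mulr_ge0// addr_ge0.
  by rewrite le_eqVlt; apply/orP; left; apply/eqP; ring.
have e2 : h * s <= 2 * h * a by rewrite (mulrC 2) -mulrA ler_wpM2l.
have pb : p <= s + 2 * h * a + 4 * (Cg * h) * (a + p) by lra.
rewrite -mulrA in hC; move: (Cg * h) g0 hC pb {e1} => g g0 hC pb.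
have q1 : 4 * g * (a + p) <= (a + p) / 2.
  by rewrite mulrC ler_wpM2l ?addr_ge0//; lra.
have q2 : 2 * h * a <= 2 * a by rewrite -mulrA ler_wpM2l// ler_piMl.
have p16 : p <= 16 * a by lra.
split => //; apply: (le_trans pb).
have q3 : 4 * g * (a + p) <= 4 * g * (17 * a) by rewrite ler_wpM2l ?mulr_ge0//; lra.
lra.
Qed.

End energy_numeric.

(** * Energy balance of the linear step *)

Section energy.
Context {R : realType} {I : finType}.
Variable lam : I -> R.
Hypothesis lam1 : forall n, 1 <= lam n.
Local Notation V := (I -> R[i]).
Local Notation wn := (wn lam).
Local Notation rip := (rip lam).
Local Notation Lop := (lamop lam).
Variable b : V -> V.
Hypothesis blin : clinear b.
Hypothesis bsym : forall u v, \sum_n b u n * conjc (v n) = \sum_n u n * conjc (b v n).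
Variables (j : nat) (C K : R).
Hypotheses (C0 : 0 < C) (K0 : 0 <= K).
Implicit Types (u v c : V) (h x : R).

Definition comm u : V := fun n => (lam n ^+ j)%:C * b u n - b (Lop j u) n.

Hypothesis lamK : forall n, lam n <= 6 * K.
Hypothesis hb2 : forall u, wn j (b u) <= (C * K) ^+ 2 * wn j u.
Hypothesis hb3 : forall u, wn 0 (comm u) <= C ^+ 2 * wn (2 * j) u.
Hypothesis hb4 : forall u, `|rip 0 (comm u) (b u)| <= C * wn j u.

(** Equal to -2 Re <c, i B c> in Sigma^j ([mformE]): the first-order variation of the energy under
    the noise. The commutator form shows that it costs no factor [K]. *)
Definition mform c := rip 0 (comm c) (mulI c).

Lemma ripBl u v w : rip 0 (fun n => u n - v n) w = rip 0 u w - rip 0 v w.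
Proof. by rewrite ripC (ripDr lam 0 w u (fun n => - v n)) ripNr ripC [X in _ - X]ripC. Qed.

Lemma comm_ripE u v : rip 0 (comm u) v = rip j (b u) v - rip 0 (Lop j u) (b v).
Proof. by rewrite (ripBl (Lop j (b u))) (b_rip lam bsym) Lop_rip add0n. Qed.

Lemma comm_anti u v : rip 0 (comm u) v = - rip 0 u (comm v).
Proof.
by rewrite comm_ripE [in RHS]ripC comm_ripE Lop_rip Lop_rip add0n opprB ripC [in X in _ - X]ripC.
Qed.

(** The operator A^-j [A^j, B] is skew for the Sigma^j form, and the hypothesis that [A^j, B] maps
    Sigma^2j to L^2 says that it is bounded on Sigma^2j. [krein] asks for symmetry up to sign only
    and moves the bound to Sigma^j. *)
Lemma comm_bound u v : rip 0 (comm u) v ^+ 2 <= C ^+ 2 * wn j u * wn j v.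
Proof.
pose Q u : V := fun n => ((lam n ^+ j)^-1)%:C * comm u n.
have ln0 p n : lam n ^+ p != 0 by rewrite expf_neq0// gt_eqF// (lt_le_trans ltr01).
have QE w z : rip j (Q w) z = rip 0 (comm w) z.
  apply: eq_bigr => n _; rewrite Re_real_mul Im_real_mul expr0.
  by move: (ln0 j n); move: (lam n ^+ j) => l l0; field.
have K1 : forall w, wn j (Q w) <= C ^+ 2 * wn j w.
  apply: (krein lam1 (_ : j <= 2 * j)%N) => //; first by rewrite mul2n -addnn leq_addl.
  - by rewrite exprn_gt0.
  - by move=> w z; rewrite QE [in RHS]ripC QE comm_anti normrN ripC.
  move=> w; rewrite (_ : wn _ (Q w) = wn 0 (comm w))//.
  apply: eq_bigr => n _; rewrite nsqZ expr0 mul1r mulrA exprVn mulnC exprM mulfV ?mul1r//.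
  by rewrite expf_neq0.
rewrite -QE (le_trans (rip_CS lam1 _ _ _))// ler_wpM2r ?wn_ge0//.
Qed.

Lemma comm_bound' u v (p B : R) : 0 <= p -> wn j u <= B -> wn j v <= p ^+ 2 * B ->
  `|rip 0 (comm u) v| <= C * p * B.
Proof.
move=> p0 uB vB; have B0 := le_trans (wn_ge0 lam1 j u) uB.
rewrite -(@ler_pXn2r _ 2)// ?nnegrE ?mulr_ge0 ?(ltW C0)//.
rewrite real_normK ?num_real// (le_trans (comm_bound u v))//.
rewrite (_ : (C * p * B) ^+ 2 = C ^+ 2 * B * (p ^+ 2 * B)); last by ring.
apply: ler_pM; [|exact: wn_ge0| |exact: vB].
  by rewrite mulr_ge0 ?wn_ge0 ?sqr_ge0.
by rewrite ler_wpM2l ?sqr_ge0.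
Qed.

Lemma comm_mulI u : comm (mulI u) = mulI (comm u).
Proof.
apply/funext => n; rewrite /comm (_ : Lop j (mulI u) = mulI (Lop j u)).
  by rewrite !(b_mulI blin) /mulI; move: (b u n) (b _ n) => p q; ring.
by apply/funext => m; rewrite /lamop /mulI; ring.
Qed.

Lemma comm_add u v : comm (fun n => u n + v n) = fun n => comm u n + comm v n.
Proof.
have BL u' v' : b (fun n => u' n + v' n) = fun n => b u' n + b v' n.
  have := blin 1 u' v'; under eq_fun do rewrite mul1r.
  by move=> ->; apply/funext => n; rewrite mul1r.
apply/funext => n; rewrite /comm BL (_ : Lop j _ = fun n => Lop j u n + Lop j v n).
  by rewrite BL; move: (b u n) (b v n) (b _ n) (b _ n) => p q r s; ring.
by apply/funext => m; rewrite /lamop mulrDr.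
Qed.

Lemma mform_mulI u : mform (mulI u) = mform u.
Proof. by rewrite /mform comm_mulI rip_mulI mulIK ripNr opprK. Qed.

Lemma mform_add u v : mform (fun n => u n + v n) = mform u + 2 * rip 0 (comm u) (mulI v) + mform v.
Proof.
rewrite /mform comm_add (_ : mulI (fun n => u n + v n) = fun n => mulI u n + mulI v n); last first.
  by apply/funext => n; rewrite /mulI mulrDr.
have DL u' v' w' : rip 0 (fun n => u' n + v' n) w' = rip 0 u' w' + rip 0 v' w'.
  by rewrite ripC ripDr ripC [X in _ + X]ripC.
rewrite DL !ripDr (_ : rip 0 (comm v) (mulI u) = rip 0 (comm u) (mulI v)).
  by move: (rip _ _ _) (rip _ _ _) (rip _ _ _) => p q r; ring.
by rewrite comm_anti comm_mulI -rip_mulI ripC.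
Qed.

Lemma mformE u : mform u = - 2 * rip j u (mulI (b u)).
Proof.
rewrite /mform comm_ripE (b_mulI blin) Lop_rip add0n ripC rip_mulI.
by rewrite -/(rip _ _ _); move: (rip _ _ _) => r; ring.
Qed.

Lemma mform_bound u : `|mform u| <= C * wn j u.
Proof.
rewrite -[C]mulr1; apply: comm_bound' => //.
by rewrite wn_mulI expr1n mul1r.
Qed.

(** Eigenvalues are at most 6K and B costs C K; doubling for the sum of two terms gives 18 = 2
    (6/2)^2 and 1/2 = 2 (1/2)^2. *)
Lemma ham_wn h x u : wn j (ham lam b h x u) <= (18 * h ^+ 2 * K ^+ 2 + C ^+ 2 * K ^+ 2 * x ^+ 2 / 2) * wn j u.
Proof.
have L1 : wn j (Lop 1 u) <= (6 * K) ^+ 2 * wn j u.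
  rewrite mulr_sumr; apply: ler_sum => n _; rewrite nsqZ expr1 mulrCA.
  rewrite ler_wpM2r ?mulr_ge0 ?lamX_ge0 ?nsq_ge0// lerXn2r ?nnegrE ?lam_ge0'// mulr_ge0//.
rewrite (wnD lam j (fun n => (h / 2)%:C * Lop 1 u n) (fun n => (x / 2)%:C * b u n)).
set p := fun n => (h / 2)%:C * _; set q := fun n => (x / 2)%:C * _.
have r2 : 2 * rip j p q <= wn j p + wn j q.
  have := wn_ge0 lam1 j (fun n => p n + (fun n => - q n) n); rewrite wnD ripNr.
  rewrite (_ : wn j (fun n => - q n) = wn j q); last by apply: eq_bigr => n _; rewrite /nsq ReN ImN !sqrrN.
  by move: (rip _ _ _) (wn j p) (wn j q) => *; lra.
have P1 : wn j p <= (h / 2) ^+ 2 * ((6 * K) ^+ 2 * wn j u) by rewrite wnZ ler_wpM2l ?sqr_ge0.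
have P2 : wn j q <= (x / 2) ^+ 2 * ((C * K) ^+ 2 * wn j u) by rewrite wnZ ler_wpM2l ?sqr_ge0.
rewrite (_ : _ * wn j u = 2 * ((h / 2) ^+ 2 * ((6 * K) ^+ 2 * wn j u)) + 2 * ((x / 2) ^+ 2 * ((C * K) ^+ 2 * wn j u))); last by field.
by move: (rip _ _ _) (wn j p) (wn j q) P1 P2 r2 => *; lra.
Qed.

(** The energies of p - iHp and p + iHp differ by -4 Re <p, iHp>. The part of H with A drops out, A
    being diagonal and real, and the part with B is x times [mform], taken at p and not at [c]. *)
Lemma energy_identity h x c : let p := cayR lam b h x c in
  wn j (cayS lam b h x c) = wn j c + x * mform p.
Proof.
move=> p; rewrite (cayS_E lam1 blin bsym) -[in RHS](cayRK lam1 blin bsym h x c) -/p.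
set q := mulI (ham lam b h x p).
rewrite (_ : (fun n => _ - _) = fun n => p n + (fun n => - q n) n)// (_ : cayT _ _ _ _ p = fun n => p n + q n)//.
rewrite !wnD ripNr (_ : wn j (fun n => - q n) = wn j q); last by apply: eq_bigr => n _; rewrite /nsq ReN ImN !sqrrN.
have -> : rip j p q = x / 2 * rip j p (mulI (b p)).
  rewrite (_ : q = fun n => (h / 2)%:C * mulI (Lop 1 p) n + (x / 2)%:C * mulI (b p) n); last first.
    by apply/funext => n; rewrite /q /ham /mulI; move: (b p n) (Lop 1 p n) => s t; ring.
  rewrite ripDr !ripZr (_ : mulI (Lop 1 p) = Lop 1 (mulI p)); last first.
    by apply/funext => n; rewrite /mulI /lamop; ring.
  by rewrite Lop_ripr rip_mulI0 mulr0 add0r.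
by rewrite mformE; move: (rip _ _ _) (wn j p) (wn j q) => *; field.
Qed.

(** The point is to replace p = T^-1 c, which depends on the increment, by [c]. As c = p + iHp, the
    forms at the two points differ by 2 <[A^j, B] p, H p> and the form at H p. In the first, the A
    part is bounded through the eigenvalues, and the B part is Re <[A^j, B] p, B p>, bounded by
    hypothesis without a factor [K]. *)
Lemma energy_step h x c : 0 <= h -> wn j (cayR lam b h x c) <= 2 * wn j c ->
  wn j (cayS lam b h x c) <= wn j c + x * mform c +
   `|x| * (2 * (6 * C * h * K + C * `|x| + C * (18 * h ^+ 2 * K ^+ 2 + C ^+ 2 * K ^+ 2 * x ^+ 2 / 2))) * wn j c.
Proof.
move=> h0 Hp; rewrite energy_identity; set p := cayR _ _ _ _ _ in Hp *.
have e : mform c = mform p - 2 * rip 0 (comm p) (ham lam b h x p) + mform (ham lam b h x p).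
  rewrite -[in LHS](cayRK lam1 blin bsym h x c) -/p (_ : cayT _ _ _ _ p = fun n => p n + mulI (ham lam b h x p) n)//.
  by rewrite mform_add mform_mulI mulIK ripNr mulrN.
have -> : mform p = mform c + 2 * rip 0 (comm p) (ham lam b h x p) - mform (ham lam b h x p).
  by rewrite e; move: (rip _ _ _) (mform _) (mform _) => *; ring.
set G := 6 * C * h * K + _ + _.
have r1 : `|rip 0 (comm p) (Lop 1 p)| <= C * (6 * K) * wn j p.
  apply: comm_bound' => //; first by rewrite mulr_ge0.
  rewrite mulr_sumr; apply: ler_sum => n _; rewrite nsqZ expr1 mulrCA.
  rewrite ler_wpM2r ?mulr_ge0 ?lamX_ge0 ?nsq_ge0// lerXn2r ?nnegrE ?lam_ge0'// mulr_ge0//.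
have r2 : `|2 * rip 0 (comm p) (ham lam b h x p)| <= (6 * C * h * K + C * `|x|) * wn j p.
  rewrite /ham ripDr !ripZr mulrDr !mulrA (le_trans (ler_normD _ _))// [leRHS]mulrDl.
  rewrite (_ : 2 * h / 2 = h); last by field. rewrite (_ : 2 * x / 2 = x); last by field.
  rewrite !normrM (ger0_norm h0); apply: lerD.
    by rewrite (le_trans (ler_wpM2l h0 r1))// le_eqVlt; apply/orP; left; apply/eqP; ring.
  by rewrite (mulrC C) -mulrA ler_wpM2l.
have r3 : `|mform (ham lam b h x p)| <= C * (18 * h ^+ 2 * K ^+ 2 + C ^+ 2 * K ^+ 2 * x ^+ 2 / 2) * wn j p.
  by rewrite (le_trans (mform_bound _))// -mulrA ler_wpM2l ?ham_wn// ltW.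
have D : `|2 * rip 0 (comm p) (ham lam b h x p) - mform (ham lam b h x p)| <= 2 * G * wn j c.
  rewrite (le_trans (ler_normB _ _))// (le_trans (lerD r2 r3))// -mulrDl -/G.
  rewrite (mulrC 2) -mulrA ler_wpM2l// /G !addr_ge0 ?mulr_ge0 ?(ltW C0)//.
  by apply: addr_ge0; [|apply: divr_ge0 => //]; apply: mulr_ge0; rewrite ?sqr_ge0//; apply: mulr_ge0; rewrite ?sqr_ge0.
rewrite -[X in x * X]addrA mulrDr addrA lerD2l (le_trans (ler_norm _))// normrM -[leRHS]mulrA ler_wpM2l//.
Qed.

End energy.

(** * Pointwise bounds for Hermite expansions *)

Section agmon.
Context {R : realType}.
Local Notation mu := (@lebesgue_measure R).
Implicit Types (x t : R) (l n : nat).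

(** Integration of the derivative of f^2 from [x] to a far point, where f is small by decay, bounds
    f(x)^2 by the integral of 2 |f g|; the parameter [tau] balances the two factors. *)
Lemma agmon (f g : R -> R) (C tau x : R) : 0 < tau ->
  (forall y : R, is_derive y (1 : R) f (g y)) -> continuous g ->
  (forall y, `|f y| <= C * (1 + y ^+ 2)^-1) ->
  rint mu (fun y => f y ^+ 2) -> rint mu (fun y => g y ^+ 2) ->
  f x ^+ 2 <= tau * \int[mu]_y (f y ^+ 2) + tau^-1 * \int[mu]_y (g y ^+ 2).
Proof.
move=> t0 fg cg fC f2 g2; have cf := is_derive_continuous1 fg.
pose G y := 2 * (f y * g y).
have cG : continuous G.
  by apply: continuous_mul; [exact: continuous_const|exact: continuous_mul].
have fG y : is_derive y (1 : R) (fun z => f z ^+ 2) (G y).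
  have [e1 e2] := is_deriveM (fg y) (fg y); split; first exact: e1.
  by rewrite [LHS]e2 /G -![_ *: _]/(_ * _); ring.
have mfi : measurable_fun setT f by exact: continuous_measurable_fun.
have mgi : measurable_fun setT g by exact: continuous_measurable_fun.
have iG : rint mu G by apply: rintZ; apply: rintM.
have bound b : x < b -> f x ^+ 2 <= f b ^+ 2 + \int[mu]_y `|G y|.
  move=> xb; have E : \int[mu]_y (G y * \1_(`[x, b]%classic) y) = f b ^+ 2 - f x ^+ 2.
    rewrite (_ : \int[mu]_y _ = \int[mu]_(y in `[x, b]%classic) G y); last first.
      rewrite [RHS]Rintegral_mkcond; apply: eq_Rintegral => y _.
      by rewrite patchE indicE; case: ifPn => _; rewrite ?mulr1 ?mulr0.
    have c2 : continuous (fun z : R => f z ^+ 2) by exact: is_derive_continuous1 fG.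
    rewrite /Rintegral (@continuous_FTC2 _ G (fun z => f z ^+ 2))//.
    - exact: continuous_subspaceT.
    - split => //.
      + by apply: cvg_at_right_filter; exact: c2.
      + by apply: cvg_at_left_filter; exact: c2.
    - by move=> y _; rewrite derive1E; apply: derive_val.
  have : - (\int[mu]_y (G y * \1_(`[x, b]%classic) y)) <= \int[mu]_y `|G y|.
    have iI : rint mu (fun y => G y * \1_(`[x, b]%classic) y).
      apply: rint_le (rint_norm iG).
        apply: measurable_funM; first exact: continuous_measurable_fun.
        by apply: measurable_indic; exact: measurable_itv.
      move=> y; rewrite normrM indicE; case: (_ \in _) => /=; first by rewrite normr1 mulr1.
      by rewrite normr0 mulr0.
    rewrite -IntN//; apply: Int_le; [exact: rintN|exact: rint_norm|move=> y].
    rewrite indicE; case: (_ \in _) => /=; last by rewrite mulr0 oppr0.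
    by rewrite mulr1 -normrN ler_norm.
  by rewrite E; move: (\int[mu]_y _) => p; lra.
have small e : 0 < e -> exists2 b, x < b & f b ^+ 2 <= e.
  move=> e0; have C0 : 0 <= C by have := le_trans (normr_ge0 _) (fC 0); rewrite expr0n /= addr0 invr1 mulr1.
  (* Chosen so that f(b)^2 <= C^2/b <= e. *)
  pose b := `|x| + 1 + (1 + C ^+ 2) / e; exists b.
    have := ler_norm x; have : 0 <= (1 + C ^+ 2) / e by rewrite divr_ge0 ?addr_ge0 ?sqr_ge0// ltW.
    by rewrite /b; lra.
  have b1 : 1 + (1 + C ^+ 2) / e <= b by rewrite /b -addrA lerDr.
  have c2 : 0 <= (1 + C ^+ 2) / e by rewrite divr_ge0 ?addr_ge0 ?sqr_ge0// ltW.
  have b0 : 0 < b by lra.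
  rewrite -(real_normK (num_real _)) (@le_trans _ _ ((C * (1 + b ^+ 2)^-1) ^+ 2))//.
    by rewrite lerXn2r ?nnegrE// (le_trans _ (fC b)).
  have i1 : (1 + b ^+ 2)^-1 <= 1 by rewrite invf_le1 ?lerDl ?sqr_ge0// ltr_wpDr// sqr_ge0.
  have i2 : (1 + b ^+ 2)^-1 <= b^-1.
    by rewrite lef_pV2 ?posrE// ?ltr_wpDr ?sqr_ge0//; nra.
  have i0 : 0 <= (1 + b ^+ 2)^-1 by rewrite invr_ge0 addr_ge0// sqr_ge0.
  rewrite exprMn (@le_trans _ _ (C ^+ 2 * b^-1))// ?ler_wpM2l ?sqr_ge0//.
    by rewrite expr2 (le_trans _ i2)// ler_piMr.
  rewrite ler_pdivrMr// (@le_trans _ _ (e * (1 + (1 + C ^+ 2) / e)))//; last by rewrite ler_wpM2l// ltW.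
  by rewrite mulrDr mulr1 mulrCA divff ?gt_eqF// mulr1; lra.
have sup : f x ^+ 2 <= \int[mu]_y `|G y|.
  apply/ler_addgt0Pr => e e0; have [b xb fb] := small e e0.
  by rewrite (le_trans (bound b xb))// addrC lerD2l.
apply: (le_trans sup); rewrite -IntZ// -IntZ// -IntD; [|exact: rintZ|exact: rintZ].
apply: Int_le; [exact: rint_norm|by apply: rintD; exact: rintZ|move=> y].
have ti : 0 < tau^-1 by rewrite invr_gt0.
have key p q : 2 * (p * q) <= tau * p ^+ 2 + tau^-1 * q ^+ 2.
  have := mulr_ge0 (ltW ti) (sqr_ge0 (tau * p - q)).
  rewrite (_ : _ * _ ^+ 2 = tau * p ^+ 2 + tau^-1 * q ^+ 2 - 2 * (p * q)) ?subr_ge0//.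
  by field; rewrite gt_eqF.
by rewrite ler_norml /G key andbT lerNl -mulrN -mulNr (le_trans (key _ _))// sqrrN.
Qed.

(** The indices [f l] may repeat if one of the two coefficients vanishes: in the lowered sum l = 0
    and l = 1 both give the index 0, and the former comes with [hs 0] = 0. *)
Lemma hermite_span_norm n (a : 'I_n -> R) (f : 'I_n -> nat) :
  (forall l l' : 'I_n, l != l' -> a l * a l' * (f l == f l')%:R = 0) ->
  let F x := \sum_(l < n) a l * hermite (f l) x in
  rint mu (fun x => F x ^+ 2) /\ \int[mu]_x (F x ^+ 2) = \sum_(l < n) a l ^+ 2.
Proof.
move=> af F.
have E x : F x ^+ 2 = \sum_(l < n) \sum_(k < n) a l * a k * (hermite (f l) x * hermite (f k) x).
  rewrite expr2 /F mulr_suml; apply: eq_bigr => l _; rewrite mulr_sumr; apply: eq_bigr => k _.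
  by move: (hermite _ _) (hermite _ _) => p q; ring.
have r (l k : 'I_n) : rint mu (fun x => a l * a k * (hermite (f l) x * hermite (f k) x)).
  by apply: rintZ; exact: rint_hermiteM.
under eq_fun do rewrite E; split; first by apply: rint_sum => l _; apply: rint_sum => k _; exact: r.
rewrite Int_sum; last by move=> l _; apply: rint_sum => k _; exact: r.
apply: eq_bigr => l _; rewrite Int_sum; last by move=> k _; exact: r.
rewrite (bigD1 l)//= big1 ?addr0.
  by rewrite IntZ ?hermite_ortho ?eqxx ?mulr1 ?expr2//; exact: rint_hermiteM.
move=> k kl; rewrite IntZ ?hermite_ortho; last exact: rint_hermiteM.
by apply: af; rewrite eq_sym.
Qed.

(** Agmon's inequality with parameter [y] is applied at [x] to the reproducing kernel F(t), the sum
    of e_l(x) e_l(t) over l < n. There F(x) = S, the squared norm of F is S and that of its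
    derivative at most 2 y^2 S, so that S^2 <= 3 y S. *)
Lemma hermite_christoffel n x (y : R) : 0 < y -> n%:R <= y ^+ 2 ->
  \sum_(l < n) hermite l x ^+ 2 <= 4 * y.
Proof.
move=> y0 ny; pose a (l : 'I_n) : R := hermite l x; set S := \sum_(l < n) _.
pose F t := \sum_(l < n) a l * hermite l t.
pose P t := \sum_(l < n) (a l * hs l) * hermite l.-1 t.
pose Q t := \sum_(l < n) (a l * hs l.+1) * hermite l.+1 t.
have [rF iF] : rint mu (fun t => F t ^+ 2) /\ \int[mu]_t (F t ^+ 2) = \sum_(l < n) a l ^+ 2.
  apply: hermite_span_norm => l l' /eqP ll.
  by case: eqP => [/val_inj //|_]; rewrite mulr0.
have [rP iP] : rint mu (fun t => P t ^+ 2) /\ \int[mu]_t (P t ^+ 2) = \sum_(l < n) (a l * hs l) ^+ 2.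
  apply: hermite_span_norm => l l' ll.
  case: l l' ll => -[|l] hl [[|l'] hl'] ll /=; rewrite ?hs0 ?(mulr0, mul0r)//.
  have -> : (l.+1.-1 == l'.+1.-1) = false; last by rewrite mulr0.
  by apply/negbTE; apply: contraNneq ll => e; apply/eqP/val_inj; rewrite /= [l]e.
have [rQ iQ] : rint mu (fun t => Q t ^+ 2) /\ \int[mu]_t (Q t ^+ 2) = \sum_(l < n) (a l * hs l.+1) ^+ 2.
  apply: hermite_span_norm => l l' /eqP ll.
  by rewrite eqSS; case: eqP => [/val_inj //|_]; rewrite mulr0.
have S0 : 0 <= S by apply: sumr_ge0 => l _; exact: sqr_ge0.
have Fx : F x = S by apply: eq_bigr => l _; rewrite expr2.
have isd (b : 'I_n -> R) (f : 'I_n -> nat) t : is_derive t (1 : R) (fun t => \sum_(l < n) b l * hermite (f l) t)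
    (\sum_(l < n) b l * dhermite (f l) t).
  have := @is_derive_sum R R R n (fun l : 'I_n => b l *: (hermite (f l) : R -> R)) t 1 (fun l : 'I_n => b l * dhermite (f l) t)
    (fun l : 'I_n => is_deriveZ (b l) (hermite_is_derive (f l) t)).
  rewrite (_ : \sum_(l < n) _ *: _ = fun t => \sum_(l < n) b l * hermite (f l) t)//.
  by apply/funext => s; rewrite fct_sumE.
have dF t : is_derive t (1 : R) F (P t - Q t).
  have := isd a (fun l : 'I_n => l : nat) t.
  rewrite (_ : \sum_(l < n) _ = P t - Q t)// /P /Q -sumrB; apply: eq_bigr => l _.
  by rewrite /dhermite; move: (hermite _ _) (hermite _ _) => p q; ring.
have csum (b : 'I_n -> R) (f : 'I_n -> nat) : continuous (fun t => \sum_(l < n) b l * hermite (f l) t).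
  exact: is_derive_continuous1 (isd b f).
have cg : continuous (fun t => P t - Q t).
  rewrite (_ : (fun t => _) = fun t => P t + (- 1) * Q t); last by apply/funext => t; rewrite mulN1r.
  by apply: continuous_add; [exact: csum|apply: continuous_mul; [exact: continuous_const|exact: csum]].
have [C FC] : exists C, forall t, `|F t| <= C * (1 + t ^+ 2)^-1.
  pose c l := projT1 (cid (pgauss_bound ((hnorm l)%:P * hermite_poly l : {poly R}) 1)).
  have cP l t : `|hermite l t| <= c l * (1 + t ^+ 2)^-1.
    by rewrite hermiteE /c; case: cid => /= k /(_ t); rewrite expr1.
  exists (\sum_(l < n) `|a l| * c l) => t; rewrite mulr_suml (le_trans (ler_norm_sum _ _ _))//.
  by apply: ler_sum => l _; rewrite normrM -mulrA ler_wpM2l.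
have mP : measurable_fun setT P by apply: continuous_measurable_fun; exact: csum.
have mQ : measurable_fun setT Q by apply: continuous_measurable_fun; exact: csum.
have rPQ : rint mu (fun t => P t * Q t) by exact: rintM.
have r2 : rint mu (fun t => (P t - Q t) ^+ 2).
  have := rintD (rintD rP (rintZ (- 2) rPQ)) rQ; congr (rint _ _); apply/funext => t; ring.
have := agmon x y0 dF cg FC rF r2; rewrite Fx iF.
have I2 : \int[mu]_t ((P t - Q t) ^+ 2) <= 2 * (y ^+ 2 * S).
  apply: (@le_trans _ _ (\int[mu]_t (2 * P t ^+ 2 + 2 * Q t ^+ 2))).
    apply: Int_le => // [|t]; first by apply: rintD; exact: rintZ.
    by move: (P t) (Q t) => p q; have := sqr_ge0 (p + q); nra.
  rewrite IntD ?IntZ ?iP ?iQ//; try exact: rintZ.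
  rewrite -mulrDr ler_wpM2l// -big_split mulr_sumr; apply: ler_sum => l _ /=.
  have -> : (a l * hs l) ^+ 2 + (a l * hs l.+1) ^+ 2 = (l%:R / 2 + l.+1%:R / 2) * hermite l x ^+ 2.
    by rewrite !(exprMn _ (a l)) !hs_sqr -mulrDr mulrC.
  rewrite ler_wpM2r ?sqr_ge0// (le_trans _ ny)//.
  have : (l.+1%:R : R) <= n%:R by rewrite ler_nat.
  by rewrite -natr1; move: (l%:R : R) => p; lra.
rewrite -/S => h; have {}h : S ^+ 2 <= 3 * y * S.
  apply: (le_trans h); rewrite (_ : 3 * y * S = y * S + y^-1 * (2 * (y ^+ 2 * S))); last by field; rewrite gt_eqF.
  by rewrite lerD2l ler_wpM2l// invr_ge0 ltW.
have [->|Sn] := eqVneq S 0; first by rewrite mulr_ge0// ltW.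
have Sp : 0 < S by rewrite lt_neqAle eq_sym Sn.
by move: h; rewrite expr2 ler_pM2r// => h; rewrite (le_trans h)// ler_pM2r//; lra.
Qed.

End agmon.

(** * Weighted sums of squares of Hermite functions *)

Section sixth_root.
Context {R : realType}.

(** Sixth roots make all exponents integers: the Christoffel bound n^(1/2) is the third power, and
    the weight n^(-2/3), for which the sum converges, is the power -4. *)
Definition root6 (n : nat) : R := n%:R `^ 6^-1.

Lemma root6E n : root6 n ^+ 6 = n%:R.
Proof. by rewrite /root6 -powR_mulrn ?powR_ge0// -powRrM mulVf// powRr1. Qed.

Lemma root6_ge1 n : 1 <= root6 n.+1.
Proof.
rewrite -(@ler_pXn2r _ 6)// ?nnegrE ?powR_ge0// root6E expr1n.
by rewrite ler1n.
Qed.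

Lemma root6_le n : root6 n <= root6 n.+1.
Proof. by rewrite -(@ler_pXn2r _ 6)// ?nnegrE ?powR_ge0// !root6E ler_nat. Qed.

Lemma abel_term (y z : R) : 1 <= y -> y <= z ->
  (y ^- 4 - z ^- 4) * y ^+ 3 <= 4 * (y^-1 - z^-1).
Proof.
move=> y1 yz; have y0 : 0 < y by lra. have z0 : 0 < z by lra.
have -> : (y ^- 4 - z ^- 4) * y ^+ 3 = (y^-1 - z^-1) * ((1 + y / z) * (1 + (y / z) ^+ 2)).
  by field; rewrite !gt_eqF.
have t1 : y / z <= 1 by rewrite ler_pdivrMr ?mul1r.
have t0 : 0 <= y / z by rewrite divr_ge0// ltW.
rewrite mulrC ler_wpM2r//; first by rewrite subr_ge0 lef_pV2 ?posrE.
by move: (y / z) t0 t1 => t t0 t1; nra.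
Qed.

(** Abel summation: the partial sums are at most 4 m^(1/2), the weights are m^(-2/3), and
    [abel_term] bounds each term by a telescoping difference of m^(-1/6). The telescope contributes
    at most 16, the boundary term at most 4. *)
Lemma hermite_weighted_sum n (x : R) : \sum_(l < n) root6 l.+1 ^- 4 * hermite l x ^+ 2 <= 20.
Proof.
pose S m := \sum_(l < m) hermite l x ^+ 2 : R.
pose T m := \sum_(l < m) root6 l.+1 ^- 4 * hermite l x ^+ 2 : R.
have Sb m : S m.+1 <= 4 * root6 m.+1 ^+ 3.
  apply: hermite_christoffel; first by rewrite exprn_gt0// (lt_le_trans ltr01 (root6_ge1 m)).
  by rewrite -exprM root6E.
have Sle m : S m <= S m.+1 by rewrite /S big_ord_recr /= lerDl sqr_ge0.
have U m : T m - root6 m.+1 ^- 4 * S m <= 16 * (1 - (root6 m.+1)^-1).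
  elim: m => [|m IH].
    by rewrite /T /S !big_ord0 mulr0 subr0 /root6 powR1 invr1 subrr mulr0.
  have -> : T m.+1 - root6 m.+2 ^- 4 * S m.+1 = (T m - root6 m.+1 ^- 4 * S m) +
      (root6 m.+1 ^- 4 - root6 m.+2 ^- 4) * S m.+1.
    rewrite /T /S !big_ord_recr /=; move: (hermite _ _) (root6 m.+2 ^- 4) (root6 m.+1 ^- 4) => h a b.
    by move: (\sum_(i < m) _) (\sum_(i < m) _) => p q; ring.
  have y1 := root6_ge1 m; have yz := root6_le m.+1.
  have y0 : 0 < root6 m.+1 by lra.
  have w0 : 0 <= root6 m.+1 ^- 4 - root6 m.+2 ^- 4.
    rewrite subr_ge0 lef_pV2 ?posrE ?exprn_gt0 ?(lt_le_trans y0)//.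
    by rewrite lerXn2r ?nnegrE ?(le_trans (ltW y0))// ltW.
  have A := abel_term y1 yz.
  have B := ler_wpM2l w0 (Sb m).
  rewrite mulrCA in B; move: IH A B; move: (T m - _) (_ * S m.+1) (_ * root6 m.+1 ^+ 3) => p q r.
  by move: (root6 m.+1)^-1 (root6 m.+2)^-1 => s t; lra.
have y1 := root6_ge1 n; have y0 : 0 < root6 n.+1 by lra.
have i0 : 0 < (root6 n.+1)^-1 by rewrite invr_gt0.
have last : root6 n.+1 ^- 4 * S n <= 4 * (root6 n.+1)^-1.
  apply: (@le_trans _ _ (root6 n.+1 ^- 4 * (4 * root6 n.+1 ^+ 3))).
    by rewrite ler_wpM2l ?invr_ge0 ?exprn_ge0 ?(ltW y0)// (le_trans (Sle n)).
  by rewrite le_eqVlt; apply/orP; left; apply/eqP; field; rewrite gt_eqF.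
have i1 : (root6 n.+1)^-1 <= 1 by rewrite invf_le1.
have := U n; rewrite -/(T n); move: last; move: (_ * S n) (T n) => p q.
by move: (root6 n.+1)^-1 i0 i1 => s; lra.
Qed.

End sixth_root.

(** * Ladder operators and the sup-norm bound in dimension d *)

Section spans.
Context {R : realType} {d : nat}.
Local Notation X := 'rV[R]_d.
Local Notation leb := (@lebesgue_rV R d).
Local Notation idx := ('I_d -> nat).
Implicit Types (f g : X -> R) (i : 'I_d) (m : idx).

(** Arbitrary indices are allowed: the space for a fixed [K] is not stable under coordinates and
    derivatives, whereas the span of all Hermite functions is, and each of its elements lies in some
    box ([Span_hexpP]). *)
Definition lspan (s : seq (R * idx)) : X -> R := fun x => \sum_(t <- s) t.1 * hT t.2 x.

Definition Span f := exists s, f = lspan s.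

Lemma Span_schwartz f : Span f -> schwartz f.
Proof. by move=> [s ->]; apply: schwartz_sum => t _; apply: schwartzZ; exact: schwartz_hT. Qed.

Lemma Span_hexp K (c : {ffun 'I_d -> 'I_K} -> R) : Span (hexp c).
Proof.
exists [seq (c n, vidx n) | n <- index_enum {ffun 'I_d -> 'I_K}]; apply/funext => x.
by rewrite /lspan big_map.
Qed.

Lemma Span_flat (s : seq (R * idx)) (p : R * idx -> seq (R * idx)) (F : R * idx -> X -> R) f :
  (forall t x, F t x = lspan (p t) x) -> f = (fun x => \sum_(t <- s) F t x) -> Span f.
Proof.
move=> h ->; exists (flatten (map p s)); apply/funext => x.
by rewrite /lspan big_flatten big_map; apply: eq_bigr => t _; rewrite h.
Qed.

Lemma Span_X i f : Span f -> Span (fun x : X => x 0 i * f x).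
Proof.
move=> [s ->].
apply: (@Span_flat s (fun t => [:: (t.1 * hs (t.2 i), upd t.2 i (t.2 i).-1);
   (t.1 * hs (t.2 i).+1, upd t.2 i (t.2 i).+1)]) (fun t x => x 0 i * (t.1 * hT t.2 x))).
  move=> t x; rewrite /lspan !big_cons big_nil addr0 /= mulrCA hT_X.
  by rewrite mulrDr !mulrA.
by apply/funext => x; rewrite mulr_sumr.
Qed.

Lemma Span_partial i f : Span f -> Span (partial i f).
Proof.
move=> [s ->].
apply: (@Span_flat s (fun t => [:: (t.1 * hs (t.2 i), upd t.2 i (t.2 i).-1);
   (- (t.1 * hs (t.2 i).+1), upd t.2 i (t.2 i).+1)]) (fun t x => t.1 * partial i (hT t.2) x)).
  move=> t x; rewrite /lspan !big_cons big_nil addr0 /= hT_partial.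
  by rewrite mulrBr mulNr !mulrA.
rewrite /lspan schwartz_partial_sum; last by move=> t _; apply: schwartzZ; exact: schwartz_hT.
apply/funext => x; apply: eq_bigr => t _; rewrite schwartz_partialZ//; exact: schwartz_hT.
Qed.

Lemma Span_hexpP f : Span f -> exists K (c : {ffun 'I_d -> 'I_K} -> R), f = hexp c.
Proof.
move=> [s ->]; pose K := (\sum_(t <- s) \sum_i t.2 i)%N; exists K.+1.
pose nm m : {ffun 'I_d -> 'I_K.+1} := [ffun i => inord (m i)].
exists (fun n => \sum_(t <- s | nm t.2 == n) t.1).
apply/funext => x; rewrite /lspan /hexp.
under [RHS]eq_bigr do rewrite big_mkcond mulr_suml.
rewrite exchange_big /= big_seq [RHS]big_seq; apply: eq_bigr => t ts.
rewrite (bigD1 (nm t.2))//= eqxx big1 ?addr0; last first.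
  by move=> n; rewrite eq_sym => /negbTE ->; rewrite mul0r.
congr (_ * hT _ x); apply/funext => i; rewrite /vidx ffunE inordK// ltnS.
by rewrite /K (big_rem t)//= (bigD1 i)//= -addnA leq_addr.
Qed.

Lemma Nr_ge0 k f : 0 <= Nr k f.
Proof.
rewrite /Nr; case: ifP => _; last by apply: Int_ge0 => x; exact: sqr_ge0.
by apply: sumr_ge0 => i _; apply: addr_ge0; apply: Int_ge0 => x; exact: sqr_ge0.
Qed.

Lemma iterAopD k f g : schwartz f -> schwartz g ->
  iter k Aop (fun x => f x + g x) = fun x => iter k Aop f x + iter k Aop g x.
Proof.
move=> sf sg; elim: k => //= k ->.
have := @Aop_sum R d bool [:: true; false] (fun b => if b then iter k Aop f else iter k Aop g).
rewrite (_ : (fun x => \sum_(t <- _) _) = fun x => iter k Aop f x + iter k Aop g x).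
  move=> ->; last by case; exact: schwartz_iterA.
  by apply/funext => x; rewrite !big_cons big_nil addr0.
by apply/funext => x; rewrite !big_cons big_nil addr0.
Qed.

Lemma iterAopZ k (a : R) f : schwartz f ->
  iter k Aop (fun x => a * f x) = fun x => a * iter k Aop f x.
Proof. by move=> sf; elim: k => //= k ->; rewrite AopZ//; exact: schwartz_iterA. Qed.

Lemma NrZ k (a : R) f : schwartz f -> Nr k (fun x => a * f x) = a ^+ 2 * Nr k f.
Proof.
move=> sf; rewrite !NrE//; last exact: schwartzZ.
rewrite iterAopZ// -IntZ; last by apply/schwartz_rint/schwartzM => //; exact: schwartz_iterA.
by apply: eq_Rintegral => x _; ring.
Qed.

Lemma NrD k f g : schwartz f -> schwartz g ->
  Nr k (fun x => f x + g x) <= 2 * Nr k f + 2 * Nr k g.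
Proof.
move=> sf sg; have sg' : schwartz (fun x => (- 1) * g x) by exact: schwartzZ.
have sA h : schwartz h -> schwartz (iter k Aop h) by exact: schwartz_iterA.
have e (h1 h2 : X -> R) : schwartz h1 -> schwartz h2 -> Nr k (fun x => h1 x + h2 x) =
    Nr k h1 + (\int[leb]_x (h1 x * iter k Aop h2 x) + \int[leb]_x (h2 x * iter k Aop h1 x)) + Nr k h2.
  move=> s1 s2; rewrite !NrE//; last exact: schwartzD.
  have r (p q : X -> R) : schwartz p -> schwartz q -> rint leb (fun x => p x * iter k Aop q x).
    by move=> sp sq; apply/schwartz_rint/schwartzM => //; exact: sA.
  have r11 := r _ _ s1 s1; have r12 := r _ _ s1 s2; have r21 := r _ _ s2 s1; have r22 := r _ _ s2 s2.
  rewrite -(IntD r12 r21) -(IntD r11 (rintD r12 r21)) -(IntD (rintD r11 (rintD r12 r21)) r22).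
  by rewrite iterAopD//; apply: eq_Rintegral => x _; ring.
have := Nr_ge0 k (fun x => f x + (- 1) * g x); rewrite !e//.
rewrite iterAopZ// NrZ//.
have -> : \int[leb]_x (f x * (-1 * iter k Aop g x)) = - 1 * \int[leb]_x (f x * iter k Aop g x).
  rewrite -IntZ; last by apply/schwartz_rint/schwartzM => //; exact: sA.
  by apply: eq_Rintegral => x _; ring.
have -> : \int[leb]_x (-1 * g x * iter k Aop f x) = - 1 * \int[leb]_x (g x * iter k Aop f x).
  rewrite -IntZ; last by apply/schwartz_rint/schwartzM => //; exact: sA.
  by apply: eq_Rintegral => x _; ring.
by move: (\int[leb]_x _) (\int[leb]_x _) (Nr k f) (Nr k g) => p q r s; lra.
Qed.

Lemma Nr_sum k (T : Type) (s : seq T) (F : T -> X -> R) : (forall t, schwartz (F t)) ->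
  Nr k (fun x => \sum_(t <- s) F t x) <= 2 ^+ size s * \sum_(t <- s) Nr k (F t).
Proof.
move=> sF; elim: s => [|t s IH].
  rewrite big_nil mulr0 (_ : (fun x => _) = fun x => 0 * (0 : R)); last first.
    by apply/funext => x; rewrite big_nil mul0r.
  by rewrite NrZ ?expr0n ?mul0r//; exact: schwartz0.
under eq_fun do rewrite big_cons; rewrite big_cons.
apply: (le_trans (NrD _ _ _)) => //; first exact: schwartz_sum.
rewrite mulrDr /= exprS -!mulrA; apply: lerD.
  rewrite mulrA ler_wpM2r ?Nr_ge0// ler_peMr// exprn_ege1//; lra.
by rewrite ler_wpM2l.
Qed.

Section shifts.
Variables (K : nat) (c : {ffun 'I_d -> 'I_K} -> R).
Local Notation I := {ffun 'I_d -> 'I_K}.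

Lemma Nr_ortho s (a : I -> R) (f : I -> idx) :
  (forall n n', n != n' -> a n * a n' * \int[leb]_x (hT (f n) x * hT (f n') x) = 0) ->
  (forall n, \int[leb]_x (hT (f n) x * hT (f n) x) = 1) ->
  Nr s (fun x => \sum_n a n * hT (f n) x) = \sum_n a n ^+ 2 * lam (f n) ^+ s.
Proof.
move=> h0 h1; have sF n : schwartz (fun x => a n * hT (f n) x) by apply: schwartzZ; exact: schwartz_hT.
rewrite NrE; last by apply: schwartz_sum => n _; exact: sF.
have -> : iter s Aop (fun x => \sum_n a n * hT (f n) x) = fun x => \sum_n a n * lam (f n) ^+ s * hT (f n) x.
  elim: s => [|s /= ->]; first by apply/funext => x; apply: eq_bigr => n _; rewrite mulr1.
  rewrite Aop_sum; last by move=> n; apply: schwartzZ; exact: schwartz_hT.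
  apply/funext => x; apply: eq_bigr => n _; rewrite AopZ ?Aop_hT; last exact: schwartz_hT.
  by rewrite exprSr; ring.
have r n n' : rint leb (fun x => a n * a n' * lam (f n') ^+ s * (hT (f n) x * hT (f n') x)).
  by apply: rintZ; exact: rint_hTM.
have -> : (fun x : X => (\sum_n a n * hT (f n) x) * (\sum_n a n * lam (f n) ^+ s * hT (f n) x)) =
   fun x => \sum_n \sum_n' a n * a n' * lam (f n') ^+ s * (hT (f n) x * hT (f n') x).
  apply/funext => x; rewrite mulr_suml; apply: eq_bigr => n _; rewrite mulr_sumr; apply: eq_bigr => n' _.
  by move: (hT _ _) (hT _ _) => p q; ring.
rewrite Int_sum; last by move=> n _; apply: rint_sum => n' _; exact: r.
apply: eq_bigr => n _; rewrite Int_sum; last by move=> n' _; exact: r.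
rewrite (bigD1 n)//= big1 ?addr0.
  by rewrite IntZ ?h1 ?mulr1 ?expr2//; exact: rint_hTM.
move=> n' nn; rewrite IntZ; last exact: rint_hTM.
rewrite (_ : _ * _ = lam (f n') ^+ s * (a n * a n' * \int[leb]_x (hT (f n) x * hT (f n') x))).
  by rewrite h0 ?mulr0// eq_sym.
by ring.
Qed.

Lemma lam_upd m i n : lam (upd m i n) = lam m - 2 * (m i)%:R + 2 * n%:R :> R.
Proof.
have e (a : nat) : (2 * a + 1)%:R = 2 * a%:R + 1 :> R by rewrite natrD natrM.
rewrite /lam (bigD1 i)//= [in RHS](bigD1 i)//= upd_at !e.
rewrite (eq_bigr (fun j => (2 * m j + 1)%:R)); first by ring.
by move=> j /negbTE ji; rewrite /upd ji.
Qed.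

Lemma lam_ge m i : (2 * m i + 1)%:R <= lam m :> R.
Proof. by rewrite /lam (bigD1 i)//= lerDl sumr_ge0. Qed.

Lemma upd_ortho (n n' : I) i (p q : nat) : n != n' ->
  (p = q -> n i = n' i) -> \int[leb]_x (hT (upd (vidx n) i p) x * hT (upd (vidx n') i q) x) = 0.
Proof.
move=> nn pq; rewrite hT_ortho.
have [epq|/eqP npq] := eqVneq p q; last first.
  by rewrite (bigD1 i)//= !upd_at (introF eqP npq) mul0r.
have [k [ki nk]] : exists k, k != i /\ n k != n' k.
  apply/not_existsP => h; move/negP: nn; apply; apply/eqP/ffunP => k.
  have [->|ki] := eqVneq k i; first exact: pq.
  by apply/eqP/negPn/negP => nk; exact: (h k).
rewrite (bigD1 k)//= /upd (negbTE ki) (_ : (vidx n k == vidx n' k) = false) ?mul0r//.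
by apply/negbTE.
Qed.

(** Raising multiplies the squared coefficient by 2 (n_i + 1) <= 2 lam and moves the eigenvalue from
    lam to lam + 2 <= 3 lam; distinct indices stay distinct, so orthogonality persists. *)
Lemma Nr_raise s i :
  Nr s (fun x => \sum_n (c n * (2 * hs (n i).+1)) * hT (upd (vidx n) i (n i).+1) x) <=
  2 * 3 ^+ s * Nr s.+1 (hexp c).
Proof.
rewrite Nr_ortho.
- rewrite Nr_hexp mulr_sumr; apply: ler_sum => n _.
  have L := lam_ge (vidx n) i; rewrite lam_upd exprMn exprMn hs_sqr /vidx in L *.
  rewrite natrD natrM in L; rewrite -[(n i).+1%:R]natr1.
  move: (n i)%:R (lam (fun k => n k)) L (ler0n R (n i)) => p l L p0.
  rewrite (_ : _ * (2 ^+ 2 * _) = c n ^+ 2 * (2 * (p + 1))); last by field.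
  rewrite (_ : l - _ + _ = l + 2); last by ring.
  rewrite (_ : 2 * 3 ^+ s * _ = c n ^+ 2 * (2 * l) * (3 * l) ^+ s); last by rewrite exprMn exprS; ring.
  apply: ler_pM.
  - by apply: mulr_ge0; [exact: sqr_ge0|lra].
  - by apply: exprn_ge0; lra.
  - by rewrite ler_wpM2l ?sqr_ge0//; lra.
  - by rewrite lerXn2r ?nnegrE//; lra.
- move=> n n' nn; rewrite upd_ortho ?mulr0// => -[e]; exact: val_inj.
by move=> n; rewrite hT_ortho big1// => k _; rewrite eqxx.
Qed.

Lemma Nr_lower s i :
  Nr s (fun x => \sum_n (c n * (2 * hs (n i))) * hT (upd (vidx n) i (n i).-1) x) <=
  2 * 3 ^+ s * Nr s.+1 (hexp c).
Proof.
rewrite Nr_ortho.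
- rewrite Nr_hexp mulr_sumr; apply: ler_sum => n _.
  have [n0|np] := posnP (n i).
    rewrite n0 hs0 !mulr0 expr0n /= mul0r; apply: mulr_ge0; first by rewrite mulr_ge0 ?exprn_ge0.
    by apply: mulr_ge0; [rewrite exprn_ge0// lam_ge0|exact: sqr_ge0].
  have L := lam_ge (vidx n) i; rewrite lam_upd exprMn exprMn hs_sqr /vidx in L *.
  rewrite natrD natrM in L; have : (n i).-1%:R = (n i)%:R - 1 :> R by rewrite -subn1 natrB.
  move=> ->; have p1 : 1 <= (n i)%:R :> R by rewrite ler1n.
  move: (n i)%:R (lam (fun k => n k)) L p1 => p l L p1.
  rewrite (_ : _ * (2 ^+ 2 * _) = c n ^+ 2 * (2 * p)); last by field.
  rewrite (_ : l - _ + _ = l - 2); last by ring.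
  rewrite (_ : 2 * 3 ^+ s * _ = c n ^+ 2 * (2 * l) * (3 * l) ^+ s); last by rewrite exprMn exprS; ring.
  apply: ler_pM.
  - by apply: mulr_ge0; [exact: sqr_ge0|lra].
  - by apply: exprn_ge0; lra.
  - by rewrite ler_wpM2l ?sqr_ge0//; lra.
  - by rewrite lerXn2r ?nnegrE//; lra.
- move=> n n' nn.
  have [n0|np] := posnP (n i); first by rewrite n0 hs0 !(mulr0, mul0r).
  have [n0'|np'] := posnP (n' i); first by rewrite n0' hs0 !(mulr0, mul0r).
  rewrite upd_ortho ?mulr0// => e; apply: val_inj => /=.
  by rewrite -(prednK np) -(prednK np') e.
by move=> n; rewrite hT_ortho big1// => k _; rewrite eqxx.
Qed.

End shifts.

(** x_i f and d_i f are half the sum and half the difference of the lowered and the raised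
    expansion. *)
Lemma Nr_step s i f : Span f ->
  Nr s (partial i f) <= 2 * 3 ^+ s * Nr s.+1 f /\ Nr s (fun x => x 0 i * f x) <= 2 * 3 ^+ s * Nr s.+1 f.
Proof.
move=> /Span_hexpP[K [c ->]].
pose P x := \sum_n (c n * (2 * hs (n i))) * hT (upd (vidx n) i (n i).-1) x.
pose Q x := \sum_n (c n * (2 * hs (n i).+1)) * hT (upd (vidx n) i (n i).+1) x.
have hP := Nr_lower c s i; have hQ := Nr_raise c s i; rewrite -/P in hP; rewrite -/Q in hQ.
have sP : schwartz P by apply: schwartz_sum => n _; apply: schwartzZ; exact: schwartz_hT.
have sQ : schwartz Q by apply: schwartz_sum => n _; apply: schwartzZ; exact: schwartz_hT.
have eX : (fun x : X => x 0 i * hexp c x) = fun x => 2^-1 * P x + 2^-1 * Q x.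
  apply/funext => x; rewrite /hexp mulr_sumr -mulrDr -big_split mulr_sumr; apply: eq_bigr => n _ /=.
  rewrite mulrCA hT_X /vidx; move: (hT _ x) (hT _ x) => p q; by field.
have eD : partial i (hexp c) = fun x => 2^-1 * P x + (- 2^-1) * Q x.
  rewrite /hexp schwartz_partial_sum; last by move=> n _; apply: schwartzZ; exact: schwartz_hT.
  apply/funext => x; rewrite mulNr -mulrBr -sumrB mulr_sumr; apply: eq_bigr => n _ /=.
  rewrite schwartz_partialZ ?hT_partial /vidx; last exact: schwartz_hT.
  by move: (hT _ x) (hT _ x) => p q; field.
rewrite eX eD; split.
  apply: (le_trans (NrD _ _ _)); [exact: schwartzZ|exact: schwartzZ|].
  by rewrite !NrZ// sqrrN; move: (Nr s P) (Nr s Q) hP hQ => p q; move: (_ * Nr _ _) => r hp hq; lra.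
apply: (le_trans (NrD _ _ _)); [exact: schwartzZ|exact: schwartzZ|].
by rewrite !NrZ//; move: (Nr s P) (Nr s Q) hP hQ => p q; move: (_ * Nr _ _) => r hp hq; lra.
Qed.

Lemma hT_sum_weighted K (x : X) :
  \sum_(n : {ffun 'I_d -> 'I_K}) \prod_i (root6 (n i).+1 ^- 4 * hermite (n i) (x 0 i) ^+ 2) <= 20 ^+ d.
Proof.
rewrite -(bigA_distr_bigA (fun i (l : 'I_K) => root6 l.+1 ^- 4 * hermite l (x 0 i) ^+ 2)).
apply: (@le_trans _ _ (\prod_(i < d) 20)); last by rewrite prodr_const card_ord.
apply: ler_prod => i _; rewrite hermite_weighted_sum andbT.
apply: sumr_ge0 => l _; rewrite mulr_ge0 ?sqr_ge0// invr_ge0 exprn_ge0//.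
by rewrite (le_trans ler01)// root6_ge1.
Qed.

(** Cauchy-Schwarz between lam^k c_n^2 and lam^-k e_n(x)^2. The condition 2d <= 3k gives lam^(3k) >=
    lam^(2d), which is at least the product of the (n_i + 1)^2; hence lam^-k is below the product of
    the weights (n_i + 1)^(-2/3), and the sum factors into d one-dimensional sums, each at most
    20. *)
Lemma sup_bound k f (x : X) : (0 < d)%N -> (2 * d <= 3 * k)%N -> Span f ->
  f x ^+ 2 <= 20 ^+ d * Nr k f.
Proof.
move=> d0 dk /Span_hexpP[K [c ->]].
have l1 (n : {ffun 'I_d -> 'I_K}) : 1 <= lam (vidx n) :> R.
  by apply: le_trans (lam_ge _ (Ordinal d0)); rewrite ler1n addn1.
have lp (n : {ffun 'I_d -> 'I_K}) : 0 < lam (vidx n) ^+ k :> R by rewrite exprn_gt0// (lt_le_trans ltr01).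
have w (n : {ffun 'I_d -> 'I_K}) : (lam (vidx n) ^+ k)^-1 * hT (vidx n) x ^+ 2 <=
    \prod_i (root6 (n i).+1 ^- 4 * hermite (n i) (x 0 i) ^+ 2).
  rewrite big_split /= /hT /tens prodrXl ler_wpM2r ?sqr_ge0// prodfV lef_pV2 ?posrE//; last first.
    by apply: prodr_gt0 => i _; rewrite exprn_gt0// (lt_le_trans ltr01)// root6_ge1.
  rewrite -(@ler_pXn2r _ 3)// ?nnegrE ?(ltW (lp _))//; last first.
    by apply: prodr_ge0 => i _; rewrite exprn_ge0// (le_trans ler01)// root6_ge1.
  rewrite -prodrXl -exprM (mulnC k) (le_trans _ (ler_weXn2l (l1 n) dk))// exprM.
  have -> : (lam (vidx n) ^+ 2) ^+ d = \prod_(i < d) lam (vidx n) ^+ 2 :> R.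
    by rewrite prodr_const card_ord.
  apply: ler_prod => i _; rewrite !exprn_ge0 ?(le_trans ler01 (root6_ge1 _))//=.
  rewrite -exprM (_ : (4 * 3 = 6 * 2)%N)// exprM root6E lerXn2r ?nnegrE ?lam_ge0//.
  by rewrite (le_trans _ (lam_ge _ i))// ler_nat -addn1 leq_add2r leq_pmull.
have CS := @rip_CS R _ (fun n => lam (vidx n)) l1 k (fun n => (c n)%:C)
  (fun n => ((lam (vidx n) ^+ k)^-1 * hT (vidx n) x)%:C).
have e : rip (fun n => lam (vidx n)) k (fun n => (c n)%:C)
    (fun n => ((lam (vidx n) ^+ k)^-1 * hT (vidx n) x)%:C) = hexp c x.
  apply: eq_bigr => n _ /=; rewrite mulr0 addr0.
  by move: (lp n); move: (lam _ ^+ k) => l l0; field; rewrite gt_eqF.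
rewrite e in CS; apply: (le_trans CS); rewrite mulrC.
have -> : wn (fun n => lam (vidx n)) k (fun n => (c n)%:C) = Nr k (hexp c).
  by rewrite Nr_hexp; apply: eq_bigr => n _; rewrite /nsq /= expr0n addr0.
rewrite ler_wpM2r ?Nr_ge0//; apply: le_trans (hT_sum_weighted K x); apply: ler_sum => n _.
apply: le_trans (w n); rewrite /nsq /= expr0n addr0 exprMn.
by move: (lp n); move: (lam _ ^+ k) => l l0; rewrite le_eqVlt; apply/orP; left; apply/eqP; field; rewrite gt_eqF.
Qed.

End spans.

(** * The truncated cubic term *)

Section phase_words.
Context {R : realType} {d : nat}.
Local Notation X := 'rV[R]_d.
Local Notation leb := (@lebesgue_rV R d).
Local Notation ltr := ('I_d * bool)%type.
Implicit Types (f g h F : X -> R) (o : ltr) (w : seq ltr) (j k s : nat).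

(* The letter (i, true) is multiplication by x_i and (i, false) is the derivative along x_i. *)
Definition opw o f : X -> R := if o.2 then fun x : X => x 0 o.1 * f x else partial o.1 f.
Definition Wd w f : X -> R := foldr opw f w.

Lemma opw_schwartz o f : schwartz f -> schwartz (opw o f).
Proof. by case: o => i []; [exact: schwartz_coor|exact: schwartz_partial]. Qed.

Lemma Wd_schwartz w f : schwartz f -> schwartz (Wd w f).
Proof. by move=> sf; elim: w => //= o w; exact: opw_schwartz. Qed.

Lemma opw_Span o f : Span f -> Span (opw o f).
Proof. by case: o => i []; [exact: Span_X|exact: Span_partial]. Qed.

Lemma Wd_Span w f : Span f -> Span (Wd w f).
Proof. by move=> sf; elim: w => //= o w; exact: opw_Span. Qed.

Lemma WdD w f g : schwartz f -> schwartz g ->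
  Wd w (fun x => f x + g x) = fun x => Wd w f x + Wd w g x.
Proof.
move=> sf sg; elim: w => //= -[i b] w ->; rewrite /opw /=; case: b.
  by apply/funext => x; rewrite mulrDr.
by rewrite schwartz_partialD//; exact: Wd_schwartz.
Qed.

Lemma Wd_rcons w o f : Wd (rcons w o) f = Wd w (opw o f).
Proof. by rewrite /Wd -cats1 foldr_cat. Qed.

Lemma Wd_cat w w' f : Wd (w ++ w') f = Wd w (Wd w' f).
Proof. by rewrite /Wd foldr_cat. Qed.

(** A raises the order by two and is a signed sum of words of two equal letters, hence an induction
    by steps of two, with both parities carried along. *)
Lemma Nr_words j : exists2 C : R, 0 <= C & forall F (E : R), schwartz F ->
  (forall w, size w = j -> \int[leb]_x (Wd w F x ^+ 2) <= E) -> Nr j F <= C * E.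
Proof.
pose P j := exists2 C : R, 0 <= C & forall F (E : R), schwartz F ->
  (forall w, size w = j -> \int[leb]_x (Wd w F x ^+ 2) <= E) -> Nr j F <= C * E.
suff [//] : P j /\ P j.+1.
elim: j => [|j [IH0 IH1]].
  split.
    by exists 1 => // F E sF h; rewrite mul1r; exact: (h [::] erefl).
  exists (d%:R * 2) => // F E sF h.
  apply: (@le_trans _ _ (\sum_(i < d) (E + E))).
    apply: ler_sum => i _; apply: lerD.
      exact: (h [:: (i, false)] erefl).
    exact: (h [:: (i, true)] erefl).
  by rewrite sumr_const card_ord -[X in X <= _]mulr_natl le_eqVlt; apply/orP; left; apply/eqP; ring.
split => //; have [C C0 H] := IH0.
pose r := index_enum ltr.
exists (2 ^+ size r * \sum_(o <- r) C); first by rewrite mulr_ge0 ?exprn_ge0// sumr_ge0.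
move=> F E sF h; pose sg o : R := if o.2 then 1 else -1.
have sW o : schwartz (fun x => sg o * Wd [:: o; o] F x) by apply: schwartzZ; exact: Wd_schwartz.
have -> : Nr j.+2 F = Nr j (fun x => \sum_(o <- r) sg o * Wd [:: o; o] F x).
  have -> : Nr j.+2 F = Nr j (Aop F) by rewrite /Nr /= negbK -iterSr.
  congr Nr; rewrite AopE; apply/funext => x.
  rewrite (eq_bigr (fun i => \sum_(b : bool) sg (i, b) * Wd [:: (i, b); (i, b)] F x)).
    by rewrite pair_bigA /=; apply: eq_bigr => -[i b].
  by move=> i _; rewrite big_bool /sg /Wd /opw /= mul1r mulN1r addrC.
apply: (le_trans (Nr_sum _ _ sW)); rewrite -mulrA ler_wpM2l ?exprn_ge0// mulr_suml.
apply: ler_sum => o _; rewrite NrZ; last exact: Wd_schwartz.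
rewrite (_ : sg o ^+ 2 = 1); last by rewrite /sg; case: ifP => _; ring.
rewrite mul1r; apply: H; first exact: Wd_schwartz.
by move=> w sw; rewrite -Wd_cat; apply: h; rewrite size_cat sw addn2.
Qed.

Lemma rint_sq f : schwartz f -> rint leb (fun x => f x ^+ 2).
Proof. by move=> /schwartz_L2r[]. Qed.

(** Leibniz rule: a coordinate goes to the first factor, a derivative is distributed over the three.
    A letter costs at most 9: a factor 3 from squaring a sum of three terms and 3 from their number.
    The innermost letter is treated first, so the factors vary in the induction. *)
Lemma word_prod w f g h (E : R) : schwartz f -> schwartz g -> schwartz h ->
  (forall w1 w2 w3, (size w1 + size w2 + size w3 = size w)%N ->
    \int[leb]_x ((Wd w1 f x * Wd w2 g x * Wd w3 h x) ^+ 2) <= E) ->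
  \int[leb]_x (Wd w (fun x => f x * g x * h x) x ^+ 2) <= 9 ^+ size w * E.
Proof.
elim/last_ind: w f g h => [|w o IH] f g h sf sg sh H.
  by rewrite expr0 mul1r; exact: (H [::] [::] [::] erefl).
rewrite Wd_rcons size_rcons.
have sM p q : schwartz p -> schwartz q -> schwartz (fun x : X => p x * q x) by exact: schwartzM.
have E0 : 0 <= E.
  apply: le_trans (H (rcons w o) [::] [::] _); last by rewrite !addn0.
  by apply: Int_ge0 => x; exact: sqr_ge0.
have IH1 : \int[leb]_x (Wd w (fun x => opw o f x * g x * h x) x ^+ 2) <= 9 ^+ size w * E.
  apply: IH => //; first exact: opw_schwartz.
  by move=> w1 w2 w3 e; rewrite -Wd_rcons; apply: H; rewrite !size_rcons !addSn e.
case: o H IH1 => i [] H IH1.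
  rewrite (_ : opw _ _ = fun x : X => opw (i, true) f x * g x * h x); last first.
    by apply/funext => x; rewrite /opw /= !mulrA.
  apply: (le_trans IH1); rewrite exprS ler_wpM2r// ler_peMl ?exprn_ge0//; lra.
have IH2 : \int[leb]_x (Wd w (fun x => f x * opw (i, false) g x * h x) x ^+ 2) <= 9 ^+ size w * E.
  apply: IH => //; first exact: opw_schwartz.
  by move=> w1 w2 w3 e; rewrite -Wd_rcons; apply: H; rewrite !size_rcons addnS addSn e.
have IH3 : \int[leb]_x (Wd w (fun x => f x * g x * opw (i, false) h x) x ^+ 2) <= 9 ^+ size w * E.
  apply: IH => //; first exact: opw_schwartz.
  by move=> w1 w2 w3 e; rewrite -Wd_rcons; apply: H; rewrite !size_rcons addnS e.
have sfi := opw_schwartz (i, false) sf; have sgi := opw_schwartz (i, false) sg.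
have shi := opw_schwartz (i, false) sh.
pose p1 x := opw (i, false) f x * g x * h x; pose p2 x := f x * opw (i, false) g x * h x.
pose p3 x := f x * g x * opw (i, false) h x.
have s1 : schwartz p1 by apply: (sM _ _) => //; exact: sM.
have s2 : schwartz p2 by apply: (sM _ _) => //; exact: sM.
have s3 : schwartz p3 by apply: (sM _ _) => //; exact: sM.
have -> : opw (i, false) (fun x => f x * g x * h x) = fun x => (p1 x + p2 x) + p3 x.
  rewrite {1}/opw /= (schwartz_partialM _ (sM _ _ sf sg) sh).
  apply/funext => x; rewrite (schwartz_partialM _ sf sg) /p1 /p2 /p3 /opw /=.
  by move: (partial _ _ _) (partial _ _ _) (partial _ _ _) => *; ring.
rewrite (WdD _ (schwartzD s1 s2) s3) (WdD _ s1 s2).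
have r1 := rint_sq (Wd_schwartz w s1); have r2 := rint_sq (Wd_schwartz w s2).
have r3 := rint_sq (Wd_schwartz w s3).
apply: (@le_trans _ _ (\int[leb]_x (3 * ((Wd w p1 x ^+ 2 + Wd w p2 x ^+ 2) + Wd w p3 x ^+ 2)))).
  apply: Int_le.
  - by apply: rint_sq; apply: schwartzD; [apply: schwartzD|]; exact: Wd_schwartz.
  - by apply: rintZ; apply: rintD => //; exact: rintD.
  move=> x; move: (Wd w p1 x) (Wd w p2 x) (Wd w p3 x) => p q r.
  by have := sqr_ge0 (p - q); have := sqr_ge0 (p - r); have := sqr_ge0 (q - r); nra.
rewrite (IntZ 3 (rintD (rintD r1 r2) r3)) (IntD (rintD r1 r2) r3) (IntD r1 r2).
rewrite exprS -mulrA.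
by move: IH1 IH2 IH3; move: (\int[leb]_x _) (\int[leb]_x _) (\int[leb]_x _) (_ * E) => *; lra.
Qed.

Lemma Nr_word s w f : Span f ->
  Nr s (Wd w f) <= (2 * 3 ^+ (s + size w)) ^+ size w * Nr (s + size w) f.
Proof.
move=> sf; elim: w s => [|o w IH] s; first by rewrite addn0 expr0 mul1r.
have h : Nr s (opw o (Wd w f)) <= 2 * 3 ^+ s * Nr s.+1 (Wd w f).
  by have [h1 h2] := Nr_step s o.1 (Wd_Span w sf); rewrite /opw; case: ifP.
apply: (le_trans h); rewrite [size _]/= addnS exprS.
have IH' := IH s.+1; rewrite addSn in IH'.
have a3 : 2 * 3 ^+ s <= 2 * 3 ^+ (s + size w).+1 :> R.
  by rewrite ler_wpM2l// ler_weXn2l ?ler1n// -addnS leq_addr.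
by rewrite -[leRHS]mulrA; apply: ler_pM => //; exact: Nr_ge0.
Qed.

(** A Gagliardo-Nirenberg inequality. With p and q the first and second derivatives, integration by
    parts turns the integral of p^4 into -3 times that of f p^2 q, and Young's inequality absorbs
    half of the left side. For a coordinate letter a pointwise bound suffices. *)
Lemma quartic o f (S : R) : schwartz f -> (forall x, f x ^+ 2 <= S) ->
  \int[leb]_x (opw o f x ^+ 4) <= 9 * S * \int[leb]_x (opw o (opw o f) x ^+ 2).
Proof.
move=> sf fS; have S0 : 0 <= S by apply: le_trans (fS 0); exact: sqr_ge0.
have half (a b : R) : a <= 2^-1 * a + 9 / 2 * S * b -> a <= 9 * S * b by move=> {fS S0}; lra.
have s1 := opw_schwartz o sf; have s2 := opw_schwartz o s1.
have r2 := rint_sq s2.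
have sM p q : schwartz p -> schwartz q -> schwartz (fun x : X => p x * q x) by exact: schwartzM.
have r4 : rint leb (fun x => opw o f x ^+ 4).
  rewrite (_ : (fun x => _) = fun x => (opw o f x * opw o f x) ^+ 2).
    by apply: rint_sq; exact: sM.
  by apply/funext => x; ring.
case: o s1 s2 r2 r4 => i [] s1 s2 r2 r4.
  rewrite -IntZ//; apply: Int_le => // [|x]; first exact: rintZ.
  rewrite /opw /= (_ : (x 0 i * f x) ^+ 4 = f x ^+ 2 * (x 0 i * (x 0 i * f x)) ^+ 2); last by ring.
  rewrite ler_wpM2r ?sqr_ge0// (le_trans (fS x))//; lra.
set p := opw (i, false) f in s1 s2 r2 r4 *; set q := opw (i, false) p in s2 r2 *.
have sp2 : schwartz (fun x => p x * p x) by exact: sM.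
have sp3 : schwartz (fun x => p x * p x * p x) by exact: sM.
have e : \int[leb]_x (p x ^+ 4) = - \int[leb]_x (f x * (3 * (p x * p x * q x))).
  have := int_by_parts i sf sp3.
  have -> : partial i (fun x => p x * p x * p x) = fun x => 3 * (p x * p x * q x).
    rewrite (schwartz_partialM _ sp2 s1); apply/funext => x.
    rewrite (schwartz_partialM _ s1 s1) /q /opw /=.
    by move: (partial i p x) => z; ring.
  move=> <-; apply: eq_Rintegral => x _; rewrite -/(opw (i, false) f x) -/(p x).
  by rewrite (_ : partial i f x = p x)//; ring.
have sq3 : schwartz (fun x => 3 * (p x * p x * q x)) by apply: schwartzZ; exact: sM.
have r3 : rint leb (fun x => f x * (3 * (p x * p x * q x))) by apply/schwartz_rint/sM.
have : \int[leb]_x (p x ^+ 4) <= \int[leb]_x (2^-1 * p x ^+ 4 + 9 / 2 * S * q x ^+ 2).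
  rewrite {1}e -IntN//; apply: Int_le; [exact: rintN|by apply: rintD; exact: rintZ|move=> x].
  have h : 9 / 2 * f x ^+ 2 * q x ^+ 2 <= 9 / 2 * S * q x ^+ 2.
    by rewrite ler_wpM2r ?sqr_ge0// ler_wpM2l ?fS//; lra.
  apply: le_trans (lerD (lexx _) h); rewrite -subr_ge0.
  rewrite (_ : _ - _ = 2^-1 * (p x ^+ 2 + 3 * (f x * q x)) ^+ 2); last by field.
  by rewrite mulr_ge0 ?sqr_ge0.
rewrite (IntD (rintZ _ r4) (rintZ _ r2)) (IntZ _ r4) (IntZ _ r2).
exact: half.
Qed.

Lemma int_sup p q (S : R) : schwartz p -> schwartz q -> (forall x, q x ^+ 2 <= S) ->
  \int[leb]_x ((p x * q x) ^+ 2) <= S * \int[leb]_x (p x ^+ 2).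
Proof.
move=> sp sq qS; have rp := rint_sq sp.
rewrite -IntZ//; apply: Int_le.
- by apply: rint_sq; exact: schwartzM.
- exact: rintZ.
- by move=> x; rewrite exprMn mulrC ler_wpM2r ?sqr_ge0.
Qed.

(** Term by term, t^(D-e) lam^e <= t^D + lam^D. The parameter [t] encodes the ratio of the two
    norms: each order counts for a factor t, and in products the exponents add up. *)
Lemma interpolate k D e f (t M : R) : (e <= D)%N -> (0 < d)%N -> 0 < t -> Span f ->
  Nr k f <= M -> Nr (k + D) f <= t ^+ D * M -> Nr (k + e) f <= 2 * (t ^+ e * M).
Proof.
move=> eD d0 t0 /Span_hexpP[K [c ->]] h1 h2.
have te : 0 < t ^+ (D - e) by rewrite exprn_gt0.
rewrite -(ler_pM2l te) (_ : _ * (2 * _) = t ^+ D * M + t ^+ D * M); last first.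
  by rewrite (_ : t ^+ D = t ^+ (D - e) * t ^+ e); [ring|rewrite -exprD subnK].
have h1' : t ^+ D * Nr k (hexp c) <= t ^+ D * M by rewrite ler_wpM2l ?exprn_ge0 ?(ltW t0).
apply: le_trans (lerD h1' h2); rewrite !Nr_hexp !mulr_sumr -big_split; apply: ler_sum => n _ /=.
set l := lam (vidx n); have l0 : 0 <= l by exact: lam_ge0.
rewrite mulrA -mulrDl [X in X <= _]mulrA ler_wpM2r ?sqr_ge0//.
rewrite (exprD l k e) (exprD l k D).
rewrite (_ : t ^+ D * l ^+ k + _ = l ^+ k * (t ^+ D + l ^+ D)); last by ring.
rewrite (_ : _ * (l ^+ k * _) = l ^+ k * (t ^+ (D - e) * l ^+ e)); last by ring.
rewrite ler_wpM2l ?exprn_ge0//.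
have [lt|/ltW tl] := leP l t.
  apply: (@le_trans _ _ (t ^+ D)); last by rewrite lerDl exprn_ge0.
  rewrite -[in leRHS](subnK eD) exprD ler_wpM2l ?(ltW te)// lerXn2r ?nnegrE//.
  exact: ltW.
apply: (@le_trans _ _ (l ^+ D)); last by rewrite lerDr exprn_ge0// ltW.
rewrite -[in leRHS](subnK eD) exprD ler_wpM2r ?exprn_ge0// lerXn2r ?nnegrE//.
exact: ltW.
Qed.

End phase_words.

(** * The tame trilinear estimate *)

Section tame.
Context {R : realType} {d : nat}.
Local Notation X := 'rV[R]_d.
Local Notation leb := (@lebesgue_rV R d).
Hypothesis d0 : (0 < d)%N.
Variables (k j : nat).
Hypotheses (dk : (2 * d <= 3 * k)%N) (k2 : (k <= 2)%N) (kj : (k <= j)%N).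
Implicit Types (f g h : X -> R).

Let D := (j - k)%N.
Let A : R := (2 * 3 ^+ (k + j)) ^+ j.
Let S : R := 20 ^+ d.

Let A1 : 1 <= A.
Proof.
rewrite /A exprn_ege1// (le_trans _ (ler_peMr _ _))//; last first.
  by rewrite exprn_ege1//; lra.
lra.
Qed.

Let A0 : 0 <= A. Proof. exact: le_trans A1. Qed.
Let S0 : 0 <= S. Proof. by rewrite exprn_ge0. Qed.

Let NrA s w f : (s <= k)%N -> (size w <= j)%N -> Span f -> Nr s (Wd w f) <= A * Nr (s + size w) f.
Proof.
move=> sk wj sf; apply: (le_trans (Nr_word s w sf)); rewrite ler_wpM2r ?Nr_ge0// /A.
have b1 (n : nat) : 1 <= 2 * 3 ^+ n :> R.
  have : 1 <= 3 ^+ n :> R by rewrite exprn_ege1//; lra.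
  by move: (3 ^+ n) => p; lra.
apply: (le_trans (ler_weXn2l (b1 _) wj)).
rewrite lerXn2r ?nnegrE ?mulr_ge0 ?exprn_ge0// ler_wpM2l// ler_weXn2l ?ler1n//.
exact: leq_add.
Qed.

Let half_sum (p q r : R) : p <= r -> q <= r -> 2^-1 * p + 2^-1 * q <= r.
Proof. lra. Qed.

Section bounds.
Variables (M t : R).
Hypotheses (M0 : 0 <= M) (t0 : 0 < t).

Definition tame_ball f := [/\ Span f, Nr k f <= M & Nr j f <= t ^+ D * M].

Let sup_word w f x : tame_ball f -> (size w <= D)%N -> Wd w f x ^+ 2 <= S * (A * (2 * (t ^+ size w * M))).
Proof.
move=> [sf f1 f2] wD; apply: (le_trans (sup_bound x d0 dk (Wd_Span w sf))).
rewrite ler_wpM2l// (le_trans (NrA _ _ sf))//; first by rewrite (leq_trans wD)// leq_subr.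
by rewrite ler_wpM2l// (interpolate wD)// subnKC.
Qed.

Let big_word w f : tame_ball f -> (k <= size w <= j)%N ->
  \int[leb]_x (Wd w f x ^+ 2) <= A * (2 * (t ^+ (size w - k) * M)).
Proof.
move=> [sf f1 f2] /andP[kw wj]; have := @NrA 0 w f isT wj sf; rewrite add0n {1}/Nr /= => h.
apply: (le_trans h); rewrite ler_wpM2l// -{1}(subnKC kw).
by apply: (@interpolate _ _ k D) => //; [rewrite leq_sub2r|rewrite subnKC].
Qed.

Let C1 : R := (S * A * 2) * (S * A * 2) * (A * 2).
Let C2 : R := (S * A * 2) * (9 * S * A).
Let C := C1 + C2.

Let C10 : 0 <= C1. Proof. by rewrite !mulr_ge0. Qed.
Let C20 : 0 <= C2. Proof. by rewrite !mulr_ge0. Qed.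

(** A factor with at least [k] letters is measured in L^2, which saves the [k] orders that a sup
    bound costs; the other two are bounded pointwise. The orders spent are size w1 + size w2 + (size
    w3 - k) = D, so the powers of [t] combine to t^D. *)
Let case_big f g h w1 w2 w3 : tame_ball f -> tame_ball g -> tame_ball h ->
  (size w1 + size w2 + size w3 = j)%N -> (k <= size w3)%N ->
  \int[leb]_x ((Wd w1 f x * Wd w2 g x * Wd w3 h x) ^+ 2) <= C * (t ^+ D * M ^+ 3).
Proof.
move=> Bf Bg Bh e kw; have [sf _ _] := Bf; have [sg _ _] := Bg; have [sh _ _] := Bh.
have [s1 s2 s3] : [/\ schwartz (Wd w1 f), schwartz (Wd w2 g) & schwartz (Wd w3 h)].
  by split; apply: Wd_schwartz; exact: Span_schwartz.
have eD : (size w1 + size w2 + (size w3 - k) = D)%N by rewrite addnBA// e.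
have w1D : (size w1 <= D)%N by rewrite -eD -addnA leq_addr.
have w2D : (size w2 <= D)%N by rewrite -eD addnAC leq_addl.
have b3 := big_word Bh (w := w3); have b1 x := sup_word x Bf w1D; have b2 x := sup_word x Bg w2D.
have {b3} b3 : \int[leb]_x (Wd w3 h x ^+ 2) <= A * (2 * (t ^+ (size w3 - k) * M)).
  by apply: b3; rewrite kw -e leq_addl.
have tp n : 0 <= t ^+ n by rewrite exprn_ge0// ltW.
have -> : \int[leb]_x ((Wd w1 f x * Wd w2 g x * Wd w3 h x) ^+ 2) =
    \int[leb]_x (((Wd w3 h x * Wd w2 g x) * Wd w1 f x) ^+ 2).
    by apply: eq_Rintegral => x _; ring.
apply: (le_trans (int_sup (schwartzM s3 s2) s1 b1)).
apply: (@le_trans _ _ (S * (A * (2 * (t ^+ size w1 * M))) * (S * (A * (2 * (t ^+ size w2 * M))) *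
    (A * (2 * (t ^+ (size w3 - k) * M)))))).
  rewrite ler_wpM2l ?mulr_ge0// (le_trans (int_sup s3 s2 b2))// ler_wpM2l ?mulr_ge0//.
rewrite (_ : _ * _ = C1 * (t ^+ D * M ^+ 3)); last by rewrite -eD !exprD /C1; ring.
by apply: ler_wpM2r; [rewrite mulr_ge0 ?tp ?exprn_ge0|rewrite /C lerDl].
Qed.

(** This serves when no word has [k] letters. Two factors with one letter each are put in L^4 by
    [quartic], which only uses the low norm, and the third, with D letters, is bounded pointwise. *)
Let case_small f g h w1 w2 w3 : k = 2%N -> tame_ball f -> tame_ball g -> tame_ball h ->
  size w1 = 1%N -> size w2 = 1%N -> (2 + size w3 = j)%N ->
  \int[leb]_x ((Wd w1 f x * Wd w2 g x * Wd w3 h x) ^+ 2) <= C * (t ^+ D * M ^+ 3).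
Proof.
move=> kE Bf Bg Bh e1 e2 e3; have [sf f1 _] := Bf; have [sg g1 _] := Bg; have [sh _ _] := Bh.
have [s1 s2 s3] : [/\ schwartz (Wd w1 f), schwartz (Wd w2 g) & schwartz (Wd w3 h)].
  by split; apply: Wd_schwartz; exact: Span_schwartz.
have w3D : size w3 = D by rewrite /D kE -e3 addKn.
have b3 x : Wd w3 h x ^+ 2 <= S * (A * (2 * (t ^+ D * M))).
  by rewrite -w3D; apply: sup_word => //; rewrite w3D.
have tp n : 0 <= t ^+ n by rewrite exprn_ge0// ltW.
have Q w u : size w = 1%N -> Span u -> Nr k u <= M ->
    rint leb (fun x => Wd w u x ^+ 4) /\ \int[leb]_x (Wd w u x ^+ 4) <= 9 * (S * M) * (A * M).
  case: w => [|o []]// _ su u1; have ssu := Span_schwartz su; split.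
    rewrite (_ : (fun x => _) = fun x => (Wd [:: o] u x * Wd [:: o] u x) ^+ 2).
      by apply: rint_sq; apply: schwartzM; exact: Wd_schwartz.
    by apply/funext => x; ring.
  have q := @quartic _ _ o u (S * M) ssu (fun x => le_trans (sup_bound x d0 dk su) (ler_wpM2l S0 u1)).
  apply: (le_trans q); rewrite ler_wpM2l ?mulr_ge0//.
  have h2 : (2 <= j)%N by rewrite -e3 leq_addr.
  have := @NrA 0 [:: o; o] u isT h2 su; rewrite add0n {1}/Nr /= => h'.
  by apply: (le_trans h'); rewrite ler_wpM2l// -kE.
have [r1 q1] := Q w1 f e1 sf f1; have [r2 q2] := Q w2 g e2 sg g1.
apply: (le_trans (int_sup (schwartzM s1 s2) s3 b3)).
have : \int[leb]_x ((Wd w1 f x * Wd w2 g x) ^+ 2) <= 9 * (S * M) * (A * M).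
  apply: (@le_trans _ _ (\int[leb]_x (2^-1 * Wd w1 f x ^+ 4 + 2^-1 * Wd w2 g x ^+ 4))).
    apply: Int_le; [by apply: rint_sq; exact: schwartzM|by apply: rintD; exact: rintZ|move=> x].
    move: (Wd w1 f x) (Wd w2 g x) => p q; rewrite -subr_ge0.
    rewrite (_ : _ - _ = 2^-1 * (p ^+ 2 - q ^+ 2) ^+ 2); last by field.
    by rewrite mulr_ge0 ?sqr_ge0.
  rewrite (IntD (rintZ _ r1) (rintZ _ r2)) (IntZ _ r1) (IntZ _ r2).
  exact: half_sum.
move=> h'; apply: (le_trans (ler_wpM2l _ h')); first by rewrite !mulr_ge0.
rewrite (_ : S * (A * (2 * (t ^+ D * M))) * (9 * (S * M) * (A * M)) = C2 * (t ^+ D * M ^+ 3)); last by rewrite /C2; ring.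
by apply: ler_wpM2r; [rewrite mulr_ge0 ?tp ?exprn_ge0|rewrite /C lerDr].
Qed.

(** If no word has [k] letters, then k <= 2 and k <= j force k = 2, and at least two of the words
    have exactly one letter. *)
Lemma tame_word f g h w1 w2 w3 : tame_ball f -> tame_ball g -> tame_ball h ->
  (size w1 + size w2 + size w3 = j)%N ->
  \int[leb]_x ((Wd w1 f x * Wd w2 g x * Wd w3 h x) ^+ 2) <= C * (t ^+ D * M ^+ 3).
Proof.
move=> Bf Bg Bh e.
have [h3|h3] := leqP k (size w3); first exact: case_big.
have [h2|h2] := leqP k (size w2).
  have -> : \int[leb]_x ((Wd w1 f x * Wd w2 g x * Wd w3 h x) ^+ 2) =
    \int[leb]_x (((Wd w1 f x * Wd w3 h x) * Wd w2 g x) ^+ 2).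
    by apply: eq_Rintegral => x _; ring.
  by apply: case_big => //; rewrite addnAC.
have [h1|h1] := leqP k (size w1).
  have -> : \int[leb]_x ((Wd w1 f x * Wd w2 g x * Wd w3 h x) ^+ 2) =
    \int[leb]_x (((Wd w3 h x * Wd w2 g x) * Wd w1 f x) ^+ 2).
    by apply: eq_Rintegral => x _; ring.
  by apply: case_big => //; rewrite addnC (addnC (size w3)) addnA.
have kE : k = 2%N.
  move: k2 h1 h2 h3 kj e; case: (k) => [|[|[|]]]//.
  by rewrite !ltnS !leqn0 => _ /eqP-> /eqP-> /eqP->; case: (j).
rewrite kE in h1 h2 h3.
have c01 (n : nat) : (n < 2)%N -> n = 0%N \/ n = 1%N by case: n => [|[|]]// _; [left|right].
have [e1|e1] := c01 _ h1; have [e2|e2] := c01 _ h2; have [e3|e3] := c01 _ h3; move: (e);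
  rewrite e1 e2 e3 => ej; try (by exfalso; move: kj; rewrite kE -ej).
- have -> : \int[leb]_x ((Wd w1 f x * Wd w2 g x * Wd w3 h x) ^+ 2) =
    \int[leb]_x (((Wd w3 h x * Wd w2 g x) * Wd w1 f x) ^+ 2).
    by apply: eq_Rintegral => x _; ring.
  by apply: case_small => //; rewrite e1 -ej.
- have -> : \int[leb]_x ((Wd w1 f x * Wd w2 g x * Wd w3 h x) ^+ 2) =
    \int[leb]_x (((Wd w1 f x * Wd w3 h x) * Wd w2 g x) ^+ 2).
    by apply: eq_Rintegral => x _; ring.
  by apply: case_small => //; rewrite e2 -ej.
- by apply: case_small => //; rewrite e3 -ej.
- by apply: case_small => //; rewrite e3 -ej.
Qed.

End bounds.

Lemma tame : exists2 C : R, 0 <= C & forall (M t : R) f g h, 0 <= M -> 0 < t ->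
  tame_ball M t f -> tame_ball M t g -> tame_ball M t h ->
  Nr j (fun x => f x * g x * h x) <= C * (t ^+ D * M ^+ 3).
Proof.
have [Cw Cw0 H] := @Nr_words R d j.
exists (Cw * (9 ^+ j * ((S * A * 2) * (S * A * 2) * (A * 2) + (S * A * 2) * (9 * S * A)))).
  by rewrite !mulr_ge0 ?exprn_ge0// addr_ge0 ?mulr_ge0.
move=> M t f g h M0 t0 Bf Bg Bh; have [sf _ _] := Bf; have [sg _ _] := Bg; have [sh _ _] := Bh.
have [zf zg zh] : [/\ schwartz f, schwartz g & schwartz h] by split; exact: Span_schwartz.
rewrite -(mulrA Cw) -(mulrA (9 ^+ j)).
apply: H; first by apply: (@schwartzM R d (fun x => f x * g x)) => //; exact: schwartzM.
move=> w sw; rewrite -{1}sw; apply: word_prod => // w1 w2 w3 e.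
by apply: (tame_word (M := M) (t := t)) => //; rewrite e.
Qed.

End tame.

(** * Lipschitz bounds for the cutoff *)

Section cutoff.
Context {R : realType}.

Lemma max1_lip (x y : R) : `|Num.max x 1 - Num.max y 1| <= `|x - y|.
Proof.
have a1 := ler_norm (x - y); have a2 := ler_norm (- (x - y)); rewrite normrN in a2.
have [x1|x1] := leP x 1; have [y1|y1] := leP y 1; rewrite ler_norml; apply/andP.
- by split; lra.
- by split; lra.
- by split; lra.
- by split; lra.
Qed.

Variable theta : R -> R.
Hypothesis hth : cutoff theta.

Lemma cutoff_derivable (x : R) : 0 < x -> derivable theta x 1.
Proof. by move=> x0; have := @cutoff_smooth R theta hth 0 x x0; rewrite derive1n0. Qed.

(** On this compact interval of positive reals the derivative is continuous, hence bounded. The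
    constancy of [theta] on [0, 1] later extends the estimate to the origin, by replacing x with
    max(x, 1). *)
Lemma cutoff_lip13 : exists2 La : R, 0 < La & forall x y, 1 <= x <= 3 -> 1 <= y <= 3 ->
  `|theta x - theta y| <= La * `|x - y|.
Proof.
pose g (x : R) := `|derive1 theta x|.
have cg : {within `[1, 3 : R], continuous g}.
  have c1 : {within `[1, 3 : R], continuous (derive1 theta)}.
    apply: derivable_within_continuous => x; rewrite in_itv /= => /andP[x1 _].
    by have := @cutoff_smooth R theta hth 1 x (lt_le_trans ltr01 x1); rewrite derive1n1.
  by move=> x; apply: continuous_comp; [exact: c1|exact: norm_continuous].
have [|c _ hc] := @EVT_max R g 1 3 _ cg; first by lra.
exists (g c + 1); first by have := normr_ge0 (derive1 theta c); rewrite -/(g c); lra.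
suff key x y : x <= y -> 1 <= x <= 3 -> 1 <= y <= 3 -> `|theta x - theta y| <= (g c + 1) * `|x - y|.
  move=> x y hx hy; case: (leP x y) => [|/ltW] h; first exact: key.
  by rewrite distrC (distrC x); exact: key.
move=> xy /andP[x1 x3] /andP[y1 y3].
have [||z] := @MVT_segment R theta (derive1 theta) x y xy.
- move=> z; rewrite in_itv /= => /andP[z1 z2]; have z0 : 0 < z by lra.
  have d := cutoff_derivable z0; rewrite derive1E; exact: derivableP.
- apply: derivable_within_continuous => z; rewrite in_itv /= => /andP[z1 z2].
  by apply: cutoff_derivable; lra.
rewrite in_itv /= => /andP[z1 z2] e; rewrite distrC e normrM (distrC x) ler_wpM2r//.
have : g z <= g c by apply: hc; rewrite in_itv /= (le_trans x1 z1) (le_trans z2 y3).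
by rewrite /g; lra.
Qed.

(** The support condition speaks of x > 2 only; the value at 2 follows by continuity. It serves as
    reference when a norm crosses the threshold. *)
Lemma cutoff_2 : theta 2 = 0.
Proof.
have [La La0 h] := cutoff_lip13; apply/eqP; rewrite -normr_eq0 eq_le normr_ge0 andbT.
apply/ler_addgt0Pr => e e0; rewrite add0r.
pose t := Num.min 1 (e / La); have t0 : 0 < t by rewrite lt_min ltr01 divr_gt0.
have t1 : t <= 1 by rewrite ge_min lexx.
have tL : t <= e / La by rewrite ge_min lexx orbT.
have e2 : theta (2 + t) = 0 by apply: cutoff_supp => //; lra.
have := h 2 (2 + t); rewrite e2 subr0 (_ : 2 - (2 + t) = - t); last by ring.
rewrite normrN (gtr0_norm t0) => h2; apply: le_trans (h2 _ _) _; try by apply/andP; split; lra.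
by rewrite mulrC -ler_pdivlMr.
Qed.

Lemma cutoff_lip : exists2 La : R, 0 < La & (forall x y, 0 <= x <= 2 -> 0 <= y <= 2 ->
  `|theta x - theta y| <= La * `|x - y|) /\ forall x, 0 <= x -> `|theta x| <= La.
Proof.
have [La La0 h] := cutoff_lip13; exists (1 + 2 * La); first by lra.
pose m (x : R) := Num.max x 1.
have tm (x : R) : 0 <= x -> theta x = theta (m x).
  move=> x0; rewrite /m; case: leP => // x1.
  by rewrite !(cutoff_one hth)//; apply/andP; split => //; lra.
have mb (x : R) : 0 <= x <= 2 -> 1 <= m x <= 3.
  by move=> /andP[x0 x2]; rewrite /m; case: (leP x 1) => ?; apply/andP; split; lra.
have lip (x y : R) : 0 <= x <= 2 -> 0 <= y <= 2 -> `|theta x - theta y| <= La * `|x - y|.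
  move=> hx hy; have /andP[x0 _] := hx; have /andP[y0 _] := hy; rewrite (tm x x0) (tm y y0).
  apply: (le_trans (h _ _ (mb _ hx) (mb _ hy))); rewrite ler_pM2l// /m.
  exact: max1_lip.
split=> [x y hx hy|x x0].
  apply: (le_trans (lip x y hx hy)); rewrite ler_wpM2r//; lra.
have [x2|x2] := leP x 2; last by rewrite (cutoff_supp hth)// normr0; lra.
have h1 : 0 <= x <= 2 by rewrite x0.
have h0 : 0 <= (0 : R) <= 2 by rewrite lexx; lra.
have := lip x 0 h1 h0; rewrite subr0 (ger0_norm x0).
have -> : theta 0 = 1 by rewrite (cutoff_one hth)// lexx ler01.
move=> hl; rewrite -[theta x](subrK 1) (le_trans (ler_normD _ _))// normr1 addrC lerD2l (le_trans hl)//.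
by rewrite mulrC ler_pM2r.
Qed.

End cutoff.

(** * The trilinear form on Hermite coefficients *)

Section cubic.
Context {R : realType} {d : nat} (K : nat).
Local Notation X := 'rV[R]_d.
Local Notation leb := (@lebesgue_rV R d).
Local Notation I := {ffun 'I_d -> 'I_K}.
Local Notation V := (I -> R[i]).
Implicit Types (c u v w : V) (s k j : nat).
Local Notation Re := complex.Re.
Local Notation Im := complex.Im.
Local Notation wn := (wn (@lamK R d K)).

(** Antilinear in [v]; linearity of the slots is therefore stated with real scalars throughout. *)
Definition trip u v w : X -> R[i] := fun x => hexpC u x * conjc (hexpC v x) * hexpC w x.
Definition tcoef u v w : V := coef (trip u v w).

Definition hr c : X -> R := hexp (fun n => Re (c n)).
Definition hi c : X -> R := hexp (fun n => Im (c n)).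

Lemma reP_trip u v w : reP (trip u v w) = fun x => (hr u x * hr v x * hr w x + hi u x * hi v x * hr w x) +
  (hr u x * hi v x * hi w x + (- 1) * (hi u x * hr v x * hi w x)).
Proof.
apply/funext => x; rewrite /reP /trip !ReM !ImM Re_conj Im_conj.
rewrite -!/(reP _ x) -!/(imP _ x) !reP_hexpC !imP_hexpC -/(hr u) -/(hr v) -/(hr w) -/(hi u) -/(hi v) -/(hi w).
by move: (hr u x) (hr v x) (hr w x) (hi u x) (hi v x) (hi w x) => *; ring.
Qed.

Lemma imP_trip u v w : imP (trip u v w) = fun x => (hr u x * hr v x * hi w x + hi u x * hi v x * hi w x) +
  (hi u x * hr v x * hr w x + (- 1) * (hr u x * hi v x * hr w x)).
Proof.
apply/funext => x; rewrite /imP /trip !ImM !ReM Re_conj Im_conj.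
rewrite -!/(reP _ x) -!/(imP _ x) !reP_hexpC !imP_hexpC -/(hr u) -/(hr v) -/(hr w) -/(hi u) -/(hi v) -/(hi w).
by move: (hr u x) (hr v x) (hr w x) (hi u x) (hi v x) (hi w x) => *; ring.
Qed.

Lemma schwartz_hr c : schwartz (hr c). Proof. exact: schwartz_hexp. Qed.
Lemma schwartz_hi c : schwartz (hi c). Proof. exact: schwartz_hexp. Qed.

Lemma schwartz3 (f g h : X -> R) : schwartz f -> schwartz g -> schwartz h ->
  schwartz (fun x => f x * g x * h x).
Proof. by move=> sf sg sh; apply: (@schwartzM R d (fun x => f x * g x)) => //; exact: schwartzM. Qed.

Let sr := schwartz_hr. Let si := schwartz_hi.

Lemma schwartzC_trip u v w : schwartzC (trip u v w).
Proof.
split; rewrite ?reP_trip ?imP_trip; apply: schwartzD; apply: schwartzD; try apply: schwartzZ;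
  apply: schwartz3; by [exact: sr|exact: si].
Qed.

Lemma Nr4 s (f1 f2 f3 f4 : X -> R) (B : R) : schwartz f1 -> schwartz f2 -> schwartz f3 -> schwartz f4 ->
  Nr s f1 <= B -> Nr s f2 <= B -> Nr s f3 <= B -> Nr s f4 <= B ->
  Nr s (fun x => (f1 x + f2 x) + (f3 x + (- 1) * f4 x)) <= 16 * B.
Proof.
move=> s1 s2 s3 s4 h1 h2 h3 h4; have s4' : schwartz (fun x => (- 1) * f4 x) by exact: schwartzZ.
have N4 := @NrZ R d s (- 1) f4 s4; have N12 := NrD s s1 s2; have N34 := NrD s s3 s4'.
have N := NrD s (schwartzD s1 s2) (schwartzD s3 s4').
rewrite sqrrN expr1n mul1r in N4; rewrite N4 in N34.
apply: (le_trans N); move: h1 h2 h3 h4 N12 N34; clear -R.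
by move: (Nr s f1) (Nr s f2) (Nr s f3) (Nr s f4) (Nr s _) (Nr s _) => *; lra.
Qed.

Lemma wn_parts s c : wn s c = Nr s (hr c) + Nr s (hi c).
Proof. by rewrite !Nr_hexp -big_split; apply: eq_bigr => n _ /=; rewrite mulrDr. Qed.

Lemma Nr_hr s c : Nr s (hr c) <= wn s c.
Proof. by rewrite wn_parts lerDl Nr_ge0. Qed.

Lemma Nr_hi s c : Nr s (hi c) <= wn s c.
Proof. by rewrite wn_parts lerDr Nr_ge0. Qed.

End cubic.

Section tame_complex.
Context {R : realType} {d : nat}.
Hypothesis d0 : (0 < d)%N.

Lemma tcoef_tame (k j : nat) : (2 * d <= 3 * k)%N -> (k <= 2)%N -> (k <= j)%N ->
  exists2 C : R, 0 <= C & forall (K : nat) (M t : R) (u v w : {ffun 'I_d -> 'I_K} -> R[i]), 0 <= M -> 0 < t ->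
  (forall c, c = u \/ c = v \/ c = w -> wn (@lamK R d K) k c <= M /\ wn (@lamK R d K) j c <= t ^+ (j - k) * M) ->
  wn (@lamK R d K) j (tcoef u v w) <= C * (t ^+ (j - k) * M ^+ 3).
Proof.
move=> dk k2 kj; have [C C0 H] := @tame R d d0 k j dk k2 kj.
exists (32 * C); first by rewrite mulr_ge0.
move=> K M t u v w M0 t0 B.
have Br c : c = u \/ c = v \/ c = w -> tame_ball k j M t (hr c).
  move=> /B[b1 b2]; split; first exact: Span_hexp.
    exact: le_trans (Nr_hr k c) b1.
  exact: le_trans (Nr_hr j c) b2.
have Bi c : c = u \/ c = v \/ c = w -> tame_ball k j M t (hi c).
  move=> /B[b1 b2]; split; first exact: Span_hexp.
    exact: le_trans (Nr_hi k c) b1.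
  exact: le_trans (Nr_hi j c) b2.
have iu : u = u \/ u = v \/ u = w by left.
have iv : v = u \/ v = v \/ v = w by right; left.
have iw : w = u \/ w = v \/ w = w by right; right.
apply: le_trans (proj_contract K (schwartzC_Sigma j (schwartzC_trip u v w))) _.
rewrite Snorm2_schwartz; last exact: schwartzC_trip.
rewrite reP_trip imP_trip (_ : 32 * C * _ = 16 * (C * (t ^+ (j - k) * M ^+ 3)) + 16 * (C * (t ^+ (j - k) * M ^+ 3))); last first.
  by move: (_ * M ^+ 3) => p; ring.
have sr := @schwartz_hr R d K; have si := @schwartz_hi R d K.
apply: lerD; apply: Nr4; try (apply: schwartz3; by [exact: sr|exact: si]);
  apply: H => //; by [exact: Br|exact: Bi].
Qed.

End tame_complex.

Section weighted_misc.
Context {R : realType} {I : finType}.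
Variable lam : I -> R.
Hypothesis lam1 : forall n, 1 <= lam n.
Local Notation V := (I -> R[i]).
Local Notation wn := (wn lam).
Implicit Types (u v : V) (s : nat).

Lemma wn_addle s u v : wn s (fun n => u n + v n) <= 2 * wn s u + 2 * wn s v.
Proof.
have := wn_ge0 lam1 s (fun n => u n + - v n); rewrite (wnD lam s u (fun n => - v n)) ripNr wnD.
rewrite (_ : wn s (fun n => - v n) = wn s v); last by apply: eq_bigr => n _; rewrite /nsq ReN ImN !sqrrN.
by move: (rip _ _ _ _) (wn s u) (wn s v) => *; lra.
Qed.

Lemma wn_opp s u : wn s (fun n => - u n) = wn s u.
Proof. by apply: eq_bigr => n _; rewrite /nsq ReN ImN !sqrrN. Qed.

Lemma wn_sub_sqr s u v : (wn s u - wn s v) ^+ 2 <= wn s (fun n => u n - v n) * (2 * wn s u + 2 * wn s v).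
Proof.
have -> : wn s u - wn s v = rip lam s (fun n => u n - v n) (fun n => u n + v n).
  rewrite -sumrB; apply: eq_bigr => n _; rewrite /nsq !ReD !ImD ReN ImN; ring.
apply: (le_trans (rip_CS lam1 s _ _)); rewrite ler_wpM2l ?wn_ge0//; exact: wn_addle.
Qed.

(** Homogeneity: [u] is rescaled so that its squared norm is at most M. The small [eta] covers a
    vector of norm zero and is removed at the end. *)
Lemma slot_bound s (M B : R) (T : V -> V) u : 0 < M -> 0 <= B ->
  (forall (a : R) v, T (fun n => a%:C * v n) = fun n => a%:C * T v n) ->
  (forall v, wn s v <= M -> wn s (T v) <= B) -> wn s (T u) <= B / M * wn s u.
Proof.
move=> M0 B0 Th Tb; rewrite -subr_le0; apply/ler_addgt0Pr => e e0; rewrite add0r.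
have BM : 0 <= B / M by rewrite divr_ge0// ltW.
pose eta := e / (B / M + 1); have bm1 : 0 < B / M + 1 by rewrite ltr_wpDl.
have eta0 : 0 < eta by rewrite divr_gt0.
have y0 : 0 < wn s u + eta by rewrite ltr_wpDl// wn_ge0.
pose a := Num.sqrt (M / (wn s u + eta)).
have a2 : a ^+ 2 = M / (wn s u + eta) by rewrite sqr_sqrtr// divr_ge0// ltW.
have a20 : 0 < a ^+ 2 by rewrite a2 divr_gt0.
have := Tb (fun n => a%:C * u n); rewrite wnZ Th wnZ => h.
have {}h : a ^+ 2 * wn s (T u) <= B.
  apply: h; rewrite a2 mulrAC -mulrA ler_piMr ?(ltW M0)// ler_pdivrMr// mul1r lerDl ltW//.
have : wn s (T u) <= B / M * (wn s u + eta).
  rewrite -(ler_pM2l a20) (le_trans h)// a2 le_eqVlt; apply/orP; left; apply/eqP; field.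
  by rewrite !gt_eqF.
move=> h2; rewrite lerBlDl (le_trans h2)// mulrDr lerD2l /eta mulrA ler_pdivrMr// mulrC ler_wpM2l ?(ltW e0)//.
by rewrite lerDl.
Qed.

Lemma six_terms s (t1 t2 t3 t4 t5 t6 : V) (B : R) : wn s t1 <= B -> wn s t2 <= B -> wn s t3 <= B ->
  wn s t4 <= B -> wn s t5 <= B -> wn s t6 <= B ->
  wn s (fun n => (4^-1)%:C * (((t1 n + t2 n) + (t3 n + t4 n)) + (t5 n + t6 n))) <= 3 * B.
Proof.
move=> b1 b2 b3 b4 b5 b6; rewrite wnZ.
have B0 := le_trans (wn_ge0 lam1 s t1) b1.
have a1 := wn_addle s t1 t2; have a2 := wn_addle s t3 t4; have a3 := wn_addle s t5 t6.
have a4 := wn_addle s (fun n => t1 n + t2 n) (fun n => t3 n + t4 n).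
have := wn_addle s (fun n => (t1 n + t2 n) + (t3 n + t4 n)) (fun n => t5 n + t6 n).
move: B0 a1 a2 a3 a4 b1 b2 b3 b4 b5 b6; do 11! move: (wn _ _).
by move=> *; lra.
Qed.

End weighted_misc.

(** * The truncated cubic map: linear bound and Lipschitz bound *)

Section cubic_map.
Context {R : realType} {d : nat}.
Hypothesis hd : (1 <= d <= 3)%N.
Local Notation X := 'rV[R]_d.
Local Notation leb := (@lebesgue_rV R d).
Local Notation I K := {ffun 'I_d -> 'I_K}.
Local Notation lamK := (@lamK R d _).

Lemma d_gt0 : (0 < d)%N. Proof. by case/andP: hd. Qed.

Lemma lamK_ge1 K (n : I K) : 1 <= lamK n.
Proof. by apply: le_trans (lam_ge _ (Ordinal d_gt0)); rewrite ler1n addn1. Qed.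

Lemma lamK_le K (n : I K) : lamK n <= 6 * K%:R.
Proof.
have [K0|K0] := posnP K; first by case: (n (Ordinal d_gt0)) => m; rewrite {1}K0.
apply: (@le_trans _ _ (\sum_(i < d) (2 * K%:R))).
  apply: ler_sum => i _; rewrite -natrM ler_nat /vidx.
  by rewrite addn1 ltn_pmul2l// ltn_ord.
rewrite sumr_const card_ord -[leLHS]mulr_natr.
have : d%:R <= 3%:R :> R by rewrite ler_nat; case/andP: hd.
by have : 0 <= K%:R :> R by []; move: (K%:R : R) (d%:R : R) => k e; nra.
Qed.

Lemma coef_lin K (a : R) (u v : X -> R[i]) : L2 u -> L2 v ->
  coef (K := K) (fun x => a%:C * u x + v x) = fun n => a%:C * coef u n + coef v n.
Proof.
move=> /L2_parts[ur ui] /L2_parts[vr vi]; apply/funext => n; rewrite !coefE.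
have r f : L2r f -> rint leb (fun x => f x * hT (vidx n) x).
  by move=> Lf; apply: L2rM_schwartz => //; exact: schwartz_hT.
apply: complex_eq; rewrite ?(ReD, ImD, Re_real_mul, Im_real_mul) /=.
  rewrite -(IntZ a (r _ ur)) -(IntD (rintZ a (r _ ur)) (r _ vr)); apply: eq_Rintegral => x _.
  by rewrite /reP ReD Re_real_mul; ring.
rewrite -(IntZ a (r _ ui)) -(IntD (rintZ a (r _ ui)) (r _ vi)); apply: eq_Rintegral => x _.
by rewrite /imP ImD Im_real_mul; ring.
Qed.

Section fixed_K.
Variable K : nat.
Local Notation V := (I K -> R[i]).
Implicit Types (u v w c : V).

Lemma trip_L2 u v w : L2 (trip u v w).
Proof. exact: schwartzC_L2 (schwartzC_trip u v w). Qed.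

Lemma tcoef_lin1 (a : R) u u' v w :
  tcoef (fun n => a%:C * u n + u' n) v w = fun n => a%:C * tcoef u v w n + tcoef u' v w n.
Proof.
rewrite /tcoef -(coef_lin K a (trip_L2 u v w) (trip_L2 u' v w)); congr coef.
by apply/funext => x; rewrite /trip hexpC_lin; ring.
Qed.

Lemma tcoef_lin2 (a : R) u v v' w :
  tcoef u (fun n => a%:C * v n + v' n) w = fun n => a%:C * tcoef u v w n + tcoef u v' w n.
Proof.
rewrite /tcoef -(coef_lin K a (trip_L2 u v w) (trip_L2 u v' w)); congr coef.
have cj (z z' : R[i]) : conjc (a%:C * z + z') = a%:C * conjc z + conjc z'.
  by apply: complex_eq; rewrite ?(ReD, ImD, Re_conj, Im_conj, Re_real_mul, Im_real_mul)//; ring.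
apply/funext => x; rewrite /trip hexpC_lin cj.
by move: (conjc _) (conjc _) => p q; ring.
Qed.

Lemma tcoef_lin3 (a : R) u v w w' :
  tcoef u v (fun n => a%:C * w n + w' n) = fun n => a%:C * tcoef u v w n + tcoef u v w' n.
Proof.
rewrite /tcoef -(coef_lin K a (trip_L2 u v w) (trip_L2 u v w')); congr coef.
by apply/funext => x; rewrite /trip hexpC_lin; ring.
Qed.

(** The projection of (|c|^2 + |v|^2)/2 times (c + v)/2, expanded into trilinear terms. *)
Definition cubc c v : V := fun n =>
  (4^-1)%:C * ((tcoef c c c n + tcoef c c v n) + (tcoef v v c n + tcoef v v v n)).

Lemma tcoef_Z1 (a : R) u v w : tcoef (fun n => a%:C * u n) v w = fun n => a%:C * tcoef u v w n.
Proof.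
have z := tcoef_lin1 (- 1) u u v w; have := tcoef_lin1 a u (fun n => (- 1)%:C * u n + u n) v w.
rewrite z => h; apply/funext => n; have := congr1 (fun f => f n) h => /=.
rewrite rmorphN1 mulN1r addNr addr0 => <-.
by congr (tcoef _ v w n); apply/funext => m; rewrite mulN1r addNr addr0.
Qed.

Lemma tcoef_Z2 (a : R) u v w : tcoef u (fun n => a%:C * v n) w = fun n => a%:C * tcoef u v w n.
Proof.
have z := tcoef_lin2 (- 1) u v v w; have := tcoef_lin2 a u v (fun n => (- 1)%:C * v n + v n) w.
rewrite z => h; apply/funext => n; have := congr1 (fun f => f n) h => /=.
rewrite rmorphN1 mulN1r addNr addr0 => <-.
by congr (tcoef u _ w n); apply/funext => m; rewrite mulN1r addNr addr0.
Qed.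

Lemma tcoef_Z3 (a : R) u v w : tcoef u v (fun n => a%:C * w n) = fun n => a%:C * tcoef u v w n.
Proof.
have z := tcoef_lin3 (- 1) u v w w; have := tcoef_lin3 a u v w (fun n => (- 1)%:C * w n + w n).
rewrite z => h; apply/funext => n; have := congr1 (fun f => f n) h => /=.
rewrite rmorphN1 mulN1r addNr addr0 => <-.
by congr (tcoef u v _ n); apply/funext => m; rewrite mulN1r addNr addr0.
Qed.

Lemma tcoef_diff2 v v' w : let e n := v n - v' n in
  tcoef v v w = fun n => (tcoef e v w n + tcoef v' e w n) + tcoef v' v' w n.
Proof.
move=> e; have E : v = fun n => 1%:C * e n + v' n.
  by apply/funext => n; rewrite /e mul1r subrK.
rewrite {1}E tcoef_lin1 [in tcoef v' v w]E tcoef_lin2; apply/funext => n.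
by rewrite !mul1r addrA.
Qed.

(** Slot by slot telescoping: each of the six terms contains the difference exactly once. *)
Lemma cubc_diff c v v' : let e n := v n - v' n in
  (fun n => cubc c v n - cubc c v' n) = fun n =>
  (4^-1)%:C * (((tcoef c c e n + tcoef e v c n) + (tcoef v' e c n + tcoef e v v n)) +
               (tcoef v' e v n + tcoef v' v' e n)).
Proof.
move=> e; have E : v = fun n => 1%:C * e n + v' n.
  by apply/funext => n; rewrite /e mul1r subrK.
have e1 : tcoef c c v = fun n => tcoef c c e n + tcoef c c v' n.
  by rewrite {1}E tcoef_lin3; apply/funext => n; rewrite mul1r.
have e2 := tcoef_diff2 v v' c; have e3 := tcoef_diff2 v v' v.
have e4 : tcoef v' v' v = fun n => tcoef v' v' e n + tcoef v' v' v' n.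
  by rewrite {1}E tcoef_lin3; apply/funext => n; rewrite mul1r.
apply/funext => n; rewrite /cubc e1 e2 e3 e4 -/e /=.
move: (tcoef c c c n) (tcoef c c v' n) (tcoef c c e n) (tcoef e v c n) (tcoef v' e c n) (tcoef v' v' c n).
by move: (tcoef e v v n) (tcoef v' e v n) (tcoef v' v' e n) (tcoef v' v' v' n) => *; ring.
Qed.

Variables (theta : R -> R) (L : nat).

Definition gcoef k c v : V := fun n =>
  (theta (wn lamK k c / L%:R) * theta (wn lamK k v / L%:R))%:C * cubc c v n.

Let cubic_facts k c v : L2 (truncated_cubic theta k L (hexpC c) (hexpC v)) /\
  coef (K := K) (truncated_cubic theta k L (hexpC c) (hexpC v)) = gcoef k c v.
Proof.
rewrite /truncated_cubic !Snorm2_hexpC.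
set r := _ * theta _.
have sq (z : R[i]) : `|z| ^+ 2 = z * conjc z by rewrite sqr_normc.
have L0 : L2 (fun _ : X => 0 : R[i]).
  by apply/L2_parts; split; exact: L2r0.
pose q := r * 4^-1.
have E : (fun x : X => r%:C * ((`|hexpC c x| ^+ 2 + `|hexpC v x| ^+ 2) / 2) * ((hexpC c x + hexpC v x) / 2)) =
  fun x => q%:C * trip c c c x + (q%:C * trip c c v x + (q%:C * trip v v c x + (q%:C * trip v v v x + 0))).
  have qE : q%:C = r%:C / 4 :> R[i] by rewrite /q rmorphM fmorphV rmorph_nat.
  apply/funext => x; rewrite !sq /trip qE addr0; move: r%:C => rr.
  by move: (hexpC c x) (hexpC v x) (conjc _) (conjc _) => p s p' s'; field.
rewrite E; have tl := trip_L2.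
have La (u : X -> R[i]) (b : R) (f : X -> R[i]) : L2 u -> L2 f -> L2 (fun x => b%:C * u x + f x).
  move=> /L2_parts[ur ui] /L2_parts[fr fi]; apply/L2_parts; rewrite /reP /imP; split.
    by under eq_fun do rewrite ReD Re_real_mul; apply: L2rD => //; exact: L2rZ.
  by under eq_fun do rewrite ImD Im_real_mul; apply: L2rD => //; exact: L2rZ.
have H4 := La (trip v v v) q _ (tl v v v) L0; have H3 := La (trip v v c) q _ (tl v v c) H4.
have H2 := La (trip c c v) q _ (tl c c v) H3.
split; first exact: (La (trip c c c) q _ (tl c c c) H2).
rewrite (coef_lin K q (tl c c c) H2) (coef_lin K q (tl c c v) H3).
rewrite (coef_lin K q (tl v v c) H4) (coef_lin K q (tl v v v) L0).
apply/funext => n; rewrite /gcoef /cubc -/r -!/(tcoef _ _ _).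
have -> : coef (K := K) (fun=> 0) n = 0 :> R[i].
  rewrite coefE; apply: complex_eq => /=; rewrite -[RHS](@Int0 _ _ R leb);
  by apply: eq_Rintegral => x _; rewrite mul0r.
by rewrite /q rmorphM; move: (tcoef _ _ _ n) (tcoef _ _ _ n) (tcoef _ _ _ n) (tcoef _ _ _ n) => *; ring.
Qed.

Lemma L2_cubic_hexpC k c v : L2 (truncated_cubic theta k L (hexpC c) (hexpC v)).
Proof. exact: (cubic_facts k c v).1. Qed.

Lemma projK_cubic k c v :
  Defs.projK K (truncated_cubic theta k L (hexpC c) (hexpC v)) = hexpC (gcoef k c v).
Proof. by rewrite projKE (cubic_facts k c v).2. Qed.

End fixed_K.

(** For d in {1, 2, 3} this is the least integer above d/2, and also the least with 2d <= 3 kd. It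
    satisfies both requirements of the tame estimate, and every admissible [k] is at least [kd]. *)
Definition kd : nat := if (d == 1)%N then 1 else 2.

Lemma kd_props : [/\ (2 * d <= 3 * kd)%N, (kd <= 2)%N & forall k, (d < 2 * k)%N -> (kd <= k)%N].
Proof.
move: hd; rewrite /kd; case: (d) => [|[|[|[|]]]]//= _; split => //; by case=> [|[|]].
Qed.

Variables (theta : R -> R) (L : nat).
Hypothesis hth : cutoff theta.
Hypothesis L0 : (0 < L)%N.

Let l : R := L%:R.
Let l0 : 0 < l. Proof. by rewrite ltr0n. Qed.

Lemma scale_root (D : nat) (y M : R) : (0 < D)%N -> 0 < y -> 0 < M -> exists2 t : R, 0 < t & t ^+ D * M = y.
Proof.
move=> D0 y0 M0; exists ((y / M) `^ (D%:R^-1)); first by rewrite powR_gt0// divr_gt0.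
rewrite -powR_mulrn ?powR_ge0// -powRrM mulVf ?pnatr_eq0 -?lt0n//.
by rewrite powRr1 ?divfK ?gt_eqF// divr_ge0// ltW.
Qed.

Let th0 (x : R) : 2 < x -> theta x = 0. Proof. exact: cutoff_supp. Qed.

Lemma theta_off K k (c : I K -> R[i]) : 2 * l < wn lamK k c -> theta (wn lamK k c / l) = 0.
Proof. by move=> h; apply: th0; rewrite ltr_pdivlMr. Qed.

Lemma wn_cubc K s (c v : I K -> R[i]) (B : R) :
  wn lamK s (tcoef c c c) <= B -> wn lamK s (tcoef c c v) <= B ->
  wn lamK s (tcoef v v c) <= B -> wn lamK s (tcoef v v v) <= B -> wn lamK s (cubc c v) <= B.
Proof.
have l1 := @lamK_ge1 K; move=> h1 h2 h3 h4; rewrite /cubc wnZ.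
have a1 := wn_addle l1 s (tcoef c c c) (tcoef c c v).
have a2 := wn_addle l1 s (tcoef v v c) (tcoef v v v).
have := wn_addle l1 s (fun n => tcoef c c c n + tcoef c c v n) (fun n => tcoef v v c n + tcoef v v v n).
by move: h1 h2 h3 h4 a1 a2; do 7! move: (wn _ _ _); clear -R => *; lra.
Qed.

(** Outside the ball of squared radius 2L in Sigma^k the cutoff vanishes. Inside, the tame estimate
    at order [kd] gives t^D M^3 = (t^D M) M^2: linear in the high norm, with a factor M^2 controlled
    by the cutoff. Using [kd] instead of [k] makes the constant independent of [k]. *)
Lemma gcoef_bound j : exists2 C : R, 0 <= C & forall k K (c v : I K -> R[i]),
  (d < 2 * k)%N -> (k <= j)%N -> wn lamK j (gcoef theta L k c v) <= C * (wn lamK j c + wn lamK j v).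
Proof.
have [k3 k2 kk] := kd_props; have [La La0 [_ thb]] := cutoff_lip hth.
have [kj|jk] := leqP kd j; last first.
  exists 0 => // k K c v dk kj; have := leq_trans (kk k dk) kj.
  by rewrite leqNgt jk.
have [C C0 H] := @tcoef_tame R d d_gt0 kd _ k3 k2 kj.
pose C' := C * (4 * l + 1) ^+ 2; have C'0 : 0 <= C' by rewrite mulr_ge0 ?sqr_ge0.
exists (La ^+ 4 * C'); first by apply: mulr_ge0 => //; rewrite exprn_ge0// ltW.
move=> k K c v dk kj'; have l1 := @lamK_ge1 K.
have Y0 : 0 <= wn lamK j c + wn lamK j v by rewrite addr_ge0 ?wn_ge0.
have rhs0 : 0 <= La ^+ 4 * C' * (wn lamK j c + wn lamK j v).
  by apply: mulr_ge0 => //; apply: mulr_ge0 => //; rewrite exprn_ge0// ltW.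
have [cb|/theta_off cb] := leP (wn lamK k c) (2 * l); last by rewrite /gcoef cb mul0r wnZ expr0n /= mul0r.
have [vb|/theta_off vb] := leP (wn lamK k v) (2 * l); last by rewrite /gcoef vb mulr0 wnZ expr0n /= mul0r.
(* The extra [e] keeps Y positive, so that t can be solved from t^D M = Y; it is removed
   afterwards. *)
have key (e : R) : 0 < e -> e <= 1 -> wn lamK j (cubc c v) <= C' * (wn lamK j c + wn lamK j v + e).
  move=> e0 e1; set Y := wn lamK j c + wn lamK j v + e; have Yp : 0 < Y by rewrite ltr_wpDl.
  have cY : wn lamK j c <= Y by rewrite /Y -addrA lerDl addr_ge0 ?wn_ge0// ltW.
  have vY : wn lamK j v <= Y by rewrite /Y addrAC lerDr addr_ge0 ?wn_ge0// ltW.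
  have ck : wn lamK kd c <= 2 * l by rewrite (le_trans _ cb)// wn_le// kk.
  have vk : wn lamK kd v <= 2 * l by rewrite (le_trans _ vb)// wn_le// kk.
  have [M [t [M0 t0 HM HB]]] : exists M t : R, [/\ 0 <= M, 0 < t, M <= 4 * l + 1,
      t ^+ (j - kd) * M = Y & wn lamK kd c <= M /\ wn lamK kd v <= M].
    have l2 : 0 < 2 * l by rewrite mulr_gt0.
    (* If j = kd there is no room between the two norms: t = 1 and M = Y, which the cutoff bounds by
       4L + 1. *)
    have [D0|D0] := posnP (j - kd)%N.
      have jE : j = kd by apply/eqP; rewrite eqn_leq kj -subn_eq0 D0 eqxx.
      exists Y, 1; split => //; first exact: ltW.
      - by rewrite /Y jE; lra.
      - by rewrite D0 expr0 mul1r.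
      - by rewrite -jE; split.
    have [t t0 tE] := scale_root D0 Yp l2.
    by exists (2 * l), t; split => //; lra.
  move=> [cM vM].
  have B u1 u2 u3 : (u1 = c \/ u1 = v) -> (u2 = c \/ u2 = v) -> (u3 = c \/ u3 = v) ->
      wn lamK j (tcoef u1 u2 u3) <= C' * Y.
    move=> i1 i2 i3; apply: (le_trans (H K M t u1 u2 u3 M0 t0 _)).
      by move=> u [->|[->|->]]; rewrite HB; [case: i1|case: i2|case: i3] => ->.
    rewrite (_ : t ^+ _ * M ^+ 3 = Y * M ^+ 2); last by rewrite -HB; ring.
    rewrite (_ : C' * Y = C * (Y * (4 * l + 1) ^+ 2)); last by rewrite /C'; ring.
    by rewrite ler_wpM2l// ler_wpM2l ?(ltW Yp)// lerXn2r ?nnegrE// (le_trans M0).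
  by apply: wn_cubc; apply: B; by [left|right].
have cub : wn lamK j (cubc c v) <= C' * (wn lamK j c + wn lamK j v).
  rewrite -subr_le0; apply/ler_addgt0Pr => e e0; rewrite add0r.
  pose e' := Num.min 1 (e / (C' + 1)); have C'1 : 0 < C' + 1 by rewrite ltr_wpDl.
  have e'0 : 0 < e' by rewrite lt_min ltr01 divr_gt0.
  have e'1 : e' <= 1 by rewrite ge_min lexx.
  have e'2 : e' <= e / (C' + 1) by rewrite ge_min lexx orbT.
  rewrite lerBlDl (le_trans (key e' e'0 e'1))// mulrDr lerD2l (le_trans (ler_wpM2l C'0 e'2))//.
  by rewrite mulrA ler_pdivrMr// mulrC ler_wpM2l ?(ltW e0)// lerDl.
rewrite /gcoef wnZ -mulrA; apply: ler_pM => //; [exact: sqr_ge0|exact: wn_ge0|].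
rewrite -(real_normK (num_real _)) normrM exprMn.
rewrite (_ : La ^+ 4 = La ^+ 2 * La ^+ 2); last by rewrite -exprD.
by apply: ler_pM; rewrite ?sqr_ge0// lerXn2r ?nnegrE ?(ltW La0)// thb// divr_ge0 ?wn_ge0 ?(ltW l0).
Qed.

(** The squared norm is Lipschitz on bounded sets only, so three cases arise. With both points in
    the ball, [wn_sub_sqr] applies. If the larger one leaves the ball, its cutoff is the boundary
    value theta 2 = 0, and the boundary replaces it. If its squared norm exceeds 8L, the squared
    distance is at least 2L. The factor 20 L is 2 (2L) + 2 (8L), from the second case. *)
Lemma theta_diff : exists2 C : R, 0 <= C & forall k K (u v : I K -> R[i]),
  (theta (wn lamK k u / l) - theta (wn lamK k v / l)) ^+ 2 <= C * wn lamK k (fun n => u n - v n).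
Proof.
have [La La0 [lip _]] := cutoff_lip hth; have t2 := cutoff_2 hth.
exists ((La / l) ^+ 2 * (20 * l)); first by apply: mulr_ge0; [exact: sqr_ge0|rewrite mulr_ge0 ?(ltW l0)].
move=> k K u v; have l1 := @lamK_ge1 K.
have Ll : 0 <= La / l by rewrite divr_ge0// ltW.
have lip' (a a' : R) : 0 <= a <= 2 * l -> 0 <= a' <= 2 * l ->
    (theta (a / l) - theta (a' / l)) ^+ 2 <= (La / l) ^+ 2 * (a - a') ^+ 2.
  move=> /andP[a0 a2] /andP[a0' a2'].
  have h : 0 <= a / l <= 2 by rewrite divr_ge0 ?(ltW l0)//= ler_pdivrMr.
  have h' : 0 <= a' / l <= 2 by rewrite divr_ge0 ?(ltW l0)//= ler_pdivrMr.
  have hl : `|theta (a / l) - theta (a' / l)| <= La / l * `|a - a'|.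
    apply: (le_trans (lip _ _ h h')); rewrite -mulrBl normrM (gtr0_norm (_ : 0 < l^-1)) ?invr_gt0//.
    by rewrite mulrA mulrAC.
  rewrite -(real_normK (num_real (theta _ - _))) -(real_normK (num_real (a - a'))) -exprMn.
  by rewrite lerXn2r ?nnegrE// (mulr_ge0 Ll (normr_ge0 _)).
wlog uv : u v / wn lamK k u <= wn lamK k v.
  move=> H; case: (leP (wn lamK k u) (wn lamK k v)) => [|/ltW] h; first exact: H.
  rewrite -sqrrN opprB (_ : wn lamK k (fun n => u n - v n) = wn lamK k (fun n => v n - u n)); first exact: H.
  by rewrite -(wn_opp lamK k (fun n => v n - u n)); congr wn; apply/funext => n; rewrite opprB.
have := wn_sub_sqr l1 k u v; have u0 := wn_ge0 l1 k u; have v0 := wn_ge0 l1 k v.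
have e0 := wn_ge0 l1 k (fun n => u n - v n).
have tri : wn lamK k v <= 2 * wn lamK k u + 2 * wn lamK k (fun n => u n - v n).
  have := wn_addle l1 k u (fun n => - (u n - v n)); rewrite wn_opp.
  by rewrite (_ : (fun n => u n + - (u n - v n)) = v)//; apply/funext => n; rewrite opprB addrC subrK.
move: tri e0 u0 v0 uv; move: (wn lamK k (fun n => u n - v n)) (wn lamK k u) (wn lamK k v) => e a b tri e0 a0 b0 ab CS.
have off x : 2 * l < x -> theta (x / l) = 0 by move=> h; apply: th0; rewrite ltr_pdivlMr.
have [bl|bl] := leP b (2 * l).
  apply: (le_trans (lip' a b _ _)); [by rewrite a0 (le_trans ab)|by rewrite b0|].
  rewrite -mulrA ler_wpM2l ?sqr_ge0// (le_trans CS)// mulrC ler_wpM2r//; lra.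
have [al|al] := leP a (2 * l); last by rewrite !off// subrr expr0n /= mulr_ge0// mulr_ge0 ?sqr_ge0// mulr_ge0// ltW.
rewrite (off b)// -t2 (_ : 2 = 2 * l / l); last by rewrite mulfK// gt_eqF.
apply: (le_trans (lip' a (2 * l) _ _)); [by rewrite a0|by rewrite lexx mulr_ge0 ?(ltW l0)|].
rewrite -mulrA ler_wpM2l ?sqr_ge0//.
have [b8|b8] := leP b (8 * l).
  apply: (@le_trans _ _ ((a - b) ^+ 2)); last first.
    by rewrite (le_trans CS)// mulrC ler_wpM2r//; lra.
  by rewrite -sqrrN opprB -(sqrrN (a - b)) opprB lerXn2r ?nnegrE; lra.
apply: (@le_trans _ _ ((2 * l) ^+ 2)).
  by rewrite -sqrrN opprB lerXn2r ?nnegrE; move: l l0 al a0 => z *; lra.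
rewrite (_ : (2 * l) ^+ 2 = 4 * l * l); last by ring.
apply: (@le_trans _ _ (20 * l * (2 * l))); last by rewrite ler_wpM2l ?mulr_ge0 ?(ltW l0)//; lra.
by have := mulr_ge0 (ltW l0) (ltW l0); lra.
Qed.

(** The difference splits into theta(v) (cubic(v) - cubic(v')) and (theta(v) - theta(v')) cubic(v').
    If one point leaves the ball, its cutoff is 0 and the cubic is evaluated at the other. In the
    first part, [slot_bound] makes each trilinear term linear in the difference. *)
Lemma gcoef_lip k : (d < 2 * k)%N -> exists2 C : R, 0 <= C & forall K (c v v' : I K -> R[i]),
  wn lamK k (fun n => gcoef theta L k c v n - gcoef theta L k c v' n) <= C * wn lamK k (fun n => v n - v' n).
Proof.
move=> dk; have [k3 k2 kk] := kd_props; have [La La0 [_ thb]] := cutoff_lip hth.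
have [Ct Ct0 TD] := theta_diff.
have [C C0 H] := @tcoef_tame R d d_gt0 kd _ k3 k2 (kk k dk).
have l2 : 0 < 2 * l by rewrite mulr_gt0.
pose B := C * (2 * l) ^+ 3; have B0 : 0 <= B by rewrite mulr_ge0 ?exprn_ge0 ?(ltW l2).
pose B' := B / (2 * l); have B'0 : 0 <= B' by rewrite divr_ge0 ?(ltW l2).
pose C1 := La ^+ 2 * (2 * La ^+ 2 * (3 * B') + 2 * Ct * B).
have C10 : 0 <= C1.
  apply: mulr_ge0; first exact: sqr_ge0.
  apply: addr_ge0; last by rewrite !mulr_ge0.
  by apply: mulr_ge0; [apply: mulr_ge0 => //; exact: sqr_ge0|rewrite mulr_ge0].
exists C1 => //.
move=> K c v v'; have l1 := @lamK_ge1 K.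
set e := fun n => v n - v' n; have e0 := wn_ge0 l1 k e.
have tb (u : I K -> R[i]) : `|theta (wn lamK k u / l)| <= La by apply: thb; rewrite divr_ge0 ?wn_ge0 ?(ltW l0).
have rhs0 : 0 <= C1 * wn lamK k e by exact: mulr_ge0.
have [cb|/theta_off cb] := leP (wn lamK k c) (2 * l); last first.
  rewrite (_ : (fun n => _) = fun n => (0 : R)%:C * c n); first by rewrite wnZ expr0n /= mul0r.
  by apply/funext => n; rewrite /gcoef cb !mul0r subrr.
have TB (u1 u2 u3 : I K -> R[i]) : wn lamK k u1 <= 2 * l -> wn lamK k u2 <= 2 * l -> wn lamK k u3 <= 2 * l ->
    wn lamK k (tcoef u1 u2 u3) <= B.
  move=> h1 h2 h3; have := H K (2 * l) 1 u1 u2 u3 (ltW l2) ltr01; rewrite !expr1n !mul1r; apply.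
  move=> u hu; have ub : wn lamK k u <= 2 * l by case: hu => [->|[->|->]].
  by rewrite ub (le_trans _ ub)// wn_le// kk.
have S1 (u2 u3 : I K -> R[i]) : wn lamK k u2 <= 2 * l -> wn lamK k u3 <= 2 * l ->
    wn lamK k (tcoef e u2 u3) <= B' * wn lamK k e.
  move=> h2 h3; apply: (slot_bound l1 (T := fun u => tcoef u u2 u3)) => //; last by move=> u hu; exact: TB.
  by move=> a u; exact: tcoef_Z1.
have S2 (u1 u3 : I K -> R[i]) : wn lamK k u1 <= 2 * l -> wn lamK k u3 <= 2 * l ->
    wn lamK k (tcoef u1 e u3) <= B' * wn lamK k e.
  move=> h2 h3; apply: (slot_bound l1 (T := fun u => tcoef u1 u u3)) => //; last by move=> u hu; exact: TB.
  by move=> a u; exact: tcoef_Z2.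
have S3 (u1 u2 : I K -> R[i]) : wn lamK k u1 <= 2 * l -> wn lamK k u2 <= 2 * l ->
    wn lamK k (tcoef u1 u2 e) <= B' * wn lamK k e.
  move=> h2 h3; apply: (slot_bound l1 (T := fun u => tcoef u1 u2 u)) => //; last by move=> u hu; exact: TB.
  by move=> a u; exact: tcoef_Z3.
have tsq (x : R) : `|x| <= La -> x ^+ 2 <= La ^+ 2.
  by move=> h; rewrite -(real_normK (num_real x)) lerXn2r ?nnegrE ?(ltW La0).
have CB u : wn lamK k u <= 2 * l -> wn lamK k (cubc c u) <= B by move=> h; apply: wn_cubc; apply: TB.
have single u : wn lamK k u <= 2 * l ->
    La ^+ 2 * ((theta (wn lamK k v / l) - theta (wn lamK k v' / l)) ^+ 2 * wn lamK k (cubc c u)) <= C1 * wn lamK k e.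
  move=> ub; rewrite /C1 -[leRHS]mulrA ler_wpM2l ?sqr_ge0// mulrDl.
  apply: (@le_trans _ _ (Ct * B * wn lamK k e)).
    by rewrite [leRHS]mulrAC; apply: ler_pM; [exact: sqr_ge0|exact: wn_ge0|exact: TD|exact: CB].
  rewrite -(mulrA 2 Ct) -(mulrA 2 (Ct * B)).
  apply: (@le_trans _ _ (2 * (Ct * B * wn lamK k e))).
    by rewrite ler_peMl ?mulr_ge0//; lra.
  rewrite lerDr; apply: mulr_ge0 => //; apply: mulr_ge0; last by rewrite mulr_ge0.
  by apply: mulr_ge0 => //; exact: sqr_ge0.
have [vb|/theta_off vb] := leP (wn lamK k v) (2 * l); have [vb'|/theta_off vb'] := leP (wn lamK k v') (2 * l).
- rewrite (_ : (fun n => _) = fun n => (theta (wn lamK k c / l))%:C * ((theta (wn lamK k v / l))%:C * (cubc c v n - cubc c v' n) +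
      (theta (wn lamK k v / l) - theta (wn lamK k v' / l))%:C * cubc c v' n)); last first.
    apply/funext => n; rewrite /gcoef -/l; move: (cubc c v n) (cubc c v' n) => p q.
    by rewrite !rmorphM rmorphB /=; ring.
  rewrite wnZ /C1 -[leRHS]mulrA; apply: ler_pM; [exact: sqr_ge0|exact: wn_ge0|exact: tsq|].
  apply: (le_trans (wn_addle l1 k _ _)); rewrite (wnZ lamK k _ (fun n => cubc c v n - cubc c v' n)) wnZ.
  have cd : wn lamK k (fun n => cubc c v n - cubc c v' n) <= 3 * B' * wn lamK k e.
    rewrite cubc_diff -/e.
    have b1 := S3 c c cb cb; have b2 := S1 v c vb cb; have b3 := S2 v' c vb' cb.
    have b4 := S1 v v vb vb; have b5 := S2 v' v vb' vb; have b6 := S3 v' v' vb' vb'.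
    rewrite -(mulrA 3); exact: six_terms.
  have t1 : theta (wn lamK k v / l) ^+ 2 * wn lamK k (fun n => cubc c v n - cubc c v' n) <= La ^+ 2 * (3 * B' * wn lamK k e).
    by apply: ler_pM => //; [exact: sqr_ge0|exact: wn_ge0|exact: tsq].
  have t2 : (theta (wn lamK k v / l) - theta (wn lamK k v' / l)) ^+ 2 * wn lamK k (cubc c v') <= Ct * wn lamK k e * B.
    by apply: ler_pM; [exact: sqr_ge0|exact: wn_ge0|exact: TD|exact: CB].
  rewrite (_ : _ * wn lamK k e = 2 * (La ^+ 2 * (3 * B' * wn lamK k e)) + 2 * (Ct * wn lamK k e * B)); last by ring.
  by rewrite lerD// ler_wpM2l.
- rewrite (_ : (fun n => _) = fun n => (theta (wn lamK k c / l))%:C *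
      ((theta (wn lamK k v / l) - theta (wn lamK k v' / l))%:C * cubc c v n)); last first.
    by apply/funext => n; rewrite /gcoef -/l vb' mulr0 mul0r !subr0 rmorphM /= mulrA.
  rewrite wnZ wnZ (le_trans _ (single v vb))// ler_wpM2r ?tsq// mulr_ge0 ?sqr_ge0// wn_ge0//.
- rewrite (_ : (fun n => _) = fun n => (theta (wn lamK k c / l))%:C *
      ((theta (wn lamK k v / l) - theta (wn lamK k v' / l))%:C * cubc c v' n)); last first.
    by apply/funext => n; rewrite /gcoef -/l vb mulr0 mul0r !sub0r rmorphM rmorphN /=; ring.
  rewrite wnZ wnZ (le_trans _ (single v' vb'))// ler_wpM2r ?tsq// mulr_ge0 ?sqr_ge0// wn_ge0//.
rewrite (_ : (fun n => _) = fun n => (0 : R)%:C * c n); first by rewrite wnZ expr0n /= mul0r.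
by apply/funext => n; rewrite /gcoef -/l vb vb' !mulr0 !mul0r subrr.
Qed.

End cubic_map.

(** * The scheme on Hermite coefficients *)

Section noise_matrix.
Context {R : realType} {d : nat}.
Hypothesis hd : (1 <= d <= 3)%N.
Local Notation X := 'rV[R]_d.
Local Notation leb := (@lebesgue_rV R d).
Variable B : nat -> (X -> R[i]) -> (X -> R[i]).
Hypothesis hB : noise_operator B.
Variable K : nat.
Hypothesis K0 : (0 < K)%N.
Local Notation I := {ffun 'I_d -> 'I_K}.
Local Notation V := (I -> R[i]).
Local Notation lamK := (@lamK R d K).
Local Notation wn := (wn lamK).
Local Notation b := (@bop R d B K).
Implicit Types (c u v : V) (j : nat).

Lemma Snorm_hexpC k c : Snorm k (hexpC c) = Num.sqrt (wn k c).
Proof. by rewrite /Snorm Snorm2_hexpC. Qed.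

Lemma sqrt_le_sq (x y a : R) : 0 <= x -> 0 <= y -> 0 <= a -> Num.sqrt x <= a * Num.sqrt y -> x <= a ^+ 2 * y.
Proof.
move=> x0 y0 a0 h; rewrite -(sqr_sqrtr x0) -(sqr_sqrtr y0) -exprMn.
by rewrite lerXn2r ?nnegrE ?mulr_ge0 ?sqrtr_ge0.
Qed.

Let l1 := @lamK_ge1 R d hd K.

Lemma bop_bound j (C : R) : 0 <= C -> opnorm_le j j (B K) (C * K%:R) ->
  forall u, wn j (b u) <= (C * K%:R) ^+ 2 * wn j u.
Proof.
move=> C0 H u; have := H _ (hexpC_Sigma j u); rewrite (B_hexpC hB K0) !Snorm_hexpC.
by apply: sqrt_le_sq; rewrite ?wn_ge0 ?mulr_ge0.
Qed.

Lemma comm_hexpC_bound j (C : R) : 0 <= C -> opnorm_le (2 * j) 0 (commA j (B K)) C ->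
  forall u, wn 0 (comm lamK b j u) <= C ^+ 2 * wn (2 * j) u.
Proof.
move=> C0 H u; have := H _ (hexpC_Sigma (2 * j) u); rewrite [in X in _ <= X -> _]Snorm_hexpC.
have e := commA_hexpC hB K0 j u.
have L : L2 (commA j (B K) (hexpC u)).
  have /L2_parts[r1 i1] : L2 (iter j opA (B K (hexpC u))).
    rewrite (B_hexpC hB K0); have [|/Sigma_L2//] := @opA_iter R d j 0 (hexpC (b u)).
    exact: hexpC_Sigma.
  have Lu : L2 (iter j opA (hexpC u)).
    by have [|/Sigma_L2//] := @opA_iter R d j 0 (hexpC u); exact: hexpC_Sigma.
  have [v ev] := noise_range hB K0 Lu.
  have /L2_parts[r2 i2] : L2 (B K (iter j opA (hexpC u))) by rewrite ev; exact: hexpC_L2.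
  apply/L2_parts; rewrite /reP /imP /commA; split.
    by under eq_fun do rewrite ReD ReN; exact: L2rB.
  by under eq_fun do rewrite ImD ImN; exact: L2rB.
rewrite /Snorm -(@Snorm2_ae _ _ 0 _ _ (hexpC_Sigma 0 _) L (eq_L2_sym e)) Snorm2_hexpC.
by apply: sqrt_le_sq => //; exact: wn_ge0.
Qed.

Lemma inner_ae (u w w' : X -> R[i]) : L2 u -> L2 w -> L2 w' -> eq_L2 w w' -> inner u w = inner u w'.
Proof.
move=> /L2_measurable[mr mi] /L2_measurable[wr wi] /L2_measurable[wr' wi'] e.
rewrite /inner /cintegral; congr (_ +i* _); apply: Int_ae.
- rewrite (_ : (fun x => _) = fun x => reP u x * reP w x + imP u x * imP w x).
    by apply: measurable_funD; apply: measurable_funM.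
  by apply/funext => x; rewrite ReM Re_conj Im_conj mulrN opprK.
- rewrite (_ : (fun x => _) = fun x => reP u x * reP w' x + imP u x * imP w' x).
    by apply: measurable_funD; apply: measurable_funM.
  by apply/funext => x; rewrite ReM Re_conj Im_conj mulrN opprK.
- by apply: filterS e => x ->.
- rewrite (_ : (fun x => _) = fun x => imP u x * reP w x - reP u x * imP w x).
    by apply: measurable_funB; apply: measurable_funM.
  by apply/funext => x; rewrite ImM Re_conj Im_conj /reP /imP; ring.
- rewrite (_ : (fun x => _) = fun x => imP u x * reP w' x - reP u x * imP w' x).
    by apply: measurable_funB; apply: measurable_funM.
  by apply/funext => x; rewrite ImM Re_conj Im_conj /reP /imP; ring.
- by apply: filterS e => x ->.
Qed.

Lemma iterA_L2 j c : L2 (iter j opA (hexpC c)).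
Proof. by have [|/Sigma_L2//] := @opA_iter R d j 0 (hexpC c); exact: hexpC_Sigma. Qed.

(** The bracket <u, A^j B B u> in [commA_form] becomes <B A^j u, B u> on coefficients, by symmetry
    of the matrix. *)
Lemma comm_form_bound j (C : R) : 0 <= C ->
  (forall u : X -> R[i], Sigma j u -> `|complex.Re (commA_form j (B K) u)| <= C * Snorm2 j u) ->
  forall u, `|rip lamK 0 (comm lamK b j u) (b u)| <= C * wn j u.
Proof.
move=> C0 H u; have := H _ (hexpC_Sigma j u); rewrite Snorm2_hexpC /commA_form !(B_hexpC hB K0).
rewrite inner_hexpC; last exact: iterA_L2.
rewrite (inner_ae (hexpC_L2 u) (iterA_L2 j (b (b u))) (hexpC_L2 _) (opA_hexpC j (b (b u)))).
rewrite (inner_hexpC _ (hexpC_L2 u)) (_ : rip _ _ _ _ = complex.Re (\sum_n coef (iter j opA (hexpC (b u))) n * (b u n)^*%C -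
   \sum_n coef (hexpC u) n * (((lamK n ^+ j)%:C * b (b u) n))^*%C))//.
rewrite rip0E; congr complex.Re.
have -> : \sum_n comm lamK b j u n * (b u n)^*%C =
   \sum_n ((lamK n ^+ j)%:C * b u n) * (b u n)^*%C - \sum_n b (lamop lamK j u) n * (b u n)^*%C.
  by rewrite -sumrB; apply: eq_bigr => n _; rewrite /comm mulrBl.
rewrite (bop_sym hB K0); congr (_ - _); apply: eq_bigr => n _.
  rewrite coef_opA_iter ?coef_hexpC//; exact: hexpC_Sigma.
rewrite coef_hexpC /lamop; move: (b (b u) n) (u n) (lamK n ^+ j) => p q r.
by apply: complex_eq; rewrite !(ReM, ImM, Re_conj, Im_conj) /=; ring.
Qed.

Section step.
Context {disp : measure_display} {Omega : measurableType disp}.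
Variables (W : R -> Omega -> R) (T : R) (N : nat).
Hypotheses (T0 : 0 < T) (N0 : (0 < N)%N).

Lemma dt_gt0 : 0 < dt T N. Proof. by rewrite divr_gt0// ltr0n. Qed.

Definition incr n w : R := W (time T N n) w - W (time T N n.-1) w.

Lemma midpoint_ae n w (u : X -> R[i]) c : L2 u -> eq_L2 u (hexpC c) ->
  eq_L2 (midpoint_op W B T N K n w u) (hexpC (ham lamK b (dt T N) (incr n w) c)).
Proof.
move=> Lu e; rewrite /midpoint_op /opAK projKE (coef_ae K Lu (hexpC_L2 c) e).
rewrite (_ : coef (hexpC c) = c); last by apply/funext => m; rewrite coef_hexpC.
rewrite (B_ae hB K0 Lu (hexpC_L2 c) e) (B_hexpC hB K0).
apply: filterS (opA_hexpC 1 c) => x /= ->.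
(* The normalisation of [chi] cancels: only the plain Brownian increment remains. *)
have -> : Num.sqrt (dt T N) / 2 * chi W T N n w = incr n w / 2.
  rewrite /chi -/(incr n w); have : Num.sqrt (dt T N) != 0 by rewrite gt_eqF// sqrtr_gt0 dt_gt0.
  by move: (Num.sqrt _) => s s0; field.
rewrite /ham; set a := (dt T N / 2)%:C; set a' := (incr n w / 2)%:C.
have := hexpC_lin a (lamop lamK 1 c) (fun m => a' * b c m) x; rewrite /lamop => ->; congr (_ + _).
have := hexpC_lin a' (b c) (fun=> 0) x.
rewrite (_ : hexpC (fun=> 0) x = 0) ?addr0; last by rewrite /hexpC big1// => m _; rewrite mul0r.
by move=> <-; congr hexpC; apply/funext => m; rewrite addr0.
Qed.

Lemma hexpC_addZ (a : R[i]) c v x : hexpC (fun n => c n + a * v n) x = hexpC c x + a * hexpC v x.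
Proof. by rewrite addrC -hexpC_lin; congr hexpC; apply/funext => n; rewrite addrC. Qed.

Let bl : clinear b. Proof. exact: bop_lin. Qed.
Let bs := bop_sym hB K0.

(** The set from which [invK] chooses is a singleton: expansions that agree almost everywhere have
    equal coefficients, and 1 + iH is invertible on coefficients. Hence an exact equality, although
    the equation holds almost everywhere. *)
Lemma invK_hexpC n w (v : X -> R[i]) c : eq_L2 v (hexpC c) ->
  Defs.invK K (fun (v : X -> R[i]) x => v x + 'i%C * midpoint_op W B T N K n w v x) v =
  hexpC (cayR lamK b (dt T N) (incr n w) c).
Proof.
move=> e; rewrite /Defs.invK; set S := [set u | _].
have SE (u : X -> R[i]) : S u <-> u = hexpC (cayR lamK b (dt T N) (incr n w) c).
  have P c' : eq_L2 (fun x => hexpC c' x + 'i%C * midpoint_op W B T N K n w (hexpC c') x)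
     (hexpC (cayT lamK b (dt T N) (incr n w) c')).
    apply: filterS (midpoint_ae n w (hexpC_L2 c') (filterE _ (fun x => erefl))) => x ->.
    by rewrite -(hexpC_addZ 'i%C c' _ x).
  split=> [[/SigmaKP[c' ->]] h|->].
    have := eq_L2_trans (eq_L2_trans (eq_L2_sym (P c')) h) e; move/hexpC_inj => <-.
    by rewrite (cayKR l1 bl bs).
  split; first by apply/SigmaKP; eexists.
  by apply: (eq_L2_trans (P _)); rewrite (cayRK l1 bl bs); exact: eq_L2_sym.
by apply/SE; apply: xgetPex; eexists; apply/SE.
Qed.

Lemma schemeTinv_hexpC n C0 w (v : X -> R[i]) c : eq_L2 v (hexpC c) ->
  schemeTinv W B T N K n C0 w v =
  if (n < tau W T N C0 w)%N then hexpC (cayR lamK b (dt T N) (incr n w) c) else fun=> 0.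
Proof. by move=> e; rewrite /schemeTinv; case: ifP => // _; exact: invK_hexpC. Qed.

Lemma schemeS_hexpC n C0 w (u : X -> R[i]) c : L2 u -> eq_L2 u (hexpC c) ->
  schemeS W B T N K n C0 w u =
  if (n < tau W T N C0 w)%N then hexpC (cayS lamK b (dt T N) (incr n w) c) else u.
Proof.
move=> Lu e; rewrite /schemeS; case: ifP => // h.
rewrite (@schemeTinv_hexpC _ _ _ _ (fun m => c m - 'i%C * ham lamK b (dt T N) (incr n w) c m)) ?h//.
apply: filterS2 e (midpoint_ae n w Lu e) => x -> ->.
have := hexpC_addZ (- 'i%C) c (ham lamK b (dt T N) (incr n w) c) x; rewrite mulNr => <-.
by congr hexpC; apply/funext => m; rewrite mulNr.
Qed.

(** The condition n < tau includes the increment of step [n] itself. The default N+1 of the minimum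
    makes it true when no increment is large. *)
Lemma tau_gt n C0 w : (0 < n <= N)%N ->
  (n < tau W T N C0 w)%N = [forall m : 'I_n, `|incr m.+1 w| < C0].
Proof.
move=> /andP[n0 nN]; rewrite /tau.
have P (s : seq nat) : (n < \big[minn/N.+1]_(i <- s | (C0 <= `|W (time T N i) w - W (time T N i.-1) w|)%R) i)%N =
    all (fun i => (C0 <= `|incr i w|) ==> (n < i)%N) s.
  elim: s => [|i s IH]; first by rewrite big_nil ltnS nN.
  rewrite big_cons /= /incr; case: ifP => h /=; last by rewrite IH.
  by rewrite leq_min IH.
rewrite P; apply/allP/forallP => h.
  move=> m; rewrite ltNge; apply/negP => hm.
  have mi : (m.+1 \in index_iota 1 N.+1).
    by rewrite mem_index_iota; apply/andP; split => //; rewrite ltnS; exact: leq_trans (ltn_ord m) nN.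
  have := h m.+1 mi; rewrite hm /=.
  by rewrite ltnS leqNgt ltn_ord.
move=> i; rewrite mem_index_iota => /andP[i0 iN]; apply/implyP => hi.
rewrite ltnNge; apply/negP => ni.
have ii : (i.-1 < n)%N by rewrite prednK.
by have := h (Ordinal ii); rewrite /= prednK// ltNge hi.
Qed.

End step.
End noise_matrix.

(** * Geometric convergence and Picard iteration *)

Section geometric_limit.
Context {R : realType}.

(** f m + 2 D 2^-m decreases and f m - 2 D 2^-m increases; the common limit lies between them, which
    also gives the rate. *)
Lemma geometric_cvg (f : nat -> R) (D : R) : (forall m, `|f m.+1 - f m| <= D * 2^-1 ^+ m) ->
  exists2 l : R, f m @[m --> \oo] --> l & forall m, `|f m - l| <= 2 * D * 2^-1 ^+ m.
Proof.
move=> h; have D0 : 0 <= D by have := le_trans (normr_ge0 _) (h 0%N); rewrite expr0 mulr1.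
have p0 m : 0 <= 2^-1 ^+ m :> R by rewrite exprn_ge0// invr_ge0.
pose g m := f m + 2 * D * 2^-1 ^+ m; pose g' m := f m - 2 * D * 2^-1 ^+ m.
have hm m : - (D * 2^-1 ^+ m) <= f m.+1 - f m <= D * 2^-1 ^+ m by rewrite -ler_norml.
have gd : {homo g : m n / (m <= n)%N >-> n <= m}.
  apply/nonincreasing_seqP => m; have /andP[_ h2] := hm m; rewrite /g exprS.
  by move: (2^-1 ^+ m) (f m) (f m.+1) h2 => q a b; lra.
have gi : {homo g' : m n / (m <= n)%N >-> m <= n}.
  apply/nondecreasing_seqP => m; have /andP[h1 _] := hm m; rewrite /g' exprS.
  by move: (2^-1 ^+ m) (f m) (f m.+1) h1 => q a b; lra.
have gg m n : g' m <= g n.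
  have g'g i : g' i <= g i by rewrite /g /g' lerD2l ge0_cp// !mulr_ge0.
  case: (leqP m n) => mn; first by rewrite (le_trans (gi _ _ mn)).
  by rewrite (le_trans (g'g m))// gd// ltnW.
have cg : cvgn g by apply: nonincreasing_is_cvgn => //; exists (g' 0%N) => _ [n _ <-].
have cq : 2 * D * 2^-1 ^+ m @[m --> \oo] --> (0 : R).
  rewrite -[X in _ --> X](mulr0 (2 * D)); apply: cvgM; first exact: cvg_cst.
  by apply: cvg_expr; rewrite ger0_norm ?invr_ge0//; lra.
exists (limn g).
  have : (g \- (fun m => 2 * D * 2^-1 ^+ m)) @ \oo --> limn g - 0 by apply: cvgB.
  by rewrite subr0; apply: cvg_trans; rewrite (_ : _ \- _ = f)//; apply/funext => m; rewrite /g /= addrK.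
move=> m; have l1 : limn g <= g m by apply: nonincreasing_cvgn_ge.
have l2 : g' m <= limn g by apply: limr_ge => //; near=> n; exact: gg.
by move: l1 l2; rewrite ler_distlC /g /g' => l1 l2; apply/andP; split; lra.
Unshelve. all: by end_near.
Qed.

Lemma lt_geometric (Q e : R) : 0 < e -> exists m, Q * 4^-1 ^+ m < e.
Proof.
move=> e0; have q4 : 1 < 4 :> R by lra.
have [m hm] := geom_unbounded (Q / e) q4.
exists m; rewrite exprVn ltr_pdivrMr ?exprn_gt0// mulrC -ltr_pdivrMr//.
Qed.

End geometric_limit.

Section picard.
Context {R : realType} {I : finType}.
Variable lam : I -> R.
Hypothesis lam1 : forall n, 1 <= lam n.
Local Notation V := (I -> R[i]).
Local Notation wn := (wn lam).
Implicit Types (u v : V) (k m : nat).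

Definition picard (F : V -> V) m : V := iter m F (fun=> 0).

(** Upper limits of the coordinates are defined and measurable for every outcome, also where the
    iteration fails to converge; where it converges they give the limit. *)
Definition picard_lim (F : V -> V) : V := fun n =>
  (fine (limn_esup (fun m => (complex.Re (picard F m n))%:E))) +i*
  (fine (limn_esup (fun m => (complex.Im (picard F m n))%:E))).

Variables (k : nat) (F : V -> V).
Hypothesis Fc : forall u v, wn k (fun n => F u n - F v n) <= 4^-1 * wn k (fun n => u n - v n).

Lemma nsq_le_wn u n : nsq (u n) <= wn k u.
Proof.
rewrite [leRHS](bigD1 n)//= -[leLHS]addr0; apply: lerD.
  by rewrite ler_peMl ?nsq_ge0// exprn_ege1.
by apply: sumr_ge0 => i _; rewrite mulr_ge0 ?lamX_ge0 ?nsq_ge0.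
Qed.

Lemma wn_dist0 u v : wn k (fun n => u n - v n) <= 0 -> u = v.
Proof.
move=> h; apply/funext => n; apply/eqP; rewrite -subr_eq0.
have : nsq (u n - v n) <= 0 by rewrite (le_trans _ h)//; exact: (nsq_le_wn (fun n => u n - v n)).
move=> h'; have : nsq (u n - v n) == 0 by rewrite eq_le h' nsq_ge0.
rewrite paddr_eq0 ?sqr_ge0// !sqrf_eq0 => /andP[/eqP a /eqP b].
by apply/eqP/complex_eq.
Qed.

Lemma picard_unique u v : F u = u -> F v = v -> u = v.
Proof.
move=> fu fv; apply: wn_dist0; have := Fc u v; rewrite fu fv.
by have := wn_ge0 lam1 k (fun n => u n - v n); move: (wn _ _) => a; lra.
Qed.

(** Squared distances shrink by 1/4, so each coordinate is geometric with ratio 1/2 and the iterates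
    are within Q 4^-m of the limit. By contraction the image of the limit is as close to them. *)
Lemma picard_fix : F (picard_lim F) = picard_lim F.
Proof.
pose D := 1 + wn k (fun n => F (fun=> 0) n - 0).
have D1 : 1 <= D by rewrite lerDl wn_ge0.
have p0 m : 0 <= 2^-1 ^+ m :> R by rewrite exprn_ge0// invr_ge0.
have step m : wn k (fun n => picard F m.+1 n - picard F m n) <= 4^-1 ^+ m * D.
  elim: m => [|m IH]; first by rewrite expr0 mul1r /D lerDr.
  by rewrite (le_trans (Fc _ _))// exprS -mulrA ler_wpM2l// invr_ge0.
have e4 m : 4^-1 ^+ m = (2^-1 ^+ m) ^+ 2 :> R.
  by rewrite exprAC; congr (_ ^+ m); field.
have part (a : R) m : a ^+ 2 <= 4^-1 ^+ m * D -> `|a| <= D * 2^-1 ^+ m.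
  move=> h; rewrite -(@ler_pXn2r _ 2)// ?nnegrE ?mulr_ge0 ?(le_trans ler01 D1)//.
  rewrite real_normK ?num_real// (le_trans h)// exprMn -e4 mulrC.
  have D2 : D <= D ^+ 2 by rewrite -[leLHS]mulr1 [in leRHS]expr2 ler_wpM2l// (le_trans ler01).
  by apply: ler_wpM2r D2; rewrite e4 sqr_ge0.
have cR n := @geometric_cvg R (fun m => complex.Re (picard F m n)) D.
have cI n := @geometric_cvg R (fun m => complex.Im (picard F m n)) D.
have {}cR n : (complex.Re (picard F m n) @[m --> \oo] --> complex.Re (picard_lim F n)) /\
    forall m, `|complex.Re (picard F m n) - complex.Re (picard_lim F n)| <= 2 * D * 2^-1 ^+ m.
  have [|l hl hb] := cR n.
    move=> m; apply: part; apply: le_trans (step m).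
    apply: le_trans (nsq_le_wn (fun n => picard F m.+1 n - picard F m n) n).
    by rewrite -ReN -ReD lerDl sqr_ge0.
  suff -> : complex.Re (picard_lim F n) = l by [].
  rewrite /picard_lim /=; have /cvg_limn_einf_sup : (complex.Re (picard F m n))%:E @[m --> \oo] --> l%:E.
    by apply/fine_cvgP; split; [exact: nearW|].
  by case=> _ ->.
have {}cI n : (complex.Im (picard F m n) @[m --> \oo] --> complex.Im (picard_lim F n)) /\
    forall m, `|complex.Im (picard F m n) - complex.Im (picard_lim F n)| <= 2 * D * 2^-1 ^+ m.
  have [|l hl hb] := cI n.
    move=> m; apply: part; apply: le_trans (step m).
    apply: le_trans (nsq_le_wn (fun n => picard F m.+1 n - picard F m n) n).
    by rewrite -ImN -ImD lerDr sqr_ge0.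
  suff -> : complex.Im (picard_lim F n) = l by [].
  rewrite /picard_lim /=; have /cvg_limn_einf_sup : (complex.Im (picard F m n))%:E @[m --> \oo] --> l%:E.
    by apply/fine_cvgP; split; [exact: nearW|].
  by case=> _ ->.
pose Q := \sum_n lam n ^+ k * (8 * D ^+ 2).
have Q0 : 0 <= Q by apply: sumr_ge0 => n _; rewrite mulr_ge0 ?lamX_ge0// mulr_ge0// sqr_ge0.
have E m : wn k (fun n => picard F m n - picard_lim F n) <= Q * 4^-1 ^+ m.
  rewrite /Q mulr_suml; apply: ler_sum => n _; rewrite -mulrA ler_wpM2l ?lamX_ge0//.
  have sq (a : R) : `|a| <= 2 * D * 2^-1 ^+ m -> a ^+ 2 <= 4 * D ^+ 2 * 4^-1 ^+ m.
    move=> h; rewrite -(real_normK (num_real a)) e4.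
    rewrite (_ : 4 * D ^+ 2 * _ = (2 * D * 2^-1 ^+ m) ^+ 2); last by ring.
    by rewrite lerXn2r ?nnegrE// (le_trans _ h).
  have := sq _ ((cR n).2 m); have := sq _ ((cI n).2 m); rewrite /nsq ReD ImD ReN ImN.
  by move: (_ ^+ 2) (_ ^+ 2) (D ^+ 2) (4^-1 ^+ m) => a b c p; lra.
apply: wn_dist0; apply/ler_addgt0Pr => e e0; rewrite add0r.
have [m hm] := lt_geometric (4 * Q) e0; apply: le_trans (ltW hm).
have -> : (fun n => F (picard_lim F) n - picard_lim F n) = fun n => (F (picard_lim F) n - F (picard F m) n) +
    (picard F m.+1 n - picard_lim F n).
  by apply/funext => n; rewrite addrA subrK.
apply: (le_trans (wn_addle lam1 k _ _)).
have h1 := Fc (picard_lim F) (picard F m); have h2 := E m; have h3 := E m.+1.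
have h4 : wn k (fun n => picard_lim F n - picard F m n) = wn k (fun n => picard F m n - picard_lim F n).
  by rewrite -(wn_opp lam k (fun n => picard F m n - picard_lim F n)); congr (wn k); apply/funext => n; rewrite opprB.
rewrite h4 in h1; rewrite exprS mulrCA in h3.
have q0 : 0 <= Q * 4^-1 ^+ m by rewrite mulr_ge0// exprn_ge0// invr_ge0.
rewrite -(mulrA 4); move: h1 h2 h3 q0; move: (Q * _) (wn _ _) (wn _ _) (wn _ _) => q a b c; lra.
Qed.

End picard.

Lemma step_sum_le {R : realType} (s a y e p q z : R) :
  s <= a + y + e -> e <= q -> 0 <= z -> s + p <= a + y + (q + p + z).
Proof. lra. Qed.

(** * One implicit step on coefficients *)

Section scheme_step.
Context {R : realType} {I : finType}.
Variable lam : I -> R.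
Hypothesis lam1 : forall n, 1 <= lam n.
Local Notation V := (I -> R[i]).
Local Notation wn := (wn lam).
Variable b : V -> V.
Hypothesis blin : clinear b.
Hypothesis bsym : forall u v, \sum_n b u n * conjc (v n) = \sum_n u n * conjc (b v n).
Variable G : V -> V -> V.
Implicit Types (u v c : V).

Definition stepF h x c v : V := fun n => cayS lam b h x c n - 'i%C * h%:C * cayR lam b h x (G c v) n.

Variables (j k : nat) (C K Cg CL kap h x : R).
Hypotheses (C0 : 0 < C) (K0 : 0 <= K) (kj : (k <= j)%N) (Cg0 : 0 <= Cg) (CL0 : 0 <= CL).
Hypothesis lamK : forall n, lam n <= 6 * K.
Hypothesis hb2 : forall u, wn j (b u) <= (C * K) ^+ 2 * wn j u.
Hypothesis hb3 : forall u, wn 0 (comm lam b j u) <= C ^+ 2 * wn (2 * j) u.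
Hypothesis hb4 : forall u, `|rip lam 0 (comm lam b j u) (b u)| <= C * wn j u.
Hypothesis hG : forall c v, wn j (G c v) <= Cg * (wn j c + wn j v).
Hypothesis hL : forall c v v', wn k (fun n => G c v n - G c v' n) <= CL * wn k (fun n => v n - v' n).
Hypotheses (h0 : 0 < h) (h1 : h <= 1) (hCg : 8 * Cg * h <= 1) (hCL : 8 * CL * h <= 1) (hK : K ^+ 4 * h <= kap).
Hypothesis SR : forall u, wn j (cayR lam b h x u) <= 2 * wn j u.
Hypothesis SS : forall u, wn j (cayS lam b h x u) <= 2 * wn j u.

Lemma linv_sub (L : V -> V) u v : linv L (fun n => u n - v n) = fun n => linv L u n - linv L v n.
Proof.
rewrite /linv (_ : rowV (fun n => u n - v n) = rowV u - rowV v); last by apply/rowP => p; rewrite !mxE.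
by rewrite mulmxBl; apply/funext => n; rewrite /unrowV !mxE.
Qed.

Lemma nsqi (a : R) (z : R[i]) : nsq ('i%C * a%:C * z) = a ^+ 2 * nsq z.
Proof. by rewrite /nsq !ReM !ImM /=; ring. Qed.

(** At order [k] the factor 2 for T^-1 comes from interpolation. The squared Lipschitz constant is
    then 2 CL h^2, at most h/4 since 8 CL h <= 1. *)
Lemma stepF_contract c u v :
  wn k (fun n => stepF h x c u n - stepF h x c v n) <= 4^-1 * wn k (fun n => u n - v n).
Proof.
have -> : wn k (fun n => stepF h x c u n - stepF h x c v n) =
    h ^+ 2 * wn k (cayR lam b h x (fun n => G c v n - G c u n)).
  rewrite [in RHS]/cayR linv_sub mulr_sumr; apply: eq_bigr => n _; rewrite mulrCA -nsqi; congr (_ * nsq _).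
  by rewrite /stepF /cayR; move: (linv _ _ n) (linv _ _ n) (cayS _ _ _ _ _ n) => *; ring.
have r := cayR_scale lam1 blin bsym SR (fun n => G c v n - G c u n) kj.
have l := hL c v u; have e : wn k (fun n => v n - u n) = wn k (fun n => u n - v n).
  by rewrite -(wn_opp lam k (fun n => u n - v n)); congr (wn k); apply/funext => n; rewrite opprB.
rewrite e in l; have w0 := wn_ge0 lam1 k (fun n => u n - v n).
apply: (@le_trans _ _ (h ^+ 2 * (2 * (CL * wn k (fun n => u n - v n))))).
  by rewrite ler_wpM2l ?sqr_ge0// (le_trans r)// ler_wpM2l.
rewrite (_ : _ * _ = h * (8 * CL * h) * (4^-1 * wn k (fun n => u n - v n))); last by field.
rewrite ler_piMl ?mulr_ge0// ?invr_ge0//.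
by rewrite mulr_ile1// ?mulr_ge0// ltW.
Qed.

Definition step_sol c : V := picard_lim (stepF h x c).

Lemma step_sol_fix c : stepF h x c (step_sol c) = step_sol c.
Proof. exact: (picard_fix lam1 (stepF_contract c)). Qed.

Lemma step_sol_uniq c v : v = stepF h x c v -> v = step_sol c.
Proof.
by move=> e; apply: (picard_unique lam1 (stepF_contract c)); [rewrite -e|exact: step_sol_fix].
Qed.

(** The coefficient in [drift_bound] plus 2 + 68 Cg, the cost of the implicit nonlinearity in
    [implicit_step]. *)
Definition rate : R := 24 * C * (1 + kap) + 26 * C + C ^+ 3 + 2 + 68 * Cg.

Lemma step_estimate c : wn j (step_sol c) <= 16 * wn j c /\
  wn j (step_sol c) <= wn j c + x * mform lam b j c + rate * (h + x ^+ 2 + x ^+ 4 * K ^+ 4) * wn j c.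
Proof.
set v := step_sol c; set s := cayS lam b h x c; set r := cayR lam b h x (G c v).
have c0 := wn_ge0 lam1 j c; have v0 := wn_ge0 lam1 j v.
(* Young's inequality with weight [h]: the cross term of s and h i r is at most h |s|^2 + h
   |r|^2. *)
have P : wn j v <= (1 + h) * wn j s + (h + h ^+ 2) * wn j r.
  have ve : v = stepF h x c v by rewrite /v step_sol_fix.
  rewrite {1}ve /stepF -/s -/r.
  pose q n := (- h)%:C * mulI r n.
  have -> : (fun n => s n - 'i%C * h%:C * r n) = fun n => s n + q n.
    by apply/funext => n; rewrite /q /mulI rmorphN /=; ring.
  rewrite wnD wnZ wn_mulI sqrrN.
  have : 2 * rip lam j s q <= h * wn j s + h * wn j r.
    rewrite /q ripZr; have := wn_ge0 lam1 j (fun n => s n + mulI r n); rewrite wnD wn_mulI.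
    move=> /(mulr_ge0 (ltW h0)); move: (rip _ _ _ _) (wn j s) (wn j r) => p a d; rewrite !mulrDr mulNr.
    by rewrite (mulrCA h 2 p); move: (h * _) (h * _) (h * _) => *; lra.
  move: (rip _ _ _ _) (wn j s) (wn j r) => p a d; rewrite !mulrDl mul1r.
  by move: (h * _) (h * _) (h ^+ 2 * _) => *; lra.
have h01 : 0 <= h <= 1 by rewrite ltW.
have rb : wn j r <= 2 * (Cg * (wn j c + wn j v)) by rewrite (le_trans (SR _))// ler_wpM2l.
have [p16 ps] := implicit_step h01 Cg0 hCg c0 v0 (SS c) rb P; split => //.
have es := energy_step lam1 blin bsym C0 K0 lamK hb2 hb3 hb4 (ltW h0) (SR c).
have db := drift_bound x (ltW C0) h01 K0 hK.
apply: (le_trans ps); rewrite /s.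
have := ler_wpM2r c0 db; move: es; set dr := `|x| * _.
set cc := 24 * C * (1 + kap) + 26 * C + C ^+ 3 in db *; rewrite /rate -/cc.
have k0 : 0 <= K ^+ 4 by rewrite exprn_ge0.
have x4 : 0 <= x ^+ 4 by rewrite (_ : x ^+ 4 = (x ^+ 2) ^+ 2) ?sqr_ge0// -exprM.
have z0 : 0 <= (2 + 68 * Cg) * (x ^+ 2 + x ^+ 4 * K ^+ 4) * wn j c.
  apply: mulr_ge0 => //; apply: mulr_ge0; first by rewrite addr_ge0// mulr_ge0.
  by rewrite addr_ge0 ?sqr_ge0// mulr_ge0.
move: (wn j (cayS _ _ _ _ _)) (mform _ _ _ _) => s' m' e1 e2.
rewrite (_ : (cc + 2 + 68 * Cg) * _ * wn j c = cc * (h + x ^+ 2 + x ^+ 4 * K ^+ 4) * wn j c +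
  (2 * h + 68 * (Cg * h)) * wn j c + (2 + 68 * Cg) * (x ^+ 2 + x ^+ 4 * K ^+ 4) * wn j c); last by ring.
exact: (step_sum_le _ e1 e2 z0).
Qed.

End scheme_step.

(** * Gaussian increments and Doob's inequality *)

Section gaussian.
Context {R : realType}.
Local Notation mu := (@lebesgue_measure R).
Implicit Types (s x : R) (f : R -> R).

Lemma ge0_integral_normal s (f : measurableTypeR R -> R) : measurable_fun setT f -> (forall x, 0 <= f x) ->
  (\int[normal_prob 0 s]_x (f x)%:E = \int[mu]_x (f x * normal_pdf 0 s x)%:E)%E.
Proof.
move=> mf f0; have dom := normal_prob_dominates 0 s.
rewrite -(Radon_Nikodym_SigmaFinite.change_of_variables dom)//; last exact/measurable_EFinP.
have RI := Radon_Nikodym_SigmaFinite.f_integrable dom.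
apply: ae_eq_integral => //.
- by apply: emeasurable_funM; [exact/measurable_EFinP|exact: measurable_int RI].
- by apply/measurable_EFinP; apply: measurable_funM => //; exact: measurable_normal_pdf.
under [X in ae_eq _ _ _ X]eq_fun do rewrite EFinM.
apply: ae_eqe_mul2l; apply: integral_ae_eq => //.
  by apply/measurable_EFinP; exact: measurable_normal_pdf.
by move=> E _ mE; rewrite -(Radon_Nikodym_SigmaFinite.f_integral dom).
Qed.

(** Moments by comparison with a Gaussian of twice the deviation. With t = x^2/(8 s^2) the
    exponentials are exp(-4t) and exp(-t), and the factor (2t)^p <= p! exp(2t) fits between them. *)
Lemma normal_pdf_pow s x p : 0 < s ->
  x ^+ (2 * p) * normal_pdf 0 s x <= 2 * 4 ^+ p * p`!%:R * s ^+ (2 * p) * normal_pdf 0 (2 * s) x.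
Proof.
move=> s0; have s2 : 2 * s != 0 by rewrite gt_eqF// mulr_gt0.
have sn : s != 0 by rewrite gt_eqF.
rewrite (normal_pdfE 0 s2) (normal_pdfE 0 sn) /normal_fun /normal_peak subr0.
have -> : Num.sqrt ((2 * s) ^+ 2 * pi *+ 2) = 2 * Num.sqrt (s ^+ 2 * pi *+ 2).
  rewrite exprMn -mulrA -mulrnAr.
  by rewrite sqrtrM ?sqr_ge0// sqrtr_sqr ger0_norm.
set r := Num.sqrt _; have r0 : 0 < r.
  by rewrite sqrtr_gt0 -mulr_natr !mulr_gt0 ?pi_gt0 ?exprn_gt0.
rewrite invfM; set t := x ^+ 2 / (8 * s ^+ 2).
have t0 : 0 <= t by rewrite divr_ge0 ?sqr_ge0// mulr_ge0// sqr_ge0.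
have -> : - x ^+ 2 / ((2 * s) ^+ 2 *+ 2) = - t by rewrite /t -mulr_natr; field.
have -> : - x ^+ 2 / (s ^+ 2 *+ 2) = - (3 * t) - t by rewrite /t -mulr_natr; field.
rewrite expRD.
have -> : x ^+ (2 * p) = (4 * s ^+ 2) ^+ p * (2 * t) ^+ p.
  by rewrite -exprMn exprM; congr (_ ^+ _); rewrite /t; field.
rewrite exprM; have ip : 0 <= r^-1 by rewrite invr_ge0 ltW.
rewrite (_ : _ * (r^-1 * _) = (4 * s ^+ 2) ^+ p * ((2 * t) ^+ p * expR (- (3 * t))) * (r^-1 * expR (- t))); last by ring.
rewrite (_ : _ * (2^-1 * _ * _) = (4 * s ^+ 2) ^+ p * p`!%:R * (r^-1 * expR (- t))); last first.
  have F (a b f i e : R) : 2 * a * f * b * (2^-1 * i * e) = a * b * f * (i * e) by field.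
  by rewrite F (exprMn p 4).
apply: ler_wpM2r; first by rewrite mulr_ge0// expR_ge0.
apply: ler_wpM2l; first by rewrite exprn_ge0// mulr_ge0// sqr_ge0.
rewrite expRN ler_pdivrMr ?expR_gt0//.
apply: (@le_trans _ _ (p`!%:R * expR (2 * t))); last first.
  by rewrite ler_wpM2l// ler_expR ler_wpM2r// ler_nat.
case: p => [|p]; first by rewrite expr0 fact0 mul1r -[leLHS]expR0 ler_expR mulr_ge0.
have := @expR_ge1Dxn _ _ p (mulr_ge0 (ler0n R 2) t0).
have f0 : 0 < p.+1`!%:R :> R by rewrite ltr0n fact_gt0.
by move=> h; rewrite [leRHS]mulrC -ler_pdivrMr//; apply: le_trans h; rewrite lerDr.
Qed.

Lemma gauss_moment s p : 0 < s -> rint (normal_prob 0 s) (fun x : measurableTypeR R => x ^+ (2 * p)) /\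
  \int[normal_prob 0 s]_x (x ^+ (2 * p)) <= 2 * 4 ^+ p * p`!%:R * s ^+ (2 * p).
Proof.
move=> s0; have mx : measurable_fun setT (fun x : measurableTypeR R => x ^+ (2 * p)) by exact: measurable_funX.
have x0 (x : R) : 0 <= x ^+ (2 * p) by rewrite exprM exprn_ge0// sqr_ge0.
set M := 2 * 4 ^+ p * _ * _.
have M0 : 0 <= M by rewrite !mulr_ge0// ?exprn_ge0// ltW.
have I1 : (\int[normal_prob 0 s]_x (x ^+ (2 * p))%:E <= M%:E)%E.
  rewrite ge0_integral_normal//.
  apply: (@le_trans _ _ (\int[mu]_x (M%:E * (normal_pdf 0 (2 * s) x)%:E)))%E.
    apply: ge0_le_integral => //.
    - by move=> x _; rewrite lee_fin mulr_ge0// normal_pdf_ge0.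
    - by apply/measurable_EFinP; apply: measurable_funM => //; exact: measurable_normal_pdf.
    - apply/measurable_EFinP; apply: measurable_funM => //; exact: measurable_normal_pdf.
    - by move=> x _; rewrite -EFinM lee_fin; exact: normal_pdf_pow.
  rewrite ge0_integralZl//; last 2 first.
  - by apply/measurable_EFinP; exact: measurable_normal_pdf.
  - by move=> x _; rewrite lee_fin normal_pdf_ge0.
  by rewrite integral_normal_pdf mule1.
have ri : rint (normal_prob 0 s) (fun x : measurableTypeR R => x ^+ (2 * p)).
  by apply/(rint_lty _ mx x0); rewrite (le_lt_trans I1)// ltry.
split => //; by rewrite -lee_fin EFin_Int.
Qed.

Lemma rint_normal_bounded s (f : measurableTypeR R -> R) (M : R) : measurable_fun setT f -> (forall x, `|f x| <= M) ->
  rint (normal_prob 0 s) f.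
Proof. by move=> mf fM; apply: (rint_bounded _ mf fM); rewrite [X in (X < _)%E]probability_setT ltry. Qed.

Definition trunc (c x : R) : R := if `|x| < c then x else 0.

Lemma measurable_trunc c : measurable_fun setT (trunc c : measurableTypeR R -> R).
Proof.
apply: measurable_fun_ifT => //; apply: measurable_fun_ltr => //.
Qed.

Lemma trunc_bound c x : 0 <= c -> `|trunc c x| <= c.
Proof. by rewrite /trunc; case: ifP => [/ltW//|_]; rewrite normr0. Qed.

Lemma trunc_sqr c x : trunc c x ^+ 2 <= x ^+ 2.
Proof. by rewrite /trunc; case: ifP => // _; rewrite expr0n sqr_ge0. Qed.

(** Adding the bound [M] makes the integrand nonnegative, the case of [ge0_integral_normal]. *)
Lemma integral_normal_bounded s (f : measurableTypeR R -> R) (M : R) : 0 < s ->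
  measurable_fun setT f -> (forall x, `|f x| <= M) ->
  \int[normal_prob 0 s]_x f x = \int[mu]_x (f x * normal_pdf 0 s x).
Proof.
move=> s0 mf fM; have fM0 (x : R) : 0 <= f x + M.
  by have := fM x; rewrite ler_norml => /andP[]; lra.
have mp : measurable_fun setT (normal_pdf 0 s : R -> R) by exact: measurable_normal_pdf.
have mfM : measurable_fun setT (fun x : measurableTypeR R => f x + M) by exact: measurable_funD.
have pi_ : rint mu (normal_pdf 0 s : R -> R) by exact: integrable_normal_pdf.
have rf := rint_normal_bounded s mf fM.
have rM : rint (normal_prob 0 s) (fun _ : measurableTypeR R => M).
  by apply: (@rint_normal_bounded _ _ `|M|).
have rfM := rintD rf rM.
have E := ge0_integral_normal s mfM fM0.
have gi : rint mu (fun x : R => (f x + M) * normal_pdf 0 s x).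
  apply/rint_lty.
  - exact: measurable_funM.
  - by move=> x; rewrite mulr_ge0// normal_pdf_ge0.
  - by rewrite -E -EFin_Int// ltry.
have -> : \int[mu]_x (f x * normal_pdf 0 s x) = \int[mu]_x ((f x + M) * normal_pdf 0 s x - M * normal_pdf 0 s x).
  by apply: eq_Rintegral => x _; ring.
rewrite IntB//; last exact: rintZ.
rewrite IntZ// [X in _ - M * X](_ : _ = 1); last by rewrite /Rintegral integral_normal_pdf.
rewrite [X in X - _](_ : _ = \int[normal_prob 0 s]_x (f x + M)); last by rewrite /Rintegral E.
rewrite IntD// [X in _ + X - _](_ : _ = M) ?mulr1 ?addrK//.
by rewrite /Rintegral integral_cst//= [X in (_ * X)%E]probability_setT mule1.
Qed.

(** x times the density is the derivative of -s^2 times the density, which has equal values at -c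
    and c. *)
Lemma gauss_trunc s (c : R) : 0 < s -> 0 < c -> \int[normal_prob 0 s]_x (trunc c x) = 0.
Proof.
move=> s0 c0; have sn : s != 0 by rewrite gt_eqF.
rewrite (@integral_normal_bounded _ _ c)//; last 2 first.
- exact: measurable_trunc.
- by move=> x; rewrite trunc_bound// ltW.
pose p := normal_pdf 0 s : R -> R.
have mp : measurable_fun setT p by exact: measurable_normal_pdf.
have pE : p = fun x => normal_peak s * expR (- x ^+ 2 / (s ^+ 2 *+ 2)).
  by rewrite /p normal_pdfE//; apply/funext => x; rewrite /normal_fun subr0.
pose F x := - s ^+ 2 * p x.
have dF (x : R) : is_derive x 1 F (x * p x).
  pose u (y : R) := - y ^+ 2 / (s ^+ 2 *+ 2).
  have d0 : is_derive x 1 u (- x / s ^+ 2).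
    pose a := - (s ^+ 2 *+ 2)^-1.
    have h := is_derive_poly (a%:P * 'X * 'X : {poly R}) x.
    have e : (a%:P * 'X * 'X : {poly R})^`().[x] = - x / s ^+ 2.
      by rewrite !(derivM, derivC, derivX, hornerE) /a -mulr_natr; field.
    rewrite e in h; rewrite (_ : u = horner (a%:P * 'X * 'X : {poly R}))//.
    by apply/funext => y; rewrite !hornerE /u /a mulrC !mulNr mulrN -mulrA -expr2 mulrC.
  have d1 := @is_derive1_comp R expR u x _ _ (is_derive_expR _) d0.
  rewrite /F pE (_ : (fun y => _) = (fun y => (- s ^+ 2 * normal_peak s) * (expR \o u) y)).
    have [e1 e2] := is_deriveZ (- s ^+ 2 * normal_peak s) d1; split; first exact: e1.
    rewrite [LHS]e2 -![_ *: _]/(_ * _); move: (expR _) (normal_peak s) => a b; field; exact: sn.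
  by apply/funext => y; rewrite /u /= mulrA.
have cp : continuous p by exact: continuous_normal_pdf.
have FTC : (\int[mu]_(x in `[(- c)%R, c]) (x * p x)%:E = 0)%E.
  rewrite (@continuous_FTC2 _ _ F).
  - by rewrite /F pE sqrrN -EFinB subrr.
  - lra.
  - by apply: continuous_subspaceT => x; apply: cvgM => //; exact: cp.
  - split => [x _||].
    + by have [] := dF x.
    + apply: cvg_at_right_filter; apply: cvgM; [exact: cvg_cst|exact: cp].
    + apply: cvg_at_left_filter; apply: cvgM; [exact: cvg_cst|exact: cp].
  - by move=> x _; rewrite derive1E; have [_ ->] := dF x.
have mxp : measurable_fun setT (fun x : R => (x * p x)%:E).
  by apply/measurable_EFinP; exact: measurable_funM.
rewrite /Rintegral (_ : (\int[mu]_x _)%E = 0%E)// -[RHS]FTC -integral_itv_obnd_cbnd; last exact: measurable_funTS.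
rewrite -integral_itv_bndo_bndc; last exact: measurable_funTS.
rewrite [RHS]integral_mkcond; apply: eq_integral => x _; rewrite patchE mem_setE in_itv /= -ltr_norml /trunc.
by case: ifP; rewrite ?mul0r.
Qed.

End gaussian.

(** * The Brownian filtration and independence *)

Section history_measurability.
Context {R : realType} {disp : measure_display} {Omega : measurableType disp}.
Variables (P : probability Omega R) (W : R -> Omega -> R).
Hypothesis hW : brownian P W.
Implicit Types (s t : R).

Definition hgen t : set (set Omega) := [set A | exists (s : R) (E : set R),
  [/\ 0 <= s <= t, measurable E & A = W s @^-1` E]].

(** The sample space with the sigma-algebra of the past up to [t], as a measurable type: adaptedness
    becomes ordinary measurability. *)
Definition histT t := g_sigma_algebraType (hgen t).

Lemma historyE t (A : set Omega) : history W t A <-> measurable (A : set (histT t)).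
Proof. by []. Qed.

Lemma history_measurable t (A : set Omega) : history W t A -> measurable A.
Proof.
move: A; apply: smallest_sub; first exact: sigma_algebra_measurable.
move=> _ [s [E [/andP[s0 _] mE ->]]]; rewrite -[X in measurable X]setTI.
exact: (brownian_measurable hW s0).
Qed.

Lemma history_mono s t (A : set Omega) : s <= t -> history W s A -> history W t A.
Proof.
move=> st; move: A; apply: smallest_sub; first exact: smallest_sigma_algebra.
move=> _ [r [E [/andP[r0 rs] mE ->]]]; apply: sub_sigma_algebra; exists r, E.
by split => //; rewrite r0 (le_trans rs).
Qed.

Lemma hist_measurable_mono s t d' (Y : measurableType d') (f : Omega -> Y) : s <= t ->
  measurable_fun setT (f : histT s -> Y) -> measurable_fun setT (f : histT t -> Y).
Proof. by move=> st mf _ A mA; apply: (history_mono st); exact: mf. Qed.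

Lemma hist_measurable t d' (Y : measurableType d') (f : Omega -> Y) :
  measurable_fun setT (f : histT t -> Y) -> measurable_fun setT f.
Proof. by move=> mf _ A mA; apply: (@history_measurable t); exact: mf. Qed.

Lemma hist_W s t : 0 <= s <= t -> measurable_fun setT (W s : histT t -> R).
Proof.
by move=> st _ A mA; rewrite setTI; apply: sub_sigma_algebra; exists s, A.
Qed.

Section independence.
Variables (s t : R).
Hypothesis st : 0 <= s < t.

Let idm : measurable_fun setT (id : Omega -> histT s).
Proof. by move=> _ A mA; rewrite setTI preimage_id; exact: history_measurable mA. Qed.

Let inc w : measurableTypeR R := W t w - W s w.

Let incm : measurable_fun setT inc.
Proof.
case/andP: st => s0 st'; apply: measurable_funB; apply: (brownian_measurable hW) => //.
by rewrite (le_trans s0) ?ltW.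
Qed.

Let pm : @measurable_fun _ _ Omega (histT s * measurableTypeR R)%type setT (fun w => (w, inc w)).
Proof. by apply/measurable_fun_pair; [exact: idm|exact: incm]. Qed.

(** By independence, the joint law of the outcome, seen by the past, and of the increment agrees
    with a product measure on rectangles, hence everywhere; Fubini's theorem then factors the
    integral. *)
Lemma indep_Int (Z : Omega -> R) (f : measurableTypeR R -> R) (M : R) :
  measurable_fun setT (Z : histT s -> R) -> (forall w, `|Z w| <= M) ->
  rint (normal_prob 0 (Num.sqrt (t - s))) f ->
  rint P (fun w => Z w * f (W t w - W s w)) /\
  \int[P]_w (Z w * f (W t w - W s w)) =
    (\int[P]_w Z w) * \int[normal_prob 0 (Num.sqrt (t - s))]_x f x.
Proof.
set nu := normal_prob 0 _; move=> mZ ZM fi.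
pose m1 := distribution P (mfun_Sub (mem_set idm)).
pose m' := distribution P (mfun_Sub (mem_set pm)).
pose F (p : histT s * measurableTypeR R) := Z p.1 * f p.2.
have uniq : forall X, measurable X -> (m1 \x nu)%E X = m' X.
  apply: product_measure_unique => A E mA mE.
  exact: etrans (brownian_indep hW st mA mE) (congr1 (fun x => P A * x)%E (brownian_gaussian hW st mE)).
have Zi : rint m1 Z by apply: (rint_bounded _ mZ ZM); rewrite [X in (X < _)%E]probability_setT ltry.
have ZP : rint P Z.
  by apply: (rint_bounded _ (hist_measurable mZ) ZM); rewrite [X in (X < _)%E]probability_setT ltry.
have mF : measurable_fun setT F by exact: rint_measurable (rint_prod Zi fi).
have mFP : measurable_fun setT (F \o (fun w => (w, inc w))) by exact: measurableT_comp mF pm.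
have eI (G : histT s * measurableTypeR R -> \bar R) :
    (\int[m']_p G p = \int[(m1 \x nu)]_p G p)%E.
  by apply: (@eq_measure_integral _ _ _ setT (m1 \x nu)%E m') => A mA _; exact: (esym (uniq A mA)).
have FP : rint P (fun w => Z w * f (inc w)).
  apply/integrableP; split; first exact/measurable_EFinP.
  have /integrableP[_] := rint_prod Zi fi; apply: le_lt_trans.
  rewrite -(eI (fun p => `|(F p)%:E|%E)).
  rewrite [leRHS](@ge0_integral_pushforward _ _ _ _ _ _ pm P setT)//; last by apply/measurable_EFinP; exact: measurableT_comp.
split => //.
have -> : \int[P]_w Z w = \int[m1]_w Z w.
  congr fine; rewrite [RHS](@integral_pushforward _ _ _ _ _ _ idm P setT)//; exact/measurable_EFinP.
rewrite -Int_prodM//; congr fine; rewrite -[RHS]eI.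
rewrite [RHS](@integral_pushforward _ _ _ _ _ _ pm P setT)//; exact/measurable_EFinP.
Qed.

End independence.
End history_measurability.

Section second_moment.
Context {R : realType}.

Lemma Int_le_ae d (T : measurableType d) (mu : {measure set T -> \bar R}) (f g : T -> R) :
  rint mu f -> rint mu g -> {ae mu, forall x, f x <= g x} -> \int[mu]_x f x <= \int[mu]_x g x.
Proof.
move=> fi gi fg; rewrite -subr_ge0 -IntB//.
have mgf := rint_measurable (rintB gi fi).
rewrite (@Int_ae _ _ _ mu _ (fun x => Num.max (g x - f x) 0))//.
- by apply: Int_ge0 => x; rewrite le_max lexx orbT.
- exact: measurable_maxr.
- by apply: filterS fg => x h; rewrite max_l// subr_ge0.
Qed.

Fixpoint runmax (M : nat -> R) n : R :=
  if n is n'.+1 then Num.max (runmax M n') (M n'.+1) else M 0%N.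

Lemma runmax_ge M n i : (i <= n)%N -> M i <= runmax M n.
Proof.
elim: n => [|n IH]; first by rewrite leqn0 => /eqP->.
by rewrite leq_eqVlt /= le_max => /predU1P[->|/IH ->//]; rewrite lexx orbT.
Qed.

(* Pathwise form of Doob's L^2 inequality. *)
Lemma doob_pathwise (D M : nat -> R) n : (forall n, M n = \sum_(i < n) D i) ->
  runmax M n ^+ 2 <= 4 * M n ^+ 2 - 4 * \sum_(i < n) runmax M i * D i.
Proof.
move=> ME; have M0 : M 0%N = 0 by rewrite ME big_ord0.
(* Doubling this inequality and adding the square of [runmax M n] - 2 M n eliminates the mixed
   product. *)
suff : runmax M n ^+ 2 + 2 * \sum_(i < n) runmax M i * D i <= 2 * M n * runmax M n.
  have := sqr_ge0 (runmax M n - 2 * M n); rewrite sqrrB.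
  by move: (runmax M n) (M n) (\sum_(_ < _) _) => s m q; nra.
elim: n => [|n IH]; first by rewrite /= M0 big_ord0 expr2 !mulr0 addr0.
rewrite big_ord_recr /=.
have -> : M n.+1 = M n + D n by rewrite !ME big_ord_recr.
move: IH; move: (runmax M n) (M n) (D n) (\sum_(_ < _) _) => s m e q.
by case: (leP s (m + e)); nra.
Qed.

End second_moment.

Section noise_moments.
Context {R : realType} {disp : measure_display} {Omega : measurableType disp}.
Variables (P : probability Omega R) (W : R -> Omega -> R).
Hypothesis hW : brownian P W.
Variables (T : R) (N : nat).
Hypotheses (T0 : 0 < T) (N0 : (0 < N)%N).
Local Notation h := (dt T N).
Local Notation hT n := (histT W (time T N n)).
Local Notation inc n w := (W (time T N n.+1) w - W (time T N n) w).
Local Notation nu := (normal_prob 0 (Num.sqrt h)).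
Implicit Types (x : R) (U : Omega -> R).

Let h0 : 0 < h. Proof. exact: dt_gt0. Qed.

Lemma time_lt n : 0 <= time T N n < time T N n.+1.
Proof.
by rewrite /time; apply/andP; split; [rewrite mulr_ge0// ltW|rewrite ltr_pM2r// ltr_nat].
Qed.

Lemma timeB n : time T N n.+1 - time T N n = h.
Proof. by rewrite /time -mulrBl -natrB// subSnn mul1r. Qed.

Lemma time_le n m : (n <= m)%N -> time T N n <= time T N m.
Proof. by move=> nm; rewrite /time ler_pM2r// ler_nat. Qed.

Lemma measurable_inc n m : (n < m)%N -> measurable_fun setT ((fun w => inc n w) : hT m -> R).
Proof.
have tm k : (k <= m)%N -> 0 <= time T N k <= time T N m.
  by move=> km; rewrite time_le// mulr_ge0// ltW.
by move=> nm; apply: measurable_funB; apply: hist_W; apply: tm => //; exact: ltnW.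
Qed.

Lemma hist_rint n U M : measurable_fun setT (U : hT n -> R) -> (forall w, `|U w| <= M) -> rint P U.
Proof.
move=> mU UM; apply: (rint_bounded _ (hist_measurable hW mU) UM).
by rewrite [X in (X < _)%E]probability_setT ltry.
Qed.

Lemma Int_step n U (f : measurableTypeR R -> R) M :
  measurable_fun setT (U : hT n -> R) -> (forall w, `|U w| <= M) -> rint nu f ->
  rint P (fun w => U w * f (inc n w)) /\
  \int[P]_w (U w * f (inc n w)) = (\int[P]_w U w) * \int[nu]_x f x.
Proof.
move=> mU UM fi; have := @indep_Int _ _ _ _ _ hW _ _ (time_lt n) U f M mU UM.
by rewrite timeB; apply.
Qed.

(** The constant of [gauss_moment] for the moment of order 8, which dominates those of the lower
    orders. *)
Definition mom : R := 2 * 4 ^+ 4 * 4`!%:R.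

Lemma mom_ge p : (p <= 4)%N -> 2 * 4 ^+ p * p`!%:R <= mom.
Proof.
move=> p4; rewrite /mom -(mulrA 2 (4 ^+ p)) -(mulrA 2 (4 ^+ 4)); apply: ler_wpM2l => //; apply: ler_pM.
- exact: exprn_ge0.
- exact: ler0n.
- by rewrite ler_eXn2l// ltr1n.
- by rewrite ler_nat; move: p4; case: p => [|[|[|[|[|]]]]].
Qed.

Lemma mom_ge0 : 0 <= mom. Proof. by rewrite /mom !mulr_ge0// exprn_ge0. Qed.

Lemma gauss_poly (b0 b2 b4 b8 : R) : 0 <= b2 -> 0 <= b4 -> 0 <= b8 ->
  let f : measurableTypeR R -> R := fun x => b0 + b2 * x ^+ 2 + b4 * x ^+ 4 + b8 * x ^+ 8 in
  rint nu f /\ \int[nu]_x f x <= b0 + mom * (b2 * h + b4 * h ^+ 2 + b8 * h ^+ 4).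
Proof.
move=> p2 p4 p8 f; have s0 : 0 < Num.sqrt h by rewrite sqrtr_gt0.
have G p : (p <= 4)%N -> rint nu (fun x : measurableTypeR R => x ^+ (2 * p)) /\
    \int[nu]_x (x ^+ (2 * p)) <= mom * h ^+ p.
  move=> pl; have [r le] := gauss_moment p s0; split => //; apply: le_trans le _.
  have -> : Num.sqrt h ^+ (2 * p) = h ^+ p by rewrite exprM sqr_sqrtr// ltW.
  exact: (ler_wpM2r (exprn_ge0 p (ltW h0)) (mom_ge pl)).
have [r1 l1] := G 1%N isT; have [r2 l2] := G 2%N isT; have [r4 l4] := G 4%N isT.
have rc : rint nu (fun _ : measurableTypeR R => b0).
  by apply: (@rint_normal_bounded _ _ _ `|b0|).
have z2 := rintZ b2 r1; have z4 := rintZ b4 r2; have z8 := rintZ b8 r4.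
have s1 := rintD rc z2; have s2 := rintD s1 z4; have s3 := rintD s2 z8; split => //.
rewrite /f !IntD// !IntZ// [X in X + _ + _ + _](_ : _ = b0); last first.
  by rewrite /Rintegral integral_cst//= [X in (_ * X)%E]probability_setT mule1.
have F (c2 c4 c8 m t : R) : b0 + c2 * (m * t ^+ 1) + c4 * (m * t ^+ 2) + c8 * (m * t ^+ 4) =
    b0 + m * (c2 * t + c4 * t ^+ 2 + c8 * t ^+ 4) by ring.
rewrite -F; apply: lerD; last exact: ler_wpM2l.
by apply: lerD; [apply: lerD => //|]; exact: ler_wpM2l.
Qed.

End noise_moments.

Section step_square.
Context {R : realType}.

(** Separates a growth factor of X^2, to be integrated against the law of the increment, from the
    cross term 2 X z f, which is linear in the truncated increment and will have mean zero. *)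
Lemma step_square (X z f r Cm x2 q : R) : 0 <= X -> 0 <= Cm -> `|z| <= Cm * X -> f ^+ 2 <= x2 ->
  0 <= r -> r ^+ 2 <= q ->
  (X + z * f + r * X) ^+ 2 <= (1 + (2 * r + (1 + Cm) * q + (Cm + Cm ^+ 2) * x2)) * X ^+ 2 + 2 * (X * z * f).
Proof.
move=> X0 C0 zX fx r0 rq.
have z2 : z ^+ 2 <= Cm ^+ 2 * X ^+ 2.
  by rewrite -exprMn -(real_normK (num_real z)) lerXn2r// ?nnegrE ?mulr_ge0.
have x20 : 0 <= x2 by rewrite (le_trans _ fx)// sqr_ge0.
have q0 : 0 <= q by rewrite (le_trans _ rq)// sqr_ge0.
have XX : 0 <= X ^+ 2 by exact: sqr_ge0.
have t1 : z ^+ 2 * f ^+ 2 <= Cm ^+ 2 * X ^+ 2 * x2.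
  by apply: ler_pM => //; exact: sqr_ge0.
have t2 : r ^+ 2 * X ^+ 2 <= q * X ^+ 2 by apply: ler_wpM2r.
have t3 : 2 * (r * X * (z * f)) <= Cm * X ^+ 2 * (q + x2).
  have a1 : r * X * (z * f) <= r * X * (Cm * X * `|f|).
    apply: ler_wpM2l; first exact: mulr_ge0.
    by rewrite (le_trans (ler_norm _))// normrM ler_wpM2r.
  have a2 : 2 * (r * `|f|) <= q + x2.
    have := sqr_ge0 (r - `|f|); rewrite sqrrB real_normK ?num_real//.
    by move: rq fx; move: (r ^+ 2) (f ^+ 2) (r * `|f|) => *; lra.
  have := ler_wpM2l (mulr_ge0 C0 XX) a2; move: a1.
  rewrite (_ : r * X * (Cm * X * `|f|) = Cm * X ^+ 2 * (r * `|f|)); last by ring.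
  by rewrite (mulrCA _ 2); move: (r * X * _) (_ * (r * _)) (_ * (q + _)) => *; lra.
rewrite (_ : (X + z * f + r * X) ^+ 2 = X ^+ 2 + z ^+ 2 * f ^+ 2 + r ^+ 2 * X ^+ 2 + 2 * (X * z * f) + 2 * r * X ^+ 2 +
  2 * (r * X * (z * f))); last by ring.
rewrite (_ : (1 + _) * X ^+ 2 = X ^+ 2 + 2 * r * X ^+ 2 + q * X ^+ 2 + Cm * X ^+ 2 * (q + x2) + Cm ^+ 2 * X ^+ 2 * x2); last by ring.
move: t1 t2 t3; move: (z ^+ 2 * _) (_ * _ * x2) (r ^+ 2 * _) (q * _) (2 * (r * X * _)) (_ * (q + x2)) => *; lra.
Qed.

Lemma norm_sqr_le (y b : R) : `|y| <= b -> `|y ^+ 2| <= b ^+ 2.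
Proof. by move=> yb; rewrite normrX lerXn2r// nnegrE// (le_trans _ yb). Qed.

Lemma psum_mono (F : nat -> R) n N : (n <= N)%N -> (forall i, (i < N)%N -> 0 <= F i) ->
  \sum_(i < n) F i <= \sum_(i < N) F i.
Proof.
move=> nN F0; rewrite -(subnKC nN) big_split_ord /= lerDl; apply: sumr_ge0 => i _; apply: F0.
by rewrite -[ltnRHS](subnKC nN) ltn_add2l.
Qed.

Lemma sqr_sum3 (a b c : R) : (a + b + c) ^+ 2 <= 3 * (a ^+ 2 + b ^+ 2 + c ^+ 2).
Proof. by have := sqr_ge0 (a - b); have := sqr_ge0 (b - c); have := sqr_ge0 (a - c); nra. Qed.

Lemma young (a s : R) : 0 < a -> s <= 2^-1 * (a + a^-1 * s ^+ 2).
Proof.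
move=> a0; have an : a != 0 by rewrite gt_eqF.
rewrite -(ler_pM2r a0) (_ : 2^-1 * _ * a = 2^-1 * (a ^+ 2 + s ^+ 2)); last by field.
by have := sqr_ge0 (s - a); nra.
Qed.

(** Discrete Gronwall lemma, through 1 + r h <= exp(r h). *)
Lemma geometric_growth (u : nat -> R) (r h T : R) N : 0 <= r -> 0 <= h -> N%:R * h <= T ->
  (forall n, (n < N)%N -> u n.+1 <= (1 + r * h) * u n) -> 0 <= u 0%N ->
  forall n, (n <= N)%N -> u n <= expR (r * T) * u 0%N.
Proof.
move=> r0 h0 hT hu u0 n nN.
have : u n <= (1 + r * h) ^+ n * u 0%N.
  elim: n nN => [_|n IH nN]; first by rewrite expr0 mul1r.
  rewrite (le_trans (hu _ nN))// exprS -mulrA ler_wpM2l ?IH ?(ltnW nN)//.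
  by rewrite addr_ge0// mulr_ge0.
move/le_trans; apply; apply: ler_wpM2r => //.
apply: (@le_trans _ _ (expR (r * h) ^+ n)).
  by rewrite lerXn2r ?nnegrE ?expR_ge0 ?addr_ge0 ?mulr_ge0// expR_ge1Dx.
rewrite -expRM_natl ler_expR mulrCA ler_wpM2l//.
by rewrite (le_trans _ hT)// ler_wpM2r// ler_nat.
Qed.

End step_square.

(** * Second moments and expected supremum *)

Section sup_estimate.
Context {R : realType} {disp : measure_display} {Omega : measurableType disp}.
Variables (P : probability Omega R) (W : R -> Omega -> R).
Hypothesis hW : brownian P W.
Variables (T : R) (N : nat).
Hypotheses (T0 : 0 < T) (N0 : (0 < N)%N).
Local Notation h := (dt T N).
Local Notation hT n := (histT W (time T N n)).
Local Notation inc n w := (W (time T N n.+1) w - W (time T N n) w).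
Local Notation nu := (normal_prob 0 (Num.sqrt h)).
Implicit Types (x : R) (U : Omega -> R).

Variables (a c0 Cm rt K kap : R) (X Z : nat -> Omega -> R).
Hypotheses (a0 : 0 < a) (c00 : 0 < c0) (Cm0 : 0 <= Cm) (rt0 : 0 <= rt) (K0 : 0 <= K).
Hypotheses (Kh : K ^+ 4 * h <= kap) (h1 : h <= 1).
Hypothesis mX : forall n, (n <= N)%N -> measurable_fun setT (X n : hT n -> R).
Hypothesis mZ : forall n, (n < N)%N -> measurable_fun setT (Z n : hT n -> R).
Hypothesis X0 : forall w, X 0%N w = a.
(** The bound degenerates with [N], but it only makes the integrands bounded; the resulting
    [sup_const] is free of it. *)
Hypothesis Xb : forall n w, (n <= N)%N -> 0 <= X n w <= 16 ^+ n * a.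
Hypothesis ZX : forall n w, (n < N)%N -> `|Z n w| <= Cm * X n w.

(** The random drift rate. Its mean is of order [h], since the fourth moment of the increment is of
    order h^2 and K^4 h <= kap. *)
Definition rho x : R := rt * (h + x ^+ 2 + x ^+ 4 * K ^+ 4).

Hypothesis stepX : {ae P, forall w, forall n, (n < N)%N ->
  X n.+1 w <= X n w + Z n w * trunc c0 (inc n w) + rho (inc n w) * X n w}.

Let h0 : 0 < h. Proof. exact: dt_gt0. Qed.
Let NhT : N%:R * h = T. Proof. by rewrite /dt mulrCA divff ?mulr1// pnatr_eq0 -lt0n. Qed.
Let K40 : 0 <= K ^+ 4. Proof. exact: exprn_ge0. Qed.
Let kap0 : 0 <= kap. Proof. by rewrite (le_trans _ Kh)// mulr_ge0// ltW. Qed.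
Local Notation mo := (@mom R).
Let mo0 : 0 <= mo. Proof. exact: mom_ge0. Qed.

Definition r1 : R := rt * (1 + mo + mo * kap).

Lemma rho_mean : rint nu (rho : measurableTypeR R -> R) /\ \int[nu]_x rho x <= r1 * h.
Proof.
have [|//||ri rl] := @gauss_poly R T N T0 N0 (rt * h) rt (rt * K ^+ 4) 0; rewrite ?mulr_ge0//.
have e : rho = fun x => rt * h + rt * x ^+ 2 + rt * K ^+ 4 * x ^+ 4 + 0 * x ^+ 8.
  by apply/funext => x; rewrite /rho; ring.
rewrite e; split => //; apply: le_trans rl _; rewrite mul0r addr0 expr2.
have F (r m k t : R) : r * t + m * (r * t + r * k * (t * t)) = r * (1 + m + m * (k * t)) * t by ring.
rewrite F.
by rewrite /r1 ler_wpM2r ?(ltW h0)// ler_wpM2l// lerD2l ler_wpM2l.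
Qed.

Let q := 3 * rt ^+ 2.

(** The growth factor in [step_square], with rho^2 replaced by 3 rt^2 (h^2 + x^4 + K^8 x^8); hence
    the moments up to order 8. *)
Definition Gq x : R := 2 * rho x + (1 + Cm) * (q * (h ^+ 2 + x ^+ 4 + x ^+ 8 * (K ^+ 4) ^+ 2)) + (Cm + Cm ^+ 2) * x ^+ 2.

Definition r3 : R := 2 * r1 + (1 + Cm) * (q * (1 + mo + mo * kap ^+ 2)) + (Cm + Cm ^+ 2) * mo.

Lemma Gq_mean : rint nu (Gq : measurableTypeR R -> R) /\ \int[nu]_x Gq x <= r3 * h.
Proof.
have q0 : 0 <= q by rewrite /q mulr_ge0// sqr_ge0.
have C1 : 0 <= 1 + Cm by rewrite addr_ge0.
have p2 : 0 <= (Cm + Cm ^+ 2) by rewrite addr_ge0// sqr_ge0.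
have p4 : 0 <= (1 + Cm) * q by rewrite mulr_ge0.
have p8 : 0 <= (1 + Cm) * q * (K ^+ 4) ^+ 2 by apply: mulr_ge0 => //; exact: sqr_ge0.
have [gi gl] := @gauss_poly R T N T0 N0 ((1 + Cm) * q * h ^+ 2) (Cm + Cm ^+ 2) ((1 + Cm) * q) _ p2 p4 p8.
have [ri rl] := rho_mean; have r2 := rintZ 2 ri.
have e : Gq = fun x => 2 * rho x + ((1 + Cm) * q * h ^+ 2 + (Cm + Cm ^+ 2) * x ^+ 2 + (1 + Cm) * q * x ^+ 4 +
    (1 + Cm) * q * (K ^+ 4) ^+ 2 * x ^+ 8).
  by apply/funext => x; rewrite /Gq; ring.
rewrite e; split; first exact: rintD r2 gi.
rewrite IntD// IntZ//; apply: le_trans (lerD (ler_wpM2l _ rl) gl) _ => //.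
have hh : h ^+ 2 <= h by rewrite expr2 ler_piMl// ltW.
have k2 : (K ^+ 4 * h) ^+ 2 <= kap ^+ 2 by rewrite lerXn2r ?nnegrE// mulr_ge0// ltW.
have t1 := ler_wpM2l p4 hh.
have t2 := ler_wpM2l (mulr_ge0 p4 mo0) hh.
have t3 : (1 + Cm) * q * mo * ((K ^+ 4 * h) ^+ 2 * h ^+ 2) <= (1 + Cm) * q * mo * (kap ^+ 2 * h).
  apply: ler_wpM2l; first exact: mulr_ge0.
  by apply: ler_pM => //; exact: sqr_ge0.
have F1 (r c t p m k : R) : 2 * (r * t) + (c * t ^+ 2 + m * (p * t + c * t ^+ 2 + c * k ^+ 2 * t ^+ 4)) =
    2 * r * t + c * t ^+ 2 + p * m * t + c * m * t ^+ 2 + c * m * ((k * t) ^+ 2 * t ^+ 2) by ring.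
have F2 (r c p t b m k : R) : (2 * r + b * (c * (1 + m + m * k)) + p * m) * t =
    2 * r * t + b * c * t + p * m * t + b * c * m * t + b * c * m * (k * t) by ring.
rewrite F1 /r3 F2.
by apply: lerD t3; apply: lerD t2; rewrite lerD2r lerD2l.
Qed.

Let b16 : 0 <= 16 ^+ N * a. Proof. by rewrite mulr_ge0 ?exprn_ge0// ltW. Qed.

Let Xle n w : (n <= N)%N -> X n w <= 16 ^+ N * a.
Proof.
move=> nN; have /andP[_ /le_trans] := Xb w nN; apply; rewrite ler_wpM2r// ?(ltW a0)//.
by rewrite ler_eXn2l// ltr1n.
Qed.

Let Xabs n w : (n <= N)%N -> `|X n w| <= 16 ^+ N * a.
Proof. by move=> nN; have /andP[x0 _] := Xb w nN; rewrite ger0_norm// Xle. Qed.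

Let X2abs n w : (n <= N)%N -> `|X n w ^+ 2| <= (16 ^+ N * a) ^+ 2.
Proof. by move=> nN; rewrite normrX lerXn2r ?nnegrE// Xabs. Qed.

Let X2m n : (n <= N)%N -> measurable_fun setT ((fun w => X n w ^+ 2) : hT n -> R).
Proof. by move=> nN; apply: measurable_funX; exact: mX. Qed.

Let Zabs n w : (n < N)%N -> `|Z n w| <= Cm * (16 ^+ N * a).
Proof. by move=> nN; rewrite (le_trans (ZX w nN))// ler_wpM2l// Xle// ltnW. Qed.

Let rint_trunc : rint nu (trunc c0 : measurableTypeR R -> R).
Proof. by apply: (rint_normal_bounded _ (measurable_trunc c0) (fun x => trunc_bound x (ltW c00))). Qed.

Lemma Int_mart n U M : (n < N)%N -> measurable_fun setT (U : hT n -> R) -> (forall w, `|U w| <= M) ->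
  rint P (fun w => U w * trunc c0 (inc n w)) /\ \int[P]_w (U w * trunc c0 (inc n w)) = 0.
Proof.
move=> nN mU UM; have [ri ->] := Int_step hW T0 N0 mU UM rint_trunc.
by rewrite gauss_trunc ?mulr0// sqrtr_gt0.
Qed.

Definition Gam : R := expR (r3 * T).

(** In the squared step inequality the growth factor is independent of the past with mean at most r3
    h, and the cross term is a martingale difference; the discrete Gronwall lemma closes the
    recursion. *)
Lemma second_moment n : (n <= N)%N -> \int[P]_w (X n w ^+ 2) <= Gam * a ^+ 2.
Proof.
move=> nN.
have r30 : 0 <= r3.
  rewrite /r3 /r1 /q; apply: addr_ge0; last by rewrite mulr_ge0 ?addr_ge0 ?sqr_ge0.
  apply: addr_ge0; first by rewrite !mulr_ge0// !addr_ge0 ?mulr_ge0.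
  rewrite mulr_ge0 ?addr_ge0// mulr_ge0//; first by rewrite mulr_ge0 ?sqr_ge0.
  by rewrite !addr_ge0// mulr_ge0// sqr_ge0.
have hT' : N%:R * h <= T by rewrite /dt mulrCA divff ?mulr1// pnatr_eq0 -lt0n.
have e0 : \int[P]_w (X 0%N w ^+ 2) = a ^+ 2.
  under eq_Rintegral do rewrite X0.
  by rewrite /Rintegral integral_cst//= [X in (_ * X)%E]probability_setT mule1.
have := @geometric_growth _ (fun n => \int[P]_w (X n w ^+ 2)) _ _ _ N r30 (ltW h0) hT'.
rewrite /= e0; apply => //; last exact: sqr_ge0.
move=> m mN; have mN' := ltnW mN.
have [gi gl] := Gq_mean.
have rX2 : rint P (fun w => X m w ^+ 2) by apply: (hist_rint hW (X2m mN')) => w; exact: X2abs.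
have [i1 e1] := Int_step hW T0 N0 (X2m mN') (fun w => X2abs w mN') gi.
have XZb w : `|X m w * Z m w| <= 16 ^+ N * a * (Cm * (16 ^+ N * a)).
  by rewrite normrM ler_pM// ?Xabs// Zabs.
have mXZ : measurable_fun setT ((fun w => X m w * Z m w) : hT m -> R).
  by apply: measurable_funM; [exact: mX|exact: mZ].
have [i2 e2] := Int_mart mN mXZ XZb.
apply: (@le_trans _ _ (\int[P]_w (X m w ^+ 2 + X m w ^+ 2 * Gq (inc m w) + 2 * (X m w * Z m w * trunc c0 (inc m w))))).
  apply: Int_le_ae.
  - by apply: (hist_rint hW (X2m mN)) => w; exact: X2abs.
  - by apply: rintD; [exact: rintD|exact: rintZ].
  apply: filterS stepX => w /(_ _ mN) le1.
  have /andP[xm0 _] := Xb w mN'; have /andP[xn0 _] := Xb w mN.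
  have rho0 : 0 <= rho (inc m w).
    rewrite /rho mulr_ge0// !addr_ge0 ?(ltW h0) ?sqr_ge0// mulr_ge0//.
    by rewrite (exprM _ 2 2) sqr_ge0.
  have rq : rho (inc m w) ^+ 2 <= q * (h ^+ 2 + inc m w ^+ 4 + inc m w ^+ 8 * (K ^+ 4) ^+ 2).
    rewrite /rho /q exprMn (mulrC 3) -(mulrA (rt ^+ 2)); apply: ler_wpM2l; first exact: sqr_ge0.
    have := sqr_sum3 h (inc m w ^+ 2) (inc m w ^+ 4 * K ^+ 4).
    by rewrite (exprMn 2 (inc m w ^+ 4)) -(exprM (inc m w) 2 2) -(exprM (inc m w) 4 2).
  have := step_square xm0 Cm0 (ZX w mN) (trunc_sqr c0 (inc m w)) rho0 rq.
  rewrite -/(Gq _) => le2.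
  apply: (@le_trans _ _ ((X m w + Z m w * trunc c0 (inc m w) + rho (inc m w) * X m w) ^+ 2)).
    by rewrite lerXn2r// nnegrE// (le_trans xn0).
  by apply: (le_trans le2); rewrite mulrDl mul1r (mulrC (Gq _)).
rewrite IntD//; [|exact: rintD|exact: rintZ].
rewrite IntD// IntZ// e1 e2 mulr0 addr0 mulrDl mul1r lerD2l mulrC ler_wpM2r//.
by apply: Int_ge0 => w; exact: sqr_ge0.
Qed.

Let D n w : R := Z n w * trunc c0 (inc n w).
Let M n w : R := \sum_(i < n) D i w.
Let S n w : R := runmax (fun i => M i w) n.
Let Bd : R := Cm * (16 ^+ N * a) * c0.

Let Bd0 : 0 <= Bd. Proof. by rewrite mulr_ge0 ?(ltW c00)// mulr_ge0. Qed.

Let Dm i n : (i < n)%N -> (n <= N)%N -> measurable_fun setT (D i : hT n -> R).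
Proof.
move=> i_n nN; apply: measurable_funM.
  apply: (hist_measurable_mono (time_le T0 N0 (ltnW i_n))).
  by apply: mZ; exact: leq_trans nN.
apply: (measurableT_comp (measurable_trunc c0)).
exact: measurable_inc.
Qed.

Let Db i w : (i < N)%N -> `|D i w| <= Bd.
Proof.
move=> iN; rewrite normrM ler_pM ?Zabs//; exact: (trunc_bound _ (ltW c00)).
Qed.

Let Mm n : (n <= N)%N -> measurable_fun setT (M n : hT n -> R).
Proof.
by move=> nN; apply: measurable_sum => i; exact: Dm.
Qed.

Let Mm' i n : (i <= n)%N -> (n <= N)%N -> measurable_fun setT (M i : hT n -> R).
Proof.
move=> i_n nN; apply: (hist_measurable_mono (time_le T0 N0 i_n)).
by apply: Mm; exact: leq_trans nN.
Qed.

Let Mb n w : (n <= N)%N -> `|M n w| <= N%:R * Bd.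
Proof.
move=> nN; apply: le_trans (ler_norm_sum _ _ _) _.
apply: (@le_trans _ _ (\sum_(i < n) Bd)).
  by apply: ler_sum => i _; apply: Db; exact: leq_trans nN.
rewrite sumr_const card_ord -(mulr_natl Bd n); apply: ler_wpM2r => //.
by rewrite ler_nat.
Qed.

Let Sm n : (n <= N)%N -> measurable_fun setT (S n : hT n -> R).
Proof.
move=> nN; have H i : (i <= n)%N -> measurable_fun setT (S i : hT n -> R).
  elim: i => [|i IH] i_n; first exact: Mm'.
  by apply: measurable_maxr; [apply: IH; exact: ltnW|exact: Mm'].
exact: H.
Qed.

Let Sb n w : (n <= N)%N -> `|S n w| <= N%:R * Bd.
Proof.
rewrite /S; elim: n => [|n IH] nN /=; first exact: Mb.
by case: (leP (runmax _ _) _) => _; [exact: Mb|apply: IH; exact: ltnW].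
Qed.

Let Gam0 : 0 <= Gam. Proof. exact: expR_ge0. Qed.

(** The increments are orthogonal, so their second moments add up; truncation only lowers x^2, and
    |Z| <= Cm X reduces each of them to [second_moment]. *)
Lemma mart_square n : (n <= N)%N ->
  \int[P]_w (M n w ^+ 2) <= n%:R * (Cm ^+ 2 * mo * h * (Gam * a ^+ 2)).
Proof.
elim: n => [|n IH] nN.
  rewrite mul0r; under eq_Rintegral do rewrite /M big_ord0 expr0n.
  by rewrite Int0.
have nN' := ltnW nN; have {}IH := IH nN'.
have M2b w : `|M n w ^+ 2| <= (N%:R * Bd) ^+ 2.
  by apply: norm_sqr_le; exact: Mb.
have iM2 : rint P (fun w => M n w ^+ 2).
  by apply: (hist_rint hW _ M2b); apply: measurable_funX; exact: Mm.
have mMZ : measurable_fun setT ((fun w => M n w * Z n w) : hT n -> R).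
  by apply: measurable_funM; [exact: Mm|exact: mZ].
have MZb w : `|M n w * Z n w| <= N%:R * Bd * (Cm * (16 ^+ N * a)).
  by rewrite normrM ler_pM ?Mb ?Zabs.
have [i2 e2] := Int_mart nN mMZ MZb.
have b00 : (0 : R) <= 0 by []; have b01 : (0 : R) <= 1 by [].
have [gi gl] := @gauss_poly R T N T0 N0 0 1 0 0 b01 b00 b00.
have [i3 e3] := Int_step hW T0 N0 (X2m nN') (fun w => X2abs w nN') gi.
have i4 := rintZ (Cm ^+ 2) i3.
have iM2' : rint P (fun w => M n.+1 w ^+ 2).
  apply: (hist_rint (n := n.+1) hW (M := (N%:R * Bd) ^+ 2)).
    by apply: measurable_funX; exact: Mm.
  by move=> w; apply: norm_sqr_le; exact: Mb.
apply: (@le_trans _ _ (\int[P]_w (M n w ^+ 2 + 2 * (M n w * Z n w * trunc c0 (inc n w)) +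
   Cm ^+ 2 * (X n w ^+ 2 * (0 + 1 * inc n w ^+ 2 + 0 * inc n w ^+ 4 + 0 * inc n w ^+ 8))))).
  apply: Int_le => //.
    by apply: rintD => //; apply: rintD => //; exact: rintZ.
  move=> w; have -> : M n.+1 w = M n w + D n w by rewrite /M big_ord_recr.
  rewrite sqrrD /D -[leLHS]addrA -[leRHS]addrA lerD2l -mulr_natl (mulrA (M n w)) lerD2l.
  rewrite add0r mul1r !mul0r !addr0 (mulrA (Cm ^+ 2)) -(exprMn 2 Cm) (exprMn 2 (Z n w)).
  apply: ler_pM; [exact: sqr_ge0|exact: sqr_ge0| |exact: trunc_sqr].
  have /andP[x0 _] := Xb w nN'.
  by rewrite -(real_normK (num_real (Z n w))) lerXn2r ?nnegrE ?mulr_ge0// ZX.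
rewrite IntD//; last by apply: rintD => //; exact: rintZ.
rewrite IntD//; last exact: rintZ.
rewrite !IntZ// e2 mulr0 addr0 e3 -natr1 mulrDl mul1r; apply: lerD => //.
have F (A m t g : R) : A * m * t * g = A * ((m * t) * g) by ring.
rewrite F; apply: ler_wpM2l; first exact: sqr_ge0.
apply: (@le_trans _ _ (\int[P]_w (X n w ^+ 2) * (mo * h))).
  apply: ler_wpM2l; first by apply: Int_ge0 => w; exact: sqr_ge0.
  by apply: le_trans gl _; rewrite add0r mul1r !mul0r !addr0.
rewrite mulrC; apply: ler_wpM2l; first by rewrite mulr_ge0// ltW.
exact: second_moment.
Qed.

(** The three summands come from the initial value, from the maximum of the martingale and from the
    accumulated drift. *)
Definition sup_const : R := 1 + (2^-1 + 2 * (Cm ^+ 2 * mo * T * Gam)) + r1 * T * (2^-1 * (1 + Gam)).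

Let rho_ge0 x : 0 <= rho x.
Proof.
by rewrite /rho mulr_ge0// !addr_ge0 ?(ltW h0) ?sqr_ge0// mulr_ge0// (exprM x 2 2) sqr_ge0.
Qed.

Let rcst (e : R) : rint P (fun=> e).
Proof. by apply: (rint_bounded (M := `|e|)) => //; rewrite [X in (X < _)%E]probability_setT ltry. Qed.

Let Icst (e : R) : \int[P]_w e = e.
Proof. by rewrite /Rintegral integral_cst//= [X in (_ * X)%E]probability_setT mule1. Qed.

(** Summed over the steps, X_n is at most a plus the maximum of the martingale plus all X_i rho_i,
    for every n at once. The inequality s <= (a + s^2/a)/2 converts the second-moment bounds into
    bounds linear in [a]. *)
Lemma sup_estimate (Y : Omega -> R) : rint P Y -> (forall w e, (forall n, (n <= N)%N -> X n w <= e) -> Y w <= e) ->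
  \int[P]_w Y w <= sup_const * a.
Proof.
move=> iY hY; have [ri rl] := rho_mean; have NN := leqnn N.
have r10 : 0 <= r1 by rewrite /r1 mulr_ge0// !addr_ge0// mulr_ge0.
have iS2 : rint P (fun w => S N w ^+ 2).
  apply: (hist_rint (n := N) hW (M := (N%:R * Bd) ^+ 2)).
    by apply: measurable_funX; exact: Sm.
  by move=> w; apply: norm_sqr_le; exact: Sb.
have iM2 : rint P (fun w => M N w ^+ 2).
  apply: (hist_rint (n := N) hW (M := (N%:R * Bd) ^+ 2)).
    by apply: measurable_funX; exact: Mm.
  by move=> w; apply: norm_sqr_le; exact: Mb.
have SD n : (n < N)%N -> rint P (fun w => S n w * D n w) /\ \int[P]_w (S n w * D n w) = 0.
  move=> nN; have mU : measurable_fun setT ((fun w => S n w * Z n w) : hT n -> R).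
    by apply: measurable_funM; [apply: Sm; exact: ltnW|exact: mZ].
  have Ub w : `|S n w * Z n w| <= N%:R * Bd * (Cm * (16 ^+ N * a)).
    by rewrite normrM ler_pM ?Sb ?Zabs// ltnW.
  have [i e] := Int_mart nN mU Ub.
  have E : (fun w => S n w * D n w) = (fun w => S n w * Z n w * trunc c0 (inc n w)).
    by apply/funext => w; rewrite /D mulrA.
  by rewrite E.
have ES : \int[P]_w (S N w ^+ 2) <= 4 * (T * (Cm ^+ 2 * mo) * (Gam * a ^+ 2)).
  have iSD : rint P (fun w => \sum_(i < N) S i w * D i w) by apply: rint_sum => i _; exact: (SD i _).1.
  apply: (@le_trans _ _ (\int[P]_w (4 * M N w ^+ 2 - 4 * \sum_(i < N) S i w * D i w))).
    apply: Int_le => //; first by apply: rintB; exact: rintZ.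
    by move=> w; exact: (doob_pathwise (D := fun i => D i w)).
  rewrite IntB; [|exact: rintZ|exact: rintZ]; rewrite !IntZ// Int_sum; last by move=> i _; exact: (SD i _).1.
  rewrite big1 => [|i _]; last exact: (SD i _).2.
  rewrite mulr0 subr0; apply: ler_wpM2l => //; apply: le_trans (mart_square NN) _.
  rewrite (_ : N%:R * _ = (N%:R * h) * (Cm ^+ 2 * mo) * (Gam * a ^+ 2)); last by move: h mo => t m; ring.
  by rewrite NhT.
have rX n : (n < N)%N -> rint P (fun w => X n w * rho (inc n w)) /\
    \int[P]_w (X n w * rho (inc n w)) <= r1 * h * (2^-1 * (a + Gam * a)).
  move=> nN; have nN' := ltnW nN.
  have [i e] := Int_step hW T0 N0 (mX nN') (fun w => Xabs w nN') ri; split => //; rewrite e mulrC.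
  have iX : rint P (X n) by apply: (hist_rint hW (mX nN')) => w; exact: Xabs.
  have iX2 : rint P (fun w => X n w ^+ 2) by apply: (hist_rint hW (X2m nN')) => w; exact: X2abs.
  have EX : \int[P]_w X n w <= 2^-1 * (a + Gam * a).
    apply: (@le_trans _ _ (\int[P]_w (2^-1 * (a + a^-1 * X n w ^+ 2)))).
      apply: Int_le => //; last by move=> w; exact: young.
      by apply: rintZ; apply: rintD; [exact: rcst|exact: rintZ].
    rewrite IntZ; last by apply: rintD; [exact: rcst|exact: rintZ].
    rewrite IntD//; [|exact: rintZ]; rewrite IntZ// Icst ler_wpM2l ?invr_ge0// lerD2l.
    rewrite mulrC ler_pdivrMr// -mulrA -expr2; exact: second_moment.
  apply: ler_pM => //; apply: Int_ge0 => w; first exact: rho_ge0.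
  by have /andP[] := Xb w nN'.
have iS : rint P (fun w => 2^-1 * (a + a^-1 * S N w ^+ 2)).
  by apply: rintZ; apply: rintD; [exact: rcst|exact: rintZ].
have iR : rint P (fun w => \sum_(i < N) X i w * rho (inc i w)) by apply: rint_sum => i _; exact: (rX i _).1.
apply: (@le_trans _ _ (\int[P]_w (a + 2^-1 * (a + a^-1 * S N w ^+ 2) + \sum_(i < N) X i w * rho (inc i w)))).
  apply: Int_le_ae => //; first by apply: rintD => //; exact: rintD.
  apply: filterS stepX => w sw; apply: hY => n nN.
  have rg i : (i < N)%N -> 0 <= X i w * rho (inc i w).
    by move=> iN; have /andP[x0 _] := Xb w (ltnW iN); rewrite mulr_ge0// rho_ge0.
  have : X n w <= a + M n w + \sum_(i < n) X i w * rho (inc i w).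
    elim: n nN => [_|n IH nN]; first by rewrite X0 /M !big_ord0 !addr0.
    have {}IH := IH (ltnW nN); have := sw n nN; rewrite /M !big_ord_recr /= -/(M n w) -/(D n w).
    by rewrite (mulrC (rho _)); move: IH; move: (\sum_(_ < _) _) (M n w) (D n w) (X n w) (X n.+1 w) (_ * _) => *; lra.
  move/le_trans; apply; apply: lerD; last first.
    exact: (psum_mono (F := fun i => X i w * rho (inc i w)) nN).
  have Mle : M n w <= S N w := @runmax_ge _ (fun i => M i w) N n nN.
  by apply: lerD => //; exact: le_trans Mle (young (S N w) a0).
rewrite IntD//; last exact: rintD.
rewrite IntD//; rewrite Int_sum; last by move=> i _; exact: (rX i _).1.
rewrite IntZ; last by apply: rintD; [exact: rcst|exact: rintZ].
rewrite IntD//; last exact: rintZ.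
rewrite IntZ// Icst.
have h3 : \sum_(i < N) \int[P]_w (X i w * rho (inc i w)) <= N%:R * (r1 * h * (2^-1 * (a + Gam * a))).
  apply: (@le_trans _ _ (\sum_(i < N) (r1 * h * (2^-1 * (a + Gam * a))))).
    by apply: ler_sum => i _; exact: (rX i _).2.
  by rewrite sumr_const card_ord (mulr_natl (r1 * h * (2^-1 * (a + Gam * a))) N).
have h2 : a^-1 * \int[P]_w (S N w ^+ 2) <= 4 * (T * (Cm ^+ 2 * mo) * (Gam * a)).
  rewrite mulrC ler_pdivrMr//; apply: le_trans ES _.
  by rewrite expr2 -!(mulrA 4) -!mulrA.
apply: le_trans (lerD (lerD (lexx a) (ler_wpM2l _ (lerD (lexx a) h2))) h3) _; first by rewrite invr_ge0.
rewrite le_eqVlt; apply/orP; left; apply/eqP.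
have F (n r t g c m e : R) : a + 2^-1 * (a + 4 * (e * (c * m) * (g * a))) + n * (r * t * (2^-1 * (a + g * a))) =
    (1 + (2^-1 + 2 * (c * m * e * g)) + r * (n * t) * (2^-1 * (1 + g))) * a by field.
by rewrite F NhT.
Qed.

End sup_estimate.

(** * Measurability of the coefficients *)

Section complex_measurability.
Context {R : realType} {dd : measure_display} {Y : measurableType dd}.
Implicit Types (f g : Y -> R[i]).

Definition cmeas f := measurable_fun setT (fun w => complex.Re (f w)) /\
  measurable_fun setT (fun w => complex.Im (f w)).

Lemma cmeas_cst z : cmeas (fun=> z). Proof. by split; exact: measurable_cst. Qed.

Lemma cmeas_real (r : Y -> R) : measurable_fun setT r -> cmeas (fun w => (r w)%:C).
Proof. by move=> mr; split => //=; exact: measurable_cst. Qed.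

Lemma cmeasD f g : cmeas f -> cmeas g -> cmeas (fun w => f w + g w).
Proof.
move=> [fr fi] [gr gi]; split; [under eq_fun do rewrite ReD|under eq_fun do rewrite ImD]; exact: measurable_funD.
Qed.

Lemma cmeasM f g : cmeas f -> cmeas g -> cmeas (fun w => f w * g w).
Proof.
move=> [fr fi] [gr gi]; split; [under eq_fun do rewrite ReM|under eq_fun do rewrite ImM].
  by apply: measurable_funB; exact: measurable_funM.
by apply: measurable_funD; exact: measurable_funM.
Qed.

Lemma cmeasN f : cmeas f -> cmeas (fun w => - f w).
Proof.
move=> [fr fi]; split; [under eq_fun do rewrite ReN|under eq_fun do rewrite ImN]; exact: measurable_funN.
Qed.

Lemma cmeasB f g : cmeas f -> cmeas g -> cmeas (fun w => f w - g w).
Proof. by move=> mf mg; apply: cmeasD => //; exact: cmeasN. Qed.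

Lemma cmeas_sum (J : Type) (s : seq J) (p : pred J) (F : J -> Y -> R[i]) :
  (forall i, cmeas (F i)) -> cmeas (fun w => \sum_(i <- s | p i) F i w).
Proof.
move=> mF; elim: s => [|i s IH].
  by under eq_fun do rewrite big_nil; exact: cmeas_cst.
by under eq_fun do rewrite big_cons; case: (p i) => //; exact: cmeasD.
Qed.

Lemma cmeas_prod (J : Type) (s : seq J) (p : pred J) (F : J -> Y -> R[i]) :
  (forall i, cmeas (F i)) -> cmeas (fun w => \prod_(i <- s | p i) F i w).
Proof.
move=> mF; elim: s => [|i s IH].
  by under eq_fun do rewrite big_nil; exact: cmeas_cst.
by under eq_fun do rewrite big_cons; case: (p i) => //; exact: cmeasM.
Qed.

Lemma measurable_nsq f : cmeas f -> measurable_fun setT (fun w => nsq (f w)).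
Proof. by move=> [fr fi]; apply: measurable_funD; exact: measurable_funX. Qed.

Lemma cmeas_inv f : cmeas f -> (forall w, f w != 0) -> cmeas (fun w => (f w)^-1).
Proof.
move=> mf f0.
have n0 w : 0 < nsq (f w).
  rewrite lt0r nsq_ge0 andbT; apply: contra (f0 w).
  rewrite paddr_eq0 ?sqr_ge0// !sqrf_eq0 => /andP[/eqP a /eqP b].
  by apply/eqP/complex_eq.
(* Division by the squared modulus is written as exp(-ln), so that measurability reduces to
   compositions. *)
have -> : (fun w => (f w)^-1) = fun w => (complex.Re (f w) -i* complex.Im (f w))%C * (expR (- ln (nsq (f w))))%:C.
  apply/funext => w; apply: (mulfI (f0 w)); rewrite divff// mulrA.
  rewrite expRN lnK ?posrE//; move: (n0 w); case: (f w) => a b; rewrite /nsq /= => n; apply: complex_eq => /=; field; exact: lt0r_neq0.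
have [fr fi] := mf; apply: cmeasM; first by split => //=; exact: measurable_funN.
apply: cmeas_real; apply: measurableT_comp => //; apply: measurable_funN.
by apply: measurableT_comp => //; exact: measurable_nsq.
Qed.

Lemma cmeas_if (q : Y -> bool) f g : measurable_fun setT q -> cmeas f -> cmeas g ->
  cmeas (fun w => if q w then f w else g w).
Proof.
move=> mq [fr fi] [gr gi]; split.
  have := measurable_fun_ifT mq fr gr; apply: eq_measurable_fun => w _; by case: (q w).
have := measurable_fun_ifT mq fi gi; apply: eq_measurable_fun => w _; by case: (q w).
Qed.

Lemma cmeas_det n (M : Y -> 'M[R[i]]_n) : (forall i j, cmeas (fun w => M w i j)) -> cmeas (fun w => \det (M w)).
Proof.
move=> mM; rewrite /determinant; apply: cmeas_sum => s; apply: cmeasM; first exact: cmeas_cst.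
by apply: cmeas_prod.
Qed.

Lemma cmeas_inv_mx n (M : Y -> 'M[R[i]]_n) : (forall w, M w \in unitmx) ->
  (forall i j, cmeas (fun w => M w i j)) -> forall i j, cmeas (fun w => invmx (M w) i j).
Proof.
move=> uM mM i j.
have -> : (fun w => invmx (M w) i j) = fun w => (\det (M w))^-1 * \adj (M w) i j.
  by apply/funext => w; rewrite /invmx uM !mxE.
apply: cmeasM.
  apply: cmeas_inv; first exact: cmeas_det.
  by move=> w; have := uM w; rewrite unitmxE unitfE.
under eq_fun do rewrite mxE; apply: cmeasM; first exact: cmeas_cst.
by apply: cmeas_det => k l; under eq_fun do rewrite !mxE.
Qed.

End complex_measurability.

Section coefficient_measurability.
Context {R : realType} {I : finType} {dd : measure_display} {Y : measurableType dd}.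
Local Notation V := (I -> R[i]).

Definition vmeas (c : Y -> V) := forall n, cmeas (fun w => c w n).

(** Expansion in the real basis e_m, i e_m reduces the claim to fixed vectors. Real linearity is
    what the conjugated slot of [tcoef] offers. *)
Lemma cmeas_real_linear (Phi : Y -> V -> R[i]) (c : Y -> V) :
  (forall w (a : R) u v, Phi w (fun n => a%:C * u n + v n) = a%:C * Phi w u + Phi w v) ->
  (forall u, cmeas (fun w => Phi w u)) -> vmeas c -> cmeas (fun w => Phi w (c w)).
Proof.
move=> lin mP mc.
have P0 w : Phi w (fun=> 0) = 0.
  have := lin w (-1) (fun=> 0) (fun=> 0); rewrite (_ : (fun n => _) = (fun=> 0)).
    by move=> ->; rewrite rmorphN mulN1r addNr.
  by apply/funext => n; rewrite mulr0 addr0.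
pose A m : V := kron m; pose B m : V := fun n => 'i%C * kron m n.
have E w : Phi w (c w) = \sum_m ((complex.Re (c w m))%:C * Phi w (A m) + (complex.Im (c w m))%:C * Phi w (B m)).
  have S (s : seq I) : Phi w (fun n => \sum_(m <- s) ((complex.Re (c w m))%:C * A m n + (complex.Im (c w m))%:C * B m n)) =
      \sum_(m <- s) ((complex.Re (c w m))%:C * Phi w (A m) + (complex.Im (c w m))%:C * Phi w (B m)).
    elim: s => [|m s IH]; first by under eq_fun do rewrite big_nil; rewrite P0 big_nil.
    under eq_fun do rewrite big_cons -addrA.
    by rewrite lin lin IH big_cons addrA.
  rewrite -S; congr (Phi w); rewrite {1}[c w]kron_exp; apply/funext => n; apply: eq_bigr => m _.
  rewrite /A /B; case: (c w m) => a b; rewrite mulrA -mulrDl; congr (_ * _).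
  by apply: complex_eq; rewrite ?(ReD, ImD, ReM, ImM) /=; ring.
under eq_fun do rewrite E; apply: cmeas_sum => m; have [mr mi] := mc m.
by apply: cmeasD; apply: cmeasM => //; exact: cmeas_real.
Qed.

Lemma measurable_wn (lam : I -> R) s (c : Y -> V) : vmeas c -> measurable_fun setT (fun w => wn lam s (c w)).
Proof.
move=> mc; apply: measurable_sum => n; apply: measurable_funM; first exact: measurable_cst.
exact: measurable_nsq.
Qed.

End coefficient_measurability.

Section step_measurability.
Context {R : realType} {I : finType} {dd : measure_display} {Y : measurableType dd}.
Local Notation V := (I -> R[i]).
Variable lam : I -> R.
Hypothesis lam1 : forall n, 1 <= lam n.
Variable b : V -> V.
Hypothesis blin : clinear b.
Hypothesis bsym : forall u v, \sum_n b u n * conjc (v n) = \sum_n u n * conjc (b v n).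
Variables (h : R) (x : Y -> R).
Hypothesis mx : measurable_fun setT x.
Implicit Types (u c : Y -> V).

Lemma vmeas_clinear (L : V -> V) u : clinear L -> vmeas u -> vmeas (fun w => L (u w)).
Proof.
move=> Ll mu n; apply: (@cmeas_real_linear _ _ _ _ (fun _ v => L v n)) => // w a f g.
by rewrite Ll.
Qed.

Lemma vmeas_ham u : vmeas u -> vmeas (fun w => ham lam b h (x w) (u w)).
Proof.
move=> mu n; rewrite /ham; apply: cmeasD; apply: cmeasM.
- exact: cmeas_cst.
- exact: (vmeas_clinear (Lop_lin lam 1)).
- by apply: cmeas_real; apply: measurable_funM.
- exact: vmeas_clinear.
Qed.

Lemma vmeas_cayR u : vmeas u -> vmeas (fun w => cayR lam b h (x w) (u w)).
Proof.
move=> mu n; rewrite /cayR /linv /unrowV.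
under eq_fun do rewrite mxE; apply: cmeas_sum => p; apply: cmeasM.
  by under eq_fun do rewrite mxE; exact: mu.
apply: cmeas_inv_mx => [w|i j].
  apply: lmatrix_unit; first exact: cayT_lin.
  by move=> v; exact: cayT_inj.
under eq_fun do rewrite mxE; rewrite /cayT; apply: cmeasD; first exact: cmeas_cst.
apply: cmeasM; first exact: cmeas_cst.
apply: (vmeas_ham (u := fun=> kron (enum_val i))) => m; exact: cmeas_cst.
Qed.

Lemma vmeas_cayS u : vmeas u -> vmeas (fun w => cayS lam b h (x w) (u w)).
Proof.
move=> mu n; under eq_fun do rewrite (cayS_E lam1 blin bsym).
apply: cmeasB; first exact: vmeas_cayR.
by apply: cmeasM; [exact: cmeas_cst|apply: vmeas_ham; exact: vmeas_cayR].
Qed.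

Variable G : V -> V -> V.
Hypothesis mG : forall c u, vmeas c -> vmeas u -> vmeas (fun w => G (c w) (u w)).

(** The Picard iterates are measurable one after the other, and upper limits preserve measurability,
    convergent or not. *)
Lemma vmeas_step_sol c : vmeas c -> vmeas (fun w => step_sol lam b G h (x w) (c w)).
Proof.
move=> mc; have mp m : vmeas (fun w => picard (stepF lam b G h (x w) (c w)) m).
  elim: m => [|m IH] n /=; first exact: cmeas_cst.
  rewrite /stepF; apply: cmeasB; first exact: vmeas_cayS.
  by apply: cmeasM; [exact: cmeas_cst|apply: vmeas_cayR; exact: mG].
move=> n; split => /=; apply: (measurableT_comp (@fine_measurable R setT measurableT));
  apply: measurable_fun_limn_esup => m; apply/measurable_EFinP.
  exact: (mp m n).1.
exact: (mp m n).2.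
Qed.

End step_measurability.

Section cubic_measurability.
Context {R : realType} {d : nat} {dd : measure_display} {Y : measurableType dd}.
Variable K : nat.
Local Notation I := {ffun 'I_d -> 'I_K}.
Local Notation V := (I -> R[i]).
Variable theta : R -> R.
Hypothesis hth : cutoff theta.
Implicit Types (u v w c : Y -> V).

Lemma vmeas_tcoef u v w : vmeas u -> vmeas v -> vmeas w -> vmeas (fun y => tcoef (u y) (v y) (w y)).
Proof.
move=> mu mv mw n.
apply: (@cmeas_real_linear _ _ _ _ (fun y z => tcoef (u y) (v y) z n)) => // [y a f g|f].
  by rewrite tcoef_lin3.
apply: (@cmeas_real_linear _ _ _ _ (fun y z => tcoef (u y) z f n)) => // [y a g g'|g].
  by rewrite tcoef_lin2.
apply: (@cmeas_real_linear _ _ _ _ (fun y z => tcoef z g f n)) => // y a e e'.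
by rewrite tcoef_lin1.
Qed.

(** On nonnegative reals [theta] agrees with the continuous function t -> theta (max t 1); this
    avoids its behaviour at 0 and below. *)
Lemma measurable_theta (r : Y -> R) : measurable_fun setT r -> (forall y, 0 <= r y) ->
  measurable_fun setT (fun y => theta (r y)).
Proof.
move=> mr r0; pose g (t : R) := theta (Num.max t 1).
have -> : (fun y => theta (r y)) = g \o r.
  apply/funext => y; rewrite /g /=; case: (leP (r y) 1) => // r1.
  by rewrite !(cutoff_one hth)// ?ler01 ?lexx// r0.
apply: measurableT_comp => //; apply: continuous_measurable_fun => t.
apply: (@continuous_comp _ _ _ (fun t : R => Num.max t 1) theta).
  by apply: continuous_max => //; exact: cvg_cst.
apply: differentiable_continuous; apply/derivable1_diffP; apply: (cutoff_derivable hth).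
by rewrite lt_max ltr01 orbT.
Qed.

Lemma vmeas_gcoef (L k : nat) c v : (1 <= d <= 3)%N -> vmeas c -> vmeas v ->
  vmeas (fun y => gcoef theta L k (c y) (v y)).
Proof.
move=> hd mc mv n; rewrite /gcoef; apply: cmeasM.
  have mw u : vmeas u -> measurable_fun setT (fun y => theta (wn (@lamK R d K) k (u y) / L%:R)).
    move=> mu; apply: measurable_theta.
      by apply: measurable_funM => //; exact: measurable_wn.
    by move=> y; apply: mulr_ge0; [apply: wn_ge0 => m; exact: (lamK_ge1 hd)|rewrite invr_ge0].
  by apply: cmeas_real; apply: measurable_funM; exact: mw.
rewrite /cubc; apply: cmeasM; first exact: cmeas_cst.
by apply: cmeasD; apply: cmeasD; exact: vmeas_tcoef.
Qed.

End cubic_measurability.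

(** * The discrete process *)

Section coefficient_topology.
Context {R : realType} {d : nat}.
Variables (K j : nat).
Hypothesis hd : (1 <= d <= 3)%N.
Local Notation I := {ffun 'I_d -> 'I_K}.
Local Notation V := (I -> R[i]).
Local Notation wn := (wn (@lamK R d K)).
Context {dd : measure_display} {Y : measurableType dd}.

Let vec (r : 'rV[R]_(#|I| + #|I|)) : V := fun n =>
  (r 0 (lshift _ (enum_rank n)) +i* r 0 (rshift _ (enum_rank n)))%C.

Let row_of (c : V) : 'rV[R]_(#|I| + #|I|) :=
  row_mx (\row_p complex.Re (c (enum_val p))) (\row_p complex.Im (c (enum_val p))).

Let row_ofK c : vec (row_of c) = c.
Proof.
apply/funext => n; rewrite /vec /row_of row_mxEl row_mxEr !mxE enum_rankK.
by case: (c n).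
Qed.

(** The map from the real and imaginary parts of the coefficients to Sigma^j is continuous, so an
    open set pulls back to an open set of a Euclidean space, which is Borel. *)
Lemma measurable_Sopen (U : set ('rV[R]_d -> R[i])) (c : Y -> V) : Sopen j U -> vmeas c ->
  measurable ((fun w => hexpC (c w)) @^-1` U).
Proof.
move=> [US Uop] mc; pose O := [set r | U (hexpC (vec r))].
have -> : (fun w => hexpC (c w)) @^-1` U = (row_of \o c) @^-1` O.
  by apply/seteqP; split => w /=; rewrite /O /= row_ofK.
suff oO : open O.
  suff mf : measurable_fun setT (row_of \o c).
    by rewrite -[X in measurable X]setTI; apply: mf => //; exact: open_measurable_rV.
  apply: measurable_fun_rV => i; rewrite /row_of /=; case: (split_ordP i) => p ->.
    by under eq_fun do rewrite row_mxEl mxE; exact: (mc _).1.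
  by under eq_fun do rewrite row_mxEr mxE; exact: (mc _).2.
rewrite openE => r0 Or0; have [r rp Ur] := Uop _ Or0.
pose s : R := \sum_(n : I) (@lamK R d K n ^+ j * 2).
have s0 : 0 <= s by apply: sumr_ge0 => n _; rewrite mulr_ge0// lamX_ge0// => m; exact: (lamK_ge1 hd).
(* Coordinates moved by less than [e] move the expansion by at most s e^2 in squared norm, and s e^2
   < r^2. *)
pose e := r / (1 + s); have e0 : 0 < e by rewrite divr_gt0// ltr_pwDl.
apply/nbhs_ballP; exists e => // r1 Br; apply: Ur; first exact: hexpC_Sigma.
have -> : (fun x => hexpC (vec r1) x - hexpC (vec r0) x) = hexpC (fun n => vec r1 n - vec r0 n).
  apply/funext => x; rewrite -(mulN1r (hexpC (vec r0) x)) -hexpC_addZ; congr (hexpC _ x).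
  by apply/funext => n; rewrite mulN1r.
have cb i : (r1 0 i - r0 0 i) ^+ 2 <= e ^+ 2.
  have /rV_ballP[_ /(_ i) bi] := Br; rewrite -(real_normK (num_real _)) distrC.
  by rewrite lerXn2r ?nnegrE ?(ltW e0)// ltW.
rewrite Snorm_hexpC -(ger0_norm (ltW rp)) -sqrtr_sqr ltr_sqrt ?exprn_gt0//.
apply: (@le_lt_trans _ _ (s * e ^+ 2)).
  rewrite mulr_suml; apply: ler_sum => n _; rewrite -mulrA; apply: ler_wpM2l.
    by apply: lamX_ge0 => m; exact: (lamK_ge1 hd).
  rewrite mulr_natl mulr2n /nsq ReD ImD ReN ImN /=; exact: lerD.
rewrite /e expr_div_n mulrCA gtr_pMr ?exprn_gt0// ltr_pdivrMr ?exprn_gt0 ?ltr_pwDl// mul1r.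
have F (t : R) : 0 <= t -> t < (1 + t) ^+ 2 by nra.
exact: F.
Qed.

End coefficient_topology.

Section cubic_L2.
Context {R : realType} {d : nat}.
Variable K : nat.
Variables (theta : R -> R) (L : nat).
Implicit Types (u v : 'rV[R]_d -> R[i]).

Lemma cubic_ae k u u' v v' : Sigma k u' -> Sigma k v' -> L2 u -> L2 v -> eq_L2 u u' -> eq_L2 v v' ->
  eq_L2 (truncated_cubic theta k L u v) (truncated_cubic theta k L u' v').
Proof.
move=> Su Sv Lu Lv eu ev.
have e1 := Snorm2_ae Su Lu (eq_L2_sym eu); have e2 := Snorm2_ae Sv Lv (eq_L2_sym ev).
by apply: filterS2 eu ev => x ux vx; rewrite /truncated_cubic e1 e2 ux vx.
Qed.

Lemma cubic_measurable k u v : L2 u -> L2 v ->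
  measurable_fun setT (reP (truncated_cubic theta k L u v)) /\
  measurable_fun setT (imP (truncated_cubic theta k L u v)).
Proof.
move=> /L2_measurable[ur ui] /L2_measurable[vr vi].
have mu : cmeas u by split. have mv : cmeas v by split.
have conj_m (f : 'rV[R]_d -> R[i]) : cmeas f -> cmeas (fun x => conjc (f x)).
  move=> [fr fi]; split; first by under eq_fun do rewrite Re_conj.
  by under eq_fun do rewrite Im_conj; exact: measurable_funN.
have sq (z : R[i]) : `|z| ^+ 2 = z * conjc z by rewrite sqr_normc.
suff : cmeas (truncated_cubic theta k L u v) by [].
rewrite /truncated_cubic; under eq_fun do rewrite !sq.
apply: cmeasM; last by apply: cmeasM; [exact: cmeasD|exact: cmeas_cst].
apply: cmeasM; first exact: cmeas_cst.
apply: cmeasM; last exact: cmeas_cst.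
by apply: cmeasD; apply: cmeasM => //; exact: conj_m.
Qed.

Lemma cubic_coef k u v (c e : {ffun 'I_d -> 'I_K} -> R[i]) : L2 u -> L2 v ->
  eq_L2 u (hexpC c) -> eq_L2 v (hexpC e) -> coef (truncated_cubic theta k L u v) = gcoef theta L k c e.
Proof.
move=> Lu Lv eu ev.
have E := cubic_ae (hexpC_Sigma k c) (hexpC_Sigma k e) Lu Lv eu ev.
have L0 : L2 (truncated_cubic theta k L (hexpC c) (hexpC e)) := L2_cubic_hexpC theta L k c e.
have [mr mi] := cubic_measurable k Lu Lv.
have L1 := L2_ae L0 mr mi (eq_L2_sym E).
rewrite (coef_ae K L1 L0 E); apply/funext => n.
by rewrite -(coef_hexpC (gcoef theta L k c e)) -projK_cubic projKE coef_hexpC.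
Qed.

End cubic_L2.

Section constants.
Context {R : realType}.

Lemma rate_ge0 (C Cg kap : R) : 0 <= C -> 0 <= Cg -> 0 <= kap -> 0 <= rate C Cg kap.
Proof.
move=> C0 g0 k0; rewrite /rate; apply: addr_ge0; last exact: mulr_ge0.
apply: addr_ge0 => //; apply: addr_ge0; last exact: exprn_ge0.
by apply: addr_ge0; [apply: mulr_ge0; [exact: mulr_ge0|exact: addr_ge0]|exact: mulr_ge0].
Qed.

Lemma sup_const_ge0 (T Cm rt kap : R) : 0 <= T -> 0 <= rt -> 0 <= kap -> 0 <= sup_const T Cm rt kap.
Proof.
move=> T0 r0 k0; have mo0 := @mom_ge0 R; have eg : 0 <= Gam T Cm rt kap by exact: expR_ge0.
rewrite /sup_const; apply: addr_ge0.
  apply: addr_ge0 => //; apply: addr_ge0; first by rewrite invr_ge0.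
  apply: mulr_ge0 => //; apply: mulr_ge0 => //; apply: mulr_ge0 => //; apply: mulr_ge0 => //; exact: sqr_ge0.
apply: mulr_ge0; last by apply: mulr_ge0; [rewrite invr_ge0|exact: addr_ge0].
apply: mulr_ge0 => //; rewrite /r1; apply: mulr_ge0 => //; apply: addr_ge0; first exact: addr_ge0.
exact: mulr_ge0.
Qed.

End constants.

Section mform_measurability.
Context {R : realType} {I : finType} {dd : measure_display} {Y : measurableType dd}.
Variable lam : I -> R.

Lemma measurable_mform (b : (I -> R[i]) -> I -> R[i]) j (c : Y -> I -> R[i]) : clinear b -> vmeas c ->
  measurable_fun setT (fun w => mform lam b j (c w)).
Proof.
move=> bl mc; have m1 : vmeas (fun w => comm lam b j (c w)).
  move=> n; rewrite /comm; apply: cmeasB; first by apply: cmeasM; [exact: cmeas_cst|exact: vmeas_clinear].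
  by apply: vmeas_clinear => //; apply: vmeas_clinear => //; exact: Lop_lin.
have m2 : vmeas (fun w => mulI (c w)) by move=> n; apply: cmeasM; [exact: cmeas_cst|exact: mc].
apply: measurable_sum => n; apply: measurable_funM; first exact: measurable_cst.
by apply: measurable_funD; apply: measurable_funM; [exact: (m1 n).1|exact: (m2 n).1|exact: (m1 n).2|exact: (m2 n).2].
Qed.

End mform_measurability.

(** * Construction, estimate and uniqueness of the solution *)

Section process.
Context {R : realType} {d : nat}.
Hypothesis hd : (1 <= d <= 3)%N.
Context {disp : measure_display} {Omega : measurableType disp}.
Variables (P : probability Omega R) (W : R -> Omega -> R).
Hypothesis hW : brownian P W.
Variable B : nat -> ('rV[R]_d -> R[i]) -> ('rV[R]_d -> R[i]).
Hypothesis hB : noise_operator B.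
Variables (j : nat) (C0 : R).
Hypothesis hC0 : stable_threshold P W B j C0.
Variable theta : R -> R.
Hypothesis hth : cutoff theta.
Variables (k L : nat).
Hypothesis kj : (k <= j)%N.
Variables (K N : nat) (T : R).
Hypotheses (K0 : (0 < K)%N) (N0 : (0 < N)%N) (T0 : 0 < T).
Local Notation h := (dt T N).
Local Notation I := {ffun 'I_d -> 'I_K}.
Local Notation V := (I -> R[i]).
Local Notation lamK := (@lamK R d K).
Local Notation wn := (wn lamK).
Local Notation b := (@bop R d B K).
Local Notation G := (@gcoef R d K theta L k).
Local Notation hT n := (histT W (time T N n)).
Local Notation inc n w := (W (time T N n.+1) w - W (time T N n) w).
Variables (CB Cg CL kap : R).
Hypotheses (CB0 : 0 < CB) (Cg0 : 0 <= Cg) (CL0 : 0 <= CL).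
Hypothesis hb2 : forall u, wn j (b u) <= (CB * K%:R) ^+ 2 * wn j u.
Hypothesis hb3 : forall u, wn 0 (comm lamK b j u) <= CB ^+ 2 * wn (2 * j) u.
Hypothesis hb4 : forall u, `|rip lamK 0 (comm lamK b j u) (b u)| <= CB * wn j u.
Hypothesis hG : forall c v : V, wn j (G c v) <= Cg * (wn j c + wn j v).
Hypothesis hL : forall c v v' : V, wn k (fun n => G c v n - G c v' n) <= CL * wn k (fun n => v n - v' n).
Hypotheses (h1 : h < 1) (hCg : 8 * Cg * h <= 1) (hCL : 8 * CL * h <= 1) (hK : K%:R ^+ 4 * h <= kap).
Variable phi0 : 'rV[R]_d -> R[i].
Hypothesis Sphi0 : Sigma j phi0.

Let h0 : 0 < h. Proof. exact: dt_gt0. Qed.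
Let l1 (n : I) : 1 <= lamK n. Proof. exact: (lamK_ge1 hd). Qed.
Let bl : clinear b. Proof. exact: bop_lin. Qed.
Let bs := bop_sym hB K0.

(** Amounts to n < tau for 1 <= n <= N; the recursive form shows that only the first [n] increments
    are involved, hence adaptedness. *)
Fixpoint active n w : bool := if n is n'.+1 then active n' w && (`|inc n' w| < C0) else true.

Lemma activeE n w : (n < N)%N -> active n.+1 w = (n.+1 < tau W T N C0 w)%N.
Proof.
move=> nN; rewrite tau_gt//.
have H m : active m w = [forall i : 'I_m, `|incr W T N i.+1 w| < C0].
  elim: m => [|m IH]; first by apply/esym/forallP => -[].
  rewrite /= IH; apply/andP/forallP => [[/forallP h1' h2'] i|h'].
    by case: (unliftP ord_max i) => [i'|] -> //; have := h1' i'; rewrite lift_max.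
  split; last exact: (h' ord_max).
  by apply/forallP => i; have := h' (widen_ord (leqnSn m) i).
by rewrite H.
Qed.

Definition next n w (c : V) : V := step_sol lamK b G h (inc n w) c.

(* The bound on the new value always holds almost surely; imposing it makes the process bounded. *)
Fixpoint process n w : V :=
  if n is n'.+1 then
    let c := process n' w in
    if active n w && (wn j (next n' w c) <= 16 * wn j c) then next n' w c else c
  else coef phi0.

Local Notation X n w := (wn j (process n w)).

Lemma process_bound n w : 0 <= X n w <= 16 ^+ n * wn j (coef phi0).
Proof.
rewrite wn_ge0//=; elim: n => [|n IH] /=; first by rewrite expr0 mul1r.
rewrite exprS -mulrA; have X0 := wn_ge0 l1 j (process n w).
case: ifP => [/andP[_ /le_trans]|_]; first by apply; rewrite ler_wpM2l.
by apply: (le_trans IH); rewrite ler_peMl ?mulr_ge0 ?exprn_ge0 ?wn_ge0// ler1n.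
Qed.

Lemma vmeas_mono n m (c : Omega -> V) : (n <= m)%N -> vmeas (c : hT n -> V) -> vmeas (c : hT m -> V).
Proof.
move=> nm mc i; have [mr mi] := mc i.
by split; apply: (hist_measurable_mono (time_le T0 N0 nm)).
Qed.

Lemma measurable_active n : measurable_fun setT (active n : hT n -> bool).
Proof.
elim: n => [|n IH] /=; first exact: measurable_cst.
apply: measurable_and; first exact: (hist_measurable_mono (time_le T0 N0 (leqnSn n)) IH).
apply: measurable_fun_ltr; last exact: measurable_cst.
by apply: measurableT_comp => //; exact: measurable_inc.
Qed.

Lemma vmeas_process n : vmeas (process n : hT n -> V).
Proof.
elim: n => [|n IH]; first by move=> i; exact: cmeas_cst.
have mp := vmeas_mono (leqnSn n) IH.
have mn : vmeas ((fun w => next n w (process n w)) : hT n.+1 -> V).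
  apply: vmeas_step_sol => //.
    exact: measurable_inc.
  by move=> c u mc mu; exact: vmeas_gcoef.
move=> i /=; rewrite (_ : (fun w => _) = fun w => if active n.+1 w && (wn j (next n w (process n w)) <= 16 * X n w)
  then next n w (process n w) i else process n w i); last first.
  by apply/funext => w /=; case: ifP.
apply: cmeas_if => //; apply: measurable_and; first exact: measurable_active.
apply: measurable_fun_ler; first exact: measurable_wn.
by apply: measurable_funM; [exact: measurable_cst|exact: measurable_wn].
Qed.

Definition stable w := forall n, (n < N)%N -> active n.+1 w ->
  (forall u : V, wn j (cayR lamK b h (inc n w) u) <= 2 * wn j u) /\
  (forall u : V, wn j (cayS lamK b h (inc n w) u) <= 2 * wn j u).

(** One null set serves all steps and all vectors. Before stopping, the operators of the threshold
    condition are the Cayley operators on coefficients. *)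
Lemma stable_ae : {ae P, forall w, stable w}.
Proof.
apply: filterS (threshold_stable hC0 T0 N0 h1) => w Hw n nN act.
have ref (u : V) : eq_L2 (hexpC u) (hexpC u) by exact: aeW.
have tn : (n.+1 < tau W T N C0 w)%N by rewrite -activeE.
have sk (u : V) : SigmaK K (hexpC u) by apply/SigmaKP; exists u.
split=> u; have [hS hR] := Hw K n (hexpC u) K0 (sk u).
  by move: hR; rewrite (schemeTinv_hexpC hd hB K0 W T0 N0 _ _ _ (ref u)) tn !Snorm2_hexpC.
by move: hS; rewrite (schemeS_hexpC hd hB K0 W T0 N0 _ _ _ (hexpC_L2 u) (ref u)) tn !Snorm2_hexpC.
Qed.

Lemma next_estimate n w c : stable w -> (n < N)%N -> active n.+1 w ->
  wn j (next n w c) <= 16 * wn j c /\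
  wn j (next n w c) <= wn j c + inc n w * mform lamK b j c +
    rate CB Cg kap * (h + inc n w ^+ 2 + inc n w ^+ 4 * K%:R ^+ 4) * wn j c.
Proof.
move=> st nN act; have [SR SS] := st n nN act.
by apply: (step_estimate l1 bl bs CB0 _ kj Cg0 CL0 _ hb2 hb3 hb4 hG hL h0 (ltW h1) hCg hCL hK SR SS) => // m; exact: lamK_le.
Qed.

Lemma processS n w : stable w -> (n < N)%N ->
  process n.+1 w = if active n.+1 w then next n w (process n w) else process n w.
Proof.
move=> st nN /=; case: ifP => [/andP[-> _]//|]; case: ifP => // act.
by have [-> _] := next_estimate (process n w) st nN act.
Qed.

Definition sol n w : 'rV[R]_d -> R[i] := hexpC (process n w).

Let Sup w : R := sup_Snorm2 N j sol w.

Lemma SupE w : Sup w = \big[Num.max/0]_(n < N.+1) X n w.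
Proof. by apply: eq_bigr => n _; rewrite /sol Snorm2_hexpC. Qed.

Lemma Sup_le w e : (forall n, (n <= N)%N -> X n w <= e) -> Sup w <= e.
Proof.
move=> He; rewrite SupE; apply: bigmax_le => [|n _]; last by apply: He; rewrite -ltnS.
by apply: le_trans (He 0%N isT); rewrite wn_ge0.
Qed.

Lemma Sup_rint : rint P Sup.
Proof.
have mSup : measurable_fun setT Sup.
  rewrite (_ : Sup = fun w => \big[Num.max/0]_(n < N.+1) X n w); last by apply/funext => w; exact: SupE.
  elim: (index_enum _) => [|n s IH]; first by under eq_fun do rewrite big_nil; exact: measurable_cst.
  under eq_fun do rewrite big_cons; apply: measurable_maxr => //.
  apply: (@hist_measurable _ _ _ _ _ hW (time T N n)); apply: measurable_wn; exact: vmeas_process.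
apply: (rint_bounded (M := 16 ^+ N * wn j (coef phi0)) _ mSup).
  by rewrite [Y in (Y < _)%E]probability_setT ltry.
move=> w; rewrite ger0_norm; last by rewrite SupE; exact: bigmax_ge_id.
apply: Sup_le => n nN; have /andP[_ /le_trans] := process_bound n w; apply.
by apply: ler_wpM2r; [exact: wn_ge0|rewrite ler_eXn2l// ltr1n].
Qed.

Lemma sol_mean : \int[P]_w Sup w <= (1 + sup_const T CB (rate CB Cg kap) kap) * Snorm2 j phi0.
Proof.
have kap0 : 0 <= kap by rewrite (le_trans _ hK)// mulr_ge0 ?exprn_ge0// ltW.
have rt0 := rate_ge0 (ltW CB0) Cg0 kap0.
have a0 : 0 <= wn j (coef phi0) by exact: wn_ge0.
have aS := proj_contract K Sphi0.
have S0 : 0 <= Snorm2 j phi0 by exact: le_trans aS.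
have c0 := sup_const_ge0 CB (ltW T0) rt0 kap0.
(* If the projected initial datum vanishes so does the whole process; the case is set apart because
   [sup_estimate] divides by [a]. *)
have [aP|aN] := ltP 0 (wn j (coef phi0)); last first.
  apply: (@le_trans _ _ 0); last by rewrite mulr_ge0// addr_ge0.
  rewrite -(@Int0 _ _ R P); apply: Int_le; [exact: Sup_rint|exact: rint0|].
  move=> w; apply: Sup_le => n nN; have /andP[_ /le_trans] := process_bound n w; apply.
  by rewrite mulr_ge0_le0// exprn_ge0.
apply: (@le_trans _ _ (sup_const T CB (rate CB Cg kap) kap * wn j (coef phi0))); last first.
  by apply: ler_pM => //; rewrite lerDr.
(* After stopping [Z] is 0; at the step where the increment is too large the truncation is 0
   instead. In both cases the process stays put and the step inequality holds. *)
pose Z n w : R := if active n w then mform lamK b j (process n w) else 0.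
have mb := mform_bound l1 bs CB0 hb3.
apply: (@sup_estimate _ _ _ P W hW T N T0 N0 (wn j (coef phi0)) C0 CB _ K%:R kap (fun n w => X n w) Z) => //.
- exact: threshold_gt0 hC0.
- exact: ltW.
- exact: ltW.
- by move=> n _; apply: measurable_wn; exact: vmeas_process.
- move=> n _; apply: measurable_fun_ifT; [exact: measurable_active| |exact: measurable_cst].
  by apply: measurable_mform => //; exact: vmeas_process.
- by move=> n w _; exact: process_bound.
- move=> n w nN; rewrite /Z; case: ifP => _; first exact: mb.
  by rewrite normr0 mulr_ge0 ?(ltW CB0)// wn_ge0.
- apply: filterS stable_ae => w st n nN; rewrite processS//.
  have r0 : 0 <= rho T N (rate CB Cg kap) K%:R (inc n w) * X n w.
    apply: mulr_ge0; last exact: wn_ge0.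
    rewrite /rho mulr_ge0// !addr_ge0 ?(ltW h0) ?sqr_ge0//.
    by apply: mulr_ge0; [rewrite (exprM _ 2 2) sqr_ge0|exact: exprn_ge0].
  case: ifP => [act|/negbT nact].
    have [_ le] := next_estimate (process n w) st nN act.
    by move: (act) => /= /andP[an xn]; rewrite /Z an /trunc xn (mulrC (mform _ _ _ _)).
  rewrite [Y in _ <= _ + Y + _](_ : _ = 0) ?addr0 ?lerDl//.
  move: nact; rewrite /= negb_and /Z /trunc => /orP[/negbTE->|/negbTE->]; by rewrite ?mul0r ?mulr0.
- exact: Sup_rint.
- exact: Sup_le.
Qed.

Lemma sol_expectation : ('E_P[Sup] <= ((1 + sup_const T CB (rate CB Cg kap) kap) * Snorm2 j phi0)%:E)%E.
Proof. by rewrite unlock -EFin_Int ?lee_fin ?sol_mean//; exact: Sup_rint. Qed.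

Let eq_refl (f : 'rV[R]_d -> R[i]) : eq_L2 f f. Proof. exact: aeW. Qed.

Lemma sol_solution : discrete_solution P W B T N theta k j L C0 K phi0 sol.
Proof.
split.
- by move=> n w _; exact: hexpC_Sigma.
- move=> n U _ SU; apply/historyE; apply: (measurable_Sopen hd SU); exact: vmeas_process.
- by apply: le_lt_trans sol_expectation _; exact: ltry.
- by apply: aeW => w; rewrite /sol /= projKE; exact: eq_refl.
- apply: filterS stable_ae => w st n nN; rewrite /sol (processS st nN) projK_cubic.
  rewrite (schemeS_hexpC hd hB K0 W T0 N0 _ _ _ (hexpC_L2 _) (eq_refl _)).
  rewrite (schemeTinv_hexpC hd hB K0 W T0 N0 _ _ _ (eq_refl _)) -activeE//.
  case: ifP => act; last by apply: aeW => x; rewrite mulr0 subr0.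
  have [SR _] := st n nN act.
  have fx : stepF lamK b G h (inc n w) (process n w) (next n w (process n w)) = next n w (process n w) :=
    step_sol_fix l1 bl bs kj CL0 hL h0 (ltW h1) hCL SR (process n w).
  apply: aeW => x; rewrite -{1}fx /stepF -mulNr -hexpC_addZ; congr (hexpC _ x).
  by apply/funext => m; rewrite mulNr.
Qed.

(** By induction on n. The right side of the scheme shows first that the next value of a solution is
    an expansion in [SigmaK], whatever the coefficients [e] of its nonlinear term; only then can [e]
    be computed as the truncated cubic at c and v, and v be recognised as the unique fixed point. *)
Lemma sol_unique psi : discrete_solution P W B T N theta k j L C0 K phi0 psi ->
  {ae P, forall w, forall n, (n <= N)%N -> eq_L2 (sol n w) (psi n w)}.
Proof.
move=> [sp _ _ ini stp].
have si : {ae P, forall w, stable w /\ eq_L2 (psi 0%N w) (Defs.projK K phi0)}.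
  by apply: filterS2 stable_ae ini.
apply: filterS2 si stp => w [st e0] es n.
suff H : (n <= N)%N -> eq_L2 (psi n w) (sol n w) by move=> nN; exact: eq_L2_sym (H nN).
elim: n => [_|n IH nN]; first by rewrite /sol /= -projKE.
have {}IH := IH (ltnW nN); have := es n nN.
have Ln := Sigma_L2 (sp n w (ltnW nN)); have Ln1 := Sigma_L2 (sp n.+1 w nN).
rewrite (schemeS_hexpC hd hB K0 W T0 N0 _ _ _ Ln IH) projKE.
rewrite (schemeTinv_hexpC hd hB K0 W T0 N0 _ _ _ (eq_refl _)) -activeE// /sol (processS st nN).
case: ifP => act; last first.
  by move=> e; apply: eq_L2_trans e _; apply: filterS IH => x ->; rewrite mulr0 subr0.
set e := coef _; set c := process n w in IH *.
(* The nonlinearity is frozen at [e], so the last argument of [stepF] is immaterial. *)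
pose v : V := stepF lamK b (fun _ _ => e) h (inc n w) c c.
have -> : (fun x => hexpC (cayS lamK b h (incr W T N n.+1 w) c) x - 'i%C * h%:C *
    hexpC (cayR lamK b h (incr W T N n.+1 w) e) x) = hexpC v.
  apply/funext => x; rewrite -mulNr -hexpC_addZ; congr (hexpC _ x).
  by apply/funext => m; rewrite mulNr.
move=> ev; have eE : e = G c v by exact: cubic_coef.
have [SR _] := st n nN act.
suff -> : next n w c = v by [].
apply/esym; apply: (step_sol_uniq l1 bl bs kj CL0 hL h0 (ltW h1) hCL SR).
by rewrite /v {1}eE.
Qed.

End process.

(** * Choice of the constants *)

Section main.
Context {R : realType}.

(** The restriction on [K] read as a bound of K^4 dt, the form in which the energy estimate uses
    it. *)
Lemma power_quarter (x K0 K : R) : 0 < x -> 0 <= K -> K <= K0 * x `^ (- 4^-1) -> K ^+ 4 * x <= K0 ^+ 4.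
Proof.
move=> x0 k0 kx; have p0 := powR_ge0 x (- 4^-1).
have : K ^+ 4 <= (K0 * x `^ (- 4^-1)) ^+ 4 by rewrite lerXn2r ?nnegrE// (le_trans k0).
rewrite exprMn -(powR_mulrn 4 p0) -powRrM (_ : - 4^-1 * 4%:R = - 1); last by field.
by rewrite (powR_inv1 (ltW x0)) => le4; rewrite -ler_pdivlMr.
Qed.

End main.

Theorem proposition2 (R : realType) (d : nat) (hd : (1 <= d <= 3)%N)
    (disp : measure_display) (Omega : measurableType disp)
    (P : probability Omega R) (W : R -> Omega -> R) (hW : brownian P W)
    (B : nat -> ('rV[R]_d -> R[i]) -> ('rV[R]_d -> R[i]))
    (hB : noise_operator B)
    (C0 : nat -> R) (hC0 : forall j : nat, stable_threshold P W B j (C0 j))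
    (theta : R -> R) (htheta : cutoff theta) :
  forall (j L : nat) (K0 : R), (0 < L)%N -> 0 < K0 ->
  exists2 dt0 : R, 0 < dt0 &
  forall T : R, 0 < T ->
  exists2 C : R, 0 < C &
  forall k : nat, (d < 2 * k)%N -> (k <= j)%N ->
  forall phi0 : 'rV[R]_d -> R[i], Sigma j phi0 ->
  forall N K : nat, (0 < N)%N -> (0 < K)%N ->
  dt T N <= dt0 -> K%:R <= K0 * dt T N `^ (- 4^-1) ->
  exists phi : nat -> Omega -> 'rV[R]_d -> R[i],
  [/\ discrete_solution P W B T N theta k j L (C0 j) K phi0 phi,
      forall psi : nat -> Omega -> 'rV[R]_d -> R[i],
        discrete_solution P W B T N theta k j L (C0 j) K phi0 psi ->
        {ae P, forall w, forall n : nat, (n <= N)%N ->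
          eq_L2 (phi n w) (psi n w)} &
      ('E_P[sup_Snorm2 N j phi] <= (C * Snorm2 j phi0)%:E)%E].
Proof.
move=> j L K0 L0 K00.
have [CB CB0 hCB] := noise_bounds hB j.
have [Cg Cg0 hCg] := gcoef_bound hd htheta L0 j.
(* The Lipschitz constant depends on k, whereas dt0 is fixed before k: the constants of all orders k
   <= j are summed, with 0 where 2k <= d. *)
have lip k : exists CL : R, 0 <= CL /\ ((d < 2 * k)%N -> forall K (c v v' : {ffun 'I_d -> 'I_K} -> R[i]),
    wn (@lamK R d K) k (fun n => gcoef theta L k c v n - gcoef theta L k c v' n) <=
    CL * wn (@lamK R d K) k (fun n => v n - v' n)).
  case: (ltnP d (2 * k)) => dk; last by exists 0; split => // ; rewrite ltnNge dk.
  by have [CL CL0 hCL] := gcoef_lip hd htheta L0 dk; exists CL; split.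
have [CLf hCLf] := choice lip.
pose CL := \sum_(k < j.+1) CLf k.
have CL0 : 0 <= CL by apply: sumr_ge0 => k _; exact: (hCLf k).1.
have CLle k : (k <= j)%N -> CLf k <= CL.
  rewrite -ltnS => kj; rewrite /CL (bigD1 (Ordinal kj))//= lerDl.
  by apply: sumr_ge0 => i _; exact: (hCLf i).1.
have den0 : 0 < 2 + 8 * Cg + 8 * CL by rewrite ltr_pwDl// ?mulr_ge0// ltr_pwDl// mulr_ge0.
(* Ensures dt <= 1/2, 8 Cg dt <= 1 and 8 CL dt <= 1 at once, independently of T. *)
exists (2 + 8 * Cg + 8 * CL)^-1; first by rewrite invr_gt0.
move=> T T0; pose kap := K0 ^+ 4.
have kap0 : 0 <= kap by rewrite exprn_ge0// ltW.
have sc0 := sup_const_ge0 CB (ltW T0) (rate_ge0 (ltW CB0) Cg0 kap0) kap0.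
exists (1 + sup_const T CB (rate CB Cg kap) kap); first by rewrite ltr_pwDl.
move=> k dk kj phi0 Sphi0 N K N0 Kp hdt hKdt.
have h0 : 0 < dt T N by exact: dt_gt0.
have hd1 : dt T N * (2 + 8 * Cg + 8 * CL) <= 1 by rewrite -ler_pdivlMr// mul1r.
have hK := power_quarter h0 (ler0n R K) hKdt.
have [_ nb2 nb3 nb4] := hCB K Kp.
have hb2 := bop_bound hd hB Kp (ltW CB0) nb2.
have hb3 := comm_hexpC_bound hd hB Kp (ltW CB0) nb3.
have hb4 := comm_form_bound hB Kp (ltW CB0) nb4.
have hG (c v : {ffun 'I_d -> 'I_K} -> R[i]) := hCg k K c v dk kj.
have hL (c v v' : {ffun 'I_d -> 'I_K} -> R[i]) :
    wn (@lamK R d K) k (fun n => gcoef theta L k c v n - gcoef theta L k c v' n) <=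
    CL * wn (@lamK R d K) k (fun n => v n - v' n).
  apply: (le_trans ((hCLf k).2 dk K c v v')); apply: ler_wpM2r (CLle k kj).
  by apply: wn_ge0 => n; exact: (lamK_ge1 hd).
have gh : 0 <= Cg * dt T N by rewrite mulr_ge0// ltW.
have lh : 0 <= CL * dt T N by rewrite mulr_ge0// ltW.
have dt1 : dt T N < 1 by move: hd1 h0 gh lh; rewrite !mulrDr (mulrCA _ 8) (mulrCA _ 8) !(mulrC (dt T N)); lra.
have g1 : 8 * Cg * dt T N <= 1 by move: hd1 h0 gh lh; rewrite -mulrA !mulrDr (mulrCA _ 8) (mulrCA _ 8) !(mulrC (dt T N)); lra.
have l1 : 8 * CL * dt T N <= 1 by move: hd1 h0 gh lh; rewrite -mulrA !mulrDr (mulrCA _ 8) (mulrCA _ 8) !(mulrC (dt T N)); lra.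
exists (sol W B j (C0 j) theta k L K N T phi0); split.
- exact: (sol_solution hd hW hB (hC0 j) htheta kj Kp N0 T0 CB0 Cg0 CL0 hb2 hb3 hb4 hG hL dt1 g1 l1 hK Sphi0).
- move=> psi.
  exact: (sol_unique hd hB (hC0 j) kj Kp N0 T0 CB0 Cg0 CL0 hb2 hb3 hb4 hG hL dt1 g1 l1 hK).
- exact: (sol_expectation hd hW hB (hC0 j) htheta kj Kp N0 T0 CB0 Cg0 CL0 hb2 hb3 hb4 hG hL dt1 g1 l1 hK Sphi0).
Qed.
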